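(* Suppose that the functional $Q$ is nonnegative in $\Gamma_{\zeta,\hat R}$, that $V\in\mathbb{M}^q_{\mathrm{loc}}(p;\Gamma_{\zeta,\hat R})$, that condition (C) holds for $\mathcal{A}$ in $\Gamma_{\zeta,\hat R}$, that $q>n$ if $p<2$, and that $Q'$ has a Fuchsian-type singularity at $\zeta$ with respect to a norm $N\in C^1(\mathbb{R}^n\setminus\{0\})$ on $\mathbb{R}^n$. Let $u,v\in\mathcal{G}_{\zeta,\hat R}$, and for $R\in(0,\infty)$ with $S_{R,N}\subseteq\Gamma_{\zeta,\hat R}$ let $$m_{R,N}=\min_{S_{R,N}}\frac uv,\qquad M_{R,N}=\max_{S_{R,N}}\frac uv .$$ (i) The functions $R\mapsto m_{R,N}$ and $R\mapsto M_{R,N}$ are eventually monotone around $|\zeta|$. In particular, both $\lim_{R\to|\zeta|}m_{R,N}$ and $\lim_{R\to|\zeta|}M_{R,N}$ exist in the wide sense (i.e. in $[0,\infty]$). (ii) Let $m=\lim_{R\to|\zeta|}m_{R,N}$ and $M=\lim_{R\to|\zeta|}M_{R,N}$, and let $u,v\in\mathbf{M}_{\zeta,\hat R}$. As $R$ goes to $|\zeta|$, $m_{R,N}$ decreases to $m$ and $M_{R,N}$ increases to $M$, and $0<m\le M<\infty$. Moreover, for all $x\in\Gamma_{\zeta,\hat R}$, $m\,v(x)\le u(x)\le M\,v(x)$.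
   Context: Setting. $n\ge2$ is an integer, $1<p<\infty$, $\Omega\subseteq\mathbb{R}^n$ is a domain (nonempty connected open set), and $\zeta\in\{0,\infty\}$ is an isolated point of the boundary of $\Omega$ in the one-point compactification $\mathbb{R}^n\cup\{\infty\}$. $|\zeta|=0$ if $\zeta=0$, $|\zeta|=\infty$ if $\zeta=\infty$. $B_R(0)$, $D_R(0)$, $S_R(0)$ are the open ball, closed ball, sphere. For $R>0$: $I_{0,R}=(0,R)$, $I_{\infty,R}=(R,\infty)$, $\Gamma_{0,R}=B_R(0)\setminus\{0\}$, $\Gamma_{\infty,R}=\mathbb{R}^n\setminus D_R(0)$. A number $\hat R>0$ is fixed with $\Gamma_{\zeta,R}\subseteq\Omega$ for all $R\in I_{\zeta,\hat R}$ and $\Gamma_{\zeta,\hat R}\subseteq\Omega$. $E\Subset F$ means $\overline E$ is a compact subset of $F$. $\lambda^{<p-1>}=\lambda|\lambda|^{p-2}$. For a norm $N$: $S_{R,N}=\{x:N(x)=R\}$, $\mathbb{A}_{r,R,N}=\{x: r<N(x)<R\}$. $H$ is a norm family on $\Omega$: for a.e. $x\in\Omega$, $H(x,\cdot)$ is a norm on $\mathbb{R}^n$; $x\mapsto H(x,\xi)$ is measurable for all $\xi$; for every domain $\omega\Subset\Omega$ there are $0<\kappa_\omega\le\nu_\omega<\infty$ with $\kappa_\omega|\xi|\le H(x,\xi)\le\nu_\omega|\xi|$ for a.e. $x\in\omega$, all $\xi$; for a.e. $x$, $(\mathbb{R}^n,H(x,\cdot))$ is uniformly convex and $H(x,\cdot)$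 is differentiable in $\mathbb{R}^n\setminus\{0\}$. $\mathcal{A}(x,\xi)=\nabla_\xi(H(x,\xi)^p/p)$. Morrey spaces: $q>n/p$ if $p<n$, $q>n$ if $p=n$, $q=1$ if $p>n$; $s'=s/(s-1)$. For a bounded domain $\omega$, $\|f\|_{M^q(p;\omega)}$ is $\sup_{y\in\omega,\,0<r<\mathrm{diam}(\omega)}r^{-n/q'}\int_{\omega\cap B_r(y)}|f|\,dx$ if $p<n$; $\sup_{y\in\omega,\,0<r<\mathrm{diam}(\omega)}(\log(\mathrm{diam}(\omega)/r))^{q/n'}\int_{\omega\cap B_r(y)}|f|\,dx$ if $p=n$; $\|f\|_{L^1(\omega)}$ if $p>n$. $M^q(p;\omega)$ is the space of $f\in L^1_{\mathrm{loc}}(\omega)$ with finite norm ($L^1(\omega)$ if $p>n$); $M^q_{\mathrm{loc}}(p;\Omega)=\bigcap_{\omega\Subset\Omega}M^q(p;\omega)$ over domains $\omega$. $\mathbb{M}^q(p;\omega)$: for $p<n$, all $f\in M^q(p;\omega)$ with $|f|^{((p^*-1)/(p-1))'}\in M^q(p;\omega)$, $p^*=np/(n-p)$; for $p=n$, $L^\rho(\omega)$ for some $\rho>1$; for $p>n$, $L^1(\omega)$; $\mathbb{M}^q_{\mathrm{loc}}(p;U)=\bigcap_{\omega\Subset U}\mathbb{M}^q(p;\omega)$. The potential satisfies $V\in M^q_{\mathrm{loc}}(p;\Omega)$. $Q'[u]=-\mathrm{div}\,\mathcal{A}(x,\nabla u)+Vu^{<p-1>}$. $v\in W^{1,p}_{\mathrm{loc}}(U)$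 is a solution of $Q'[u]=g$ in $U$ if $\int_U\mathcal{A}(x,\nabla v)\cdot\nabla\phi+\int_UVv^{<p-1>}\phi=\int_Ug\phi$ for all $\phi\in C_c^\infty(U)$; solutions are identified with their continuous representatives. $Q$ is nonnegative in $U$ if $\int_U(H(x,\nabla\phi)^p+V|\phi|^p)\,dx\ge0$ for all $\phi\in C_c^\infty(U)$. $\mathcal{G}_{\zeta,\hat R}$ is the set of all positive solutions of $Q'[u]=0$ in $\Gamma_{\zeta,\hat R}$. Condition (C) for $\mathcal{A}$ in $U$: $\mathcal{A}(x,\cdot)\in C^1(\mathbb{R}^n\setminus\{0\})$ for all $x\in U$, and for every domain $\omega\Subset U$ there are positive constants $\vartheta\le1,\Lambda_1,\Lambda_2,\Lambda_3$ such that for all $x,y\in\omega$, $\xi\in\mathbb{R}^n\setminus\{0\}$, $\eta\in\mathbb{R}^n$: $D_\xi\mathcal{A}(x,\xi)\eta\cdot\eta\ge\Lambda_1|\xi|^{p-2}|\eta|^2$, $|D_\xi\mathcal{A}(x,\xi)|\le\Lambda_2|\xi|^{p-2}$, $|\mathcal{A}(x,\xi)-\mathcal{A}(y,\xi)|\le\Lambda_3|\xi|^{p-1}|x-y|^\vartheta$. Fuchsian-type singularity of $Q'$ at $\zeta$ with respect to a norm $N\in C^1(\mathbb{R}^n\setminus\{0\})$: (1) there are $\alpha,\beta>0$ with $\alpha|\xi|^p\le\mathcal{A}(x,\xi)\cdot\xi$, $|\mathcal{A}(x,\xi)|\le\beta|\xi|^{p-1}$ for a.e. $x\in\Gamma_{\zeta,\hat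 R}$ and all $\xi$; (2) there are $0<a_N<1<b_N$ and $R_N>0$ such that $\mathbb{A}_{a_NR,b_NR,N}\Subset\Gamma_{\zeta,\hat R}$ for all $R\in I_{\zeta,R_N}$ and the function of $R$ equal to $\|N(x)^{p-n/q}V\|_{M^q(p;\mathbb{A}_{a_NR,b_NR,N})}$ if $p\ne n$, and to $\|V\|_{M^q(n;\mathbb{A}_{a_NR,b_NR,N})}$ if $p=n$, is bounded on $I_{\zeta,R_N}$. Class $\mathbf{M}_{\zeta,\hat R}$ (minimal growth near $S_{\hat R}(0)$). A compact set is admissible if it is the closure of a Lipschitz domain with connected boundary. $\mathbf{M}_{0,\hat R}$: positive solutions $u$ of $Q'[w]=0$ in $B_{\hat R}(0)\setminus\{0\}$ such that for every admissible compact $K\subseteq B_{\hat R}(0)$ with $0\in\mathring K$ and every positive solution $v\in C(B_{\hat R}(0)\setminus\mathring K)$ of $Q'[w]=g$ in $B_{\hat R}(0)\setminus K$, $u\le v$ on $\partial K$ implies $u\le v$ in $B_{\hat R}(0)\setminus K$; here $g\in M^q_{\mathrm{loc}}(p;B_{\hat R}(0)\setminus\{0\})$ if $p\ne n$, $g\in L^{\bar\rho}_{\mathrm{loc}}(B_{\hat R}(0)\setminus\{0\})$ with $\bar\rho>1$ if $p=n$, and $g\ge0$ a.e. in $B_{\hat R}(0)\setminus K$. $\mathbf{M}_{\infty,\hat R}$: positive solutions $u$ of $Q'[w]=0$ in $\mathbb{R}^n\setminus D_{\hat R}(0)$ such that for every bounded Lipschitz domain $\omega\supseteq D_{\hat R}(0)$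 and every positive solution $v\in C(\overline\omega\setminus D_{\hat R}(0))$ of $Q'[w]=g$ in $\omega\setminus D_{\hat R}(0)$, $u\le v$ on $\partial\omega$ implies $u\le v$ in $\omega\setminus D_{\hat R}(0)$; here $g\in M^q(p;\omega\setminus D_{\hat R}(0))$ if $p\ne n$, $g\in L^{\bar\rho}(\omega\setminus D_{\hat R}(0))$ with $\bar\rho>1$ if $p=n$, and $g\ge0$ a.e. *)

(* Defs.v *)
From HB Require Import structures.
From mathcomp Require Export all_boot all_order all_algebra.
From mathcomp Require Export all_classical all_reals all_analysis.

Set Implicit Arguments.
Unset Strict Implicit.
Unset Printing Implicit Defensive.
Import Order.TTheory GRing.Theory Num.Theory.
Import numFieldNormedType.Exports.

Local Open Scope classical_set_scope.
Local Open Scope ring_scope.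

Definition caratheodory_measure {R : realType} {T : pointedType}
  (mu : {outer_measure set T -> \bar R}) :
  {measure set (caratheodory_type mu) -> \bar R} := mu.

Section Lebesgue.
Context {R : realType} (n : nat).
Local Notation E := 'rV[R]_n.
Local Open Scope ereal_scope.
Local Open Scope measure_display_scope.

Definition box (Q : E * E) : set E :=
  [set x | forall i, (Q.1 ord0 i <= x ord0 i <= Q.2 ord0 i)%R].

Definition box_vol (Q : E * E) : \bar R :=
  (\prod_(i < n) Num.max 0 (Q.2 ord0 i - Q.1 ord0 i))%:E.

(* The covering family is indexed by a subset D of nat, so that finite and
   empty families are allowed. *)
Definition leb (A : set E) : \bar R :=
  ereal_inf [set y | exists (D : set nat) (Q : nat -> E * E),
    A `<=` \bigcup_(k in D) box (Q k) /\ y = \esum_(k in D) box_vol (Q k)].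

Lemma box_vol_ge0 Q : 0 <= box_vol Q.
Proof. by rewrite lee_fin; apply: prodr_ge0 => i _; rewrite le_max lexx. Qed.

Lemma leb_ge0 A : 0 <= leb A.
Proof.
apply: le_ereal_inf_tmp => _ [D [Q [_ ->]]].
by apply: esum_ge0 => k _; exact: box_vol_ge0.
Qed.

Lemma leb0 : leb set0 = 0.
Proof.
apply/eqP; rewrite eq_le leb_ge0 andbT; apply: ereal_inf_lbound.
exists set0, (fun=> (0%R, 0%R)); split; first exact: sub0set.
by rewrite esum_set0.
Qed.

Lemma le_leb : {homo leb : A B / A `<=` B >-> A <= B}.
Proof.
move=> A B AB; apply/ereal_inf_le_tmp => _ [D [Q [BQ ->]]].
by exists D, Q; split => //; exact: subset_trans AB BQ.
Qed.

Lemma leb_sigma_subadditive : sigma_subadditive leb.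
Proof.
move=> A; have [[i ioo]|] := pselect (exists i, leb (A i) = +oo).
  rewrite (eseries_pinfty _ _ ioo) ?leey// => k _.
  by rewrite -ltNye (lt_le_trans _ (leb_ge0 _)).
rewrite -forallNE => Aoo.
suff add2e (e : {posnum R}) :
    leb (\bigcup_k A k) <= \sum_(i <oo) leb (A i) + e%:num%:E.
  by apply/lee_addgt0Pr => _/posnumP[].
rewrite (le_trans _ (epsilon_trick _ _ _))//; last by move=> k; exact: leb_ge0.
pose P k (DQ : set nat * (nat -> E * E)) :=
  A k `<=` \bigcup_(j in DQ.1) box (DQ.2 j) /\
  \esum_(j in DQ.1) box_vol (DQ.2 j) <= leb (A k) + (e%:num / (2 ^ k.+1)%:R)%:E.
have [G PG] : {G & forall k, P k (G k)}.
  apply: (@choice _ _ P) => k; rewrite /P.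
  have en1 : (0 < e%:num / (2 ^ k.+1)%:R :> R)%R by [].
  have fk : leb (A k) \is a fin_num.
    by rewrite ge0_fin_numE ?leb_ge0// ltey; apply/eqP/Aoo.
  have [y [D [Q [AQ ->]]] yS] := lb_ereal_inf_adherent en1 fk.
  by exists (D, Q); split => //; exact: ltW.
have /card_esym/ppcard_eqP[f] := card_nat2.
pose F (ij : nat * nat) := (G ij.1).2 ij.2.
pose J i := (G i).1.
apply: (@le_trans _ _ (\esum_(i in [set: nat]) \esum_(j in J i) box_vol (F (i, j)))).
  rewrite esum_esum; last by move=> *; exact: box_vol_ge0.
  apply: ereal_inf_lbound.
  exists (f @^-1` (setT `*`` J)), (F \o f); split.
    move=> x [i _ /(PG i).1 [j Jj Bx]].
    by exists (f^-1%FUN (i, j)); rewrite /= ?invK ?inE.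
  rewrite (reindex_esum (f @^-1` (setT `*`` J)) (setT `*`` J) f)//.
  split.
  - by move=> k.
  - by move=> x y _ _; apply: inj; rewrite inE.
  - by move=> ij Jij; exists (f^-1%FUN ij); rewrite /= ?invK ?inE.
have F0 i : 0 <= \esum_(j in J i) box_vol (F (i, j)).
  by apply: esum_ge0 => j _; exact: box_vol_ge0.
rewrite -nneseries_esumT//.
by apply: lee_nneseries => [//|i _]; exact: (PG i).2.
Qed.

HB.instance Definition _ := isOuterMeasure.Build R E leb
  leb0 leb_ge0 le_leb leb_sigma_subadditive.


(* Carathéodory's sigma-algebra of [leb] consists of the Lebesgue measurable
   sets, so [lam] is the complete Lebesgue measure. *)
Definition lebType : measurableType leb.-cara := caratheodory_type leb.
Definition lam : {measure set lebType -> \bar R} :=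
  caratheodory_measure [the {outer_measure set E -> \bar R} of leb].

End Lebesgue.
Arguments lebType R n : clear implicits.
Arguments lam R n : clear implicits.

Definition boundary {T : topologicalType} (A : set T) : set T :=
  closure A `\` interior A.

Section Euclidean.
Context {R : realType} {n : nat}.
Local Notation E := 'rV[R]_n.

(* The library's norm on 'rV[R]_n is the sup norm; it is used only through the
   topology that it induces. *)
Definition dot (x y : E) : R := \sum_(i < n) x ord0 i * y ord0 i.
Definition enorm (x : E) : R := Num.sqrt (dot x x).
Definition oball (y : E) (r : R) : set E := [set x | enorm (x - y) < r].
Definition cball (y : E) (r : R) : set E := [set x | enorm (x - y) <= r].
Definition diam (A : set E) : R := sup [set enorm (x - y) | x in A & y in A].

Definition domain (U : set E) : Prop := [/\ U !=set0, open U & connected U].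
Definition csubset (A B : set E) : Prop := compact (closure A) /\ closure A `<=` B.

Definition is_norm (N : E -> R) : Prop :=
  [/\ forall x, 0 <= N x,
      forall x, N x = 0 -> x = 0,
      forall (a : R) x, N (a *: x) = `|a| * N x &
      forall x y, N (x + y) <= N x + N y].

Definition uniformly_convex (N : E -> R) : Prop :=
  forall e : R, 0 < e -> exists2 d : R, 0 < d &
    forall x y, N x = 1 -> N y = 1 -> e <= N (x - y) ->
      N (2^-1 *: (x + y)) <= 1 - d.

Definition evec (i : 'I_n) : E := delta_mx ord0 i.
Definition grad (f : E -> R) (x : E) : E := \row_i 'D_(evec i) f x.

Definition C1_on (U : set E) (f : E -> R) : Prop :=
  forall x, U x -> differentiable f x /\ {for x, continuous (grad f)}.

Fixpoint Ck (k : nat) (f : E -> R) : Prop :=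
  if k is k'.+1 then
    continuous f /\
    forall i, (forall x, derivable f x (evec i)) /\ Ck k' ('D_(evec i) f)
  else continuous f.

Definition test_function (U : set E) (f : E -> R) : Prop :=
  [/\ forall k, Ck k f, compact (closure [set x | f x != 0]) &
      closure [set x | f x != 0] `<=` U].

Definition opnorm (L : E -> E) : R := sup [set enorm (L x) | x in cball 0 1].

Definition lipschitz_domain (U : set E) : Prop :=
  domain U /\
  forall x0, boundary U x0 ->
    exists (e : E) (r C : R) (h : E -> R),
      [/\ enorm e = 1, 0 < r,
          forall y z, `|h y - h z| <= C * enorm (y - z) &
          (* near x0, U lies above a Lipschitz graph over the hyperplane
             orthogonal to e *)
          forall y, oball x0 r y ->
            (U y <-> h (y - dot y e *: e) < dot y e)].

Definition min_on (S : set E) (f : E -> R) : R :=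
  xget 0 [set m | (exists2 x, S x & f x = m) /\ forall x, S x -> m <= f x].
Definition max_on (S : set E) (f : E -> R) : R :=
  xget 0 [set m | (exists2 x, S x & f x = m) /\ forall x, S x -> f x <= m].

Definition nsphere (N : E -> R) (r : R) : set E := [set x | N x = r].
Definition nannulus (N : E -> R) (r s : R) : set E := [set x | r < N x < s].

End Euclidean.

Section FunctionSpaces.
Context {R : realType} {n : nat}.
Local Notation E := 'rV[R]_n.
Local Notation mu := (@lam R n).
Implicit Types (p q s : R) (A U : set E) (f : E -> R).

Definition in_Lp s A f : Prop := (f \_ A : lebType R n -> R) \in Lfun mu s%:E.
Definition in_Lp_loc s U f : Prop :=
  forall K : set E, compact K -> K `<=` U -> in_Lp s K f.

Definition weak_grad U f (G : E -> E) : Prop :=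
  forall phi i, test_function U phi ->
    (\int[mu]_(x in U) (f x * 'D_(evec i) phi x) =
     - \int[mu]_(x in U) (G x ord0 i * phi x))%R.

(* f is in W^{1,p}_loc(U) with weak gradient G *)
Definition W1p_loc p U f (G : E -> E) : Prop :=
  [/\ in_Lp_loc p U f, forall i, in_Lp_loc p U (fun x => G x ord0 i) &
      weak_grad U f G].

Definition conj_exp s : R := s / (s - 1).

Definition morrey_exponent p q : Prop :=
  [/\ p < n%:R -> n%:R / p < q, p = n%:R -> n%:R < q & n%:R < p -> q = 1].

Definition morrey_norm p q A f : \bar R :=
  let I (D : set E) := (\int[mu]_(x in D) `|f x|%:E)%E in
  if p < n%:R then
    ereal_sup [set z | exists y r, [/\ A y, 0 < r < diam A &
      z = ((r `^ (- (n%:R / conj_exp q)))%:E * I (A `&` oball y r))%E]]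
  else if p == n%:R then
    ereal_sup [set z | exists y r, [/\ A y, 0 < r < diam A &
      z = ((ln (diam A / r) `^ (q / conj_exp n%:R))%:E
           * I (A `&` oball y r))%E]]
  else I A.

Definition in_morrey p q A f : Prop :=
  if n%:R < p then in_Lp 1 A f
  else in_Lp_loc 1 A f /\ (morrey_norm p q A f < +oo)%E.

Definition in_morrey_loc p q U f : Prop :=
  forall w, domain w -> csubset w U -> in_morrey p q w f.

Definition sobolev_conj p : R := n%:R * p / (n%:R - p).

Definition in_strong_morrey p q A f : Prop :=
  if p < n%:R then
    in_morrey p q A f /\
    in_morrey p q A
      (fun x => `|f x| `^ conj_exp ((sobolev_conj p - 1) / (p - 1)))
  else if p == n%:R then exists2 s, 1 < s & in_Lp s A f
  else in_Lp 1 A f.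

Definition in_strong_morrey_loc p q U f : Prop :=
  forall w, domain w -> csubset w U -> in_strong_morrey p q w f.

End FunctionSpaces.

Section Operator.
Context {R : realType} {n : nat}.
Local Notation E := 'rV[R]_n.
Local Notation mu := (@lam R n).
Implicit Types (p q : R) (U : set E) (H : E -> E -> R) (V g v : E -> R).

Definition norm_family (W : set E) H : Prop :=
  [/\ {ae mu, forall x, W x -> is_norm (H x)},
      forall xi, measurable_fun (W : set (lebType R n)) (fun x => H x xi),
      forall w, domain w -> csubset w W ->
        exists k c : R, [/\ 0 < k, k <= c &
          {ae mu, forall x, w x ->
            forall xi, k * enorm xi <= H x xi <= c * enorm xi}],
      {ae mu, forall x, W x -> uniformly_convex (H x)} &
      {ae mu, forall x, W x -> forall xi, xi != 0 -> differentiable (H x) xi}].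

Definition opA p H (x xi : E) : E := grad (fun eta => H x eta `^ p / p) xi.

Definition spow p (t : R) : R := t * `|t| `^ (p - 2).

Definition weak_solution p H V g U v : Prop :=
  exists2 G : E -> E, W1p_loc p U v G &
    forall phi, test_function U phi ->
      (\int[mu]_(x in U) dot (opA p H x (G x)) (grad phi x)
       + \int[mu]_(x in U) (V x * spow p (v x) * phi x)
       = \int[mu]_(x in U) (g x * phi x))%R.

(* v is the continuous representative of a positive solution of Q'[w] = g *)
Definition positive_solution p H V g U v : Prop :=
  [/\ {within U, continuous v}, forall x, U x -> 0 < v x &
      weak_solution p H V g U v].

Definition Q_nonneg p H V U : Prop :=
  forall phi, test_function U phi ->
    (0 <= \int[mu]_(x in U)
            (H x (grad phi x) `^ p + V x * `|phi x| `^ p))%R.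

Definition condition_C p (A : E -> E -> E) U : Prop :=
  (forall x, U x -> forall xi, xi != 0 ->
     differentiable (A x) xi /\ {for xi, continuous (jacobian (A x))}) /\
  forall w, domain w -> csubset w U ->
    exists th L1 L2 L3 : R,
      [/\ 0 < th <= 1, 0 < L1, 0 < L2, 0 < L3 &
        forall x y xi eta, w x -> w y -> xi != 0 ->
          [/\ L1 * enorm xi `^ (p - 2) * enorm eta ^+ 2
                <= dot ('d (A x) xi eta) eta,
              opnorm ('d (A x) xi) <= L2 * enorm xi `^ (p - 2) &
              enorm (A x xi - A y xi)
                <= L3 * enorm xi `^ (p - 1) * enorm (x - y) `^ th]].

End Operator.

Variant endpoint := Zero | Infinity.

Section NearEndpoint.
Context {R : realType} {n : nat}.
Local Notation E := 'rV[R]_n.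
Local Notation mu := (@lam R n).
Implicit Types (zeta : endpoint) (p q r : R) (H : E -> E -> R) (V : E -> R).

Definition endpoint_pt zeta : one_point_compactification E :=
  if zeta is Zero then Some 0 else None.

Definition isolated_boundary_point (W : set E) zeta : Prop :=
  isolated
    (boundary ([set Some x | x in W] : set (one_point_compactification E)))
    (endpoint_pt zeta).

Definition Irange zeta r : set R :=
  if zeta is Zero then [set s | 0 < s < r] else [set s | r < s].

Definition Gam zeta r : set E :=
  if zeta is Zero then oball 0 r `\ 0 else ~` cball 0 r.

(* the filter of s -> |zeta| *)
Definition at_endpoint zeta : set_system R :=
  if zeta is Zero then 0^'+ else +oo%R.

Definition eventually_monotone zeta (D : set R) (f : R -> R) : Prop :=
  exists r0, [/\ 0 < r0, Irange zeta r0 `<=` D &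
    (forall r s, Irange zeta r0 r -> Irange zeta r0 s -> r <= s -> f r <= f s)
    \/
    (forall r s, Irange zeta r0 r -> Irange zeta r0 s -> r <= s -> f s <= f r)].

(* [Irange zeta r s] says that s is closer to |zeta| than r. *)
Definition decreasing_towards zeta (D : set R) (f : R -> R) : Prop :=
  forall r s, D r -> D s -> Irange zeta r s -> f s <= f r.
Definition increasing_towards zeta (D : set R) (f : R -> R) : Prop :=
  forall r s, D r -> D s -> Irange zeta r s -> f r <= f s.

Definition fuchsian p q H V zeta Rh (N : E -> R) : Prop :=
  (exists a b : R, [/\ 0 < a, 0 < b &
    {ae mu, forall x, Gam zeta Rh x -> forall xi,
      a * enorm xi `^ p <= dot (opA p H x xi) xi /\
      enorm (opA p H x xi) <= b * enorm xi `^ (p - 1)}]) /\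
  (exists aN bN rN C : R, [/\ 0 < aN < 1, 1 < bN, 0 < rN &
    forall r, Irange zeta rN r ->
      let An := nannulus N (aN * r) (bN * r) in
      let NV := if p == n%:R then V else fun x => N x `^ (p - n%:R / q) * V x in
      csubset An (Gam zeta Rh) /\
      (morrey_norm p q An NV <= C%:E)%E]).

Definition admissible_compact (K : set E) : Prop :=
  compact K /\
  exists w, [/\ lipschitz_domain w, connected (boundary w) & K = closure w].

Definition min_growth p q H V zeta Rh (u : E -> R) : Prop :=
  positive_solution p H V (cst 0) (Gam zeta Rh) u /\
  if zeta is Zero then
    forall K, admissible_compact K -> K `<=` oball 0 Rh -> interior K 0 ->
    forall g v,
      (if p == n%:R then exists2 s, 1 < s & in_Lp_loc s (oball 0 Rh `\ 0) g
       else in_morrey_loc p q (oball 0 Rh `\ 0) g) ->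
      {ae mu, forall x, (oball 0 Rh `\` K) x -> 0 <= g x} ->
      {within oball 0 Rh `\` interior K, continuous v} ->
      positive_solution p H V g (oball 0 Rh `\` K) v ->
      (forall x, boundary K x -> u x <= v x) ->
      forall x, (oball 0 Rh `\` K) x -> u x <= v x
  else
    forall w, lipschitz_domain w -> bounded_set w -> cball 0 Rh `<=` w ->
    forall g v,
      (if p == n%:R then exists2 s, 1 < s & in_Lp s (w `\` cball 0 Rh) g
       else in_morrey p q (w `\` cball 0 Rh) g) ->
      {ae mu, forall x, (w `\` cball 0 Rh) x -> 0 <= g x} ->
      {within closure w `\` cball 0 Rh, continuous v} ->
      positive_solution p H V g (w `\` cball 0 Rh) v ->
      (forall x, boundary w x -> u x <= v x) ->
      forall x, (w `\` cball 0 Rh) x -> u x <= v x.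

End NearEndpoint.

(* Main.v *)
(* With Phi increasing and vanishing near 0, testing the equation of u with Phi(log(u/v)) u and
   that of v with Phi(log(u/v)) u^p v^(1-p) shows that u/v on an annulus lies between its extrema
   on the two bounding spheres, so m_R and M_R are eventually monotone. Minimal growth, comparing
   u with M_R v and v with u/m_R, makes them monotone and gives m v <= u <= M v. The Fuchsian
   bounds are scale invariant, so the De Giorgi-Landis proof of the Harnack inequality has a
   constant independent of R on the spheres S_{R,N}; applied to u and v it yields M_R <= C m_R,
   whence 0 < m and M < oo. *)
From HB Require Import structures.
Require Import Defs.
From mathcomp Require Import all_boot all_order all_algebra.
From mathcomp Require Import all_classical all_reals all_analysis.
From mathcomp Require Import finmap measurable_realfun ring lra.
Set Implicit Arguments.
Unset Strict Implicit.
Unset Printing Implicit Defensive.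
Import Order.TTheory GRing.Theory Num.Theory.
Import numFieldNormedType.Exports.
Local Open Scope classical_set_scope.
Local Open Scope ring_scope.

(** The equation is known only for smooth test functions, the norm [H] is not smooth at the origin,
    and the potential [V] is controlled only through its integrals over balls. Three devices meet
    these obstacles. Since solutions are continuous, all test functions are built in the class [Wfn]
    of continuous functions that are local limits of C^1 functions; it is stable under products and
    C^1 compositions. Of [H] only the facts collected in [elliptic] are kept: growth, coercivity,
    strict monotonicity, a Picone-type inequality and homogeneity. And [V] is never paired with a
    Sobolev inequality: in a De Giorgi step the solution is bounded where it is tested, so the term
    with [V] costs only the integral of [|V|] over the cube. The levels then have to rise by
    summable amounts; this is the condition [kato], a discrete Wolff potential, which the Fuchsian
    bound supplies with a power modulus for [p != n] and a logarithmic one for [p = n]. The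
    isoperimetric inequality behind De Giorgi's step is derived from translations ([level_gap]). *)

(** * Lebesgue measurability and affine changes of variables *)

Section LebesgueMeasure.
Context {R : realType} {n : nat}.
Local Notation E := 'rV[R]_n.
Local Notation L := (lebType R n).
Local Notation mu := (@lam R n).
Implicit Types (A : set E) (Q : E * E).

Lemma esumZl (c : R) (D : set nat) (f : nat -> \bar R) : 0 <= c ->
 (forall k, 0 <= f k)%E ->
 (\esum_(k in D) (c%:E * f k) = c%:E * \esum_(k in D) f k)%E.
Proof.
move=>c0 f0;rewrite esum_mkcond [in RHS]esum_mkcond.
have g0 k : (0 <= if k \in D then f k else 0)%E by case:ifP.
rewrite -!nneseries_esumT//;last first.
 by move=>k;case:ifP => // _;rewrite mule_ge0.
rewrite -nneseriesZl//;apply:eq_eseriesr => k _.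
by case:ifP => //;rewrite mule0.
Qed.

Lemma leb_box_le Q : (leb (box Q) <= box_vol Q)%E.
Proof.
apply:ereal_inf_lbound;exists [set 0%N], (fun=> Q);split.
 by move=>x Qx;exists 0%N.
by rewrite esum_set1// box_vol_ge0.
Qed.

(** A side cut at [a]: the truncation at 0 keeps the lengths additive also when the side is empty or
    [a] lies outside it, so that cutting a box needs no case distinction. *)
Lemma maxr0_split (x y a : R) : Num.max 0 (y - x) =
 Num.max 0 (Num.min y a - x) + Num.max 0 (y - Num.max x a).
Proof.
rewrite /Num.min /Num.max.
case:(ltP y a) => ya;case:(ltP x a) => xa /=;
case:(ltP 0 (y - x)) => ?;case:(ltP 0 (y - a)) => ?;case:(ltP 0 (a - x)) => ?;lra.
Qed.

(** Each box of a cover is cut by the hyperplane into [b1] and [b2], whose volumes add up; the two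
    families cover the two parts of [A] at the same total cost. *)
Lemma leb_cara_halfspace (i : 'I_n) (a : R) :
 (@leb R n).-caratheodory [set x : E | x ord0 i <= a].
Proof.
apply:le_caratheodory_measurable => A.
apply:le_ereal_inf_tmp => _ [D [Q [AQ ->]]].
pose b1 Q : E * E := (Q.1,
 \row_j if j == i then Num.min (Q.2 ord0 i) a else Q.2 ord0 j).
pose b2 Q : E * E := (\row_j (if j == i then Num.max (Q.1 ord0 i) a else Q.1 ord0 j), Q.2).
have bE k : (box_vol (Q k) = box_vol (b1 (Q k)) + box_vol (b2 (Q k)))%E.
 rewrite /box_vol -EFinD;congr EFin.
 rewrite (bigD1 i)//= [X in _ = X + _](bigD1 i)//= [X in _ = _ + X](bigD1 i)//=.
 rewrite !mxE eqxx.
 rewrite [X in _ = _ * X + _](_ : _ = \prod_(j < n | j != i) Num.max 0 ((Q k).2 ord0 j - (Q k).1 ord0 j));last first.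
  by apply:eq_bigr => j /negbTE ji;rewrite mxE ji.
 rewrite [X in _ = _ + _ * X](_ : _ = \prod_(j < n | j != i) Num.max 0 ((Q k).2 ord0 j - (Q k).1 ord0 j));last first.
  by apply:eq_bigr => j /negbTE ji;rewrite mxE ji.
 rewrite -mulrDl;congr (_ * _).
 exact:maxr0_split.
under eq_esum do rewrite bE.
rewrite esumD;[|by move=> *;exact:box_vol_ge0..].
apply:leeD;apply:ereal_inf_lbound.
- exists D, (b1 \o Q);split => // x [/AQ[k Dk Qx] /= xa];exists k => //= j.
 rewrite mxE;have /andP[-> h] := Qx j;case:eqP => [->|_]//=.
 by rewrite le_min xa andbT;have /andP[_ ->] := Qx i.
- exists D, (b2 \o Q);split => // x [/AQ[k Dk Qx] /= /negP];rewrite -ltNge => xa.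
 exists k => //= j;rewrite mxE;have /andP[h ->] := Qx j;case:eqP => [->|_]//=.
  rewrite andbT ge_max (ltW xa) andbT;by have /andP[-> _] := Qx i.
 by rewrite h.
Qed.

Lemma measurable_coord_le (i : 'I_n) (a : R) :
 measurable ([set x : E | x ord0 i <= a] : set L).
Proof. exact:leb_cara_halfspace. Qed.

Lemma measurable_coord_lt (i : 'I_n) (a : R) :
 measurable ([set x : E | x ord0 i < a] : set L).
Proof.
rewrite (_ : [set x : E | x ord0 i < a] =
 \bigcup_k [set x : E | x ord0 i <= a - k.+1%:R^-1]).
 by apply:bigcupT_measurable => k;exact:measurable_coord_le.
apply/seteqP;split=> x /=.
 move=>xa;have := @archi_boundP R (a - x ord0 i)^-1 _.
 rewrite invr_ge0 subr_ge0 ltW// => /(_ isT) h;exists (Num.bound (a - x ord0 i)^-1) => //=.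
 rewrite lerBrDr -lerBrDl -[leRHS]invrK lef_pV2 ?posrE ?invr_gt0 ?subr_gt0//.
 by rewrite (le_trans (ltW h))// ler_nat.
by move=>[k _ /= /le_lt_trans];apply;rewrite ltrBlDr ltrDl invr_gt0.
Qed.

Lemma ball_coordE (x : E) (r : R) : 0 < r ->
 ball x r = \bigcap_(i in [set: 'I_n]) ([set y : E | x ord0 i - r < y ord0 i < x ord0 i + r]).
Proof.
move=>r0;apply/seteqP;split => y.
 move=>[_ xy] i _ /=;have := xy ord0 i.
 by rewrite /ball/= ltr_distlC.
by move=>xy;split => // k i;rewrite ord1 /ball/= ltr_distlC;exact:xy.
Qed.

Lemma measurable_ball_rV (x : E) (r : R) : measurable (ball x r : set L).
Proof.
have [r0|r0] := ltP 0 r;last first.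
 rewrite (_ : ball x r = set0) //;apply/seteqP;split=> // y [] r1.
 by move: (lt_le_trans r1 r0);rewrite ltxx.
rewrite ball_coordE//;apply:fin_bigcap_measurable => // i _.
rewrite (_ : [set y | _] = [set y : E | y ord0 i < x ord0 i + r] `\` [set y : E | y ord0 i <= x ord0 i - r]).
 apply:(@measurableD _ L);[exact:measurable_coord_lt|exact:measurable_coord_le].
apply/seteqP;split => y /=.
 by move=>/andP[h ->];split => //;apply/negP;rewrite -ltNge.
by move=>[-> /negP];rewrite -ltNge => ->.
Qed.

Lemma rat_dense_rV (x : E) (e : R) : 0 < e ->
 exists q : 'rV[rat]_n, ball x e (map_mx ratr q : E).
Proof.
move=>e0;have h i : exists q : rat, x ord0 i - e < ratr q < x ord0 i + e.
 have /rat_in_itvoo[q] : x ord0 i - e < x ord0 i + e by lra.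
 by rewrite in_itv/= => ?;exists q.
have [f hf] := choice h;exists (\row_i f i);rewrite ball_coordE// => i _ /=.
by rewrite !mxE.
Qed.

(** [ball] is a cube for the sup norm, hence a finite intersection of slabs. [O] is the union of the
    countably many cubes with rational centre and radius [k.+1%:R^-1] that it contains; the other
    indices are given [set0]. *)
Lemma measurable_open_rV (O : set E) : open O -> measurable (O : set L).
Proof.
move=>oO;pose F (qk : 'rV[rat]_n * nat) : set L :=
 if `[< ball (map_mx ratr qk.1 : E) qk.2.+1%:R^-1 `<=` O >]
 then ball (map_mx ratr qk.1 : E) qk.2.+1%:R^-1 else set0.
rewrite (_ : O = \bigcup_qk F qk);last first.
 apply/seteqP;split => x;last first.
  by move=>[qk _];rewrite /F;case:asboolP => // h /h.
 move=>Ox;have /nbhs_ballP[e /= e0 eO] := open_nbhs_nbhs (conj oO Ox).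
 have e20 : 0 < e / 2 by lra.
 pose k := Num.bound (e / 2)^-1.
 have ke : k.+1%:R^-1 < e / 2 :> R.
  rewrite invf_plt ?posrE//;have := @archi_boundP R (e/2)^-1 _.
  rewrite invr_ge0 ltW// => /(_ isT)/lt_le_trans;apply.
  by rewrite ler_nat.
 have k0 : 0 < k.+1%:R^-1 :> R by rewrite invr_gt0.
 have [q xq] := rat_dense_rV x k0.
 exists (q, k) => //;rewrite /F /=.
 case:asboolP => [_|h];first exact:ball_sym.
 exfalso;apply:h => y qy;apply:eO.
 rewrite (splitr e).
 by apply:ball_triangle;[exact:(le_ball (ltW ke) xq)|exact:(le_ball (ltW ke) qy)].
apply:countable_bigcupT_measurable => [|qk];first exact:countableP.
by rewrite /F;case:ifP => _;[exact:measurable_ball_rV|exact:measurable0].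
Qed.

Lemma measurable_closed_rV (O : set E) : closed O -> measurable (O : set L).
Proof.
move=>cO;rewrite -(setCK O);apply:measurableC.
by apply:measurable_open_rV;exact:closed_openC.
Qed.

Lemma mfun_cont_open (U : set E) (f : E -> R) : open U ->
 {in U, continuous f} -> measurable_fun (U : set L) f.
Proof.
move=>oU cf.
apply:(measurability _ (@RGenOInfty.measurableE R)) => //.
move=>_ [_ [a ->] <-];apply:(@measurable_open_rV).
rewrite openE => x [Ux /= fx].
apply:filterI;first exact:open_nbhs_nbhs.
have : nbhs (f x) `]a, +oo[%classic.
 by apply:open_nbhs_nbhs;split => //;exact:interval_open.
by move/(cf x (mem_set Ux)).
Qed.

Lemma measurable_fun_continuous (f : E -> R) (D : set E) : continuous f ->
 measurable_fun (D : set L) f.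
Proof.
move=>cf;apply:(@measurable_funS _ _ _ _ setT) => //.
by apply:mfun_cont_open => //;exact:openT.
Qed.

Definition affine (a : R) (b : E) (x : E) : E := a *: x + b.

(** The preimage of a box is a box, but for negative [a] its two corners change places. *)
Lemma box_vol_affine (a : R) (b : E) Q : a != 0 -> exists Q',
 affine a b @^-1` (box Q) = box Q' /\ (box_vol Q' = (`|a| ^- n)%:E * box_vol Q)%E.
Proof.
move=>a0.
pose P (x : E) := a^-1 *: (x - b).
have PE x i : P x ord0 i = a^-1 * (x ord0 i - b ord0 i) by rewrite !mxE.
have [ap|an|] := ltgtP 0 a;last by move/eqP;rewrite eq_sym (negbTE a0).
- exists (P Q.1, P Q.2);split.
  apply/seteqP;split => x /= h i;have /andP[h1 h2] := h i;move: h1 h2;rewrite !PE !mxE.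
   by rewrite !(ler_pdivrMl _ _ ap) !(ler_pdivlMl _ _ ap) => h1 h2;apply/andP;split;lra.
  by rewrite !(ler_pdivrMl _ _ ap) !(ler_pdivlMl _ _ ap) => h1 h2;apply/andP;split;lra.
 rewrite /box_vol -EFinM;congr EFin.
 rewrite -exprVn -[n in X in X * _]card_ord -prodr_const -big_split/=.
 apply:eq_bigr => i _;rewrite !PE gtr0_norm// maxr_pMr ?mulr0;last by rewrite invr_ge0 ltW.
 by rewrite -mulrBr;congr (Num.max _ (_ * _));ring.
- exists (P Q.2, P Q.1);split.
  apply/seteqP;split => x /= h i;have /andP[h1 h2] := h i;move: h1 h2;rewrite !PE !mxE.
   by rewrite !(ler_ndivrMl _ _ an) !(ler_ndivlMl _ _ an) => h1 h2;apply/andP;split;lra.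
  by rewrite !(ler_ndivrMl _ _ an) !(ler_ndivlMl _ _ an) => h1 h2;apply/andP;split;lra.
 rewrite /box_vol -EFinM;congr EFin.
 rewrite -exprVn -[n in X in X * _]card_ord -prodr_const -big_split/=.
 apply:eq_bigr => i _;rewrite !PE ltr0_norm// maxr_pMr ?mulr0;last by rewrite invr_ge0 oppr_ge0 ltW.
 by rewrite -mulrBr invrN;congr (Num.max _ _);ring.
Qed.

Lemma leb_affine_le (a : R) (b : E) A : a != 0 ->
 (leb (affine a b @^-1` A) <= (`|a| ^- n)%:E * leb A)%E.
Proof.
move=>a0;have an0 : 0 < `|a| ^- n by rewrite invr_gt0 exprn_gt0// normr_gt0.
rewrite -lee_pdivrMl//.
apply:le_ereal_inf_tmp => _ [D [Q [AQ ->]]].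
rewrite lee_pdivrMl//.
have [Q' hQ'] := choice (fun k => box_vol_affine b (Q k) a0).
apply:ereal_inf_lbound;exists D, Q';split.
 move=>x /= /AQ[k Dk h];exists k => //;by rewrite -(hQ' k).1.
rewrite -esumZl ?ltW//;last by move=>k;exact:box_vol_ge0.
by apply:eq_esum => k Dk;rewrite (hQ' k).2.
Qed.

(** The missing inequality is [leb_affine_le] for the inverse map. *)
Lemma leb_affine (a : R) (b : E) A : a != 0 ->
 (leb (affine a b @^-1` A) = (`|a| ^- n)%:E * leb A)%E.
Proof.
move=>a0;apply/eqP;rewrite eq_le leb_affine_le//=.
have an0 : 0 < `|a| ^- n by rewrite invr_gt0 exprn_gt0// normr_gt0.
rewrite -lee_pdivlMl//;have ai0 : a^-1 != 0 by rewrite invr_eq0.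
have := @leb_affine_le a^-1 (- (a^-1 *: b)) (affine a b @^-1` A) ai0.
rewrite (_ : _ @^-1` (_ @^-1` A) = A);first by rewrite normfV exprVn.
apply/seteqP;split => x /=;rewrite /affine scalerDr scalerN !scalerA mulfV// !scale1r subrK//.
Qed.

(** Every test set [X] of the Caratheodory condition is the preimage of some [Y], so the condition
    for the preimage of [A] is the one for [A] multiplied by [|a|^-n]. *)
Lemma measurable_affine (a : R) (b : E) : a != 0 ->
 measurable_fun setT (affine a b : L -> L).
Proof.
move=>a0 mT A mA;rewrite setTI.
suff : (@leb R n).-caratheodory (affine a b @^-1` A) by [].
move=>X;have ai0 : a^-1 != 0 by rewrite invr_eq0.
pose Y := affine a^-1 (- (a^-1 *: b)) @^-1` X.
have XY : X = affine a b @^-1` Y.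
 apply/seteqP;split => x /=;rewrite /Y/= /affine scalerDr scalerA mulVf// scale1r addrK//.
have mA' : (@leb R n).-caratheodory A := mA.
rewrite XY preimage_setC -!preimage_setI.
rewrite [LHS](leb_affine _ _ a0) [X in (_ = X + _)%E](leb_affine _ _ a0) [X in (_ = _ + X)%E](leb_affine _ _ a0).
rewrite -ge0_muleDr ?leb_ge0//.
by congr (_ * _)%E;exact:mA'.
Qed.

Lemma ge0_integral_affine (a : R) (b : E) (D : set L) (f : L -> \bar R) : a != 0 ->
 measurable D -> measurable_fun D f -> (forall x, 0 <= f x)%E ->
 (\int[mu]_(x in (affine a b @^-1` D : set L)) f (affine a b x) = (`|a| ^- n)%:E * \int[mu]_(x in D) f x)%E.
Proof.
move=>a0 mD mf f0.
have an0 : 0 <= `|a| ^- n by rewrite invr_ge0 exprn_ge0.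
pose phi := affine a b : L -> L.
have mphi : measurable_fun setT phi by exact:measurable_affine.
rewrite -(@ge0_integral_pushforward _ _ L L R phi mphi mu D f mD mf);last by move=>y _.
rewrite (_ : \int[_]_(y in D) f y = \int[mscale (NngNum an0) mu]_(y in D) f y)%E;last first.
 apply:eq_measure_integral => A mA _ /=;rewrite /pushforward /mscale/=.
 exact:leb_affine.
by rewrite ge0_integral_mscale.
Qed.

End LebesgueMeasure.

(** * Positivity, finiteness and product structure of Lebesgue measure *)

Section LebesguePositive.
Context {R : realType} {n : nat}.
Local Notation E := 'rV[R]_n.
Local Notation L := (lebType R n).
Local Notation mu := (@lam R n).
Implicit Types (Q : E * E).

(** The grid points of the interval have indices between a least [m0] and a greatest [m1], and
    [m1 - m0] is at most [k] times the length. *)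
Lemma card_grid_itv (k : nat) (a b : R) : (0 < k)%N ->
 #|[pred m : 'I_k | a <= m%:R / k%:R <= b]|%:R <= k%:R * Num.max 0 (b - a) + 1 :> R.
Proof.
move=>k0;set S := [pred m : 'I_k | _].
have kR : 0 < k%:R :> R by rewrite ltr0n.
have [S0|[x0 Sx0]] := set_0Vmem [set m in S].
 by rewrite -cardsE S0 cards0 addr_ge0// mulr_ge0 ?ler0n// le_max lexx.
have {}Sx0 : S x0 by rewrite inE in Sx0.
case:(arg_minnP (fun m : 'I_k => m : nat) Sx0) => m0 Sm0 hm0.
case:(arg_maxnP (fun m : 'I_k => m : nat) Sx0) => m1 Sm1 hm1.
have m01 : (m0 <= m1)%N by exact:hm0.
have le_card : (#|S| <= (m1 - m0).+1)%N.
 rewrite cardE -(size_map val) -(size_iota m0 (m1 - m0).+1).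
 apply:uniq_leq_size;first by rewrite map_inj_uniq ?enum_uniq//;exact:val_inj.
 move=>j /mapP[m];rewrite mem_enum => Sm ->.
 rewrite mem_iota addnS subnKC// ltnS.
 by rewrite hm0//=;exact:hm1.
apply:(@le_trans _ _ ((m1 - m0).+1%:R));first by rewrite ler_nat.
rewrite -natr1 lerD2r natrB// -ler_pdivrMl// le_max;apply/orP;right.
move: Sm0 Sm1 => /andP[h1 h2] /andP[h3 h4].
by rewrite mulrC mulrBl lerB.
Qed.

(** Counting argument: the unit box contains the [k ^ n] points with coordinates [m / k], [m < k],
    while a box holds at most the product of the numbers [k * side + 1] of them. This bounds covers
    from below without any additivity of the measure. *)
Lemma box_cover_grid (I : eqType) (s : seq I) (Q : I -> E * E) (k : nat) : (0 < k)%N ->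
 box (0, const_mx 1) `<=` \bigcup_(j in [set` s]) box (Q j) ->
 1 <= \sum_(j <- s) \prod_(i < n) (Num.max 0 ((Q j).2 ord0 i - (Q j).1 ord0 i) + k%:R^-1).
Proof.
move=>k0 cov;have kR : 0 < k%:R :> R by rewrite ltr0n.
pose F j (i : 'I_n) := [pred m : 'I_k | (Q j).1 ord0 i <= m%:R / k%:R <= (Q j).2 ord0 i].
have cardF : (k ^ n <= \sum_(j <- s) \prod_(i < n) #|F j i|)%N.
 rewrite -[in leqLHS](card_ord k) -[n in leqLHS]card_ord -card_ffun.
 have -> : (\sum_(j <- s) \prod_(i < n) #|F j i| = \sum_(j <- s) #|(family (F j) : simpl_pred {ffun 'I_n -> 'I_k})|)%N.
  apply:eq_bigr => j _;rewrite card_family foldrE big_map.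
  by rewrite big_enum.
 apply:(@leq_trans (\sum_(j <- s) \sum_(f : {ffun 'I_n -> 'I_k}) (f \in family (F j)))%N).
  rewrite exchange_big/= -sum1_card;apply:leq_sum => f _.
  have [|j /= js fj] := cov (\row_i ((f i)%:R / k%:R)).
   move=>i;rewrite !mxE divr_ge0//= ler_pdivrMr// mul1r ler_nat.
   exact/ltnW/ltn_ord.
  rewrite (big_rem j)//=.
  suff -> : f \in family (F j) by [].
  by apply/familyP => i;rewrite inE;have := fj i;rewrite mxE.
 by apply:leq_sum => j _;rewrite -big_mkcond/= sum1_card.
have kn0 : 0 < k%:R ^+ n :> R by rewrite exprn_gt0.
rewrite -(ler_pM2l kn0) mulr1 mulr_sumr.
apply:(@le_trans _ _ (\sum_(j <- s) \prod_(i < n) #|F j i|)%:R).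
 by rewrite -natrX ler_nat.
rewrite natr_sum;apply:ler_sum => j _;rewrite natr_prod.
rewrite -[n in k%:R ^+ n]card_ord -prodr_const -big_split/=.
apply:ler_prod => i _;rewrite ler0n/= mulrDr mulfV ?gt_eqF//.
exact:card_grid_itv.
Qed.

Lemma cvg_prod_shift (c : 'I_n -> R) :
 (\prod_(i < n) (c i + k.+1%:R^-1)) @[k --> \oo] --> (\prod_(i < n) c i).
Proof.
rewrite /index_enum;elim:(Finite.enum _) => [|i s ih].
 by rewrite big_nil;under eq_fun do rewrite big_nil;exact:cvg_cst.
rewrite big_cons;under eq_fun do rewrite big_cons.
apply:cvgM => //;rewrite -[X in _ --> X]addr0.
by apply:cvgD;[exact:cvg_cst|exact:cvg_harmonic].
Qed.

(** The volume depends continuously on the sides, so adding a suitable [j.+1%:R^-1] to each of them,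
    half at either end, costs at most [e]. *)
Lemma box_enlarge Q (e : R) : 0 < e ->
 exists2 d, 0 < d & box Q `<=` interior (box (Q.1 - const_mx d, Q.2 + const_mx d)) /\
  (box_vol (Q.1 - const_mx d, Q.2 + const_mx d)%R <= box_vol Q + e%:E)%E.
Proof.
move=>e0;pose c i := Num.max 0 (Q.2 ord0 i - Q.1 ord0 i).
have /cvgrPdist_lt/(_ _ e0)[j _ /(_ j (leqnn _)) hj] := @cvg_prod_shift c.
pose d : R := j.+1%:R^-1 / 2;have d0 : 0 < d by rewrite divr_gt0.
exists d => //;split.
 move=>x Qx;apply/nbhs_ballP;exists d => //= y;rewrite ball_coordE// => xy i.
 have /andP[h1 h2] := Qx i;have /andP[h3 h4] := xy i Logic.I.
 by rewrite !mxE;apply/andP;split;lra.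
rewrite /box_vol -EFinD lee_fin.
apply:(@le_trans _ _ (\prod_(i < n) (c i + j.+1%:R^-1))).
 apply:ler_prod => i _;rewrite le_max lexx/= !mxE /c ge_max;apply/andP;split.
  by rewrite addr_ge0// le_max lexx.
 have h : Q.2 ord0 i - Q.1 ord0 i <= Num.max 0 (Q.2 ord0 i - Q.1 ord0 i) by rewrite le_max lexx orbT.
 rewrite (_ : _ + d - _ = (Q.2 ord0 i - Q.1 ord0 i) + j.+1%:R^-1) ?lerD2r//.
 by rewrite /d;field.
by move: hj;rewrite distrC => /(le_lt_trans (ler_norm _));rewrite /c;lra.
Qed.

Lemma box_compact Q : compact (box Q).
Proof.
have := @rV_compact R n (fun i => `[Q.1 ord0 i, Q.2 ord0 i]%classic) (fun i => @segment_compact R _ _).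
by congr compact;apply/seteqP;split => x /= h i;have := h i;rewrite /= in_itv.
Qed.

(** Heine-Borel: the boxes of a cover are enlarged to open ones at total cost [e], finitely many of
    them suffice, and the grid count with [k] tending to infinity gives total volume at least 1. *)
Lemma leb_unit_box_ge1 : (1 <= leb (box (0%R, const_mx 1%R) : set E))%E.
Proof.
apply:le_ereal_inf_tmp => _ [D [Q [KQ ->]]].
apply/lee_addgt0Pr => e e0.
have e_gt0 k : 0 < e / (2 ^ k.+1)%:R by rewrite divr_gt0// ltr0n expn_gt0.
have /choice[Q' hQ'] : forall k, exists Q' : E * E, box (Q k) `<=` interior (box Q') /\
  (box_vol Q' <= box_vol (Q k) + (e / (2 ^ k.+1)%:R)%:E)%E.
 by move=>k;have [d _ hd] := box_enlarge (Q k) (e_gt0 k);eexists;exact:hd.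
have := @box_compact (0, const_mx 1 : E);rewrite compact_cover.
move=>/(_ nat D (fun k => interior (box (Q' k)))) [|x /KQ[k Dk]|F FD cF].
- by move=>k _;exact:open_interior.
- by move/(hQ' k).1 => h;exists k.
have h1 : 1 <= \sum_(j <- enum_fset F) \prod_(i < n) Num.max 0 ((Q' j).2 ord0 i - (Q' j).1 ord0 i).
 have cv : (\sum_(j <- enum_fset F) \prod_(i < n) (Num.max 0 ((Q' j).2 ord0 i - (Q' j).1 ord0 i) + k.+1%:R^-1))
  @[k --> \oo] --> \sum_(j <- enum_fset F) \prod_(i < n) Num.max 0 ((Q' j).2 ord0 i - (Q' j).1 ord0 i).
  elim:(enum_fset F) => [|j s ih].
   by rewrite big_nil;under eq_fun do rewrite big_nil;exact:cvg_cst.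
  rewrite big_cons;under eq_fun do rewrite big_cons.
  by apply:cvgD => //;exact:cvg_prod_shift.
 rewrite -(cvg_lim _ cv)//;apply:limr_ge;first by apply/cvg_ex;eexists;exact:cv.
 apply:nearW => k;apply:box_cover_grid => // x /cF[j jF] /interior_subset ?.
 by exists j.
apply:(@le_trans _ _ (\esum_(k in D) (box_vol (Q k) + (e / (2 ^ k.+1)%:R)%:E))%E).
 apply:esum_ge;exists [set` F];first by split => // k /= /FD /set_mem.
 rewrite fsbig_finite//= set_fsetK.
 apply:(@le_trans _ _ (\sum_(j <- enum_fset F) box_vol (Q' j))%E).
  by rewrite /box_vol sumEFin lee_fin.
 by apply:lee_sum => k _;exact:(hQ' k).2.
rewrite esumD;[|by move=> *;exact:box_vol_ge0|by move=>k _;rewrite lee_fin ltW].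
apply:leeD => //;apply:(@le_trans _ _ (\esum_(k in [set: nat]) (e / (2 ^ k.+1)%:R)%:E)%E).
 rewrite esum_mkcond;apply:le_esum => k _;case:ifP => // _.
 by rewrite lee_fin ltW.
rewrite -nneseries_esumT;last by move=>k;rewrite lee_fin ltW.
by apply:epsilon_trick0;exact:ltW.
Qed.

(** The volume [2 ^ n] of the unit ball of the sup norm; it enters only through its positivity and
    the scaling law [lam_ballE]. *)
Definition cube_vol : R := fine (mu (ball (0 : E) 1)).

Lemma lam_box_fin Q : (mu (box Q) < +oo)%E.
Proof. by apply:le_lt_trans (leb_box_le Q) _;rewrite ltry. Qed.

Lemma ball_affine (x : E) (r : R) : 0 < r ->
 ball x r = affine r^-1 (- (r^-1 *: x)) @^-1` (ball (0 : E) 1).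
Proof.
move=>r0;rewrite !ball_coordE//;apply/seteqP;split => y /= h i _;have := h i Logic.I;rewrite /= !mxE.
 rewrite -mulrBr sub0r add0r => /andP[h1 h2].
 by rewrite !(ltr_pdivlMl _ _ r0) (ltr_pdivrMl _ _ r0);apply/andP;split;lra.
rewrite -mulrBr sub0r add0r !(ltr_pdivlMl _ _ r0) (ltr_pdivrMl _ _ r0) => /andP[h1 h2].
by apply/andP;split;lra.
Qed.

Lemma lam_ball_scale (x : E) (r : R) : 0 < r -> mu (ball x r) = ((r ^+ n)%:E * mu (ball (0%R : E) 1%R))%E.
Proof.
move=>r0;rewrite ball_affine// [LHS](@leb_affine R n);last by rewrite invr_eq0 gt_eqF.
by rewrite gtr0_norm ?invr_gt0// exprVn invrK.
Qed.

Lemma lamB_lty (x : E) (r : R) : (mu (ball x r) < +oo)%E.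
Proof.
have [r0|r0] := ltP 0 r;last first.
 rewrite (_ : ball x r = set0) ?measure0//;apply/seteqP;split=> // y [] r1.
 by move: (lt_le_trans r1 r0);rewrite ltxx.
apply:le_lt_trans (lam_box_fin (x - const_mx r, x + const_mx r)).
apply:le_leb => y;rewrite ball_coordE// => h i;have /andP[h1 h2] := h i Logic.I.
by rewrite !mxE !ltW.
Qed.

Lemma cube_vol_gt0 : 0 < cube_vol.
Proof.
have h : (1 <= mu (ball (0%R : E) 2%R))%E.
 apply:le_trans leb_unit_box_ge1 _;apply:le_leb => y h.
 rewrite ball_coordE// => i _;have := h i;rewrite !mxE/= => /andP[h1 h2].
 by apply/andP;split;lra.
rewrite /cube_vol fine_gt0// lamB_lty andbT lt_neqAle measure_ge0 andbT.
apply/eqP => h0;move: h;rewrite lam_ball_scale// -h0 mule0.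
by rewrite lee_fin ler10.
Qed.

Lemma lam_ballE (x : E) (r : R) : 0 < r -> mu (ball x r) = (r ^+ n * cube_vol)%:E.
Proof.
move=>r0;rewrite lam_ball_scale// EFinM /cube_vol fineK// ge0_fin_numE//.
exact:lamB_lty.
Qed.

Lemma lam_sigma_finite : sigma_finite setT mu.
Proof.
exists (fun k => ball (0 : E) k.+1%:R);last first.
 by move=>k;split;[exact:measurable_ball_rV|exact:lamB_lty].
apply/seteqP;split => // x _;exists (Num.bound `|x|) => //.
rewrite -ball_normE /= sub0r normrN.
have := @archi_boundP R `|x| (normr_ge0 _) => /lt_le_trans;apply.
by rewrite ler_nat.
Qed.

(* [lam] is a packed measure on which no further structure can be declared. *)
Definition lamf : set L -> \bar R := mu.
HB.instance Definition _ := Measure.copy lamf mu.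
HB.instance Definition _ := Measure_isSigmaFinite.Build _ _ _ lamf lam_sigma_finite.

Lemma lam_tonelli (f : L * L -> \bar R) : measurable_fun setT f ->
 (forall z, 0 <= f z)%E ->
 (\int[mu]_x \int[mu]_y f (x, y) = \int[mu]_y \int[mu]_x f (x, y))%E.
Proof. exact:(@fubini_tonelli _ _ _ _ R lamf lamf f). Qed.

Lemma measurable_lam_tonelli (f : L * L -> \bar R) : measurable_fun setT f ->
 (forall z, 0 <= f z)%E ->
 measurable_fun setT (fun x : L => \int[mu]_y f (x, y))%E.
Proof. exact:(@measurable_fun_fubini_tonelli_F _ _ _ _ R lamf f). Qed.

(** The sigma-algebra here is the product one. An open set belongs to it because it is a countable
    union of products of rational cubes. *)
Lemma measurable_fun_prod_continuous (f : E * E -> R) : continuous f ->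
 measurable_fun setT (f : (L * L)%type -> R).
Proof.
move=>cf;apply:(measurability _ (@RGenOInfty.measurableE R)) => //.
move=>_ [_ [a ->] <-];rewrite setTI.
set O := f @^-1` _.
have oO : open O by apply:open_comp => //;exact:interval_open.
pose F (q : 'rV[rat]_n * 'rV[rat]_n * nat) : set (L * L)%type :=
 let B := ball (map_mx ratr q.1.1 : E) q.2.+1%:R^-1 `*` ball (map_mx ratr q.1.2 : E) q.2.+1%:R^-1 in
 if `[< B `<=` O >] then B else set0.
rewrite (_ : O = \bigcup_q F q);last first.
 apply/seteqP;split => x;last first.
  by move=>[q _];rewrite /F;case:asboolP => // h /h.
 move=>Ox;have /nbhs_ballP[e /= e0 eO] := open_nbhs_nbhs (conj oO Ox).
 have e20 : 0 < e / 2 by lra.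
 pose k := Num.bound (e / 2)^-1.
 have ke : k.+1%:R^-1 < e / 2 :> R.
  rewrite invf_plt ?posrE//;have := @archi_boundP R (e/2)^-1 _.
  rewrite invr_ge0 ltW// => /(_ isT)/lt_le_trans;apply.
  by rewrite ler_nat.
 have k0 : 0 < k.+1%:R^-1 :> R by rewrite invr_gt0.
 have [q1 xq1] := rat_dense_rV x.1 k0.
 have [q2 xq2] := rat_dense_rV x.2 k0.
 exists (q1, q2, k) => //;rewrite /F /=.
 case:asboolP => [_|h];first by split;exact:ball_sym.
 exfalso;apply:h => y [qy1 qy2];apply:eO.
 by rewrite (splitr e);split;
  apply:ball_triangle;[exact:(le_ball (ltW ke) xq1)|exact:(le_ball (ltW ke) qy1)
   |exact:(le_ball (ltW ke) xq2)|exact:(le_ball (ltW ke) qy2)].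
apply:countable_bigcupT_measurable => [|q];first exact:countableP.
rewrite /F;case:ifP => _;last exact:measurable0.
by apply:measurableX;exact:measurable_ball_rV.
Qed.

End LebesguePositive.

(** * Continuity of combinations of functions *)

Section ContinuousCombinators.
Context {R : realType}.

Lemma contM (T : topologicalType) (f g : T -> R) : continuous f -> continuous g ->
 continuous (fun x => f x * g x).
Proof. by move=>cf cg x;exact:(cvgM (cf x) (cg x)). Qed.

Lemma contD (T : topologicalType) (f g : T -> R) : continuous f -> continuous g ->
 continuous (fun x => f x + g x).
Proof. by move=>cf cg x;exact:(cvgD (cf x) (cg x)). Qed.

Lemma continuous_oppfun (T : topologicalType) (f : T -> R) : continuous f -> continuous (fun x => - f x).
Proof. by move=>cf x;exact:(cvgN (cf x)). Qed.

Lemma contB (T : topologicalType) (f g : T -> R) : continuous f -> continuous g ->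
 continuous (fun x => f x - g x).
Proof. by move=>cf cg;apply:contD => //;exact:continuous_oppfun. Qed.

Lemma contC (T : topologicalType) (c : R) : continuous (fun _ : T => c).
Proof. by move=>x;exact:cvg_cst. Qed.

Lemma cont_comp (T U V : topologicalType) (f : T -> U) (g : U -> V) :
 continuous f -> continuous g -> continuous (fun x => g (f x)).
Proof. by move=>cf cg x;apply:continuous_comp;[exact:cf|exact:cg]. Qed.

Lemma cont_bigM (T : topologicalType) (I : Type) (s : seq I) (f : I -> T -> R) :
 (forall i, continuous (f i)) -> continuous (fun x => \prod_(i <- s) f i x).
Proof.
move=>cf;elim:s => [|i s ih].
 by under eq_fun do rewrite big_nil;move=>x;exact:cvg_cst.
by under eq_fun do rewrite big_cons;exact:contM.
Qed.

End ContinuousCombinators.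

(** * Directional derivatives and C^k functions *)

Section DirectionalDerivatives.
Context {R : realType} {n : nat}.
Local Notation E := 'rV[R]_n.
Implicit Types (f g : E -> R) (x v : E) (i : 'I_n).

Lemma line_quotient f x v (t : R) :
 (fun h : R => h^-1 *: (((fun s : R => f (x + s *: v)) \o shift t) (h *: (1 : R)) - f (x + t *: v))) =
 (fun h : R => h^-1 *: ((f \o shift (x + t *: v)) (h *: v) - f (x + t *: v))).
Proof.
apply/funext => h /=;congr (_ *: (f _ - _)).
by rewrite -[h *: 1]/(h * 1) mulr1 scalerDl addrCA.
Qed.

Lemma is_derive_line f x v (t : R) : derivable f (x + t *: v) v ->
 is_derive t (1 : R) (fun s : R => f (x + s *: v)) ('D_v f (x + t *: v)).
Proof.
move=>df;apply:DeriveDef.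
 by rewrite /derivable line_quotient.
by rewrite /derive line_quotient.
Qed.

Lemma is_der_lineV f x v (d : R) :
 is_derive (0 : R) (1 : R) (fun s : R => f (x + s *: v)) d -> is_derive x v f d.
Proof.
have := line_quotient f x v 0;rewrite scale0r addr0 => q.
case => df dE;apply:DeriveDef.
 by move: df;rewrite /derivable scale0r addr0 q.
by move: dE;rewrite /derive scale0r addr0 q.
Qed.

Lemma derive_scaler f x v (a : R) : derivable f x v ->
 is_derive x v (fun y => a * f y) (a * 'D_v f x).
Proof. by move=>df;apply:(@is_deriveZ _ _ _ f a x v);exact:DeriveDef. Qed.

Lemma is_derive_comp_real (h : R -> R) f x v :
 derivable f x v -> derivable h (f x) 1 ->
 is_derive x v (h \o f) ((derive1 h) (f x) * 'D_v f x).
Proof.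
move=>df dh;apply:is_der_lineV.
have fx : f x = f (x + 0 *: v) by rewrite scale0r addr0.
have d1 : is_derive (0 : R) (1 : R) (fun s : R => f (x + s *: v)) ('D_v f x).
 have := @is_derive_line f x v 0;rewrite scale0r addr0;exact.
have d2 : is_derive (f (x + 0 *: v)) (1 : R) h ((derive1 h) (f x)).
 by rewrite -fx derive1E;exact:DeriveDef.
exact:(@is_derive1_comp _ h (fun s : R => f (x + s *: v)) 0).
Qed.

Lemma is_deriveM_rV f g x v : derivable f x v -> derivable g x v ->
 is_derive x v (fun y => f y * g y) (f x * 'D_v g x + g x * 'D_v f x).
Proof.
move=>df dg;have := @is_deriveM _ _ f g x v _ _ (DeriveDef df erefl) (DeriveDef dg erefl).
by rewrite /GRing.scale/=.
Qed.

Lemma C1_comp (h : R -> R) f : Ck 1 f -> (forall t, derivable h t 1) ->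
 continuous (derive1 h) -> Ck 1 (h \o f).
Proof.
move=>[cf df] dh ch;split.
 move=>x;apply:continuous_comp;first exact:cf.
 by apply/differentiable_continuous/derivable1_diffP.
move=>i;have [dfi cfi] := df i;split.
 by move=>x;have [] := is_derive_comp_real (dfi x) (dh (f x)).
rewrite (_ : 'D_(evec i) (h \o f) = fun x => (derive1 h) (f x) * 'D_(evec i) f x).
 by apply:contM => //;exact:cont_comp.
by apply/funext => x;have [_ ->] := is_derive_comp_real (dfi x) (dh (f x)).
Qed.

Lemma C1_mul f g : Ck 1 f -> Ck 1 g -> Ck 1 (fun x => f x * g x).
Proof.
move=>[cf df] [cg dg];split;first exact:contM.
move=>i;have [dfi cfi] := df i;have [dgi cgi] := dg i;split.
 by move=>x;have [] := is_deriveM_rV (dfi x) (dgi x).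
rewrite (_ : 'D_(evec i) _ = fun x => f x * 'D_(evec i) g x + g x * 'D_(evec i) f x).
 by apply:contD;exact:contM.
by apply/funext => x;have [_ ->] := is_deriveM_rV (dfi x) (dgi x).
Qed.

Lemma C1_add f g : Ck 1 f -> Ck 1 g -> Ck 1 (fun x => f x + g x).
Proof.
move=>[cf df] [cg dg];split;first exact:contD.
move=>i;have [dfi cfi] := df i;have [dgi cgi] := dg i.
have h x : is_derive x (evec i) (fun x => f x + g x) ('D_(evec i) f x + 'D_(evec i) g x).
 exact:(@is_deriveD _ _ _ f g x _ _ _ (DeriveDef (dfi x) erefl) (DeriveDef (dgi x) erefl)).
split;first by move=>x;have [] := h x.
rewrite (_ : 'D_(evec i) _ = fun x => 'D_(evec i) f x + 'D_(evec i) g x).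
 exact:contD.
by apply/funext => x;have [_ ->] := h x.
Qed.

Lemma Ck_cont k f : Ck k f -> continuous f.
Proof. by case:k => [|k] //= []. Qed.

Lemma is_derive_affine f (a : R) (b : E) x i : derivable f (affine a b x) (evec i) ->
 is_derive x (evec i) (f \o affine a b) (a * 'D_(evec i) f (affine a b x)).
Proof.
move=>df;apply:is_der_lineV.
pose g (s : R) := f (affine a b x + s *: evec i).
have -> : (fun s : R => (f \o affine a b) (x + s *: evec i)) = g \o (fun s : R => a * s).
 by apply/funext => s;rewrite /g /= /affine scalerDr scalerA addrAC.
have d1 : is_derive (a * 0) (1 : R) g ('D_(evec i) f (affine a b x)).
 rewrite mulr0;have := @is_derive_line f (affine a b x) (evec i) 0.
 by rewrite scale0r addr0;exact.
have d2 : is_derive (0 : R) (1 : R) (fun s : R => a * s) a.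
 have := @is_deriveZ _ _ _ (@id R) a (0 : R) (1 : R) 1 (is_derive_id _ _).
 by rewrite /GRing.scale/= mulr1.
rewrite mulrC;exact:(@is_derive1_comp _ g (fun s : R => a * s) 0).
Qed.

Lemma affine_continuous (a : R) (b : E) : continuous (affine a b).
Proof. move=>x;apply:(@continuousD _ _ _ (fun x => a *: x) (cst b));last exact:cst_continuous.
exact:scaler_continuous. Qed.

Lemma Ck_affine k f (a : R) (b : E) : Ck k f -> Ck k (f \o affine a b).
Proof.
have ca : continuous (affine a b) := @affine_continuous a b.
have cc g : continuous g -> continuous (g \o affine a b).
 by move=>cg x;apply:continuous_comp;[exact:ca|exact:cg].
(* The constant [c] is carried along in the induction because every differentiation brings out a
   factor [a]. *)
suff : Ck k f -> forall c : R, Ck k (fun x => c * f (affine a b x)).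
 move=>h /h/(_ 1);congr Ck;by apply/funext => x;rewrite mul1r.
elim:k f => [|k ih] f /= cf c;first by apply:contM;[exact:cst_continuous|exact:cc].
have [cf0 df] := cf;split;first by apply:contM;[exact:cst_continuous|exact:cc].
move=>i;have [h1 h2] := df i.
have d x : is_derive x (evec i) (fun x => c * f (affine a b x)) (c * (a * 'D_(evec i) f (affine a b x))).
 have [d1 <-] := is_derive_affine (h1 (affine a b x)).
 exact:(derive_scaler c d1).
split;first by move=>x;have [] := d x.
rewrite (_ : 'D_(evec i) _ = fun x => (c * a) * 'D_(evec i) f (affine a b x));first exact:(ih _ h2 (c * a)).
by apply/funext => x;have [_ ->] := d x;rewrite mulrA.
Qed.

Fixpoint C1k (k : nat) (h : R -> R) : Prop :=
 if k is k'.+1 then [/\ continuous h, forall t, derivable h t 1 & C1k k' (derive1 h)]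
 else continuous h.

(** Differentiating in the direction [j] replaces the factor [h j] by its derivative and gives a
    product of the same kind; for this reason all factors are assumed smooth of every order. *)
Lemma Ck_prod k (h : 'I_n -> R -> R) : (forall k i, C1k k (h i)) ->
 Ck k (fun x => \prod_(i < n) h i (x ord0 i)).
Proof.
elim:k h => [|k ih] h hC.
 apply:cont_bigM => i;apply:cont_comp;first exact:coord_continuous.
 exact:(hC 0%N).
split.
 apply:cont_bigM => i;apply:cont_comp;first exact:coord_continuous.
 exact:(hC 0%N).
move=>j;pose h' i := if i == j then (derive1 (h j)) else h i.
have d x : is_derive x (evec j) (fun x => \prod_(i < n) h i (x ord0 i)) (\prod_(i < n) h' i (x ord0 i)).
 apply:is_der_lineV.
 have [_ dj _] := hC 1%N j.
 rewrite (_ : (fun s : R => _) = (fun s : R => (\prod_(i < n | i != j) h i (x ord0 i)) *: h j (x ord0 j + s))).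
  have -> : \prod_(i < n) h' i (x ord0 i) =
    (\prod_(i < n | i != j) h i (x ord0 i)) * derive1 (h j) (x ord0 j).
   rewrite (bigD1 j)//= mulrC;congr (_ * _);last by rewrite /h' eqxx.
   by apply:eq_bigr => i /negbTE ij;rewrite /h' ij.
  apply:is_deriveZ;rewrite -[X in is_derive _ _ _ X]mulr1.
  have d1 : is_derive (x ord0 j + 0) (1 : R) (h j) ((derive1 (h j)) (x ord0 j)).
   by rewrite addr0 derive1E;exact:DeriveDef.
  have d2 : is_derive (0 : R) (1 : R) (fun s : R => x ord0 j + s) 1.
   rewrite -[X in is_derive _ _ _ X]add0r;apply:is_deriveD.
  by have := @is_derive1_comp _ (h j) (fun s : R => x ord0 j + s) 0 _ _ d1 d2;rewrite /GRing.scale/= mulrC.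
 apply/funext => s;rewrite (bigD1 j)//= mulrC;congr (_ * _).
  by apply:eq_bigr => i ij;rewrite !mxE eqxx/= (negbTE ij) mulr0 addr0.
 by rewrite !mxE !eqxx/= mulr1.
split;first by move=>x;have [] := d x.
rewrite (_ : 'D_(evec j) _ = fun x => \prod_(i < n) h' i (x ord0 i));last first.
 by apply/funext => x;have [_ ->] := d x.
apply:ih => m i;rewrite /h';case:eqP => [_|_];last exact:hC.
by have [_ _] := hC m.+1 j.
Qed.

End DirectionalDerivatives.

(** * A smooth bump function *)

Section SmoothBump.
Context {R : realType}.
Implicit Types (f g : R -> R) (k m : nat).

Lemma C1kS k f : C1k k.+1 f -> C1k k f.
Proof. by elim:k f => [|k ih] f [] // cf df kf;split => //;exact:ih. Qed.

Lemma is_derive_derive1 f (t : R) : derivable f t 1 -> is_derive t (1 : R) f (derive1 f t).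
Proof. by move=>df;rewrite derive1E;exact:DeriveDef. Qed.

Lemma is_derive1_eq f (t d : R) : is_derive t (1 : R) f d -> derive1 f t = d.
Proof. by case=> _ <-;rewrite derive1E. Qed.

Lemma C1k_lin k (a b : R) f g : C1k k f -> C1k k g -> C1k k (fun t => a * f t + b * g t).
Proof.
elim:k f g => [|k ih] f g /=.
 move=>cf cg;apply:contD;apply:contM => //;exact:cst_continuous.
move=>[cf df kf] [cg dg kg].
have d t : is_derive t (1 : R) (fun t => a * f t + b * g t) (a * derive1 f t + b * derive1 g t).
 apply:is_deriveD;rewrite -[_ * _]/(_ *: _).
  by apply:(@is_deriveZ _ _ _ f a t 1);exact:is_derive_derive1.
 by apply:(@is_deriveZ _ _ _ g b t 1);exact:is_derive_derive1.
split.
- apply:contD;apply:contM => //;exact:cst_continuous.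
- by move=>t;have [] := d t.
- rewrite (_ : derive1 _ = fun t => a * derive1 f t + b * derive1 g t);first exact:ih.
 by apply/funext => t;exact:is_derive1_eq.
Qed.

Lemma C1k_mul k f g : C1k k f -> C1k k g -> C1k k (fun t => f t * g t).
Proof.
elim:k f g => [|k ih] f g /=;first by move=>cf cg;exact:contM.
move=>kf' kg';have kf := C1kS kf';have kg := C1kS kg'.
move: kf' kg' => [cf df kdf] [cg dg kdg].
have d t : is_derive t (1 : R) (fun t => f t * g t) (1 * (f t * derive1 g t) + 1 * (g t * derive1 f t)).
 rewrite !mul1r -[f t * _]/(_ *: _) -[g t * _]/(_ *: _).
 by apply:is_deriveM;exact:is_derive_derive1.
split;[exact:contM|by move=>t;have [] := d t|].
rewrite (_ : derive1 _ = fun t => 1 * (f t * derive1 g t) + 1 * (g t * derive1 f t)).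
 by apply:C1k_lin;exact:ih.
by apply/funext => t;exact:is_derive1_eq.
Qed.

Lemma C1k_affine k f (a b : R) : C1k k f -> C1k k (fun t => f (a * t + b)).
Proof.
have ca : continuous (fun t : R => a * t + b).
 apply:contD;last exact:cst_continuous.
 by apply:contM;[exact:cst_continuous|move=>t;exact:cvg_id].
elim:k f => [|k ih] f /=;first by move=>cf;exact:cont_comp.
move=>[cf df kf].
have d t : is_derive t (1 : R) (fun t => f (a * t + b)) (derive1 f (a * t + b) * a).
 apply:(@is_derive1_comp _ f (fun t : R => a * t + b));first exact:is_derive_derive1.
 rewrite -[X in is_derive _ _ _ X]addr0;apply:is_deriveD.
 by have := @is_deriveZ _ _ _ (@id R) a t 1 1 (is_derive_id _ _);rewrite /GRing.scale/= mulr1.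
split;[exact:cont_comp|by move=>t;have [] := d t|].
rewrite (_ : derive1 _ = fun t => a * derive1 f (a * t + b) + 0 * derive1 f (a * t + b)).
 by apply:C1k_lin;exact:ih.
by apply/funext => t;rewrite (is_derive1_eq (d t)) mul0r addr0 mulrC.
Qed.

(** The negative powers make the family closed under differentiation: the derivative of [flat k]
    combines [flat k.+2] and [flat k.+1]. *)
Definition flat k (t : R) : R := if 0 < t then t ^- k * expR (- t^-1) else 0.

Lemma flat_ge0 k t : 0 <= flat k t.
Proof. by rewrite /flat;case:ltP => // t0;rewrite mulr_ge0 ?expR_ge0// invr_ge0 exprn_ge0 ?ltW. Qed.

(** The term of order [k.+2] of the exponential series bounds [expR t^-1] from below. The quadratic
    bound makes the derivative at 0 vanish. *)
Lemma flat_le k t : flat k t <= (k.+2)`!%:R * t ^+ 2.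
Proof.
rewrite /flat;case:ltP => t0;last by rewrite mulr_ge0 ?sqr_ge0.
rewrite expRN ler_pdivrMr ?expR_gt0//.
have h : t^-1 ^+ k.+2 / (k.+2)`!%:R <= expR t^-1.
 by apply:le_trans (expR_ge1Dxn k.+1 _);rewrite ?lerDr// invr_ge0 ltW.
have f0 : 0 < (k.+2)`!%:R :> R by rewrite ltr0n fact_gt0.
move: h;rewrite ler_pdivrMr// => h.
rewrite mulrAC -ler_pdivrMr ?exprn_gt0// -exprVn -exprVn -exprD addn2.
by rewrite mulrC.
Qed.

Lemma is_derive_flat k t : is_derive t (1 : R) (flat k) (1 * flat k.+2 t + (- k%:R) * flat k.+1 t).
Proof.
have [t0|t0|t0] := ltgtP 0 t;last rewrite -{}t0.
- have loc : \forall s \near t, s ^- k * expR (- s^-1) = flat k s.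
  by near=> s;rewrite /flat ifT//;near: s;exact:lt_nbhsr.
 apply:(near_eq_is_derive loc).
 have tn0 : t != 0 by rewrite gt_eqF.
 have d1 : is_derive t (1 : R) (fun s : R => s^-1) (- t ^- 2).
  by have := @is_deriveV _ (@id R) t 1 1 tn0 (is_derive_id _ _);rewrite /GRing.scale/= mulr1.
 have d2 : is_derive t (1 : R) (fun s : R => expR (- s^-1)) (expR (- t^-1) * t ^- 2).
  apply:(@is_derive1_comp _ expR (fun s : R => - s^-1)).
  by rewrite -[X in is_derive _ _ _ X]opprK;exact:is_deriveN.
 have d3 : is_derive t (1 : R) (fun s : R => s ^- k) (- k%:R * t ^- k.+1).
  have dX : is_derive t^-1 (1 : R) (fun s : R => s ^+ k) (k%:R * t^-1 ^+ k.-1).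
   apply:DeriveDef.
    by have := @derivableX _ _ (@id R) k t^-1 1 (@derivable_id _ _ _ _);rewrite fctE.
   by rewrite exp_derive -[_ *: 1]/(_ * 1) mulr1.
  have := @is_derive1_comp _ (fun s => s ^+ k) (fun s : R => s^-1) t _ _ dX d1.
  rewrite (_ : _ \o _ = fun s : R => s ^- k);last by apply/funext => s /=;rewrite exprVn.
  congr is_derive;case:k {loc dX} => [|k];first by rewrite mulr0n !(mul0r, oppr0).
  by rewrite mulrN mulNr -mulrA -!exprVn -exprD addn2.
 have := @is_deriveM _ _ _ _ _ _ _ _ d3 d2;congr is_derive.
 rewrite /flat t0 /GRing.scale/=;rewrite !exprSr !invfM;field.
 by rewrite expf_neq0//= tn0.
- have -> : 1 * flat k.+2 t + - k%:R * flat k.+1 t = 0.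
  by rewrite /flat ltNge ltW//= !mulr0 addr0.
 have loc : \forall s \near t, (0 : R) = flat k s.
  by near=> s;rewrite /flat ifF//;apply/negbTE;rewrite -leNgt ltW//;near: s;exact:lt_nbhsl.
 apply:(near_eq_is_derive loc);exact:is_derive_cst.
- rewrite /flat !ltxx !mulr0 addr0.
 have h : (fun h : R => h^-1 *: ((flat k \o shift 0) (h *: 1) - flat k 0)) @ 0^' --> (0 : R).
  apply/cvgrPdist_le => e e0;near=> s.
  have s0 : s != 0 by near: s;exact:nbhs_dnbhs_neq.
  rewrite sub0r normrN /= addr0 {2}/flat ltxx subr0 -[s *: 1]/(s * 1) mulr1 -[_ *: _]/(_ * _).
  rewrite normrM normfV ler_pdivrMl ?normr_gt0// (ger0_norm (flat_ge0 _ _)).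
  apply:(le_trans (flat_le _ _)).
  rewrite -real_normK ?num_real// expr2 mulrCA ler_wpM2l// mulrC -ler_pdivlMr;last by rewrite ltr0n fact_gt0.
  near: s;apply:dnbhs0_le;rewrite divr_gt0// ltr0n fact_gt0 //.
 by apply:DeriveDef;[apply/cvg_ex;exists 0|exact:cvg_lim].
Unshelve. all: by end_near. Qed.

Lemma C1k_flat m k : C1k m (flat k).
Proof.
have cf j : continuous (flat j).
 move=>t;apply/differentiable_continuous/derivable1_diffP.
 by have [] := is_derive_flat j t.
elim:m k => [|m ih] k //=;split => //;first by move=>t;have [] := is_derive_flat k t.
rewrite (_ : derive1 _ = fun t => 1 * flat k.+2 t + (- k%:R) * flat k.+1 t).
 by apply:C1k_lin;exact:ih.
by apply/funext => t;rewrite (is_derive1_eq (is_derive_flat k t)).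
Qed.

Definition bump1 (t : R) : R := flat 0 (1 - t) * flat 0 (1 + t).

Lemma C1k_bump1 k : C1k k bump1.
Proof.
rewrite /bump1;apply:C1k_mul.
 have := C1k_affine (-1) 1 (C1k_flat k 0);congr C1k.
 by apply/funext => t;congr flat;rewrite mulN1r addrC.
have := C1k_affine 1 1 (C1k_flat k 0);congr C1k.
by apply/funext => t;congr flat;rewrite mul1r addrC.
Qed.

Lemma bump1_ge0 t : 0 <= bump1 t.
Proof. by rewrite mulr_ge0 ?flat_ge0. Qed.

Lemma bump1_gt0 t : (0 < bump1 t) = (`|t| < 1).
Proof.
rewrite /bump1 /flat ltr_norml;case:(ltP 0 (1 - t)) => h1;last first.
 by rewrite mul0r ltxx;apply/esym/negP => /andP[];lra.
case:(ltP 0 (1 + t)) => h2;last first.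
 by rewrite mulr0 ltxx;apply/esym/negP => /andP[];lra.
rewrite !expr0 !invr1 !mul1r mulr_gt0 ?expR_gt0//.
by apply/esym/andP;split;lra.
Qed.

Section BumpRV.
Variable n : nat.
Local Notation E := 'rV[R]_n.

Definition cbump (x : E) : R := \prod_(i < n) bump1 (x ord0 i).

Lemma cbump_ge0 x : 0 <= cbump x.
Proof. by apply:prodr_ge0 => i _;exact:bump1_ge0. Qed.

Lemma Ck_cbump k : Ck k cbump.
Proof. by apply:(@Ck_prod _ _ k (fun _ => bump1)) => j i;exact:C1k_bump1. Qed.

Lemma cbump_neq0 x : (cbump x != 0) = (`|x| < 1).
Proof.
have -> : (`|x| < 1) = `[< ball (0 : E) 1 x >].
 by apply/idP/asboolP;rewrite -ball_normE /= sub0r normrN.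
rewrite ball_coordE//;apply/idP/asboolP.
 move=>/prodf_neq0 h i _ /=;have := h i isT.
 by rewrite neq_lt ltNge bump1_ge0/= bump1_gt0 mxE sub0r add0r ltr_norml.
move=>h;apply/prodf_neq0 => i _;rewrite gt_eqF// bump1_gt0 ltr_norml.
by have := h i Logic.I;rewrite /= mxE sub0r add0r.
Qed.

End BumpRV.
End SmoothBump.

(** * Euclidean norm, general norms and the mean value theorem *)

Section EuclideanNorm.
Context {R : realType} {n : nat}.
Local Notation E := 'rV[R]_n.
Implicit Types (x y z : E).

Lemma dotC x y : dot x y = dot y x.
Proof. by apply:eq_bigr => i _;rewrite mulrC. Qed.

Lemma dotDl x y z : dot (x + y) z = dot x z + dot y z.
Proof. by rewrite -big_split;apply:eq_bigr => i _;rewrite mxE mulrDl. Qed.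

Lemma dotDr x y z : dot z (x + y) = dot z x + dot z y.
Proof. by rewrite dotC dotDl !(dotC z). Qed.

Lemma dotZl (a : R) x y : dot (a *: x) y = a * dot x y.
Proof. by rewrite mulr_sumr;apply:eq_bigr => i _;rewrite mxE mulrA. Qed.

Lemma dotZr (a : R) x y : dot x (a *: y) = a * dot x y.
Proof. by rewrite dotC dotZl dotC. Qed.

Lemma dotNl x y : dot (- x) y = - dot x y.
Proof. by rewrite -scaleN1r dotZl mulN1r. Qed.

Lemma dotNr x y : dot x (- y) = - dot x y.
Proof. by rewrite dotC dotNl dotC. Qed.

Lemma dot0l x : dot 0 x = 0.
Proof. by rewrite -(scale0r (0 : E)) dotZl mul0r. Qed.

Lemma dot0r x : dot x 0 = 0.
Proof. by rewrite dotC dot0l. Qed.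

Lemma dot_ge0 x : 0 <= dot x x.
Proof. by apply:sumr_ge0 => i _;rewrite -expr2 sqr_ge0. Qed.

Lemma enorm_ge0 x : 0 <= enorm x. Proof. exact:sqrtr_ge0. Qed.

Lemma enorm_sqr x : enorm x ^+ 2 = dot x x.
Proof. by rewrite sqr_sqrtr// dot_ge0. Qed.

Lemma enorm0 : enorm (0 : E) = 0.
Proof. by rewrite /enorm dot0l sqrtr0. Qed.

Lemma coord_le_enorm x i : `|x ord0 i| <= enorm x.
Proof.
rewrite -(ler_pXn2r (isT : (0 < 2)%N)) ?nnegrE ?enorm_ge0// enorm_sqr.
rewrite real_normK ?num_real// /dot (bigD1 i)//= -expr2 lerDl.
by apply:sumr_ge0 => j _;rewrite -expr2 sqr_ge0.
Qed.

Lemma enorm_eq0 x : enorm x = 0 -> x = 0.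
Proof.
move=>x0;apply/rowP => i;rewrite mxE.
by have := coord_le_enorm x i;rewrite x0 normr_le0 => /eqP.
Qed.

Lemma enormZ (a : R) x : enorm (a *: x) = `|a| * enorm x.
Proof. by rewrite /enorm dotZl dotZr mulrA -expr2 sqrtrM ?sqr_ge0// sqrtr_sqr. Qed.

Lemma enormN x : enorm (- x) = enorm x.
Proof. by rewrite -scaleN1r enormZ normrN1 mul1r. Qed.

(** For nonzero vectors, expand the square of [enorm b *: a - enorm a *: b]. *)
Lemma CauchySchwarz_dot x y : `|dot x y| <= enorm x * enorm y.
Proof.
suff h (a b : E) : dot a b <= enorm a * enorm b.
 by rewrite ler_norml h andbT lerNl -dotNl -(enormN x).
have [/enorm_eq0 ->|a0] := eqVneq (enorm a) 0;first by rewrite dot0l enorm0 mul0r.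
have [/enorm_eq0 ->|b0] := eqVneq (enorm b) 0;first by rewrite dot0r enorm0 mulr0.
have := dot_ge0 (enorm b *: a - enorm a *: b).
rewrite !dotDl !dotDr !(dotNl, dotNr) !(dotZl, dotZr) -!enorm_sqr (dotC b a).
have ap : 0 < enorm a by rewrite lt_neqAle eq_sym a0 enorm_ge0.
have bp : 0 < enorm b by rewrite lt_neqAle eq_sym b0 enorm_ge0.
move=>h;rewrite -(ler_pM2l (mulr_gt0 ap bp)).
by move: h;set A := enorm a;set B := enorm b;set D := dot a b;nra.
Qed.

Lemma dot_le_enorm x y : dot x y <= enorm x * enorm y.
Proof. by apply:le_trans (CauchySchwarz_dot x y);exact:ler_norm. Qed.

Lemma enormD x y : enorm (x + y) <= enorm x + enorm y.
Proof.
rewrite -(ler_pXn2r (isT : (0 < 2)%N)) ?nnegrE ?addr_ge0 ?enorm_ge0//.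
rewrite enorm_sqr !dotDl !dotDr sqrrD !enorm_sqr (dotC y x).
by have := dot_le_enorm x y;lra.
Qed.

Lemma norm_le_enorm x : `|x| <= enorm x.
Proof.
rewrite /Num.norm/= mx_normrE;apply:bigmax_le;first exact:enorm_ge0.
by move=>[i j] _ /=;rewrite ord1;exact:coord_le_enorm.
Qed.

Lemma coord_le_norm x i : `|x ord0 i| <= `|x|.
Proof.
rewrite /Num.norm/= mx_normrE.
exact:(@le_bigmax _ _ _ 0 (fun i : 'I_1 * 'I_n => `|x i.1 i.2|) (ord0, i)).
Qed.

Lemma norm_leP x (r : R) : 0 <= r -> (forall i, `|x ord0 i| <= r) -> `|x| <= r.
Proof.
move=>r0 h;rewrite /Num.norm/= mx_normrE;apply:bigmax_le => //.
by move=>[i j] _ /=;rewrite ord1.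
Qed.

Lemma enorm_le_sum x : enorm x <= \sum_(i < n) `|x ord0 i|.
Proof.
have s0 : 0 <= \sum_(i < n) `|x ord0 i| by apply:sumr_ge0.
rewrite -(ler_pXn2r (isT : (0 < 2)%N)) ?nnegrE ?enorm_ge0// enorm_sqr.
rewrite expr2 mulr_suml;apply:ler_sum => i _.
apply:(le_trans (ler_norm _));rewrite normrM ler_wpM2l//.
by rewrite (bigD1 i)//= lerDl sumr_ge0.
Qed.

Lemma enorm_le_norm x : enorm x <= n%:R * `|x|.
Proof.
apply:(le_trans (enorm_le_sum x));rewrite mulr_natl -[n in _ *+ n]card_ord -sumr_const.
by apply:ler_sum => i _;exact:coord_le_norm.
Qed.

Lemma is_norm_enorm : is_norm (@enorm R n).
Proof. by split;[exact:enorm_ge0|exact:enorm_eq0|exact:enormZ|exact:enormD]. Qed.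

Lemma is_norm_le_norm (N : E -> R) : is_norm N -> exists2 C, 0 < C & forall x, N x <= C * `|x|.
Proof.
move=>[N0 _ NZ ND];exists (1 + \sum_(i < n) N (evec i)).
 by rewrite ltr_pwDl// sumr_ge0.
move=>x;have -> : x = \sum_(i < n) x ord0 i *: evec i by exact:row_sum_delta.
apply:(@le_trans _ _ (\sum_(i < n) `|x ord0 i| * N (evec i))).
 elim/big_ind2 : _ => //.
 - have -> : (0 : E) = 0 *: 0 by rewrite scale0r.
  by rewrite NZ normr0 mul0r.
 - by move=>a b c d h1 h2;apply:(le_trans (ND _ _));exact:lerD.
 - by move=>i _;rewrite NZ.
rewrite -row_sum_delta;apply:(@le_trans _ _ (\sum_(i < n) `|x| * N (evec i))).
 by apply:ler_sum => i _;rewrite ler_wpM2r// coord_le_norm.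
by rewrite -mulr_sumr mulrC ler_wpM2r// lerDr.
Qed.

Lemma is_normN (N : E -> R) x : is_norm N -> N (- x) = N x.
Proof. by move=>[_ _ NZ _];rewrite -scaleN1r NZ normrN1 mul1r. Qed.

Lemma is_norm0 (N : E -> R) : is_norm N -> N 0 = 0.
Proof. by move=>[_ _ NZ _];rewrite -(scale0r (0 : E)) NZ normr0 mul0r. Qed.

Lemma is_norm_dist (N : E -> R) x y : is_norm N -> `|N x - N y| <= N (x - y).
Proof.
move=>Nn;have [_ _ _ ND] := Nn.
rewrite ler_norml;apply/andP;split;first rewrite lerNl opprB lerBlDr;last rewrite lerBlDr.
 by have := ND (y - x) x;rewrite subrK -(is_normN (y - x) Nn) opprB.
by have := ND (x - y) y;rewrite subrK.
Qed.

Lemma cont_rVP (f : E -> R) (x : E) : {for x, continuous f} <->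
 forall e, 0 < e -> exists2 d, 0 < d & forall y, `|x - y| < d -> `|f x - f y| <= e.
Proof.
split.
 move=>/(@cvgrPdist_le _ _ _ (nbhs x) _ f (f x)) h e /h /nbhs_ballP[d /= d0 hd].
 by exists d => // y xy;apply:hd;rewrite -ball_normE.
move=>h;apply/(@cvgrPdist_le _ _ _ (nbhs x) _ f (f x)) => e /h[d d0 hd].
by apply/nbhs_ballP;exists d => //= y;rewrite -ball_normE;exact:hd.
Qed.

Lemma norm_cont (N : E -> R) : is_norm N -> continuous N.
Proof.
move=>Nn x;have [C C0 hC] := is_norm_le_norm Nn.
apply/cont_rVP => e e0;exists (e / C);first exact:divr_gt0.
move=>y xy;apply:(le_trans (is_norm_dist _ _ Nn)).
by apply:(le_trans (hC _));rewrite mulrC -ler_pdivlMr// ltW.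
Qed.

Lemma enorm_continuous : continuous (@enorm R n).
Proof. exact:norm_cont is_norm_enorm. Qed.

Lemma clbd_cpt (A : set E) (C : R) : closed A -> (forall x, A x -> `|x| <= C) -> compact A.
Proof.
move=>cA hA;apply:bounded_closed_compact => //.
exists C;split;first exact:num_real.
by move=>M CM x /hA /le_trans;apply;exact:ltW.
Qed.

Lemma cpt_bd_norm (A : set E) : compact A -> exists2 C, 0 < C & forall x, A x -> `|x| <= C.
Proof.
move=>/compact_bounded [C [_ hC]];exists (`|C| + 1);first by rewrite ltr_wpDl.
by move=>x Ax;apply:(hC (`|C| + 1)) => //;rewrite (le_lt_trans (ler_norm _))// ltrDl.
Qed.

Lemma cont_maxK (A : set E) (f : E -> R) : compact A -> {in A, continuous f} ->
 exists2 M, 0 < M & forall x, A x -> `|f x| <= M.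
Proof.
move=>cA cf.
have /compact_bounded [C [_ hC]] : compact (f @` A).
 apply:continuous_compact => //;apply:continuous_in_subspaceT => x Ax;exact:cf.
exists (`|C| + 1);first by rewrite ltr_wpDl.
by move=>x Ax;apply:(hC (`|C| + 1));[rewrite (le_lt_trans (ler_norm _))// ltrDl|exists x].
Qed.

(* [b] is reached from [a] by changing the coordinates one at a time. *)
Lemma coordinate_mean_value (f : E -> R) (a b : E) : Ck 1 f ->
 exists xi : 'I_n -> E, (forall j, `|xi j - a| <= `|b - a|) /\
  f b - f a = \sum_(j < n) 'D_(evec j) f (xi j) * (b ord0 j - a ord0 j).
Proof.
move=>[cf df].
pose h (k : nat) : E := \row_j if (j < k)%N then b ord0 j else a ord0 j.
have step (j : 'I_n) : exists xi : E, `|xi - a| <= `|b - a| /\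
  f (h j.+1) - f (h j) = 'D_(evec j) f xi * (b ord0 j - a ord0 j).
 pose d := b ord0 j - a ord0 j;pose g (s : R) := f (h j + s *: evec j).
 have dg s : is_derive s (1 : R) g ('D_(evec j) f (h j + s *: evec j)).
  by apply:is_derive_line;exact:(df j).1.
 have cg : continuous g.
  by move=>s;apply/differentiable_continuous/derivable1_diffP;have [] := dg s.
 have hE : h j.+1 = h j + d *: evec j.
  apply/rowP => i;rewrite !mxE eqxx/= ltnS leq_eqVlt;case:eqP => [/val_inj ->|ij].
   by rewrite ltnn eqxx mulr1 /d;ring.
  case:eqP => [ij'|_];first by rewrite ij' in ij.
  by rewrite mulr0 addr0.
 have near_ s : `|s| <= `|d| -> `|h j + s *: evec j - a| <= `|b - a|.
  move=>sd;apply:norm_leP => // i;rewrite !mxE eqxx/=.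
  have [ij|ij] := eqVneq i j.
   rewrite ij ltnn mulr1 addrAC subrr add0r (le_trans sd)//.
   by have := coord_le_norm (b - a) j;rewrite !mxE.
  rewrite mulr0 addr0;case:ifP => _;last by rewrite subrr normr0.
  by have := coord_le_norm (b - a) i;rewrite !mxE.
 have [d0|d0] := leP 0 d.
  have [s /andP[]] := MVT_segment d0 (fun (s : R) _ => dg s) (continuous_subspaceT cg).
  rewrite !bnd_simp => s0 sd;rewrite /g scale0r addr0 subr0 -hE => ->.
  exists (h j + s *: evec j);split => //;apply:near_.
  by rewrite !ger0_norm// (le_trans s0).
 have [s /andP[]] := MVT_segment (ltW d0) (fun (s : R) _ => dg s) (continuous_subspaceT cg).
 rewrite !bnd_simp => sd s0;rewrite /g scale0r addr0 -hE => hh.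
 exists (h j + s *: evec j);split => //;first by apply:near_;rewrite !ler0_norm ?lerN2// (le_trans sd)// ltW.
 by rewrite -opprB hh sub0r mulrN opprK.
have [xi hxi] := choice step.
exists xi;split;first by move=>j;exact:(hxi j).1.
under eq_bigr do rewrite -(hxi _).2.
have -> : f b = f (h n) by congr f;apply/rowP => i;rewrite mxE ltn_ord.
have -> : f a = f (h 0%N) by congr f;apply/rowP => i;rewrite mxE ltn0.
by rewrite -(big_mkord xpredT (fun j => f (h j.+1) - f (h j))) telescope_sumr.
Qed.

Lemma C1_lipschitz (f : E -> R) (M : R) a b : Ck 1 f ->
 (forall i x, `|'D_(evec i) f x| <= M) -> `|f b - f a| <= n%:R * M * `|b - a|.
Proof.
move=>Cf hM;have [xi [_ ->]] := coordinate_mean_value a b Cf.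
apply:(le_trans (ler_norm_sum _ _ _)).
rewrite -mulrA mulr_natl -[n in _ *+ n]card_ord -sumr_const;apply:ler_sum => i _.
rewrite normrM ler_pM//.
by have := coord_le_norm (b - a) i;rewrite !mxE.
Qed.

Lemma compact_thicken (K U : set E) : compact K -> open U -> K `<=` U ->
 exists2 d, 0 < d & forall x y, K x -> `|y - x| <= d -> U y.
Proof.
move=>cK oU KU.
have : \forall d \near (0 : R)^'+, K `<=` (fun x => forall y, `|y - x| <= d -> U y).
 have /compact_near_coveringP := cK;apply => x /KU Ux.
 have /nbhs_ballP[r /= r0 rU] := open_nbhs_nbhs (conj oU Ux).
 have r20 : 0 < r / 2 by lra.
 exists (ball x (r / 2), [set d | d < r / 2]).
  by split => /=;[exact:nbhsx_ballx|exact:nbhs_right_lt].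
 move=>[x' d] [/= xx' dr] y yx';apply:rU;rewrite (splitr r).
 apply:ball_triangle xx' _;rewrite -ball_normE /= distrC.
 exact:le_lt_trans yx' dr.
move=>h;have [d /andP[d0 Kd]] : exists d : R, (0 < d) && `[< K `<=` (fun x => forall y, `|y - x| <= d -> U y) >].
 near (0 : R)^'+ => d;exists d;apply/andP;split;first by near: d;exact:nbhs_right_gt.
 by apply/asboolP;near: d.
by exists d => // x y Kx;move/asboolP : Kd;apply.
Unshelve. all: by end_near. Qed.

End EuclideanNorm.

(** * Real-valued integrals on row vectors *)

Section IntegralToolbox.
Context {R : realType} {n : nat}.
Local Notation E := 'rV[R]_n.
Local Notation L := (lebType R n).
Local Notation mu := (@lam R n).

(* Versions over ['rV[R]_n] of the library notions on [lebType R n]: they keep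
 the two canonical structures of the same carrier apart. *)
Definition msr (D : set E) : Prop := measurable (D : set L).
Definition meas (D : set E) (f : E -> R) : Prop := measurable_fun (D : set L) (f : L -> R).
Definition integ (D : set E) (f : E -> R) : Prop := mu.-integrable (D : set L) (EFin \o (f : L -> R)).
Definition intg (D : set E) (f : E -> R) : R := \int[mu]_(x in (D : set L)) (f : L -> R) x.
Definition vol (D : set E) : R := fine (mu D).

Implicit Types (D A B : set E) (f g h : E -> R) (c : R).

Lemma msrT : msr setT. Proof. exact:measurableT. Qed.

Lemma msr0 : msr set0. Proof. exact:measurable0. Qed.
Lemma msrI A B : msr A -> msr B -> msr (A `&` B). Proof. exact:measurableI. Qed.
Lemma msrU A B : msr A -> msr B -> msr (A `|` B). Proof. exact:measurableU. Qed.
Lemma msrD A B : msr A -> msr B -> msr (A `\` B). Proof. exact:measurableD. Qed.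
Lemma msrC A : msr A -> msr (~` A). Proof. exact:measurableC. Qed.
Lemma msr_open A : open A -> msr A. Proof. exact:measurable_open_rV. Qed.
Lemma msr_closed A : closed A -> msr A. Proof. exact:measurable_closed_rV. Qed.
Lemma msr_cpt A : compact A -> msr A.
Proof. by move=>cA;apply:msr_closed;exact:compact_closed. Qed.
Lemma msr_ball (x : E) (r : R) : msr (ball x r). Proof. exact:measurable_ball_rV. Qed.

Lemma meas_sub A D f : msr A -> D `<=` A -> meas A f -> meas D f.
Proof. by move=>mA DA;exact:measurable_funS. Qed.
Lemma meas_cst D c : meas D (fun=> c). Proof. exact:measurable_cst. Qed.
Lemma measD D f g : meas D f -> meas D g -> meas D (fun x => f x + g x).
Proof. exact:measurable_funD. Qed.
Lemma measB D f g : meas D f -> meas D g -> meas D (fun x => f x - g x).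
Proof. exact:measurable_funB. Qed.
Lemma measM D f g : meas D f -> meas D g -> meas D (fun x => f x * g x).
Proof. exact:measurable_funM. Qed.
Lemma meas_cont f D : continuous f -> meas D f.
Proof. by move=>cf;exact:measurable_fun_continuous. Qed.
Lemma meas_open_cont f D : open D -> {in D, continuous f} -> meas D f.
Proof. exact:mfun_cont_open. Qed.
Lemma meas_comp D f (h : R -> R) : measurable_fun setT h -> meas D f -> meas D (fun x => h (f x)).
Proof. by move=>mh mf;exact:measurableT_comp. Qed.
Lemma meas_comp_cont D f (h : R -> R) : continuous h -> meas D f -> meas D (fun x => h (f x)).
Proof. by move=>ch;apply:meas_comp;exact:continuous_measurable_fun. Qed.
Lemma meas_norm D f : meas D f -> meas D (fun x => `|f x|).
Proof. by apply:meas_comp_cont => x;exact:norm_continuous. Qed.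
Lemma meas_powR D f (p : R) : meas D f -> meas D (fun x => f x `^ p).
Proof. by apply:(meas_comp (h := fun t => t `^ p));exact:measurable_powR. Qed.
Lemma meas_sqrt D f : meas D f -> meas D (fun x => Num.sqrt (f x)).
Proof. by apply:meas_comp_cont;exact:sqrt_continuous. Qed.
Lemma meas_sum (I : Type) (s : seq I) D (f : I -> E -> R) : (forall i, meas D (f i)) ->
 meas D (fun x => \sum_(i <- s) f i x).
Proof. by move=>mf;exact:measurable_sum. Qed.
Lemma eq_meas D f g : (forall x, D x -> f x = g x) -> meas D f -> meas D g.
Proof. by move=>fg;apply:eq_measurable_fun => x /set_mem;exact:fg. Qed.

Lemma meas_restrict D f : msr D -> meas D f <-> meas setT (f \_ D).
Proof. by move=>mD;exact:(measurable_restrictT _ mD). Qed.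

Lemma meas_restrict_sub A D f : msr D -> D `<=` A -> msr A -> meas A f -> meas setT (f \_ D).
Proof. by move=>mD DA mA mf;apply:(meas_restrict f mD).1;exact:(meas_sub mA DA mf). Qed.

Lemma meas_indic A D : msr A -> meas D (\1_A : E -> R).
Proof. by move=>mA;exact:measurable_indic. Qed.

Lemma msr_gt D f c : msr D -> meas D f -> msr (D `&` [set x | c < f x]).
Proof.
move=>mD mf;rewrite (_ : [set x | _] = f @^-1` `]c, +oo[%classic);first exact:mf.
by apply/seteqP;split => x /=;rewrite in_itv/= andbT.
Qed.

Lemma msr_ge D f c : msr D -> meas D f -> msr (D `&` [set x | c <= f x]).
Proof.
move=>mD mf;rewrite (_ : [set x | _] = f @^-1` `[c, +oo[%classic);first exact:mf.
by apply/seteqP;split => x /=;rewrite in_itv/= andbT.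
Qed.

Lemma msr_lt D f c : msr D -> meas D f -> msr (D `&` [set x | f x < c]).
Proof.
move=>mD mf;rewrite (_ : [set x | _] = f @^-1` `]-oo, c[%classic);first exact:mf.
by apply/seteqP;split => x /=;rewrite in_itv.
Qed.

Lemma integ_meas D f : integ D f -> meas D f.
Proof. by move=>fi;apply/measurable_EFinP;exact:measurable_int fi. Qed.

Lemma integ_le D f g : msr D -> meas D f -> (forall x, D x -> `|f x| <= g x) ->
 integ D g -> integ D f.
Proof.
move=>mD mf fg;apply:le_integrable => //;first exact/measurable_EFinP.
by move=>x Dx /=;rewrite lee_fin (le_trans (fg x Dx)) ?ler_norm.
Qed.

Lemma integ_bdd D f c : msr D -> (mu D < +oo)%E -> meas D f ->
 (forall x, D x -> `|f x| <= c) -> integ D f.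
Proof.
move=>mD Dfin mf fM;apply:measurable_bounded_integrable => //.
exists c;split;first exact:num_real.
by move=>M' MM' x /fM /le_trans;apply;exact:ltW.
Qed.

Lemma eq_integ D f g : msr D -> (forall x, D x -> f x = g x) -> integ D f -> integ D g.
Proof. by move=>mD fg;apply:eq_integrable => // x /set_mem Dx /=;rewrite fg. Qed.

Lemma integ_cst D c : msr D -> (mu D < +oo)%E -> integ D (fun=> c).
Proof. by move=>mD Dfin;apply:(@integ_bdd _ _ `|c|) => //;exact:meas_cst. Qed.

Lemma integD D f g : msr D -> integ D f -> integ D g -> integ D (fun x => f x + g x).
Proof. by move=>mD fi gi;exact:(integrableD mD fi gi). Qed.
Lemma integB D f g : msr D -> integ D f -> integ D g -> integ D (fun x => f x - g x).
Proof. by move=>mD fi gi;exact:(integrableB mD fi gi). Qed.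
Lemma integZ D f c : msr D -> integ D f -> integ D (fun x => c * f x).
Proof. by move=>mD fi;exact:(integrableZl mD c fi). Qed.
Lemma integ_abs D f : msr D -> integ D f -> integ D (fun x => `|f x|).
Proof. by move=>mD fi;exact:(integrable_norm fi). Qed.
Lemma integ_sub A D f : msr A -> msr D -> D `<=` A -> integ A f -> integ D f.
Proof. by move=>mA mD DA;exact:integrableS. Qed.
Lemma integ0 D : msr D -> integ D (fun=> 0).
Proof. by move=>mD;exact:integrable0. Qed.
Lemma integ_sum (I : Type) (s : seq I) D (f : I -> E -> R) : msr D ->
 (forall i, integ D (f i)) -> integ D (fun x => \sum_(i <- s) f i x).
Proof.
move=>mD fi;elim:s => [|i s ih].
 by apply:(@eq_integ _ (fun=> 0)) => //;[move=>x _;rewrite big_nil|exact:integ0].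
apply:(@eq_integ _ (fun x => f i x + \sum_(j <- s) f j x)) => //.
 by move=>x _;rewrite big_cons.
exact:integD.
Qed.

Lemma integ_mulb D f g c : msr D -> meas D f -> (forall x, D x -> `|f x| <= c) -> integ D g ->
 integ D (fun x => f x * g x).
Proof.
move=>mD mf fc gi;apply:(@integ_le _ _ (fun x => c * `|g x|)) => //.
- by apply:measM => //;exact:integ_meas.
- by move=>x Dx;rewrite normrM ler_wpM2r// fc.
- by apply:integZ => //;exact:integ_abs.
Qed.

Lemma integ_mk D f : msr D -> integ D f <-> integ setT (f \_ D).
Proof.
move=>mD;rewrite /integ (integrable_mkcond _ mD).
by split;apply:eq_integrable => // x _ /=;rewrite restrict_EFin.
Qed.

Lemma intgD D f g : msr D -> integ D f -> integ D g ->
 intg D (fun x => f x + g x) = intg D f + intg D g.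
Proof. exact:RintegralD. Qed.
Lemma intgB D f g : msr D -> integ D f -> integ D g ->
 intg D (fun x => f x - g x) = intg D f - intg D g.
Proof. exact:RintegralB. Qed.
Lemma intgZ D f c : msr D -> integ D f -> intg D (fun x => c * f x) = c * intg D f.
Proof. by move=>mD fi;exact:RintegralZl. Qed.
Lemma intg0 D : intg D (fun=> 0) = 0.
Proof. by rewrite /intg /Rintegral integral0_eq. Qed.
Lemma intg_cst D c : msr D -> intg D (fun=> c) = c * vol D.
Proof. by move=>mD;exact:Rintegral_cst. Qed.
Lemma intg_le D f g : msr D -> integ D f -> integ D g -> (forall x, D x -> f x <= g x) ->
 intg D f <= intg D g.
Proof. exact:le_Rintegral. Qed.
Lemma intg_ge0 D f : (forall x, D x -> 0 <= f x) -> 0 <= intg D f.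
Proof. by move=>f0;apply:Rintegral_ge0 => x /f0. Qed.
Lemma le_norm_intg D f : msr D -> integ D f -> `|intg D f| <= intg D (fun x => `|f x|).
Proof. exact:le_normr_Rintegral. Qed.
Lemma eq_intg D f g : (forall x, D x -> f x = g x) -> intg D f = intg D g.
Proof. by move=>fg;apply:eq_Rintegral => x /set_mem;exact:fg. Qed.
Lemma intg_sum (I : Type) (s : seq I) D (f : I -> E -> R) : msr D ->
 (forall i, integ D (f i)) -> intg D (fun x => \sum_(i <- s) f i x) = \sum_(i <- s) intg D (f i).
Proof.
move=>mD fi;elim:s => [|i s ih].
 by rewrite big_nil -[RHS](intg0 D);apply:eq_intg => x _;rewrite big_nil.
rewrite big_cons -ih -intgD//;last exact:integ_sum.
by congr intg;apply/funext => x;rewrite big_cons.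
Qed.
Lemma intg_mk D f : intg D f = intg setT (f \_ D).
Proof. exact:Rintegral_mkcond. Qed.

Lemma intgE D f : msr D -> integ D f -> (intg D f)%:E = (\int[mu]_(x in (D : set L)) (f x)%:E)%E.
Proof. by move=>mD fi;rewrite /intg /Rintegral fineK//;exact:integrable_fin_num. Qed.

Lemma integ_ge0P D f : msr D -> meas D f -> (forall x, D x -> 0 <= f x) ->
 (\int[mu]_(x in (D : set L)) (f x)%:E < +oo)%E -> integ D f.
Proof.
move=>mD mf f0 foo;apply/integrableP;split;first exact/measurable_EFinP.
apply:le_lt_trans foo;apply:ge0_le_integral => //=.
- by apply/measurable_EFinP;exact:meas_norm.
- exact/measurable_EFinP.
- by move=>x Dx;rewrite lee_fin ger0_norm// f0.
Qed.

Lemma intg_subset A D f : msr A -> msr D -> D `<=` A -> integ A f -> (forall x, A x -> 0 <= f x) ->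
 intg D f <= intg A f.
Proof.
move=>mA mD DA fi f0;rewrite -lee_fin !intgE//;last exact:integ_sub fi.
by apply:ge0_subset_integral => //;apply/measurable_EFinP;exact:integ_meas.
Qed.

Lemma vol_ge0 D : 0 <= vol D.
Proof. by apply:fine_ge0;exact:measure_ge0. Qed.

Lemma lamS_lty A B : A `<=` B -> (mu B < +oo)%E -> (mu A < +oo)%E.
Proof. by move=>AB;apply:le_lt_trans;exact:le_leb. Qed.

Lemma le_vol A B : msr A -> msr B -> A `<=` B -> (mu B < +oo)%E -> vol A <= vol B.
Proof.
move=>mA mB AB Bfin;apply:fine_le.
- by rewrite ge0_fin_numE ?measure_ge0//;exact:lamS_lty Bfin.
- by rewrite ge0_fin_numE ?measure_ge0.
- exact:le_leb.
Qed.

Lemma vol_ball (x : E) (r : R) : 0 < r -> vol (ball x r) = r ^+ n * @cube_vol R n.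
Proof. by move=>r0;rewrite /vol lam_ballE. Qed.

Lemma lamK_lty (K : set E) : compact K -> (mu K < +oo)%E.
Proof.
move=>cK;have [C C0 hC] := cpt_bd_norm cK.
apply:lamS_lty (lamB_lty (0 : E) (C + 1)) => x /hC xC.
by rewrite -ball_normE /= sub0r normrN (le_lt_trans xC)// ltrDl.
Qed.

(* Change of variables [y = a *: x + b]. *)
Lemma intg_affine (a : R) (b : E) f : a != 0 -> integ setT f ->
 integ setT (fun x => f (affine a b x)) /\
 intg setT (fun x => f (affine a b x)) = `|a| ^- n * intg setT f.
Proof.
move=>a0;have pa : 0 <= `|a| ^- n :> R by rewrite invr_ge0 exprn_ge0.
have pos (g : E -> R) : (forall x, 0 <= g x) -> integ setT g ->
  integ setT (fun x => g (affine a b x)) /\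
  intg setT (fun x => g (affine a b x)) = `|a| ^- n * intg setT g.
 move=>g0 gi;have mg := integ_meas gi.
 have mga : meas setT (fun x => g (affine a b x)).
  by apply:(measurableT_comp mg);exact:measurable_affine.
 have := @ge0_integral_affine R n a b setT (EFin \o (g : L -> R)) a0 measurableT.
 rewrite preimage_setT => /(_ _ _)/= h.
 have {}h : (\int[mu]_x (g (affine a b x))%:E = (`|a| ^- n)%:E * \int[mu]_x (g x)%:E)%E.
  by apply:h;[exact/measurable_EFinP|move=>x;rewrite lee_fin].
 rewrite -(intgE msrT gi) -EFinM in h.
 have gai : integ setT (fun x => g (affine a b x)).
  apply:integ_ge0P => //;first exact:msrT.
  by rewrite [X in (X < _)%E]h ltry.
 by split => //;have [] := etrans (intgE msrT gai) h.
move=>fi;have mf := integ_meas fi.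
(* Two nonnegative functions whose half difference is [f]; for nonnegative functions the formula has
   just been shown. *)
pose fp x : R := `|f x| + f x;pose fm x : R := `|f x| - f x.
have nfi := integ_abs msrT fi.
have [fpi fpE] := pos fp (fun x => ltac:(rewrite /fp;by have := ler_norm (- f x);rewrite normrN;lra)) (integD msrT nfi fi).
have [fmi fmE] := pos fm (fun x => ltac:(rewrite /fm;by have := ler_norm (f x);lra)) (integB msrT nfi fi).
have fE x : f x = 2^-1 * (fp x - fm x) by rewrite /fp /fm;lra.
split.
 apply:(@eq_integ _ (fun x => 2^-1 * (fp (affine a b x) - fm (affine a b x)))) => //;first exact:msrT.
 by apply:integZ;[exact:msrT|exact:(integB msrT)].
rewrite (@eq_intg _ (fun x => f (affine a b x)) (fun x => 2^-1 * (fp (affine a b x) - fm (affine a b x))));last by [].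
have fBi := integB msrT fpi fmi.
rewrite (intgZ _ msrT fBi) (intgB msrT fpi fmi) fpE fmE -mulrBr.
have pi := integD msrT nfi fi;have mi := integB msrT nfi fi.
rewrite -(intgB msrT pi mi) mulrCA -(intgZ _ msrT (integB msrT pi mi)).
by congr (_ * _);apply:eq_intg => x _;rewrite [RHS]fE.
Qed.

Definition meas2 (F : E * E -> R) : Prop := measurable_fun setT (F : (L * L)%type -> R).

Lemma meas2_cont (F : E * E -> R) : continuous F -> meas2 F.
Proof. exact:measurable_fun_prod_continuous. Qed.
Lemma meas2M F G : meas2 F -> meas2 G -> meas2 (fun z => F z * G z).
Proof. exact:measurable_funM. Qed.
Lemma meas2_fst f : meas setT f -> meas2 (fun z => f z.1).
Proof. by move=>mf;apply:(measurableT_comp mf);exact:measurable_fst. Qed.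
Lemma meas2_snd f : meas setT f -> meas2 (fun z => f z.2).
Proof. by move=>mf;apply:(measurableT_comp mf);exact:measurable_snd. Qed.

(** The integrability hypotheses keep all iterated integrals finite, so that nothing is lost in
    passing from extended to real values. *)
Lemma intg_tonelli (F : E * E -> R) : meas2 F -> (forall z, 0 <= F z) ->
 (forall x, integ setT (fun y => F (x, y))) -> (forall y, integ setT (fun x => F (x, y))) ->
 integ setT (fun y => intg setT (fun x => F (x, y))) ->
 integ setT (fun x => intg setT (fun y => F (x, y))) /\
 intg setT (fun x => intg setT (fun y => F (x, y))) = intg setT (fun y => intg setT (fun x => F (x, y))).
Proof.
move=>mF F0 Fx Fy FI.
have mF' : measurable_fun setT (EFin \o (F : (L * L)%type -> R)) by exact/measurable_EFinP.
have F0' z : (0 <= (EFin \o (F : (L * L)%type -> R)) z)%E by rewrite lee_fin.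
have T := lam_tonelli mF' F0';rewrite /= in T.
have E1 : (fun x : L => \int[mu]_y (F (x, y))%:E)%E = (fun x : L => (intg setT (fun y => F (x, y)))%:E).
 by apply/funext => x;rewrite intgE//;exact:msrT.
have E2 : (fun y : L => \int[mu]_x (F (x, y))%:E)%E = (fun y : L => (intg setT (fun x => F (x, y)))%:E).
 by apply/funext => y;rewrite intgE//;exact:msrT.
rewrite E1 E2 in T.
have mI : meas setT (fun x => intg setT (fun y => F (x, y))).
 have := measurable_lam_tonelli mF' F0';rewrite /= E1 => h.
 exact/measurable_EFinP.
have FI2 : integ setT (fun x => intg setT (fun y => F (x, y))).
 apply:integ_ge0P => //;[exact:msrT|by move=>x _;exact:intg_ge0|].
 by rewrite [X in (X < _)%E]T -intgE ?ltry//;exact:msrT.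
split;first exact:FI2.
by have [] := etrans (intgE msrT FI2) (etrans T (esym (intgE msrT FI))).
Qed.

End IntegralToolbox.
#[global] Hint Resolve msrT : core.

(** * Convolution with a smooth kernel *)

Section Convolution.
Context {R : realType} {n : nat}.
Local Notation E := 'rV[R]_n.
Local Notation L := (lebType R n).
Local Notation mu := (@lam R n).
Implicit Types (f rho : E -> R).

Definition ssupp r rho := (forall k, Ck k rho) /\ (forall x, r < `|x| -> rho x = 0).

Lemma clnorm_le (r : R) : compact [set x : E | `|x| <= r].
Proof.
apply:(@clbd_cpt _ _ _ r) => //.
apply:(@closed_comp _ _ (fun x : E => `|x|) [set s | s <= r]);last exact:closed_le.
by move=>x _;exact:norm_continuous.
Qed.

Lemma supp_bounded r f : continuous f -> (forall x, r < `|x| -> f x = 0) ->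
 exists2 M : R, 0 < M & forall x, `|f x| <= M.
Proof.
move=>cf f0;have [M M0 hM] := cont_maxK (@clnorm_le r) (fun (x : E) _ => cf x).
exists M => // x;have [xr|xr] := leP `|x| r;first exact:hM.
by rewrite f0// normr0 ltW.
Qed.

Lemma derive_supp r f i : (forall x, r < `|x| -> f x = 0) -> forall x, r < `|x| -> 'D_(evec i) f x = 0.
Proof.
move=>f0 x rx;rewrite -(derive_cst (0 : R) x (evec i)).
apply:near_eq_derive;apply/nbhs_ballP;exists (`|x| - r) => /=;first by rewrite subr_gt0.
move=>y;rewrite -ball_normE /= => xy;apply:f0.
have := ler_normD (x - y) y;rewrite subrK;lra.
Qed.

Lemma ssupp_derive r rho i : ssupp r rho -> ssupp r ('D_(evec i) rho).
Proof.
move=>[sm su];split;last exact:derive_supp.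
by move=>k;have [_ /(_ i)[]] := sm k.+1.
Qed.

Lemma ssupp_bd r rho : ssupp r rho -> exists2 M : R, 0 < M & forall x, `|rho x| <= M.
Proof. by move=>[sm su];apply:(supp_bounded _ su);exact:(sm 0%N). Qed.

Lemma smooth_supp_lipschitz r rho : ssupp r rho ->
 exists2 M : R, 0 < M & forall x y, `|rho x - rho y| <= M * `|x - y|.
Proof.
move=>sr.
have /choice[F hF] : forall i : 'I_n, exists M, 0 < M /\ forall x, `|'D_(evec i) rho x| <= M.
 by move=>i;have [M M0 hM] := ssupp_bd (ssupp_derive i sr);exists M.
pose M := 1 + \sum_(i < n) F i.
have FM i : F i <= M.
 rewrite /M (bigD1 i)//= addrCA lerDl addr_ge0// sumr_ge0// => j _.
 exact:ltW (hF j).1.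
have M0 : 0 < M by rewrite ltr_pwDl// sumr_ge0// => j _;exact:ltW (hF j).1.
exists ((n%:R + 1) * M);first by rewrite mulr_gt0// ltr_wpDl.
move=>x y;have C1 : Ck 1 rho by exact:sr.1.
apply:(le_trans (C1_lipschitz y x C1 (fun i z => le_trans ((hF i).2 z) (FM i)))).
rewrite ler_wpM2r// ler_wpM2r ?lerDl//;exact:ltW.
Qed.

Definition convol f rho (x : E) : R := intg setT (fun y => f y * rho (x - y)).

Lemma continuous_reflect rho (x : E) : continuous rho -> continuous (fun y : E => rho (x - y)).
Proof.
move=>cr;apply:cont_comp cr => y.
by apply:continuousB;[exact:cst_continuous|exact:cvg_id].
Qed.

Lemma conv_integrable f rho x r : integ setT f -> ssupp r rho ->
 integ setT (fun y => f y * rho (x - y)).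
Proof.
move=>fi sr;have [M M0 hM] := ssupp_bd sr.
apply:(@eq_integ _ _ _ (fun y => rho (x - y) * f y));first exact:msrT.
 by move=>y _;rewrite mulrC.
apply:(@integ_mulb _ _ _ _ _ M) => //.
by apply:meas_cont;apply:continuous_reflect;exact:(sr.1 0%N).
Qed.

Lemma conv_cont f rho r : integ setT f -> ssupp r rho -> continuous (convol f rho).
Proof.
move=>fi sr x;have [M M0 hM] := smooth_supp_lipschitz sr.
pose If := intg setT (fun y => `|f y|).
have If0 : 0 <= If by exact:intg_ge0.
have nfi := integ_abs msrT fi.
apply/cont_rVP => e e0;exists (e / (M * (If + 1))).
 by rewrite divr_gt0// mulr_gt0// ltr_wpDl.
move=>y xy;have ci z := conv_integrable z fi sr.
rewrite /convol -intgB//.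
have ciB := integB msrT (ci x) (ci y).
apply:(le_trans (le_norm_intg msrT ciB)).
apply:(@le_trans _ _ (intg setT (fun z => M * `|x - y| * `|f z|))).
 apply:intg_le;[exact:msrT|exact:integ_abs msrT ciB|exact:integZ msrT nfi|].
 move=>z _;rewrite -mulrBr normrM mulrC ler_wpM2r// (le_trans (hM _ _))//.
 by rewrite ler_wpM2l ?(ltW M0)// opprB addrA subrK.
rewrite intgZ//.
apply:(@le_trans _ _ (M * `|x - y| * (If + 1))).
 by rewrite ler_wpM2l ?mulr_ge0 ?(ltW M0)// lerDl.
move: xy;rewrite ltr_pdivlMr;last by rewrite mulr_gt0// ltr_wpDl.
by move/ltW;rewrite mulrCA mulrA.
Qed.

(** Differentiation under the integral sign along the line through [x]: the derivative of [rho] is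
    bounded by some [M], so [M * |f|] dominates. *)
Lemma conv_derive f rho r i x : integ setT f -> ssupp r rho ->
 is_derive x (evec i) (convol f rho) (convol f ('D_(evec i) rho) x).
Proof.
move=>fi sr;apply:is_der_lineV.
have sdr := ssupp_derive i sr.
have [M M0 hM] := ssupp_bd sdr.
pose F (s : R) (y : L) : R := f y * rho (x + s *: evec i - y).
have dF (s : R) y : is_derive s (1 : R) (F ^~ y) (f y * 'D_(evec i) rho (x + s *: evec i - y)).
 rewrite -[_ * _]/(_ *: _);apply:is_deriveZ.
 have -> : (fun s : R => rho (x + s *: evec i - y)) = (fun s : R => rho ((x - y) + s *: evec i)).
  by apply/funext => t;rewrite addrAC.
 rewrite addrAC;apply:is_derive_line.
 by have [_ /(_ i)[]] := sr.1 1%N.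
have pF s y : partial1of2 F s y = f y * 'D_(evec i) rho (x + s *: evec i - y).
 by rewrite /partial1of2 (is_derive1_eq (dF s y)).
have I0 : `](-1 : R), 1[%classic 0 by rewrite /= in_itv/=;apply/andP;split;lra.
have h1 (s : R) : `](-1 : R), 1[%classic s -> mu.-integrable setT (EFin \o F s).
 by move=>_;exact:conv_integrable fi sr.
have h2 (s : R) (y : L) : `](-1 : R), 1[%classic s -> setT y -> derivable (F ^~ y) s 1.
 by move=>_ _;have [] := dF s y.
have G0 (y : L) : 0 <= M * `|f y| by rewrite mulr_ge0// ltW.
have h3 : mu.-integrable setT (EFin \o (fun y : L => M * `|f y|)).
 exact:(integZ M msrT (integ_abs msrT fi)).
have h4 (s : R) (y : L) : `](-1 : R), 1[%classic s -> setT y -> `|partial1of2 F s y| <= M * `|f y|.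
 by move=>_ _;rewrite pF normrM mulrC ler_wpM2r.
have D1 := @derivable_under_integral R _ L mu F setT measurableT 0 (-1) 1 I0 h1 h2 _ G0 h3 h4.
have D2 := @differentiation_under_integral R _ L mu F setT measurableT 0 (-1) 1 I0 h1 h2 _ G0 h3 h4.
apply:DeriveDef;first exact:D1.
rewrite -derive1E [LHS]D2;apply:eq_Rintegral => y _.
by rewrite pF scale0r addr0.
Qed.

Lemma Ck_conv k f rho r : integ setT f -> ssupp r rho -> Ck k (convol f rho).
Proof.
move=>fi;elim:k rho => [|k ih] rho sr /=;first exact:conv_cont sr.
split;first exact:conv_cont sr.
move=>i;split;first by move=>x;have [] := conv_derive i x fi sr.
rewrite (_ : 'D_(evec i) _ = convol f ('D_(evec i) rho)).
 by apply:ih;exact:ssupp_derive.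
by apply/funext => x;have [_ ->] := conv_derive i x fi sr.
Qed.

End Convolution.

(** * Approximation of indicators by continuous functions *)

Section Density.
Context {R : realType} {n : nat}.
Local Notation E := 'rV[R]_n.
Local Notation L := (lebType R n).
Local Notation mu := (@lam R n).
Implicit Types (A D : set E) (f g c : E -> R) (e : R).

Lemma intg_dominated D (f_ : nat -> E -> R) f g : msr D -> (forall k, meas D (f_ k)) ->
 (forall x, D x -> f_ ^~ x @ \oo --> f x) -> integ D g ->
 (forall k x, D x -> `|f_ k x| <= g x) -> integ D f /\ intg D (f_ k) @[k --> \oo] --> intg D f.
Proof.
move=>mD mf_ ff gi fg.
have mf : meas D f by apply:(measurable_fun_cvg mf_).
have ffE x : D x -> (EFin \o f_ ^~ x) @ \oo --> (f x)%:E.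
 by move=>Dx;apply:cvg_EFin;[exact:nearW|exact:ff].
have ae1 : {ae mu, forall x, D x -> (EFin \o f_ ^~ x) @ \oo --> (f x)%:E}.
 by apply:aeW => x Dx;exact:ffE.
have ae2 : {ae mu, forall x (k : nat), D x -> (`|(f_ k x)%:E| <= (g x)%:E)%E}.
 by apply:aeW => x k Dx;rewrite lee_fin;exact:fg.
have [fi _ cv] := @dominated_convergence _ L R mu D mD (fun k => EFin \o f_ k) (EFin \o f) (EFin \o g)
 (fun k => (measurable_EFinP _ _).2 (mf_ k)) ((measurable_EFinP _ _).2 mf)
 ae1 gi ae2.
split => //;rewrite /intg /Rintegral;apply:fine_cvg.
by rewrite -intgE// in cv;rewrite -/(Rintegral mu D f) -/(intg D f) intgE// in cv *.
Qed.

Definition bd_supp c := exists r : R, forall x, r < `|x| -> c x = 0.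

Lemma integ_cs c : continuous c -> bd_supp c -> integ setT c.
Proof.
move=>cc [r hr];pose K := [set x : E | `|x| <= r].
have cK : compact K by exact:clnorm_le.
have mK := msr_cpt cK.
have [M M0 hM] := cont_maxK cK (fun (x : E) _ => cc x).
have cE : c = c \_ K.
 apply/funext => x;rewrite patchE;case:ifPn => // /negP xK;apply:hr.
 by rewrite ltNge;apply/negP => h;apply:xK;exact/mem_set.
rewrite cE;apply:(integ_mk c mK).1.
by apply:(@integ_bdd _ _ _ _ M) => //;[exact:lamK_lty|exact:meas_cont].
Qed.

(** A continuous substitute for the indicator of [Q], equal to 1 on [Q] and to 0 off the box
    enlarged by [d]. *)
Definition trapezoid (Q : E * E) (d : R) (x : E) : R :=
 \prod_(i < n) Num.max 0 (1 - (Num.max 0 (Q.1 ord0 i - x ord0 i) + Num.max 0 (x ord0 i - Q.2 ord0 i)) / d).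

Lemma trapezoid_continuous Q d : continuous (trapezoid Q d).
Proof.
have cmax (f : E -> R) : continuous f -> continuous (fun x => Num.max 0 (f x)).
 move=>cf;have -> : (fun x => Num.max 0 (f x)) = (fun x => 2^-1 * (f x + `|f x|)).
  by apply/funext => x;case:leP => h;[rewrite ger0_norm|rewrite ltr0_norm];lra.
 apply:(@contM R _ (cst 2^-1));first exact:cst_continuous.
 by apply:contD => //;apply:cont_comp cf _;exact:norm_continuous.
have cc := @coord_continuous R 1 n ord0.
apply:cont_bigM => i;apply:(cmax);apply:contB;first exact:contC.
apply:contM;last exact:contC.
apply:contD;apply:(cmax);apply:contB => //;exact:contC.
Qed.

Lemma trapezoid_itv Q d x : 0 < d -> 0 <= trapezoid Q d x <= 1.
Proof.
move=>d0;apply/andP;split;first by apply:prodr_ge0 => i _;rewrite le_max lexx.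
apply:prodr_ile1 => i _;rewrite le_max lexx/= ge_max ler01/= gerBl divr_ge0 ?(ltW d0)//.
by rewrite addr_ge0// le_max lexx.
Qed.

Lemma trapezoid1 Q d x : box Q x -> trapezoid Q d x = 1.
Proof.
move=>Qx;rewrite /trapezoid big1// => i _;have /andP[h1 h2] := Qx i.
have -> : Num.max 0 (Q.1 ord0 i - x ord0 i) = 0 by apply/max_idPl;rewrite subr_le0.
have -> : Num.max 0 (x ord0 i - Q.2 ord0 i) = 0 by apply/max_idPl;rewrite subr_le0.
by rewrite addr0 mul0r subr0;apply/max_idPr.
Qed.

Lemma trapezoid0 Q d x : 0 < d -> trapezoid Q d x != 0 -> box (Q.1 - const_mx d, Q.2 + const_mx d) x.
Proof.
move=>d0 /prodf_neq0 h i;have {h} := h i isT;rewrite !mxE => h.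
have {}h : 0 < 1 - (Num.max 0 (Q.1 ord0 i - x ord0 i) + Num.max 0 (x ord0 i - Q.2 ord0 i)) / d.
 by rewrite ltNge;apply:contraNN h => h;apply/eqP/max_idPl.
move: h;rewrite subr_gt0 ltr_pdivrMr// mul1r => h.
have h1 : Q.1 ord0 i - x ord0 i <= Num.max 0 (Q.1 ord0 i - x ord0 i) by rewrite le_max lexx orbT.
have h2 : x ord0 i - Q.2 ord0 i <= Num.max 0 (x ord0 i - Q.2 ord0 i) by rewrite le_max lexx orbT.
have h3 : 0 <= Num.max 0 (Q.1 ord0 i - x ord0 i) by rewrite le_max lexx.
have h4 : 0 <= Num.max 0 (x ord0 i - Q.2 ord0 i) by rewrite le_max lexx.
by move: h h1 h2 h3 h4;set a := Num.max _ _;set b := Num.max _ _ => *;apply/andP;split;lra.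
Qed.

Definition cs_dense f := forall e, 0 < e -> exists c, [/\ continuous c, bd_supp c &
 intg setT (fun x => `|f x - c x|) <= e].

Lemma box_bounded (Q : E * E) x : box Q x -> `|x| <= `|Q.1| + `|Q.2|.
Proof.
move=>Qx;apply:norm_leP => [|i];first by rewrite addr_ge0.
have /andP[h1 h2] := Qx i;have := coord_le_norm Q.1 i;have := coord_le_norm Q.2 i.
by rewrite !ler_norml => /andP[h3 h4] /andP[h5 h6];apply/andP;split;lra.
Qed.

(** An almost optimal cover of [A] by boxes is enlarged slightly to [B], and finitely many boxes
    already cover [A] up to [e / 4]. The continuous function is 1 on this part of [A] and 0 off [B],
    so the error is at most the measure of the two gaps. *)
Lemma indic_dense A : msr A -> (mu A < +oo)%E -> cs_dense (\1_A).
Proof.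
move=>mA Afin e e0.
have e40 : 0 < e / 4 by lra.
have Afn : leb A \is a fin_num by rewrite ge0_fin_numE// leb_ge0.
have [y [D [Q [AQ ->]]] yS] := lb_ereal_inf_adherent e40 Afn.
have e_gt0 k : 0 < (e / 4) / (2 ^ k.+1)%:R by rewrite divr_gt0// ltr0n expn_gt0.
have /choice[d hd] : forall k, exists d : R, 0 < d /\
 (box_vol ((Q k).1 - const_mx d, (Q k).2 + const_mx d)%R <= box_vol (Q k) + ((e / 4) / (2 ^ k.+1)%:R)%:E)%E.
 by move=>k;have [d d0 [_ hd]] := box_enlarge (Q k) (e_gt0 k);exists d.
pose Q' k := ((Q k).1 - const_mx (d k), (Q k).2 + const_mx (d k)).
pose B := \bigcup_(k in D) box (Q' k).
have mbox (Q0 : E * E) : msr (box Q0) by apply:msr_cpt;exact:box_compact.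
have mB : msr B by apply:bigcup_measurable => k _;exact:mbox.
have BA : (leb B <= leb A + (e / 2)%:E)%E.
 apply:(@le_trans _ _ (\esum_(k in D) box_vol (Q' k))%E).
  by apply:ereal_inf_lbound;exists D, Q';split.
 apply:(@le_trans _ _ (\esum_(k in D) (box_vol (Q k) + ((e / 4) / (2 ^ k.+1)%:R)%:E))%E).
  by apply:le_esum => k _;exact:(hd k).2.
 rewrite esumD;[|by move=> *;exact:box_vol_ge0|by move=>k _;rewrite lee_fin ltW].
 rewrite (_ : e / 2 = e / 4 + e / 4);last lra.
 rewrite EFinD addeA;apply:leeD;first exact:ltW.
 apply:(@le_trans _ _ (\esum_(k in [set: nat]) ((e / 4) / (2 ^ k.+1)%:R)%:E)%E).
  rewrite esum_mkcond;apply:le_esum => k _;case:ifP => // _.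
  by rewrite lee_fin ltW.
 rewrite -nneseries_esumT;last by move=>k;rewrite lee_fin ltW.
 by apply:epsilon_trick0;exact:ltW.
have Bfin : (mu B < +oo)%E by apply:le_lt_trans BA _;rewrite lte_add_pinfty ?ltry.
have QQ' k : box (Q k) `<=` box (Q' k).
 move=>x Qx i;have /andP[h1 h2] := Qx i;have := (hd k).1;rewrite !mxE => d0.
 by apply/andP;split;lra.
have AB : A `<=` B by move=>x /AQ[k Dk Qx];exists k => //;exact:QQ'.
pose F N := A `&` \bigcup_(k in [set k | D k /\ (k < N)%N]) box (Q k).
have mF N : msr (F N) by apply:msrI => //;apply:bigcup_measurable => k _;exact:mbox.
have FA : \bigcup_N F N = A.
 apply/seteqP;split => [x [N _ []]//|x Ax].
 by have [k Dk Qx] := AQ _ Ax;exists k.+1 => //;split => //;exists k.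
have [N hN] : exists N, vol A - e / 4 <= vol (F N).
 have : mu \o F @ \oo --> mu (\bigcup_N F N).
  apply:nondecreasing_cvg_mu => //;first by rewrite FA.
  apply/nondecreasing_seqP => N;apply/subsetPset => x [Ax [k [Dk kN] Qx]].
  by split => //;exists k => //;split => //;exact:ltnW.
 have fA : mu A = (vol A)%:E by rewrite /vol fineK.
 rewrite FA fA => /fine_cvg /cvgrPdist_le => /(_ _ e40)[N _ /(_ N (leqnn _)) hN].
 exists N;have := ler_norm (vol A - vol (F N));move: hN;rewrite /vol;lra.
(* A union of boxes corresponds to a product of the complements [1 - trapezoid]. *)
pose c x := 1 - \prod_(k < N | `[< D k >]) (1 - trapezoid (Q k) (d k) x).
have c01 x : 0 <= c x <= 1.
 have h k : 0 <= 1 - trapezoid (Q k) (d k) x <= 1.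
  by have /andP[h1 h2] := @trapezoid_itv (Q k) (d k) x (hd k).1;apply/andP;split;lra.
 rewrite /c subr_ge0 gerBl;apply/andP;split;first by apply:prodr_ile1 => k _.
 by apply:prodr_ge0 => k _;have /andP[] := h k.
have cF x : F N x -> c x = 1.
 move=>[Ax [k /= [Dk kN] Qx]];rewrite /c (bigD1 (Ordinal kN))/=;last exact/asboolP.
 by rewrite trapezoid1// subrr mul0r subr0.
have cB x : c x != 0 -> B x /\ `|x| <= \sum_(k < N) (`|(Q' k).1| + `|(Q' k).2|).
 move=>cx;have [k [Dk kx]] : exists k : 'I_N, D k /\ trapezoid (Q k) (d k) x != 0.
  apply:contrapT => nk;move/eqP : cx;apply;rewrite /c big1 ?subrr// => k /asboolP Dk.
  rewrite (_ : trapezoid _ _ _ = 0) ?subr0//.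
  by apply/eqP;apply:contrapT => /negP kx;apply:nk;exists k.
 have Qx := trapezoid0 (hd k).1 kx.
 split;first by exists k.
 apply:(le_trans (box_bounded Qx));rewrite (bigD1 k)//= lerDl.
 by apply:sumr_ge0 => j _;rewrite addr_ge0.
have cc : continuous c.
 apply:contB;first exact:contC.
 rewrite (_ : (fun x => _) = (fun x => \prod_(k <- [seq k <- index_enum 'I_N | `[< D (k : 'I_N) >]]) (1 - trapezoid (Q k) (d k) x))).
  apply:cont_bigM => k;apply:contB;first exact:contC.
  exact:trapezoid_continuous.
 by apply/funext => x;rewrite big_filter.
exists c;split => //.
 exists (\sum_(k < N) (`|(Q' k).1| + `|(Q' k).2|)) => x hx;apply/eqP;apply:contraTT hx => /cB[_ h].
 by rewrite -leNgt.
have mAF : msr (A `\` F N) by exact:msrD.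
have mBA : msr (B `\` A) by exact:msrD.
have iind C : msr C -> C `<=` B -> integ setT (\1_C).
 move=>mC CB;have -> : (\1_C : E -> R) = (fun=> (1:R)) \_ C.
  by apply/funext => x;rewrite patchE indicE;case:ifP.
 by apply:(integ_mk _ mC).1;apply:integ_cst => //;exact:lamS_lty Bfin.
have eind C : msr C -> intg setT (\1_C) = vol C.
 move=>mC;rewrite -[RHS]mul1r -intg_cst// [RHS]intg_mk;apply:eq_intg => x _.
 by rewrite patchE indicE;case:ifP.
have i1 := iind _ mAF (fun x (h : (A `\` F N) x) => AB x h.1).
have i2 := iind _ mBA (@subIsetl _ _ _).
apply:(@le_trans _ _ (intg setT (fun x => \1_(A `\` F N) x + \1_(B `\` A) x))).
 apply:intg_le => //;last first.
 - move=>x _;have /andP[h1 h2] := c01 x;rewrite !indicE.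
  have [xA|xA] := boolP (x \in A).
   have [xF|xF] := boolP (x \in F N).
    by rewrite cF ?subrr ?normr0 ?addr_ge0 ?ler0n//;exact/set_mem.
   rewrite (_ : (x \in A `\` F N) = true);last by apply/mem_set;split;[exact:set_mem|move=>/mem_set h;rewrite h in xF].
   by rewrite ger0_norm ?subr_ge0//= (le_trans (_ : _ <= 1)) ?gerBl// lerDl ler0n.
  rewrite sub0r normrN ger0_norm//;have [->|/cB[Bx _]] := eqVneq (c x) 0;first by rewrite addr_ge0 ?ler0n.
  rewrite (_ : (x \in B `\` A) = true);last by apply/mem_set;split => // /mem_set h;rewrite h in xA.
  by rewrite (le_trans h2)// lerDr ler0n.
 - by apply:integD.
 - apply:integ_abs => //;apply:integB => //;first by apply:(iind A).
  apply:integ_cs => //;exists (\sum_(k < N) (`|(Q' k).1| + `|(Q' k).2|)) => x hx.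
  by apply/eqP;apply:contraTT hx => /cB[_ h];rewrite -leNgt.
rewrite intgD// !eind//.
have fA : mu A \is a fin_num by rewrite ge0_fin_numE.
have fB : mu B \is a fin_num by rewrite ge0_fin_numE.
have fF : mu (F N) \is a fin_num by rewrite ge0_fin_numE;[apply:(lamS_lty _ Afin) => x []|exact:measure_ge0].
rewrite /vol (_ : mu (A `\` F N) = (mu A - mu (F N))%E);last first.
 rewrite (measureD mA (mF N) Afin);congr (_ - mu _)%E;apply/seteqP;split => [x []//|x [xA xB]];split => //;split.
rewrite (_ : mu (B `\` A) = (mu B - mu A)%E);last by rewrite measureD// setIidr.
rewrite !fineB//;move: hN;rewrite /vol.
have : fine (mu B) <= fine (mu A) + e / 2 by rewrite -lee_fin EFinD !fineK.
lra.
Qed.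

End Density.

Import HBSimple.

(** * Density of continuous functions in L^1 and L^p *)

Section LpDensity.
Context {R : realType} {n : nat}.
Local Notation E := 'rV[R]_n.
Local Notation L := (lebType R n).
Local Notation mu := (@lam R n).
Implicit Types (A D : set E) (f g c h : E -> R) (p e : R).

Lemma powR_add_le (a b p : R) : 0 <= a -> 0 <= b -> 0 <= p ->
 (a + b) `^ p <= 2 `^ p * (a `^ p + b `^ p).
Proof.
move=>a0 b0 p0;wlog ab : a b a0 b0 / a <= b.
 move=>H;have [ab|/ltW ba] := leP a b;first exact:H.
 by rewrite addrC [X in _ <= _ * X]addrC;exact:H.
apply:(@le_trans _ _ ((2 * b) `^ p)).
 by apply:ge0_ler_powR;rewrite ?nnegrE//;lra.
rewrite powRM// ler_wpM2l ?powR_ge0// lerDr powR_ge0//.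
Qed.

Lemma powR_step (z p : R) : 0 <= z -> 1 < p -> z `^ p = z `^ (p - 1) * z.
Proof.
move=>z0 p1;have [->|ne] := eqVneq z 0;first by rewrite mulr0 powR0//;lra.
by rewrite -[X in _ * X](powRr1 z0) -powRD ?subrK// ne implybT.
Qed.

(** Young's inequality for [s] and [t^(p-1)]; it says that the convex function [s^p] lies above its
    tangent at [t]. *)
Lemma powR_tangent (s t p : R) : 0 <= s -> 0 <= t -> 1 < p ->
 p * t `^ (p - 1) * s <= s `^ p + (p - 1) * t `^ p.
Proof.
move=>s0 t0 p1;have pp : 0 < p by lra.
have p10 : 0 < p - 1 by lra.
have q0 : 0 < p / (p - 1) by rewrite divr_gt0.
have pq : p^-1 + (p / (p - 1))^-1 = 1 by rewrite invf_div;field;rewrite gt_eqF.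
have := @conjugate_powR R s (t `^ (p - 1)) p (p / (p - 1)) s0 (powR_ge0 _ _) pp q0 pq.
rewrite -powRrM mulrCA mulfV ?gt_eqF// mulr1 => h.
move: h;rewrite -(ler_pM2l pp) mulrDr invf_div.
rewrite (_ : p * (s `^ p / p) = s `^ p);last by field;rewrite gt_eqF.
rewrite [X in _ <= _ + X](_ : _ = (p - 1) * t `^ p);last by field;rewrite gt_eqF.
by apply:le_trans;rewrite mulrA mulrAC.
Qed.

Lemma dense_lin (a b : R) f g : integ setT f -> integ setT g ->
 cs_dense f -> cs_dense g -> cs_dense (fun x => a * f x + b * g x).
Proof.
move=>fi gi df dg e e0.
have ea : 0 < e / (2 * (`|a| + 1)) by rewrite divr_gt0// mulr_gt0// ltr_wpDl.
have eb : 0 < e / (2 * (`|b| + 1)) by rewrite divr_gt0// mulr_gt0// ltr_wpDl.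
have [c [cc [r cr] hc]] := df _ ea;have [d [cd [s ds] hd]] := dg _ eb.
have ci : integ setT c by apply:integ_cs => //;exists r.
have di : integ setT d by apply:integ_cs => //;exists s.
exists (fun x => a * c x + b * d x);split.
- by apply:contD;apply:contM => //;exact:contC.
- exists (Num.max r s) => x;rewrite gt_max => /andP[h1 h2].
 by rewrite cr// ds// !mulr0 addr0.
have i1 := integ_abs msrT (integB msrT fi ci);have i2 := integ_abs msrT (integB msrT gi di).
apply:(@le_trans _ _ (intg setT (fun x => `|a| * `|f x - c x| + `|b| * `|g x - d x|))).
 apply:intg_le => //.
 - by apply:integ_abs => //;apply:integB => //;apply:integD => //;exact:integZ.
 - by apply:integD => //;exact:integZ.
 - move=>x _;rewrite -!normrM.
  rewrite (_ : a * f x + b * g x - _ = a * (f x - c x) + b * (g x - d x));last ring.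
  exact:ler_normD.
rewrite intgD ?intgZ//;[|exact:integZ..].
have h (t u v : R) : 0 <= t -> 0 <= u -> u <= e / (2 * (t + 1)) -> t * u <= e / 2.
 move=>t0 u0;rewrite invfM mulrA ler_pdivlMr;last by rewrite ltr_wpDl.
 by move=>hh;apply:le_trans hh;rewrite mulrDr mulr1 mulrC lerDl.
by rewrite (splitr e);apply:lerD;apply:h => //;exact:intg_ge0.
Qed.

Lemma dense0 : cs_dense ((fun=> 0) : E -> R).
Proof.
move=>e e0;exists (fun=> 0);split;[exact:contC|by exists 0|].
by rewrite (_ : intg _ _ = 0) ?ltW// -[RHS](@intg0 R n setT);apply:eq_intg => x _;rewrite subrr normr0.
Qed.

Lemma dense_lim f : integ setT f -> (forall e, 0 < e -> exists g, [/\ integ setT g, cs_dense g &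
 intg setT (fun x => `|f x - g x|) <= e]) -> cs_dense f.
Proof.
move=>fi h e e0;have e20 : 0 < e / 2 by lra.
have [g [gi dg hg]] := h _ e20;have [c [cc cs hc]] := dg _ e20.
exists c;split => //;have ci := integ_cs cc cs.
have i1 := integ_abs msrT (integB msrT fi gi);have i2 := integ_abs msrT (integB msrT gi ci).
apply:(@le_trans _ _ (intg setT (fun x => `|f x - g x| + `|g x - c x|))).
 apply:intg_le => //;[exact:integ_abs msrT (integB msrT fi ci)|exact:integD|].
 by move=>x _;rewrite -(subrK (g x) (f x)) -addrA;apply:le_trans (ler_normD _ _) _;rewrite addrK.
by rewrite intgD//;lra.
Qed.

Lemma L1_dense f : integ setT f -> cs_dense f.
Proof.
move=>fi;apply:dense_lim => // e e0.
have [g_ [gi _ gf]] := @approximation_sfun_integrable _ L R mu setT measurableT (EFin \o f) fi.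
pose G (k : nat) : L -> R := HBSimple.SimpleFun.sort (g_ k).
have [k hk] : exists k, intg setT (fun x : E => `|f x - G k x|) <= e.
 have /fine_cvg : (fun k => (intg setT (fun x : E => `|f x - G k x|))%:E) @ \oo --> 0%:E.
  rewrite (_ : (fun k => _) = (fun k => (\int[mu]_z `|(EFin \o f) z - (G k z)%:E|)%E))//;apply/funext => k.
  by rewrite intgE//;apply:integ_abs => //;apply:integB => //;exact:gi.
 move/cvgrPdist_le => /(_ _ e0)[k _ /(_ k (leqnn _))] /=.
 by rewrite sub0r normrN => hk;exists k;apply:le_trans (ler_norm _) hk.
exists (G k);split => //;first exact:gi.
have gE : G k = (fun x => \sum_(y <- fset_set (range (G k))) (y * \1_(G k @^-1` [set y]) x)).
 by apply/funext => x;rewrite /G [LHS](fimfunE (g_ k)) fsbig_finite//=;exact:fimfunP.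
rewrite gE;elim:(enum_fset _) => [|y s ih].
 by rewrite (_ : (fun x => _) = (fun=> 0));[exact:dense0|apply/funext => x;rewrite big_nil].
set A := G k @^-1` [set y].
have mA : msr A by exact:measurable_sfunP.
(* The level set of the value 0 may have infinite measure, but it contributes nothing to the sum. *)
have ind_or : y = 0 \/ (mu A < +oo)%E.
 have [->|y0] := eqVneq y 0;[by left|right].
 have : integ setT (\1_A : E -> R).
  apply:(@integ_le _ _ _ _ (fun x : L => `|y|^-1 * `|G k x|)) => //.
  - exact:meas_indic.
  - move=>x _;rewrite indicE;have [/set_mem /= ->|_] := boolP (x \in A).
    by rewrite mulVf ?normr_eq0//= normr1.
   by rewrite normr0 mulr_ge0 ?invr_ge0.
  - by apply:integZ => //;apply:integ_abs => //;exact:gi.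
 move/integrableP => [_];rewrite (_ : (fun x : L => _) = (fun x : L => (\1_A x)%:E)).
  by rewrite integral_indic// setIT.
 by apply/funext => x /=;rewrite ger0_norm// indicE ler0n.
have iA : integ setT (fun x => y * \1_A x).
 have [->|Af] := ind_or.
  by apply:(@eq_integ _ _ _ (fun=> 0)) => //;[move=>x _;rewrite mul0r|exact:integ0].
 apply:integZ => //;have -> : (\1_A : E -> R) = (fun=> (1:R)) \_ A.
  by apply/funext => x;rewrite patchE indicE;case:ifP.
 by apply:(integ_mk _ mA).1;exact:integ_cst.
rewrite (_ : (fun x => _) = (fun x => 1 * (y * \1_A x) +
 1 * \sum_(z <- s) (z * \1_(G k @^-1` [set z]) x)));last first.
 by apply/funext => x;rewrite big_cons !mul1r.
apply:dense_lin => //.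
- apply:integ_sum => // z;set B := G k @^-1` [set z].
 apply:(@integ_le _ _ _ _ (fun x : L => `|G k x|)) => //.
 + by apply:measM;[exact:meas_cst|apply:meas_indic;exact:measurable_sfunP].
 + move=>x _;rewrite indicE;have [/set_mem /= ->|_] := boolP (x \in B);first by rewrite mulr1.
  by rewrite mulr0 normr0.
 + by apply:integ_abs => //;exact:gi.
- have [->|Af] := ind_or.
  rewrite (_ : (fun x => _) = (fun=> 0));[exact:dense0|by apply/funext => x;rewrite mul0r].
 rewrite (_ : (fun x => _) = (fun x => y * \1_A x + 0 * \1_A x)).
  have i1 : integ setT (\1_A : E -> R).
   have -> : (\1_A : E -> R) = (fun=> (1:R)) \_ A by apply/funext => x;rewrite patchE indicE;case:ifP.
   by apply:(integ_mk _ mA).1;exact:integ_cst.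
  by apply:dense_lin => //;exact:indic_dense.
 by apply/funext => x;rewrite mul0r addr0.
Qed.

(** [f] is cut off in domain and range. The L^1 approximation of the cut-off function is clamped to
    a bounded range, and between bounded functions the L^1 distance controls the L^p distance. *)
Lemma Lp_dense p f e : 1 < p -> meas setT f -> integ setT (fun x => `|f x| `^ p) -> 0 < e ->
 exists c, [/\ continuous c, bd_supp c, integ setT (fun x => `|f x - c x| `^ p) &
  intg setT (fun x => `|f x - c x| `^ p) <= e].
Proof.
move=>p1' mf fpi e0;have p0 : 0 <= p by lra.
pose D k := [set x : E | `|x| <= k%:R] `&` [set x | `|f x| <= k%:R].
have mD k : msr (D k).
 apply:msrI;first by apply:msr_cpt;exact:clnorm_le.
 have := msrC (@msr_gt _ _ setT (fun x => `|f x|) k%:R msrT (meas_norm mf)).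
 by rewrite setTI;congr msr;apply/seteqP;split => x /=;[move/negP;rewrite -leNgt|move=>h;apply/negP;rewrite -leNgt].
pose fk k := f \_ (D k).
have mfk k : meas setT (fk k) by exact:meas_restrict_sub (mD k) (@subsetT _ _) msrT mf.
have fkx x : \forall k \near \oo, fk k x = f x.
 exists (Num.bound (`|x| + `|f x|)) => // k /= hk.
 have hb : `|x| + `|f x| <= k%:R.
  apply:ltW;apply:(lt_le_trans (@archi_boundP R _ _));first by rewrite addr_ge0.
  by rewrite ler_nat.
 rewrite /fk patchE ifT//;apply/mem_set;split => /=;apply:le_trans hb;first by rewrite lerDl.
 by rewrite lerDr.
pose q : R := 2 `^ p;have q0 : 0 < q by rewrite powR_gt0.
have eq0 : 0 < e / (2 * q) by rewrite divr_gt0// mulr_gt0.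
have [k hk ki] : exists2 k, intg setT (fun x => `|f x - fk k x| `^ p) <= e / (2 * q) &
  integ setT (fun x => `|f x - fk k x| `^ p).
 have mm k : meas setT (fun x => `|f x - fk k x| `^ p).
  by apply:meas_powR;apply:meas_norm;exact:measB.
 have dd k x : setT x -> `| `|f x - fk k x| `^ p | <= `|f x| `^ p.
  move=>_;rewrite ger0_norm ?powR_ge0// /fk patchE;case:ifP => _;last by rewrite subr0.
  rewrite subrr normr0 powR0 ?powR_ge0//;lra.
 have [|_ cv] := @intg_dominated R n setT (fun k x => `|f x - fk k x| `^ p) (fun=> 0) _ msrT mm _ fpi dd.
  move=>x _;apply:cvg_near_cst;near=> k.
  rewrite (_ : fk k x = f x) ?subrr ?normr0 ?powR0//;first lra.
  by near: k;exact:fkx.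
 move: cv;rewrite intg0 => /cvgrPdist_le /(_ _ eq0)[k _ /(_ k (leqnn _))] /=.
 rewrite sub0r normrN => hk;exists k;first exact:le_trans (ler_norm _) hk.
 exact:(integ_le msrT (mm k) (dd k) fpi).
pose m : R := k%:R + 1;have m0 : 0 < m by rewrite ltr_wpDl.
have fkm x : `|fk k x| <= m.
 rewrite /fk patchE;case:ifPn => [/set_mem[_ /= h]|_];last by rewrite normr0 ltW.
 by rewrite (le_trans h)// lerDl.
have fki : integ setT (fk k).
 apply:(integ_mk _ (mD k)).1;apply:(@integ_bdd _ _ _ _ m) => //.
 - apply:lamS_lty (lamK_lty (@clnorm_le R n k%:R));exact:subIsetl.
 - exact:meas_sub mf.
 - by move=>x [_ /= h];rewrite (le_trans h)// lerDl.
pose e' := e / (2 * q * (2 * m) `^ (p - 1)).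
have e'0 : 0 < e' by rewrite divr_gt0// !mulr_gt0// powR_gt0// mulr_gt0.
have [c0 [cc0 [r cr] hc0]] := L1_dense fki e'0.
have c0i : integ setT c0 by apply:integ_cs => //;exists r.
(* The clamp to [[-m, m]], written with absolute values so that its continuity is immediate. *)
pose clamp (t : R) := 2^-1 * (`|t + m| - `|t - m|).
have clampE t : clamp t = if t < - m then - m else if t < m then t else m.
 rewrite /clamp;case:(ltP t (- m)) => h1;last case:(ltP t m) => h2.
 - rewrite ltr0_norm;last lra. rewrite ltr0_norm;lra.
 - rewrite ger0_norm;last lra. rewrite ltr0_norm;lra.
 - rewrite ger0_norm;last lra. rewrite ger0_norm;lra.
have clamp_le x t : `|x| <= m -> `|x - clamp t| <= `|x - t| /\ `|x - clamp t| <= 2 * m.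
 rewrite ler_norml => /andP[h1 h2];rewrite clampE;case:ifP => [h3|/negbT];last rewrite -leNgt => h3.
  have -> : `|x - - m| = x + m by rewrite opprK ger0_norm//;lra.
  by split;[rewrite ger0_norm;lra|lra].
 case:ifP => [h4|/negbT];last rewrite -leNgt => h4.
  by split => //;rewrite ler_norml;apply/andP;split;lra.
 by split;[rewrite (ler0_norm (_ : x - t <= 0)) ?ler_norml;lra|rewrite ler_norml;apply/andP;split;lra].
have cclamp : continuous clamp.
 apply:contM;first exact:contC.
 have cn : continuous (fun t : R => `|t|) by move=>t;exact:norm_continuous.
 apply:contB;apply:cont_comp cn.
  by apply:contD;[move=>t;exact:cvg_id|exact:contC].
 by apply:contB;[move=>t;exact:cvg_id|exact:contC].
pose c x := clamp (c0 x).
have cc : continuous c by exact:cont_comp.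
have cs : bd_supp c.
 by exists r => x /cr c0x;rewrite /c c0x clampE;repeat case:ifP => //;lra.
have ci := integ_cs cc cs.
have dk x : `|fk k x - c x| `^ p <= (2 * m) `^ (p - 1) * `|fk k x - c0 x|.
 have [h1 h2] := clamp_le _ (c0 x) (fkm x).
 rewrite (powR_step (normr_ge0 _) p1') ;apply:ler_pM => //.
 by apply:ge0_ler_powR;rewrite ?nnegrE//;lra.
have mc : meas setT (fun x => `|fk k x - c x| `^ p).
 by apply:meas_powR;apply:meas_norm;apply:measB => //;exact:meas_cont.
have dki : integ setT (fun x => `|fk k x - c x| `^ p).
 apply:(integ_le msrT mc _ (integZ ((2 * m) `^ (p - 1)) msrT (integ_abs msrT (integB msrT fki c0i)))) => x _.
 by rewrite ger0_norm ?powR_ge0.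
have mfc : meas setT (fun x => `|f x - c x| `^ p).
 by apply:meas_powR;apply:meas_norm;apply:measB => //;exact:meas_cont.
have bd x : `|f x - c x| `^ p <= q * (`|f x - fk k x| `^ p + `|fk k x - c x| `^ p).
 apply:le_trans (powR_add_le _ _ p0) => //;apply:ge0_ler_powR;rewrite ?nnegrE ?addr_ge0//.
 by rewrite (_ : f x - c x = (f x - fk k x) + (fk k x - c x)) ?ler_normD//;ring.
have sumi := integZ q msrT (integD msrT ki dki).
have fci : integ setT (fun x => `|f x - c x| `^ p).
 by apply:(integ_le msrT mfc _ sumi) => x _;rewrite ger0_norm ?powR_ge0.
exists c;split => //.
apply:(le_trans (intg_le msrT fci sumi (fun x _ => bd x))).
rewrite intgZ ?intgD//;last exact:integD.
have h2 : intg setT (fun x => `|fk k x - c x| `^ p) <= e / (2 * q).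
 apply:(le_trans (intg_le msrT dki (integZ ((2 * m) `^ (p - 1)) msrT (integ_abs msrT (integB msrT fki c0i))) (fun x _ => dk x))).
 rewrite intgZ//;last by apply:integ_abs => //;exact:integB.
 have P0 : 0 < (2 * m) `^ (p - 1) by rewrite powR_gt0// mulr_gt0.
 rewrite mulrC -ler_pdivlMr//;apply:(le_trans hc0).
 by rewrite /e' invfM mulrA.
rewrite mulrC -ler_pdivlMr//.
apply:(le_trans (lerD hk h2));rewrite invfM mulrA -mulrDl -splitr//.
Unshelve. all: by end_near. Qed.

End LpDensity.

(** * Mollification and its convergence in L^p *)

Section Mollifier.
Context {R : realType} {n : nat}.
Local Notation E := 'rV[R]_n.
Implicit Types (f g : E -> R) (d p e : R).

Lemma Ck_scale k (c : R) f : Ck k f -> Ck k (fun x => c * f x).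
Proof.
elim:k f => [|k ih] f /=;first by move=>cf;apply:contM => //;exact:contC.
move=>[cf df];split;first by apply:contM => //;exact:contC.
move=>i;have [dfi kfi] := df i;split.
 by move=>x;have [] := derive_scaler c (dfi x).
have -> : 'D_(evec i) (fun x => c * f x) = (fun x => c * 'D_(evec i) f x).
 by apply/funext => x;have [_ ->] := derive_scaler c (dfi x).
exact:ih.
Qed.

Lemma integ_bump : integ setT (@cbump R n).
Proof.
apply:integ_cs;first exact:(@Ck_cbump R n 0).
by exists 1 => x x1;apply/eqP;rewrite -[_ == _]negbK cbump_neq0 -leNgt ltW.
Qed.

Definition bump_mass : R := intg setT (@cbump R n).

Lemma bump_mass_gt0 : 0 < bump_mass.
Proof.
have b0 : 0 < cbump (0 : E) by rewrite lt_def cbump_ge0 cbump_neq0 normr0 ltr01.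
have /cont_rVP/(_ (cbump (0 : E) / 2) ltac:(lra))[d d0 hd] := @Ck_cbump R n 0 (0 : E).
have mb := @msr_ball R n 0 d.
apply:(@lt_le_trans _ _ (cbump (0 : E) / 2 * vol (ball (0 : E) d))).
 by rewrite mulr_gt0 ?divr_gt0// vol_ball// mulr_gt0 ?exprn_gt0//;exact:cube_vol_gt0.
rewrite -(intg_cst _ mb) (le_trans _ (intg_subset msrT mb (@subsetT _ _) integ_bump (fun x _ => cbump_ge0 x)))//.
apply:intg_le => //;[exact:integ_cst (lamB_lty _ _)|exact:integ_sub integ_bump|].
move=>x;rewrite -ball_normE /= => /hd;rewrite ler_norml => /andP[_ h];lra.
Qed.

Definition moll d (x : E) : R := (d ^+ n * bump_mass)^-1 * cbump (d^-1 *: x).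

Lemma moll_ge0 d x : 0 < d -> 0 <= moll d x.
Proof.
by move=>d0;rewrite mulr_ge0 ?cbump_ge0// invr_ge0 mulr_ge0 ?exprn_ge0 ?(ltW d0)// ltW// bump_mass_gt0.
Qed.

Lemma moll_smooth d : 0 < d -> ssupp d (moll d).
Proof.
move=>d0;split => [k|x dx].
 apply:Ck_scale;have := Ck_affine d^-1 0 (@Ck_cbump R n k).
 by congr Ck;apply/funext => x;rewrite /affine /= addr0.
rewrite /moll [X in _ * X](_ : _ = 0) ?mulr0//;apply/eqP;rewrite -[_ == _]negbK cbump_neq0 -leNgt.
by rewrite normrZ gtr0_norm ?invr_gt0// ler_pdivlMl// mulr1 ltW.
Qed.

Lemma moll_mass d x : 0 < d -> integ setT (fun y => moll d (x - y)) /\ intg setT (fun y => moll d (x - y)) = 1.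
Proof.
move=>d0;have nd : - d^-1 != 0 by rewrite oppr_eq0 invr_eq0 gt_eqF.
have [ib eb] := intg_affine (d^-1 *: x) nd integ_bump.
have mE y : moll d (x - y) = (d ^+ n * bump_mass)^-1 * cbump (affine (- d^-1) (d^-1 *: x) y).
 by rewrite /moll /affine scalerBr addrC scaleNr.
split;first by apply:(eq_integ msrT (fun y _ => esym (mE y)));exact:integZ.
rewrite (eq_intg (fun y _ => mE y)) intgZ// eb normrN gtr0_norm ?invr_gt0// exprVn invrK mulVf//.
by rewrite gt_eqF// mulr_gt0 ?exprn_gt0// bump_mass_gt0.
Qed.

Lemma conv_moll_close f d x e : 0 < d -> integ setT f -> (forall y, `|x - y| <= d -> `|f y - f x| <= e) ->
 `|convol f (moll d) x - f x| <= e.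
Proof.
move=>d0 fi fe;have [mi m1] := moll_mass x d0;have sm := moll_smooth d0.
have ci := conv_integrable x fi sm;have fxi := integZ (f x) msrT mi.
have -> : convol f (moll d) x - f x = intg setT (fun y => f y * moll d (x - y) - f x * moll d (x - y)).
 by rewrite intgB// intgZ// m1 mulr1.
apply:(le_trans (le_norm_intg msrT (integB msrT ci fxi))).
rewrite -[e]mulr1 -m1 -intgZ//;apply:intg_le => //.
- exact:integ_abs msrT (integB msrT ci fxi).
- exact:integZ.
move=>y _;rewrite -mulrBl normrM (ger0_norm (moll_ge0 _ d0)).
have [xd|xd] := leP `|x - y| d;first by rewrite ler_wpM2r ?moll_ge0 ?fe.
by rewrite sm.2// !mulr0.
Qed.

(** Jensen's inequality: [powR_tangent], with [t] the absolute value of the convolution at [x], is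
    integrated against the kernel, which has mass 1. *)
Lemma conv_Jensen f d p x : 0 < d -> 1 < p -> integ setT f -> integ setT (fun y => `|f y| `^ p) ->
 `|convol f (moll d) x| `^ p <= convol (fun y => `|f y| `^ p) (moll d) x.
Proof.
move=>d0 p1 fi fpi;have [mi m1] := moll_mass x d0;have sm := moll_smooth d0.
set t := `|_|;have t0 : 0 <= t by exact:normr_ge0.
have afi := integ_abs msrT fi.
have ci := conv_integrable x afi sm;have cpi := conv_integrable x fpi sm.
have tf : t <= intg setT (fun y => `|f y| * moll d (x - y)).
 apply:le_trans (le_norm_intg msrT (conv_integrable x fi sm)) _.
 by rewrite le_eqVlt;apply/orP;left;apply/eqP/eq_intg => y _;rewrite normrM (ger0_norm (moll_ge0 _ d0)).
have h : p * t `^ (p - 1) * intg setT (fun y => `|f y| * moll d (x - y)) <=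
  convol (fun y => `|f y| `^ p) (moll d) x + (p - 1) * t `^ p.
 rewrite [X in _ <= _ + X](_ : _ = (p - 1) * t `^ p * intg setT (fun y => moll d (x - y)));last by rewrite m1 mulr1.
 rewrite -!intgZ// -intgD//;last exact:integZ.
 apply:intg_le => //;[exact:integZ|apply:integD => //;exact:integZ|move=>y _].
 by have := ler_wpM2r (moll_ge0 (x - y) d0) (powR_tangent (normr_ge0 (f y)) t0 p1);lra.
have := le_trans (ler_wpM2l (mulr_ge0 (ltW (lt_trans ltr01 p1)) (powR_ge0 t (p - 1))) tf) h.
by rewrite -mulrA -powR_step//;lra.
Qed.

Lemma conv_integ f d : 0 < d -> integ setT f -> (forall y, 0 <= f y) ->
 integ setT (convol f (moll d)) /\ intg setT (convol f (moll d)) = intg setT f.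
Proof.
move=>d0 fi f0;have sm := moll_smooth d0.
pose F (z : E * E) := f z.2 * moll d (z.1 - z.2).
have flip y x : moll d (x - y) = (fun z => moll d (- (y - z))) x by rewrite opprB.
have mi y : integ setT (fun x => moll d (x - y)) /\ intg setT (fun x => moll d (x - y)) = 1.
 have [h1 h2] := moll_mass 0 d0.
 have [h3 h4] := @intg_affine R n (-1) y (fun z => moll d (0 - z)) ltac:(by rewrite oppr_eq0 oner_eq0) h1.
 have e x : moll d (0 - affine (-1) y x) = moll d (x - y) by rewrite /affine scaleN1r sub0r opprD opprK.
 split;first exact:(eq_integ msrT (fun x _ => e x)).
 by rewrite -(eq_intg (fun x _ => e x)) h4 h2 normrN1 expr1n invr1 mul1r.
have [|||||h1 h2] := @intg_tonelli R n F.
- apply:meas2M;first by apply:(@meas2_snd R n f);exact:integ_meas.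
 apply:meas2_cont => z;apply:(@continuous_comp _ _ _ (fun z : E * E => z.1 - z.2) (moll d));last exact:(sm.1 0%N).
 by apply:cvgB;[exact:cvg_fst|exact:cvg_snd].
- by move=>z;rewrite mulr_ge0// moll_ge0.
- by move=>x;exact:(conv_integrable x fi sm).
- by move=>y;exact:(integZ (f y) msrT (mi y).1).
- by apply:(@eq_integ _ _ _ f) => // y _;rewrite /F /= (intgZ (f y) msrT (mi y).1) (mi y).2 mulr1.
split;first exact:h1.
by rewrite [LHS]h2;apply:eq_intg => y _;rewrite /F /= (intgZ (f y) msrT (mi y).1) (mi y).2 mulr1.
Qed.

Lemma conv_Lp f d p : 0 < d -> 1 < p -> integ setT f -> integ setT (fun y => `|f y| `^ p) ->
 integ setT (fun x => `|convol f (moll d) x| `^ p) /\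
 intg setT (fun x => `|convol f (moll d) x| `^ p) <= intg setT (fun y => `|f y| `^ p).
Proof.
move=>d0 p1 fi fpi;have sm := moll_smooth d0.
have [ci ce] := conv_integ d0 fpi (fun y => powR_ge0 _ _).
have ii : integ setT (fun x => `|convol f (moll d) x| `^ p).
 apply:(integ_le msrT _ _ ci);last by move=>x _;rewrite ger0_norm ?powR_ge0// conv_Jensen.
 by apply:meas_powR;apply:meas_norm;apply:meas_cont;exact:conv_cont fi sm.
by split => //;rewrite -ce;apply:intg_le => // x _;exact:conv_Jensen.
Qed.

Lemma cpt_ucont (K : set E) f e : compact K -> (forall x, K x -> {for x, continuous f}) -> 0 < e ->
 exists2 d, 0 < d & forall x y, K x -> `|x - y| <= d -> `|f x - f y| <= e.
Proof.
move=>cK cf e0;have e20 : 0 < e / 2 by lra.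
have : \forall d \near (0 : R)^'+, K `<=` (fun x => forall y, `|x - y| <= d -> `|f x - f y| <= e).
 have /compact_near_coveringP := cK;apply => x /cf /cont_rVP/(_ _ e20)[r r0 hr].
 have r20 : 0 < r / 2 by lra.
 exists (ball x (r / 2), [set d | d < r / 2]).
  by split => /=;[exact:nbhsx_ballx|exact:nbhs_right_lt].
 move=>[x' d] [/= xx' dr] y yx'.
 move: xx';rewrite -ball_normE /= => xx'.
 have h1 : `|f x - f x'| <= e / 2 by apply:hr;lra.
 have h2 : `|f x - f y| <= e / 2.
  by apply:hr;have := ler_normD (x - x') (x' - y);rewrite addrA subrK;lra.
 rewrite (_ : f x' - f y = - (f x - f x') + (f x - f y));last ring.
 by rewrite (le_trans (ler_normD _ _))// normrN;lra.
move=>h;have [d /andP[d0 Kd]] : exists d : R, (0 < d) && `[< K `<=` (fun x => forall y, `|x - y| <= d -> `|f x - f y| <= e) >].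
 near (0 : R)^'+ => d;exists d;apply/andP;split;first by near: d;exact:nbhs_right_gt.
 by apply/asboolP;near: d.
by exists d => // x y Kx;move/asboolP : Kd;apply.
Unshelve. all: by end_near. Qed.

Lemma unif_cont_supp f e : continuous f -> bd_supp f -> 0 < e ->
 exists2 d, 0 < d & forall x y, `|x - y| <= d -> `|f x - f y| <= e.
Proof.
move=>cf [r hr] e0.
have [d d0 hd] := cpt_ucont (@clnorm_le R n (r + 1)) (fun x _ => cf x) e0.
exists (Num.min d 1) => [|x y];first by rewrite lt_min d0 ltr01.
rewrite le_min => /andP[xyd xy1];have [xr|xr] := leP `|x| (r + 1);first exact:hd.
have yr : r < `|y| by have := ler_normD (x - y) y;rewrite subrK;lra.
by rewrite (hr x) ?(hr y)// ?subrr ?normr0 ?ltW//;lra.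
Qed.

Lemma powR_norm_add (a b p : R) : 0 <= p -> `|a + b| `^ p <= 2 `^ p * (`|a| `^ p + `|b| `^ p).
Proof.
move=>p0;apply:le_trans (powR_add_le _ _ p0) => //.
by apply:ge0_ler_powR;rewrite ?nnegrE ?addr_ge0// ler_normD.
Qed.

(** [f] is replaced by a continuous [c] of bounded support: mollification does not increase the L^p
    norm of [f - c], and [c] is approximated uniformly inside the fixed cube [B]. *)
Lemma conv_moll_Lp f p e : 1 < p -> integ setT f -> integ setT (fun y => `|f y| `^ p) -> 0 < e ->
 exists2 d0, 0 < d0 & forall d, 0 < d <= d0 ->
  integ setT (fun x => `|convol f (moll d) x - f x| `^ p) /\
  intg setT (fun x => `|convol f (moll d) x - f x| `^ p) <= e.
Proof.
move=>p1 fi fpi e0;have p0 : 0 <= p by lra.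
pose q : R := 2 `^ p;have q0 : 0 < q by rewrite powR_gt0.
(* Splitting a sum of three terms costs the factor [q] twice, and the three errors together must fit
   into [e]. *)
pose e1 := e / (4 * q ^+ 2);have e10 : 0 < e1 by rewrite divr_gt0// mulr_gt0// exprn_gt0.
have mf := integ_meas fi.
have [c [cc cs fci fce]] := Lp_dense p1 mf fpi e10.
have ci := integ_cs cc cs;have [r hr] := cs.
pose r' := Num.max r 0 + 1;have r'0 : 0 < r' by rewrite ltr_wpDl// le_max lexx orbT.
pose B : set E := [set x | `|x| <= r'].
have cB : compact B by exact:clnorm_le.
have mB : msr B by exact:msr_cpt.
pose e2 := (e1 / (vol B + 1)) `^ p^-1.
have vB : 0 <= vol B by exact:vol_ge0.
have e20 : 0 < e2 by rewrite powR_gt0// divr_gt0// ltr_wpDl.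
have e2p : e2 `^ p * vol B <= e1.
 rewrite -powRrM mulVf ?powRr1;[|rewrite divr_ge0 ?(ltW e10)//;lra|lra].
 rewrite mulrAC ler_pdivrMr;last lra.
 by rewrite ler_wpM2l ?(ltW e10)//;lra.
have [d0 d00 hd0] := unif_cont_supp cc cs e20.
exists (Num.min d0 1);first by rewrite lt_min d00 ltr01.
move=>d /andP[dpos];rewrite le_min => /andP[dd0 d1].
have sm := moll_smooth dpos.
have ccl x : `|convol c (moll d) x - c x| <= e2.
 by apply:conv_moll_close => // y xy;rewrite distrC;apply:hd0;exact:le_trans dd0.
have cc0 x : ~ B x -> convol c (moll d) x - c x = 0.
 move/negP;rewrite -ltNge => Bx.
 have rx : r + 1 < `|x| by apply:le_lt_trans Bx;rewrite /r' lerD2r le_max lexx.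
 rewrite (hr x) ?subr0;last lra.
 rewrite /convol (_ : (fun y => _) = (fun=> 0)) ?intg0//;apply/funext => y.
 have [xy|xy] := leP `|x - y| d;last by rewrite sm.2// mulr0.
 by rewrite (hr y) ?mul0r//;have := ler_normD (x - y) y;rewrite subrK;lra.
have mcc : meas setT (fun x => `|convol c (moll d) x - c x| `^ p).
 apply:meas_powR;apply:meas_norm;apply:measB;apply:meas_cont => //.
 exact:conv_cont ci sm.
have bcc x : `|convol c (moll d) x - c x| `^ p <= ((fun=> e2 `^ p) \_ B) x.
 rewrite patchE;case:ifPn => [_|/negP Bx].
  by apply:ge0_ler_powR;rewrite ?nnegrE ?(ltW e20).
 by rewrite cc0 ?normr0 ?powR0//;[lra|move=>h;apply:Bx;exact/mem_set].
have iB : integ setT ((fun=> e2 `^ p) \_ B).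
 by apply:(integ_mk _ mB).1;exact:integ_cst (lamK_lty cB).
have icc : integ setT (fun x => `|convol c (moll d) x - c x| `^ p).
 by apply:(integ_le msrT mcc _ iB) => x _;rewrite ger0_norm ?powR_ge0.
have lcc : intg setT (fun x => `|convol c (moll d) x - c x| `^ p) <= e1.
 apply:(le_trans (intg_le msrT icc iB (fun x _ => bcc x))).
 by rewrite -intg_mk intg_cst.
have fcI : integ setT (fun x => f x - c x) by exact:integB.
have [i3 l3] := conv_Lp dpos p1 fcI fci.
have convB x : convol f (moll d) x = convol (fun x => f x - c x) (moll d) x + convol c (moll d) x.
 rewrite /convol -intgD;[|exact:msrT|exact:(conv_integrable x fcI sm)|exact:(conv_integrable x ci sm)].
 by apply:eq_intg => y _;ring.
have bd x : `|convol f (moll d) x - f x| `^ p <= q * `|convol (fun x => f x - c x) (moll d) x| `^ p +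
 (q * (q * `|convol c (moll d) x - c x| `^ p) + q * (q * `|f x - c x| `^ p)).
 rewrite convB (_ : _ - f x = convol (fun x => f x - c x) (moll d) x +
  ((convol c (moll d) x - c x) + - (f x - c x)));last ring.
 apply:(le_trans (powR_norm_add _ _ p0));rewrite -/q mulrDr lerD2l -!mulrDr ler_wpM2l ?(ltW q0)//.
 by apply:(le_trans (powR_norm_add _ _ p0));rewrite normrN.
have isum : integ setT (fun x => q * `|convol (fun x => f x - c x) (moll d) x| `^ p +
 (q * (q * `|convol c (moll d) x - c x| `^ p) + q * (q * `|f x - c x| `^ p))).
 by apply:integD => //;[|apply:integD => //];repeat apply:integZ => //.
have mm : meas setT (fun x => `|convol f (moll d) x - f x| `^ p).
 apply:meas_powR;apply:meas_norm;apply:measB => //;apply:meas_cont.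
 exact:conv_cont fi sm.
have ii : integ setT (fun x => `|convol f (moll d) x - f x| `^ p).
 by apply:(integ_le msrT mm _ isum) => x _;rewrite ger0_norm ?powR_ge0.
split => //;apply:(le_trans (intg_le msrT ii isum (fun x _ => bd x))).
have qi (g : E -> R) : integ setT g -> integ setT (fun x => q * g x) by exact:integZ.
have i1 := qi _ i3;have i2 := qi _ (qi _ icc);have i4 := qi _ (qi _ fci).
rewrite (intgD msrT i1 (integD msrT i2 i4)) (intgD msrT i2 i4).
rewrite !(intgZ _ msrT (qi _ _)) ?(intgZ _ msrT i3)//;rewrite (intgZ _ msrT icc) (intgZ _ msrT fci).
have hq1 : 1 <= q.
 by have := @ler_powR R 2 (ler1n _ 2) _ _ p0;rewrite powRr0.
have l3' := le_trans l3 fce.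
set X := intg _ _ in l3' *;set Y := intg _ _ in lcc *;set Z := intg _ _ in fce *.
have E4 : 4 * (q * q) * e1 = e by rewrite /e1 expr2;field;rewrite gt_eqF.
have : q * X <= q * (q * e1).
 rewrite ler_wpM2l ?(ltW q0)// (le_trans l3')// ler_peMl ?(ltW e10)//.
have : q * (q * Y) <= q * (q * e1) by rewrite !ler_wpM2l ?(ltW q0).
have : q * (q * Z) <= q * (q * e1) by rewrite !ler_wpM2l ?(ltW q0).
have : 0 <= q * (q * e1) by apply:mulr_ge0;[exact:ltW|apply:mulr_ge0;exact:ltW].
lra.
Qed.

End Mollifier.

(** * Local Sobolev functions as limits of C^1 functions *)

Section SobolevFunctions.
Context {R : realType} {n : nat}.
Local Notation E := 'rV[R]_n.
Local Notation L := (lebType R n).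
Implicit Types (f g phi : E -> R) (F G : E -> E) (U K : set E) (d p e : R).

Lemma in_LpE s (A : set E) f : 1 <= s -> in_Lp s A f <-> meas setT (f \_ A) /\
 integ setT (fun x => `|(f \_ A) x| `^ s).
Proof.
move=>s1;split.
 move=>h;split;last exact:(Lfun_integrable s1 h).
 by move: h => /andP[/set_mem].
move=>[mf fi];apply/andP;split;apply/mem_set => //.
rewrite /= /finite_norm unlock /Lnorm poweR_lty//=.
move: fi => /integrableP[_];congr (_ < _)%E.
by apply:eq_integral => x _ /=;rewrite ger0_norm ?powR_ge0.
Qed.

Lemma in_Lp_integ s (A : set E) f : 1 <= s -> msr A -> in_Lp s A f ->
 meas A f /\ integ A (fun x => `|f x| `^ s).
Proof.
move=>s1 mA /(in_LpE _ _ s1)[mf fi];split;first exact/(meas_restrict _ mA).2.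
apply/(integ_mk _ mA).2;apply:eq_integ fi => // x _.
by rewrite !patchE;case:ifP => // _;rewrite normr0 powR0//;lra.
Qed.

Lemma gradE f x i : grad f x ord0 i = 'D_(evec i) f x.
Proof. by rewrite mxE. Qed.

Lemma meas_dot K F G : (forall i, meas K (fun x => F x ord0 i)) -> (forall i, meas K (fun x => G x ord0 i)) ->
 meas K (fun x => dot (F x) (G x)).
Proof. by move=>mF mG;apply:meas_sum => i;exact:measM. Qed.

Lemma meas_enorm K F : (forall i, meas K (fun x => F x ord0 i)) -> meas K (fun x => enorm (F x)).
Proof. by move=>mF;apply:meas_sqrt;exact:meas_dot. Qed.

Lemma meas_grad K f i : Ck 1 f -> meas K (fun x => grad f x ord0 i).
Proof.
move=>[_ /(_ i)[_ cf]];apply:(@eq_meas _ _ _ ('D_(evec i) f));first by move=>x _;rewrite gradE.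
exact:meas_cont.
Qed.

Lemma enorm_powR_le (x : E) p : 1 < p -> enorm x `^ p <= n%:R `^ p * \sum_(i < n) `|x ord0 i| `^ p.
Proof.
move=>p1;have p0 : 0 <= p by lra.
have s0 : 0 <= \sum_(i < n) `|x ord0 i| `^ p by apply:sumr_ge0 => i _;exact:powR_ge0.
apply:(@le_trans _ _ ((n%:R * `|x|) `^ p)).
 by apply:ge0_ler_powR;rewrite ?nnegrE ?mulr_ge0 ?enorm_ge0//;exact:enorm_le_norm.
rewrite powRM// ler_wpM2l ?powR_ge0//.
set S := \sum_(i < n) _ in s0 *.
have pV : 0 < p^-1 by rewrite invr_gt0;lra.
have xS : `|x| <= S `^ p^-1.
 apply:norm_leP => [|i];first exact:powR_ge0.
 rewrite -(@powRr1 R `|x ord0 i|)// -(@mulfV _ p);last by apply:lt0r_neq0;lra.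
 rewrite powRrM ge0_ler_powR ?nnegrE ?powR_ge0// ?(ltW pV)// /S (bigD1 i)//= lerDl.
 by apply:sumr_ge0 => j _;exact:powR_ge0.
rewrite -[leRHS]powRr1// -(@mulVf _ p);last by apply:lt0r_neq0;lra.
by rewrite powRrM ge0_ler_powR ?nnegrE ?powR_ge0.
Qed.

Lemma enorm_powRD (x y : E) p : 0 <= p -> enorm (x + y) `^ p <= 2 `^ p * (enorm x `^ p + enorm y `^ p).
Proof.
move=>p0;apply:le_trans (powR_add_le (enorm_ge0 x) (enorm_ge0 y) p0).
by apply:ge0_ler_powR;rewrite ?nnegrE ?addr_ge0 ?enorm_ge0// enormD.
Qed.

Lemma integ_enorm_powR K F p : 1 < p -> msr K -> (forall i, meas K (fun x => F x ord0 i)) ->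
 (forall i, integ K (fun x => `|F x ord0 i| `^ p)) ->
 integ K (fun x => enorm (F x) `^ p) /\
 intg K (fun x => enorm (F x) `^ p) <= n%:R `^ p * \sum_(i < n) intg K (fun x => `|F x ord0 i| `^ p).
Proof.
move=>p1 mK mF iF.
have si : integ K (fun x => n%:R `^ p * \sum_(i < n) `|F x ord0 i| `^ p).
 by apply:integZ => //;apply:integ_sum.
have ei : integ K (fun x => enorm (F x) `^ p).
 apply:(integ_le mK _ _ si);first by apply:meas_powR;exact:meas_enorm.
 by move=>x _;rewrite ger0_norm ?powR_ge0//;exact:enorm_powR_le.
split => //;rewrite -intg_sum// -intgZ//;last exact:integ_sum.
by apply:intg_le => // x _;exact:enorm_powR_le.
Qed.

(** The difference quotients have integral 0 by translation invariance, and they approximate the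
    derivative uniformly and inside a fixed cube. *)
Lemma intg_derive0 f i : Ck 1 f -> bd_supp f -> intg setT ('D_(evec i) f) = 0.
Proof.
move=>Cf [r hr];have [cf /(_ i)[df cdf]] := Cf.
have r0 : exists r0, 0 < r0 /\ forall x, r0 < `|x| -> f x = 0.
 exists (`|r| + 1);split;first by rewrite ltr_wpDl.
 by move=>x hx;apply:hr;have := ler_norm r;lra.
have {r hr r0} [r [r0 hr]] := r0.
have dsupp := derive_supp i hr.
have fi : integ setT f by apply:integ_cs => //;exists r.
have di : integ setT ('D_(evec i) f) by apply:integ_cs => //;exists r.
pose B : set E := [set x | `|x| <= r + 1].
have cB : compact B by exact:clnorm_le.
have mB : msr B by exact:msr_cpt.
apply/eqP;rewrite -normr_le0;apply/ler_addgt0Pl => e e0;rewrite addr0.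
have v0 : 0 < vol B + 1 by rewrite ltr_wpDl ?vol_ge0.
have e'0 : 0 < e / (vol B + 1) by rewrite divr_gt0.
have [d d0 hd] := unif_cont_supp cdf (ex_intro _ r dsupp) e'0.
pose h := Num.min d 1;have h0 : 0 < h by rewrite lt_min d0 ltr01.
have hd' : h <= d by rewrite ge_min lexx.
have h1 : h <= 1 by rewrite ge_min lexx orbT.
have [ti te] := @intg_affine R n 1 (h *: evec i) f (oner_neq0 _) fi.
have aE x : affine 1 (h *: evec i) x = x + h *: evec i by rewrite /affine scale1r.
have {}ti : integ setT (fun x => f (x + h *: evec i)).
 by apply:eq_integ ti => // x _;rewrite aE.
have {}te : intg setT (fun x => f (x + h *: evec i)) = intg setT f.
 by rewrite -(eq_intg (fun x _ => congr1 f (aE x))) te normr1 expr1n invr1 mul1r.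
pose q x := h^-1 * (f (x + h *: evec i) - f x).
have qi : integ setT q by apply:integZ => //;exact:integB.
have q0 : intg setT q = 0 by rewrite intgZ ?intgB// ?te ?subrr ?mulr0//;exact:integB.
have nev : `|evec i : E| <= 1.
 by apply:norm_leP => // j;rewrite mxE;case:(_ && _);rewrite /= ?normr1 ?normr0.
have bd x : `|q x - 'D_(evec i) f x| <= ((fun=> e / (vol B + 1)) \_ B) x.
 rewrite patchE;case:ifPn => [_|/negP xB].
  have dl (s : R) : is_derive s (1 : R) (fun s : R => f (x + s *: evec i)) ('D_(evec i) f (x + s *: evec i)).
   exact:is_derive_line.
  have [|s] := MVT_segment (ltW h0) (fun (s : R) _ => dl s).
   apply:continuous_subspaceT => s;apply:continuous_comp;last exact:cf.
   by apply:(@continuousD _ _ _ (cst x) (fun s : R => s *: evec i));[exact:cst_continuous|exact:scalel_continuous].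
  rewrite in_itv/= => /andP[s0 sh];rewrite scale0r addr0 subr0 => fE.
  rewrite /q fE mulrCA mulVf ?gt_eqF// mulr1.
  apply:hd;rewrite addrC addKr normrZ ger0_norm// (le_trans _ hd')// (le_trans _ sh)//.
  by rewrite ler_piMr.
 have {}xB : r + 1 < `|x| by rewrite ltNge;apply/negP => h';apply:xB;exact/mem_set.
 rewrite dsupp;last lra.
 rewrite /q (hr x);last lra.
 rewrite hr ?subrr ?mulr0 ?subrr ?normr0//.
 have hn : `|h *: evec i : E| <= 1 by rewrite normrZ (ger0_norm (ltW h0)) mulr_ile1 ?(ltW h0).
 by have := ler_normB (x + h *: evec i) (h *: evec i);rewrite addrK;lra.
have iB : integ setT ((fun=> e / (vol B + 1)) \_ B).
 by apply:(integ_mk _ mB).1;exact:integ_cst (lamK_lty cB).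
have := intgB msrT qi di;rewrite q0 sub0r => /(congr1 (fun t => `|t|));rewrite normrN => <-.
apply:(le_trans (le_norm_intg msrT (integB msrT qi di))).
apply:(le_trans (intg_le msrT (integ_abs msrT (integB msrT qi di)) iB (fun x _ => bd x))).
rewrite -intg_mk intg_cst// mulrAC ler_pdivrMr//.
by rewrite ler_wpM2l ?(ltW e0)// lerDl.
Qed.

(* Functions that are limits of C^1 functions, locally uniformly and with
 gradients converging in L^p_loc to the vector field in the last argument. *)
Definition Wfn p U f G : Prop :=
 [/\ forall x, U x -> {for x, continuous f},
   forall K, compact K -> K `<=` U -> forall i, meas K (fun x => G x ord0 i),
   forall K, compact K -> K `<=` U -> integ K (fun x => enorm (G x) `^ p) &
   forall K e, compact K -> K `<=` U -> 0 < e -> exists phi, [/\ Ck 1 phi,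
    forall x, K x -> `|phi x - f x| <= e,
    integ K (fun x => enorm (grad phi x - G x) `^ p) &
    intg K (fun x => enorm (grad phi x - G x) `^ p) <= e]].

Lemma Wfn_C1 p U phi : 1 < p -> Ck 1 phi -> Wfn p U phi (grad phi).
Proof.
move=>p1 Cphi;have [cphi _] := Cphi.
have z x : enorm (grad phi x - grad phi x) `^ p = 0 by rewrite subrr enorm0 powR0//;lra.
split;first by move=>x _;exact:cphi.
- by move=>K _ _ i;exact:meas_grad.
- move=>K cK _;have mK := msr_cpt cK.
 have [||h _] := @integ_enorm_powR K (grad phi) p p1 mK;last exact:h.
  by move=>i;exact:meas_grad.
 move=>i;have [_ /(_ i)[_ ci]] := Cphi.
 have [M M0 hM] := cont_maxK cK (fun x _ => ci x).
 apply:(@integ_bdd _ _ _ _ (M `^ p)) => //;first exact:lamK_lty.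
 - by apply:meas_powR;apply:meas_norm;exact:meas_grad.
 - move=>x /hM h;rewrite ger0_norm ?powR_ge0// gradE.
  by apply:ge0_ler_powR;rewrite ?nnegrE ?(ltW M0)//;lra.
- move=>K e cK _ e0;have mK := msr_cpt cK;exists phi;split => //.
 + by move=>x _;rewrite subrr normr0 ltW.
 + by apply:eq_integ (integ0 mK) => // x _;rewrite z.
 + by rewrite (eq_intg (fun x _ => z x)) intg0 ltW.
Qed.

Lemma Wfn_sub p U U' f G : U' `<=` U -> Wfn p U f G -> Wfn p U' f G.
Proof.
move=>UU [h1 h2 h3 h4];split.
- by move=>x /UU;exact:h1.
- by move=>K cK KU;apply:h2 => //;exact:subset_trans UU.
- by move=>K cK KU;apply:h3 => //;exact:subset_trans UU.
- by move=>K e cK KU e0;apply:h4 => //;exact:subset_trans UU.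
Qed.

Lemma Wfn_eq p U f G f' G' : open U -> (forall x, U x -> f x = f' x) -> (forall x, U x -> G x = G' x) ->
 Wfn p U f G -> Wfn p U f' G'.
Proof.
move=>oU ff GG [h1 h2 h3 h4];split.
- move=>x Ux;apply/cont_rVP => e e0.
 have /cont_rVP/(_ e e0)[d d0 hd] := h1 x Ux.
 have /nbhs_ballP[r /= r0 rU] := open_nbhs_nbhs (conj oU Ux).
 exists (Num.min d r) => [|y];first by rewrite lt_min d0.
 rewrite lt_min => /andP[xyd xyr];rewrite -!ff//;first exact:hd.
 by apply:rU;rewrite -ball_normE.
- by move=>K cK KU i;apply:eq_meas (h2 K cK KU i) => x /KU /GG ->.
- by move=>K cK KU;apply:eq_integ (h3 K cK KU) => [|x /KU /GG ->//];exact:msr_cpt.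
- move=>K e cK KU e0;have [phi [p1 p2 p3 p4]] := h4 K e cK KU e0;exists phi;split;first exact:p1.
 + by move=>x Kx;rewrite -ff;[exact:p2|exact:KU].
 + by apply:eq_integ p3 => [|x /KU /GG ->//];exact:msr_cpt.
 + by apply:le_trans p4;rewrite le_eqVlt;apply/orP;left;apply/eqP/eq_intg => x /KU /GG ->.
Qed.

Lemma Wfn_bounded p U f G K : Wfn p U f G -> compact K -> K `<=` U ->
 exists2 M, 0 < M & forall x, K x -> `|f x| <= M.
Proof.
move=>[cf _ _ _] cK KU;apply:cont_maxK => // x /set_mem /KU;exact:cf.
Qed.

Lemma unif_cont_itv (h : R -> R) (M e : R) : continuous h -> 0 < e ->
 exists2 d : R, 0 < d & forall s t, `|s| <= M -> `|s - t| <= d -> `|h s - h t| <= e.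
Proof.
move=>ch e0.
have cf : continuous (fun x : 'rV[R]_1 => h (x ord0 ord0)).
 by apply:cont_comp ch;exact:coord_continuous.
have [d d0 hd] := cpt_ucont (@clnorm_le R 1 M) (fun x _ => cf x) e0.
exists d => // s t sM st;have := hd (const_mx s) (const_mx t);rewrite !mxE;apply.
 by apply:norm_leP => [|i];[exact:le_trans sM|rewrite mxE].
by apply:norm_leP => [|i];[exact:le_trans st|rewrite !mxE].
Qed.

Lemma cont_itv_bounded (h : R -> R) (M : R) : continuous h ->
 exists2 B : R, 0 < B & forall t, `|t| <= M -> `|h t| <= B.
Proof.
move=>ch.
have cf : continuous (fun x : 'rV[R]_1 => h (x ord0 ord0)).
 by apply:cont_comp ch;exact:coord_continuous.
have [B B0 hB] := cont_maxK (@clnorm_le R 1 M) (fun x _ => cf x).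
exists B => // t tM;have := hB (const_mx t);rewrite mxE;apply.
by apply:norm_leP => [|i];[exact:le_trans tM|rewrite mxE].
Qed.

Lemma meas_cont_pts K U f : open U -> K `<=` U -> (forall x, U x -> {for x, continuous f}) -> meas K f.
Proof.
move=>oU KU cf;apply:(@meas_sub _ _ U) => //;first exact:msr_open.
by apply:meas_open_cont => // x /set_mem;exact:cf.
Qed.

Lemma powR_pos_root (a b p : R) : 1 < p -> 0 < a -> 0 <= b -> exists2 w : R, 0 < w & w `^ p * b <= a.
Proof.
move=>p1 a0 b0;have q0 : 0 < a / (b + 1) by rewrite divr_gt0// ltr_wpDl.
exists ((a / (b + 1)) `^ p^-1);first exact:powR_gt0.
rewrite -powRrM mulVf;last by apply:lt0r_neq0;lra.
rewrite powRr1 ?(ltW q0)// mulrAC ler_pdivrMr ?ltr_wpDl// ler_wpM2l ?(ltW a0)//;lra.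
Qed.

(** On each compact set [h] need only agree with some C^1 function along the values of [f]. This
    admits the logarithm, which is not C^1 on the whole line. *)
Lemma Wfn_comp p U f G (h dh : R -> R) : 1 < p -> open U -> Wfn p U f G ->
 (forall K, compact K -> K `<=` U -> exists Psi : R -> R, [/\ forall t, derivable Psi t 1,
  continuous (derive1 Psi) & forall x, K x -> h (f x) = Psi (f x) /\ dh (f x) = derive1 Psi (f x)]) ->
 Wfn p U (fun x => h (f x)) (fun x => dh (f x) *: G x).
Proof.
move=>p1 oU W hPsi;have [h1 h2 h3 h4] := W;have p0 : 0 <= p by lra.
have cPsi (Psi : R -> R) : (forall t, derivable Psi t 1) -> continuous Psi.
 by move=>dP t;exact/differentiable_continuous/derivable1_diffP.
split.
- move=>x Ux;have /nbhs_ballP[r /= r0 rU] := open_nbhs_nbhs (conj oU Ux).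
 pose K : set E := [set y | `|y - x| <= r / 2].
 have cK : compact K.
  apply:(@clbd_cpt _ _ _ (`|x| + r / 2)).
   apply:(@closed_comp _ _ (fun y : E => `|y - x|) [set s | s <= r / 2]);last exact:closed_le.
   by move=>y _;apply:continuous_comp;[apply:continuousB => //;exact:cst_continuous|exact:norm_continuous].
  by move=>y;rewrite /K /= => yx;have := ler_normD x (y - x);rewrite [x + _]addrC subrK;lra.
 have KU : K `<=` U by move=>y yx;apply:rU;rewrite -ball_normE /= distrC;apply:le_lt_trans yx _;lra.
 have [Psi [dP _ hP]] := hPsi K cK KU.
 have : {for x, continuous (fun y => Psi (f y))}.
  by apply:continuous_comp;[exact:h1|exact:cPsi].
 move=>/cont_rVP c;apply/cont_rVP => e e0;have [d d0 hd] := c e e0.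
 exists (Num.min d (r / 2)) => [|y];first by rewrite lt_min d0;lra.
 rewrite lt_min => /andP[xyd xyr];rewrite (hP x _).1 ?(hP y _).1;first exact:hd.
  by rewrite /K /= distrC ltW.
 by rewrite /K /= subrr normr0;lra.
- move=>K cK KU i;have [Psi [dP cdP hP]] := hPsi K cK KU.
 apply:(@eq_meas _ _ _ (fun x => derive1 Psi (f x) * G x ord0 i)).
  by move=>x /hP[_ ->];rewrite mxE.
 by apply:measM;[apply:meas_comp_cont => //;exact:meas_cont_pts h1|exact:h2].
- move=>K cK KU;have mK := msr_cpt cK;have [Psi [dP cdP hP]] := hPsi K cK KU.
 have [M M0 hM] := Wfn_bounded W cK KU.
 have [B B0 hB] := cont_itv_bounded M cdP.
 have mf : meas K f by exact:meas_cont_pts h1.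
 have bi := integZ (B `^ p) mK (h3 K cK KU).
 apply:(integ_le mK _ _ bi).
  apply:meas_powR;apply:meas_enorm => i.
  apply:(@eq_meas _ _ _ (fun x => derive1 Psi (f x) * G x ord0 i)).
   by move=>x /hP[_ ->];rewrite mxE.
  by apply:measM;[exact:meas_comp_cont|exact:h2].
 move=>x Kx;rewrite ger0_norm ?powR_ge0// enormZ powRM ?enorm_ge0// ler_wpM2r ?powR_ge0//.
 by apply:ge0_ler_powR;rewrite ?nnegrE ?(ltW B0)// (hP x Kx).2;apply:hB;exact:hM.
move=>K e cK KU e0;have mK := msr_cpt cK;have [Psi [dP cdP hP]] := hPsi K cK KU.
have [M M0 hM] := Wfn_bounded W cK KU.
have [B B0 hB] := cont_itv_bounded (M + 1) cdP.
have mf : meas K f by exact:meas_cont_pts h1.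
have Gi := h3 K cK KU;set I := intg K (fun x => enorm (G x) `^ p).
have I0 : 0 <= I by apply:intg_ge0 => x _;exact:powR_ge0.
have q0 : 0 < 2 `^ p :> R by exact:powR_gt0.
(* [w] will bound the change of the derivative of [Psi] between [f] and [phi]; it is so small that
   its share of the error is [e / 2]. The other half is left to the gradients. *)
have [w w0 hw] := powR_pos_root p1 (divr_gt0 e0 (mulr_gt0 (ltr0n _ 2) q0)) I0.
have [d1 d10 hd1] := unif_cont_itv M (cPsi _ dP) e0.
have [d2 d20 hd2] := unif_cont_itv M cdP w0.
pose e' := Num.min (Num.min d1 d2) (Num.min 1 (e / (2 * 2 `^ p * B `^ p))).
have Bp : 0 < B `^ p by exact:powR_gt0.
have e'0 : 0 < e' by rewrite !lt_min d10 d20 ltr01 divr_gt0// !mulr_gt0.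
have [phi [C1phi phif ip lp]] := h4 K e' cK KU e'0.
have e'1 : e' <= d1 by rewrite !ge_min lexx.
have e'2 : e' <= d2 by rewrite !ge_min lexx orbT.
have e'3 : e' <= 1 by rewrite !ge_min lexx !orbT.
have e'4 : e' <= e / (2 * 2 `^ p * B `^ p) by rewrite !ge_min lexx !orbT.
have C1P : Ck 1 (Psi \o phi) by exact:C1_comp.
exists (Psi \o phi).
have gE x : grad (Psi \o phi) x = derive1 Psi (phi x) *: grad phi x.
 apply/rowP => i;rewrite gradE mxE gradE.
 by have [_ ->] := is_derive_comp_real ((C1phi.2 i).1 x) (dP (phi x)).
have bd x : K x -> enorm (grad (Psi \o phi) x - dh (f x) *: G x) `^ p <=
  2 `^ p * B `^ p * enorm (grad phi x - G x) `^ p + 2 `^ p * w `^ p * enorm (G x) `^ p.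
 move=>Kx;rewrite gE (hP x Kx).2.
 rewrite (_ : _ - _ = derive1 Psi (phi x) *: (grad phi x - G x) + (derive1 Psi (phi x) - derive1 Psi (f x)) *: G x);last first.
  by rewrite scalerBr scalerBl addrA subrK.
 apply:(le_trans (enorm_powRD _ _ p0));rewrite -!mulrA -mulrDr ler_wpM2l ?(ltW q0)//.
 rewrite !enormZ !powRM ?enorm_ge0//.
 have px := phif x Kx;have fx := hM x Kx.
 apply:lerD;rewrite ler_wpM2r ?powR_ge0//;apply:ge0_ler_powR;rewrite ?nnegrE ?(ltW B0) ?(ltW w0)//.
  apply:hB;have := ler_normD (f x) (phi x - f x);rewrite addrC subrK;lra.
 by rewrite distrC;apply:hd2 => //;rewrite distrC;lra.
have isum := integD mK (integZ (2 `^ p * B `^ p) mK ip) (integZ (2 `^ p * w `^ p) mK Gi).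
have ii : integ K (fun x => enorm (grad (Psi \o phi) x - dh (f x) *: G x) `^ p).
 apply:(integ_le mK _ _ isum);last by move=>x Kx;rewrite ger0_norm ?powR_ge0//;exact:bd.
 apply:meas_powR;apply:meas_enorm => i.
 apply:(@eq_meas _ _ _ (fun x => grad (Psi \o phi) x ord0 i - derive1 Psi (f x) * G x ord0 i)).
  by move=>x /hP[_ ->];rewrite !mxE.
 by apply:measB;[exact:meas_grad|apply:measM;[exact:meas_comp_cont|exact:h2]].
split => //.
 move=>x Kx;rewrite (hP x Kx).1 distrC;apply:hd1;first exact:hM.
 by rewrite distrC;apply:le_trans e'1;exact:phif.
apply:(le_trans (intg_le mK ii isum bd)).
rewrite intgD//;[|exact:integZ..];rewrite !intgZ//.
have t1 : 2 `^ p * B `^ p * intg K (fun x => enorm (grad phi x - G x) `^ p) <= e / 2.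
 rewrite (le_trans (ler_wpM2l _ (le_trans lp e'4)))// ?mulr_ge0 ?(ltW q0) ?(ltW Bp)//.
 by rewrite le_eqVlt;apply/orP;left;apply/eqP;field;rewrite !gt_eqF.
have t2 : 2 `^ p * w `^ p * I <= e / 2.
 rewrite -mulrA (le_trans (ler_wpM2l (ltW q0) hw))//.
 by rewrite le_eqVlt;apply/orP;left;apply/eqP;field;rewrite gt_eqF.
by rewrite -/I;lra.
Qed.

Lemma half_small (e c t : R) : 0 < e -> 0 < t -> 0 <= c -> c <= t -> c * (e / (2 * t)) <= e / 2.
Proof.
move=>e0 t0 c0 ct;rewrite (_ : c * _ = e / 2 * (c / t));last by rewrite invfM;ring.
by apply:ler_piMr;[lra|rewrite ler_pdivrMr// mul1r].
Qed.

Lemma Wfn_lin p U f F g G (a b : R) : 1 < p -> open U -> Wfn p U f F -> Wfn p U g G ->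
 Wfn p U (fun x => a * f x + b * g x) (fun x => a *: F x + b *: G x).
Proof.
move=>p1 oU [f1 f2 f3 f4] [g1 g2 g3 g4];have p0 : 0 <= p by lra.
have q0 : 0 < 2 `^ p :> R by exact:powR_gt0.
have key (X Y : E -> E) K : msr K -> (forall i, meas K (fun x => X x ord0 i)) -> (forall i, meas K (fun x => Y x ord0 i)) ->
  integ K (fun x => enorm (X x) `^ p) -> integ K (fun x => enorm (Y x) `^ p) ->
  integ K (fun x => enorm (a *: X x + b *: Y x) `^ p) /\
  intg K (fun x => enorm (a *: X x + b *: Y x) `^ p) <=
   2 `^ p * `|a| `^ p * intg K (fun x => enorm (X x) `^ p) + 2 `^ p * `|b| `^ p * intg K (fun x => enorm (Y x) `^ p).
 move=>mK mX mY iX iY.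
 have bd x : K x -> enorm (a *: X x + b *: Y x) `^ p <= 2 `^ p * `|a| `^ p * enorm (X x) `^ p + 2 `^ p * `|b| `^ p * enorm (Y x) `^ p.
  move=>_;apply:(le_trans (enorm_powRD _ _ p0)).
  by rewrite !enormZ !powRM ?enorm_ge0// mulrDr !mulrA.
 have jX := integZ (2 `^ p * `|a| `^ p) mK iX;have jY := integZ (2 `^ p * `|b| `^ p) mK iY.
 have isum := integD mK jX jY.
 have ii : integ K (fun x => enorm (a *: X x + b *: Y x) `^ p).
  apply:(integ_le mK _ _ isum);last by move=>x Kx;rewrite ger0_norm ?powR_ge0//;exact:bd.
  apply:meas_powR;apply:meas_enorm => i.
  apply:(@eq_meas _ _ _ (fun x => a * X x ord0 i + b * Y x ord0 i));first by move=>x _;rewrite !mxE.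
  by apply:measD;apply:measM => //;exact:meas_cst.
 split => //;apply:(le_trans (intg_le mK ii isum bd)).
 by rewrite (intgD mK jX jY) !intgZ.
split.
- move=>x Ux;apply:(cvgD (cvgM (cvg_cst _) (f1 x Ux)) (cvgM (cvg_cst _) (g1 x Ux))).
- move=>K cK KU i.
 apply:(@eq_meas _ _ _ (fun x => a * F x ord0 i + b * G x ord0 i));first by move=>x _;rewrite !mxE.
 by apply:measD;apply:measM;[exact:meas_cst|exact:f2|exact:meas_cst|exact:g2].
- move=>K cK KU;have [] := key F G K (msr_cpt cK) (f2 K cK KU) (g2 K cK KU) (f3 K cK KU) (g3 K cK KU) => //.
move=>K e cK KU e0;have mK := msr_cpt cK.
have side (c : R) : 0 < c -> 0 < e / (2 * c) by move=>c0;rewrite divr_gt0// mulr_gt0.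
pose A := 2 `^ p * `|a| `^ p + `|a| + 1;pose B := 2 `^ p * `|b| `^ p + `|b| + 1.
have A0 : 0 < A by rewrite ltr_wpDl// addr_ge0// mulr_ge0 ?powR_ge0.
have B0 : 0 < B by rewrite ltr_wpDl// addr_ge0// mulr_ge0 ?powR_ge0.
have hA1 : 2 `^ p * `|a| `^ p <= A by rewrite /A -addrA lerDl addr_ge0.
have hB1 : 2 `^ p * `|b| `^ p <= B by rewrite /B -addrA lerDl addr_ge0.
have hA2 : `|a| <= A by rewrite /A addrAC lerDr addr_ge0// mulr_ge0 ?powR_ge0.
have hB2 : `|b| <= B by rewrite /B addrAC lerDr addr_ge0// mulr_ge0 ?powR_ge0.
have [phi [Cphi pf ip lp]] := f4 K _ cK KU (side A A0).
have [psi [Cpsi qf iq lq]] := g4 K _ cK KU (side B B0).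
have Cx : Ck 1 (fun x => a * phi x + b * psi x) by apply:C1_add;exact:Ck_scale.
have gE x : grad (fun x => a * phi x + b * psi x) x = a *: grad phi x + b *: grad psi x.
 apply/rowP => i;rewrite gradE !mxE.
 have [dp ep] := derive_scaler a ((Cphi.2 i).1 x);have [dq eq] := derive_scaler b ((Cpsi.2 i).1 x).
 have [_ ->] := @is_deriveD _ _ _ (fun x => a * phi x) (fun x => b * psi x) x (evec i) _ _ (DeriveDef dp ep) (DeriveDef dq eq).
 by [].
have dE x : grad (fun x => a * phi x + b * psi x) x - (a *: F x + b *: G x) =
  a *: (grad phi x - F x) + b *: (grad psi x - G x).
 by rewrite gE !scalerBr opprD addrACA.
have [i1 l1] := key (fun x => grad phi x - F x) (fun x => grad psi x - G x) K mK
 (fun i => ltac:(by apply:(@eq_meas _ _ _ (fun x => grad phi x ord0 i - F x ord0 i)) => [x _|];[rewrite !mxE|apply:measB;[exact:meas_grad|exact:f2]]))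
 (fun i => ltac:(by apply:(@eq_meas _ _ _ (fun x => grad psi x ord0 i - G x ord0 i)) => [x _|];[rewrite !mxE|apply:measB;[exact:meas_grad|exact:g2]])) ip iq.
have dE' x : enorm (a *: (grad phi x - F x) + b *: (grad psi x - G x)) `^ p =
 enorm (grad (fun x => a * phi x + b * psi x) x - (a *: F x + b *: G x)) `^ p by rewrite dE.
exists (fun x => a * phi x + b * psi x);split;first exact:Cx.
- move=>x Kx;rewrite (_ : _ - _ = a * (phi x - f x) + b * (psi x - g x));last ring.
 apply:(le_trans (ler_normD _ _));rewrite !normrM (splitr e);apply:lerD.
  exact:(le_trans (ler_wpM2l (normr_ge0 a) (pf x Kx)) (half_small e0 A0 (normr_ge0 a) hA2)).
 exact:(le_trans (ler_wpM2l (normr_ge0 b) (qf x Kx)) (half_small e0 B0 (normr_ge0 b) hB2)).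
- exact:(eq_integ mK (fun x _ => dE' x) i1).
rewrite -(eq_intg (fun x _ => dE' x));apply:(le_trans l1);rewrite (splitr e);apply:lerD.
 have c0 : 0 <= 2 `^ p * `|a| `^ p by rewrite mulr_ge0 ?powR_ge0.
 exact:(le_trans (ler_wpM2l c0 lp) (half_small e0 A0 c0 hA1)).
have c0 : 0 <= 2 `^ p * `|b| `^ p by rewrite mulr_ge0 ?powR_ge0.
exact:(le_trans (ler_wpM2l c0 lq) (half_small e0 B0 c0 hB1)).
Qed.

End SobolevFunctions.

(** * From weak gradients to C^1 approximation, and C^1 test functions *)

Section WeakFormulation.
Context {R : realType} {n : nat}.
Local Notation E := 'rV[R]_n.
Implicit Types (f g phi w : E -> R) (G AA : E -> E) (U K : set E) (d p e : R).

Lemma finite_small (P : 'I_n -> R -> Prop) :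
 (forall i, exists2 d0, 0 < d0 & forall d, 0 < d <= d0 -> P i d) ->
 exists2 d0, 0 < d0 & forall i d, 0 < d <= d0 -> P i d.
Proof.
move=>h;have /choice[D hD] : forall i, exists d0, 0 < d0 /\ forall d, 0 < d <= d0 -> P i d.
 by move=>i;have [d0 h1 h2] := h i;exists d0.
have s0 : 0 <= \sum_(i < n) (D i)^-1 by apply:sumr_ge0 => i _;rewrite invr_ge0 ltW// (hD i).1.
exists (\sum_(i < n) (D i)^-1 + 1)^-1;first by rewrite invr_gt0 ltr_wpDl.
move=>i d /andP[d0 hd];apply:(hD i).2;rewrite d0 (le_trans hd)//.
have Di := (hD i).1;rewrite -[leRHS]invrK lef_pV2 ?posrE ?invr_gt0 ?ltr_wpDl//.
rewrite (bigD1 i)//= -addrA lerDl addr_ge0//;apply:sumr_ge0 => j _.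
by rewrite invr_ge0 ltW// (hD j).1.
Qed.

Lemma compact_nbhd K U : compact K -> open U -> K `<=` U -> exists (K' : set E) (d : R),
 [/\ 0 < d, compact K', K' `<=` U & forall x y, K x -> `|x - y| <= d -> K' y].
Proof.
move=>cK oU KU;have [d d0 hd] := compact_thicken cK oU KU.
pose B : set E := [set x | `|x| <= d];have cB : compact B by exact:clnorm_le.
exists ((fun z : E * E => z.1 + z.2) @` (K `*` B)), d;split => //.
- apply:continuous_compact;last exact:compact_setX.
 by apply:continuous_subspaceT => z;apply:cvgD;[exact:cvg_fst|exact:cvg_snd].
- by move=>_ [[x y] [/= Kx By] <-];apply:(hd x) => //;rewrite addrC addKr.
- by move=>x y Kx xy;exists (x, y - x);rewrite /= ?subrKC//;split => //=;rewrite /B /= distrC.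
Qed.

Lemma integ_Lp_L1 K f p : 1 < p -> compact K -> meas K f -> integ K (fun x => `|f x| `^ p) -> integ K f.
Proof.
move=>p1 cK mf fi;have mK := msr_cpt cK.
have i1 := integD mK (integ_cst 1 mK (lamK_lty cK)) fi.
apply:(integ_le mK mf _ i1) => x _;have [h|/ltW h] := leP `|f x| 1.
 by rewrite (le_trans h)// lerDl powR_ge0.
rewrite -[leLHS]powRr1// (le_trans (ler_powR h (ltW p1)))// lerDr//.
Qed.

Lemma test_function_reflect U rho r x : ssupp r rho -> (forall y, `|x - y| <= r -> U y) ->
 test_function U (fun y => rho (x - y)).
Proof.
move=>[sm su] rU.
have sub : [set y | rho (x - y) != 0] `<=` [set y | `|x - y| <= r].
 by move=>y /= h;rewrite leNgt;apply:contra h => /su ->.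
have cl : closed [set y : E | `|x - y| <= r].
 apply:(@closed_comp _ _ (fun y : E => `|x - y|) [set s | s <= r]);last exact:closed_le.
 by move=>y _;apply:continuous_comp;[apply:continuousB => //;exact:cst_continuous|exact:norm_continuous].
have csub : closure [set y | rho (x - y) != 0] `<=` [set y | `|x - y| <= r].
 by rewrite ((closure_id [set y | `|x - y| <= r]).1 cl);exact:closureS.
split.
- move=>k;have := Ck_affine (-1) x (sm k);congr Ck;apply/funext => y.
 by rewrite /affine /= scaleN1r addrC.
- apply:(@subclosed_compact _ _ [set y : E | `|x - y| <= r]) => //;first exact:closed_closure.
 apply:(@clbd_cpt _ _ _ (`|x| + r)) => // y /= h.
 by have := ler_normB x (x - y);rewrite opprB addrC subrK;lra.
- by move=>y /csub;exact:rU.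
Qed.

Lemma derive_reflect rho (x y : E) i : Ck 1 rho ->
 'D_(evec i) (fun y => rho (x - y)) y = - 'D_(evec i) rho (x - y).
Proof.
move=>[_ /(_ i)[dr _]].
have := @is_derive_affine R n rho (-1) x y i (dr _).
have aE : rho \o affine (-1) x = (fun y => rho (x - y)).
 by apply/funext => z;rewrite /affine /= scaleN1r addrC.
by rewrite aE /affine scaleN1r addrC => -[_ ->];rewrite mulN1r.
Qed.

(** The reflected kernel, as a function of [y], is itself a test function in [U], so the definition
    of the weak gradient applies to it; cutting off at [K'] changes nothing on its support. *)
Lemma convol_weak_derive U K K' f G rho r x i : open U -> K' `<=` U -> compact K' ->
 integ K' f -> integ K' (fun x => G x ord0 i) -> weak_grad U f G -> ssupp r rho ->
 (forall y, `|x - y| <= r -> K' y) ->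
 'D_(evec i) (convol (f \_ K') rho) x = convol ((fun x => G x ord0 i) \_ K') rho x.
Proof.
move=>oU KU cK' fi Gi wg sr hK';have mK := msr_cpt cK'.
have fi' := (integ_mk f mK).1 fi.
have [_ ->] := conv_derive i x fi' sr.
have tf : test_function U (fun y => rho (x - y)) by apply:test_function_reflect sr _ => y /hK' /KU.
have := wg _ i tf.
have su := sr.2;have dsu := derive_supp i su.
pose I (h : E -> R) := intg U h.
have out y (h : E -> R) : ((h \_ K') y = h y) \/ r < `|x - y|.
 have [yK|/negP yK] := boolP (y \in K');first by left;rewrite patchE yK.
 by right;rewrite ltNge;apply/negP => /hK' h';apply:yK;exact/mem_set.
have e1 : intg U (fun y => f y * 'D_(evec i) (fun y => rho (x - y)) y) = - convol (f \_ K') ('D_(evec i) rho) x.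
 rewrite intg_mk -[RHS]mulN1r -intgZ//;last exact:(conv_integrable x fi' (ssupp_derive i sr)).
 apply:eq_intg => y _;rewrite patchE;case:ifPn => [_|yU].
  rewrite derive_reflect;last exact:(sr.1 1%N).
  have [->|h] := out y f;first by ring.
  by rewrite dsu//;ring.
 rewrite [LHS](_ : _ = 0)//;have [h|h] := out y f;last by rewrite dsu//;ring.
 rewrite patchE ifF ?mul0r ?mulr0//;apply/negbTE;apply:contra yU => /set_mem/KU;exact:mem_set.
have e2 : intg U (fun y => G y ord0 i * rho (x - y)) = convol ((fun x => G x ord0 i) \_ K') rho x.
 rewrite intg_mk;apply:eq_intg => y _;rewrite patchE;case:ifPn => [_|yU].
  have [->//|h] := out y (fun x => G x ord0 i).
  by rewrite su//;ring.
 rewrite [LHS](_ : _ = 0)//;have [h|h] := out y (fun x => G x ord0 i);last by rewrite su//;ring.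
 rewrite patchE ifF ?mul0r ?mulr0//;apply/negbTE;apply:contra yU => /set_mem/KU;exact:mem_set.
move=>h;have {h} : intg U (fun y => f y * 'D_(evec i) (fun y => rho (x - y)) y) = - intg U (fun y => G y ord0 i * rho (x - y)) by [].
by rewrite e1 e2 => /oppr_inj.
Qed.

(** The approximations are mollifications of [f] cut off at a compact neighbourhood [K'] of [K].
    They are uniformly close on [K] by continuity, and their gradients are close in L^p because
    differentiation commutes with mollification there. *)
Lemma W1p_Wfn p U f G : 1 < p -> open U -> (forall x, U x -> {for x, continuous f}) ->
 W1p_loc p U f G -> Wfn p U f G.
Proof.
move=>p1 oU cf [_ LG wg];have p0 : 0 <= p by lra.
have LG' K i : compact K -> K `<=` U -> meas K (fun x => G x ord0 i) /\ integ K (fun x => `|G x ord0 i| `^ p).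
 by move=>cK KU;apply:in_Lp_integ;[exact:ltW|exact:msr_cpt|exact:LG].
split => //.
- by move=>K cK KU i;have [] := LG' K i cK KU.
- move=>K cK KU;have mK := msr_cpt cK.
 have [||h _] := @integ_enorm_powR R n K G p p1 mK;last exact:h.
  by move=>i;have [] := LG' K i cK KU.
 by move=>i;have [] := LG' K i cK KU.
move=>K e cK KU e0;have mK := msr_cpt cK.
have [K' [d1 [d10 cK' K'U hK']]] := compact_nbhd cK oU KU.
have mK' := msr_cpt cK'.
have mfK' : meas K' f by exact:meas_cont_pts cf.
have fi : integ K' f.
 have [M M0 hM] := cont_maxK cK' (fun x Kx => cf x (K'U x (set_mem Kx))).
 by apply:(@integ_bdd _ _ _ _ M) => //;exact:lamK_lty.
have Gi i : integ K' (fun x => G x ord0 i).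
 by have [h1 h2] := LG' K' i cK' K'U;exact:integ_Lp_L1 h2.
have KK' : K `<=` K' by move=>x Kx;apply:hK' Kx _;rewrite subrr normr0 ltW.
pose e1 := e / (n%:R `^ p * n%:R + 1).
have c0 : 0 <= n%:R `^ p * n%:R :> R by rewrite mulr_ge0 ?powR_ge0.
have e10 : 0 < e1 by rewrite divr_gt0// ltr_wpDl.
have [d2 d20 hd2] : exists2 d0, 0 < d0 & forall i d, 0 < d <= d0 ->
 let g := (fun x => G x ord0 i) \_ K' in
 integ setT (fun x => `|convol g (moll d) x - g x| `^ p) /\
 intg setT (fun x => `|convol g (moll d) x - g x| `^ p) <= e1.
 apply:finite_small => i;have [h1 h2] := LG' K' i cK' K'U.
 apply:conv_moll_Lp => //;first exact:(integ_mk _ mK').1.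
 apply:eq_integ ((integ_mk _ mK').1 h2) => // x _.
 by rewrite !patchE;case:ifP => // _;rewrite normr0 powR0//;apply:lt0r_neq0;lra.
have [d3 d30 hd3] := cpt_ucont cK (fun x Kx => cf x (KU x Kx)) e0.
pose d : R := Num.min d1 (Num.min d2 d3).
have d0 : 0 < d by rewrite !lt_min d10 d20 d30.
have dd1 : d <= d1 by rewrite !ge_min lexx.
have dd2 : d <= d2 by rewrite !ge_min lexx orbT.
have dd3 : d <= d3 by rewrite !ge_min lexx !orbT.
have sm := @moll_smooth R n d d0.
have fi' := (integ_mk f mK').1 fi.
have C1c := Ck_conv 1%N fi' sm.
exists (convol (f \_ K') (moll d)).
have inK' x y : K x -> `|x - y| <= d -> K' y by move=>Kx xy;apply:(hK' x) => //;exact:le_trans dd1.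
have gE x i : K x -> (grad (convol (f \_ K') (moll d)) x - G x) ord0 i =
 convol ((fun x => G x ord0 i) \_ K') (moll d) x - ((fun x => G x ord0 i) \_ K') x.
 move=>Kx;rewrite mxE gradE (@convol_weak_derive U K K' f G (moll d) d x i oU K'U cK' fi (Gi i) wg sm (fun y => inK' x y Kx)).
 by rewrite !mxE patchE ifT//;apply/mem_set/KK'.
have hi i : let g := (fun x => G x ord0 i) \_ K' in
  integ K (fun x => `|convol g (moll d) x - g x| `^ p) /\
  intg K (fun x => `|convol g (moll d) x - g x| `^ p) <= e1.
 have dd : 0 < d <= d2 by rewrite d0 dd2.
 have [h1 h2] := hd2 i d dd;split;first exact:(integ_sub msrT mK (@subsetT _ _) h1).
 by apply:le_trans h2;apply:intg_subset => // x _;exact:powR_ge0.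
have [||i1 l1] := @integ_enorm_powR R n K (fun x => grad (convol (f \_ K') (moll d)) x - G x) p p1 mK.
- move=>i;apply:(@eq_meas _ _ _ (fun x => grad (convol (f \_ K') (moll d)) x ord0 i - G x ord0 i)).
  by move=>x _;rewrite !mxE.
 by apply:measB;[exact:meas_grad|have [] := LG' K i cK KU].
- move=>i;have [h1 _] := hi i;apply:(eq_integ mK _ h1) => x Kx;by rewrite gE.
split;first exact:C1c.
- move=>x Kx;have fx : (f \_ K') x = f x by rewrite patchE ifT//;apply/mem_set/KK'.
 rewrite -fx;apply:conv_moll_close => // y xy;have K'y := inK' x y Kx xy.
 rewrite fx patchE ifT;last exact:mem_set.
 by rewrite distrC;apply:hd3 => //;exact:le_trans dd3.
- exact:i1.
apply:(le_trans l1);apply:(@le_trans _ _ (n%:R `^ p * (n%:R * e1))).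
 rewrite ler_wpM2l ?powR_ge0// mulr_natl -[n in _ *+ n]card_ord -sumr_const.
 apply:ler_sum => i _;have [_ h2] := hi i;apply:le_trans h2.
 by rewrite le_eqVlt;apply/orP;left;apply/eqP/eq_intg => x Kx;rewrite gE.
rewrite mulrA /e1 mulrCA ler_piMr ?(ltW e0)// ler_pdivrMr ?ltr_wpDl// mul1r lerDl//.
Qed.

Lemma convol_derive_C1 phi rho r x i : Ck 1 phi -> bd_supp phi -> ssupp r rho ->
 'D_(evec i) (convol phi rho) x = convol ('D_(evec i) phi) rho x.
Proof.
move=>Cphi bphi sr;have [s hs] := bphi.
have cphi := Ck_cont Cphi;have phii := integ_cs cphi bphi.
have [_ ->] := conv_derive i x phii sr.
have [_ /(_ i)[dphi cdphi]] := Cphi.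
have dphii : integ setT ('D_(evec i) phi).
 by apply:integ_cs => //;exists s;exact:derive_supp.
have Cr : Ck 1 (fun y => rho (x - y)).
 have := Ck_affine (-1) x (sr.1 1%N);congr Ck;apply/funext => y.
 by rewrite /affine /= scaleN1r addrC.
have C1p := C1_mul Cphi Cr.
have bp : bd_supp (fun y => phi y * rho (x - y)) by exists s => y /hs ->;rewrite mul0r.
have := intg_derive0 i C1p bp.
have i1 := conv_integrable x dphii sr.
have i2 := conv_integrable x phii (ssupp_derive i sr).
have -> : intg setT ('D_(evec i) (fun y => phi y * rho (x - y))) =
  intg setT (fun y => 'D_(evec i) phi y * rho (x - y) - phi y * 'D_(evec i) rho (x - y)).
 apply:eq_intg => y _;have [_ ->] := is_deriveM_rV (dphi y) ((Cr.2 i).1 y).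
 by rewrite derive_reflect;[ring|exact:(sr.1 1%N)].
by rewrite (intgB msrT i1 i2) => /eqP;rewrite subr_eq0 => /eqP h;exact:(esym h).
Qed.

Lemma le_all_small (a b : R) : 0 <= b -> (forall e : R, 0 < e -> a <= e * b) -> a <= 0.
Proof.
move=>b0 h;apply/ler_addgt0Pl => e e0;rewrite addr0.
have b1 : 0 < b + 1 by rewrite ltr_wpDl.
have := h _ (divr_gt0 e0 b1);move/le_trans;apply.
by rewrite mulrAC ler_pdivrMr// ler_wpM2l ?(ltW e0)// lerDl.
Qed.

(* A weak equation [- div AA + w = 0] tested with smooth functions extends to
 C^1 test functions. *)
Lemma weak_C1_test U AA w : open U ->
 (forall K, compact K -> K `<=` U -> forall i, integ K (fun x => AA x ord0 i)) ->
 (forall K, compact K -> K `<=` U -> integ K w) ->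
 (forall phi, test_function U phi ->
  intg U (fun x => dot (AA x) (grad phi x)) + intg U (fun x => w x * phi x) = 0) ->
 forall phi K, Ck 1 phi -> compact K -> K `<=` U -> (forall x, ~ K x -> phi x = 0) ->
 intg K (fun x => dot (AA x) (grad phi x)) + intg K (fun x => w x * phi x) = 0.
Proof.
move=>oU iA iw wk phi K Cphi cK KU phi0.
have [K' [d1 [d10 cK' K'U hK']]] := compact_nbhd cK oU KU.
have mK := msr_cpt cK;have mK' := msr_cpt cK'.
have KK' : K `<=` K' by move=>x Kx;apply:hK' Kx _;rewrite subrr normr0 ltW.
have cphi := Ck_cont Cphi.
have [s s0 hs] := cpt_bd_norm cK.
have bphi0 x : s < `|x| -> phi x = 0.
 by move=>sx;apply:phi0 => /hs;rewrite leNgt sx.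
have bphi : bd_supp phi by exists s.
have phii := integ_cs cphi bphi.
have dphi0 x i : ~ K x -> 'D_(evec i) phi x = 0.
 move=>Kx;rewrite -(derive_cst (0 : R) x (evec i));apply:near_eq_derive.
 have oK : open (~` K) by apply:closed_openC;exact:compact_closed.
 by apply:filterS (open_nbhs_nbhs (conj oK Kx)) => y;exact:phi0.
have cut (g h : E -> R) : (forall x, ~ K x -> h x = 0) -> intg K (fun x => g x * h x) = intg K' (fun x => g x * h x).
 move=>h0;rewrite intg_mk [RHS]intg_mk;apply:eq_intg => x _.
 rewrite !patchE;case:ifPn => xK;case:ifPn => xK' //.
  by exfalso;move/negP: xK';apply;apply/mem_set/KK'/set_mem.
 by rewrite h0 ?mulr0// => /mem_set h';rewrite h' in xK.
pose D := fun x => dot (AA x) (grad phi x).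
have e1 : intg K D = intg K' D.
 rewrite intg_mk [RHS]intg_mk;apply:eq_intg => x _.
 rewrite !patchE;case:ifPn => xK;case:ifPn => xK' //.
  by exfalso;move/negP: xK';apply;apply/mem_set/KK'/set_mem.
 rewrite /D /dot big1// => i _;rewrite gradE dphi0 ?mulr0// => /mem_set h;by rewrite h in xK.
rewrite -/D e1 cut//;apply/eqP;rewrite -normr_le0.
pose S := fun x => \sum_(i < n) `|AA x ord0 i|.
have iS : integ K' S by apply:integ_sum => // i;apply:integ_abs => //;exact:iA.
pose B := intg K' S + intg K' (fun x => `|w x|).
have B0 : 0 <= B by rewrite addr_ge0//;apply:intg_ge0 => x _ //;exact:sumr_ge0.
apply:(le_all_small B0) => e e0.
have [da da0 ha] := unif_cont_supp cphi bphi e0.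
have [db db0 hb] : exists2 d0, 0 < d0 & forall (i : 'I_n) d, 0 < d <= d0 ->
  forall x y, `|x - y| <= d -> `|'D_(evec i) phi x - 'D_(evec i) phi y| <= e.
 apply:finite_small => i;have [_ /(_ i)[_ cdi]] := Cphi.
 have [dd dd0 hdd] := unif_cont_supp cdi (ex_intro _ s (derive_supp i bphi0)) e0.
 by exists dd => // d /andP[_ hd] x y xy;apply:hdd;exact:le_trans hd.
(* At this scale the mollification of [phi] is still supported in [K'], and its values and partial
   derivatives differ from those of [phi] by at most [e]. *)
pose d : R := Num.min d1 (Num.min da db).
have d0 : 0 < d by rewrite !lt_min d10 da0 db0.
have dd1 : d <= d1 by rewrite !ge_min lexx.
have dda : d <= da by rewrite !ge_min lexx orbT.
have ddb : d <= db by rewrite !ge_min lexx !orbT.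
have sm := @moll_smooth R n d d0.
pose psi := convol phi (moll d).
have psi0 x : ~ K' x -> psi x = 0.
 move=>K'x;rewrite /psi /convol -[RHS](@intg0 R n setT);apply:eq_intg => y _.
 have [Ky|Ky] := pselect (K y);last by rewrite phi0 ?mul0r.
 rewrite sm.2 ?mulr0//;rewrite ltNge;apply/negP => xy;apply:K'x;apply:(hK' y) => //.
 by rewrite distrC (le_trans xy).
have Ckpsi k : Ck k psi by exact:Ck_conv sm.
have supp_psi : [set x | psi x != 0] `<=` K'.
 by move=>x /= h;apply:contrapT => /psi0 h0;rewrite h0 eqxx in h.
have clpsi : closure [set x | psi x != 0] `<=` K'.
 by rewrite ((closure_id K').1 (compact_closed (@norm_hausdorff _ _) cK'));exact:closureS.
have tpsi : test_function U psi.
 split => //;last exact:subset_trans K'U.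
 by apply:subclosed_compact cK' clpsi;exact:closed_closure.
have psiphi x : `|psi x - phi x| <= e.
 by apply:conv_moll_close => // y xy;rewrite distrC;apply:ha;exact:le_trans dda.
have dpsiphi x i : `|'D_(evec i) psi x - 'D_(evec i) phi x| <= e.
 rewrite /psi (convol_derive_C1 x i Cphi bphi sm);apply:conv_moll_close => //.
  have [_ /(_ i)[_ cdi]] := Cphi.
  by apply:integ_cs => //;exists s;exact:derive_supp.
 by move=>y xy;rewrite distrC;apply:(hb i d);rewrite ?d0.
have dpsi0 x i : ~ K' x -> 'D_(evec i) psi x = 0.
 move=>Kx;rewrite -(derive_cst (0 : R) x (evec i));apply:near_eq_derive.
 have oK : open (~` K') by apply:closed_openC;exact:compact_closed.
 by apply:filterS (open_nbhs_nbhs (conj oK Kx)) => y;exact:psi0.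
have cutU (h : E -> R) : (forall x, ~ K' x -> h x = 0) -> intg U h = intg K' h.
 move=>h0;rewrite intg_mk [RHS]intg_mk;apply:eq_intg => x _.
 rewrite !patchE;case:ifPn => xK;case:ifPn => xK' //.
  by rewrite h0// => /mem_set h';rewrite h' in xK'.
 by exfalso;move/negP: xK;apply;apply/mem_set/K'U/set_mem.
have bounded_meas (c : E -> R) : continuous c -> meas K' c /\ exists M : R, forall x, K' x -> `|c x| <= M.
 move=>cc;split;first exact:meas_cont.
 by have [M _ hM] := cont_maxK cK' (fun x _ => cc x);exists M.
have prodi (g c : E -> R) : integ K' g -> continuous c -> integ K' (fun x => g x * c x).
 move=>gi /bounded_meas[mc [M hM]].
 by apply:(eq_integ mK' (fun x _ => mulrC (c x) (g x)));exact:integ_mulb hM gi.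
have doti (c : E -> R) : Ck 1 c -> integ K' (fun x => dot (AA x) (grad c x)).
 move=>[_ Cc];apply:integ_sum => // i.
 apply:(@eq_integ _ _ _ (fun x => AA x ord0 i * 'D_(evec i) c x)) => //;first by move=>x _;rewrite gradE.
 by apply:prodi;[exact:iA|have [] := Cc i].
have i1 := doti _ Cphi;have i2 := doti _ (Ckpsi 1%N).
have wi := iw K' cK' K'U.
have i3 := prodi _ _ wi cphi;have i4 := prodi _ _ wi (Ckpsi 0%N).
have {tpsi} := wk _ tpsi.
rewrite cutU;last by move=>x Kx;rewrite /dot big1// => i _;rewrite gradE dpsi0 ?mulr0.
rewrite cutU;last by move=>x Kx;rewrite psi0 ?mulr0.
move=>eq0;rewrite -[X in `|X|]subr0 -[in X in `|X|]eq0 opprD addrACA.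
rewrite -(intgB mK' i1 i2) -(intgB mK' i3 i4).
apply:(le_trans (ler_normD _ _));rewrite /B mulrDr;apply:lerD.
 apply:(le_trans (le_norm_intg mK' (integB mK' i1 i2))).
 rewrite -(intgZ _ mK' iS);apply:intg_le => //;[exact:integ_abs (integB mK' i1 i2)|exact:integZ|].
 move=>x _;rewrite /dot -sumrB mulr_sumr (le_trans (ler_norm_sum _ _ _))//.
 apply:ler_sum => i _;rewrite -mulrBr normrM mulrC ler_wpM2r// !gradE distrC;exact:dpsiphi.
apply:(le_trans (le_norm_intg mK' (integB mK' i3 i4))).
have iw' := integ_abs mK' wi.
rewrite -(intgZ _ mK' iw');apply:intg_le => //;[exact:integ_abs (integB mK' i3 i4)|exact:integZ|].
by move=>x _;rewrite -mulrBr normrM mulrC ler_wpM2r// distrC;exact:psiphi.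
Qed.

(** Young's inequality in its crudest form, by cases: if [y <= d * x] the first term on the right
    dominates, otherwise the second. *)
Lemma young_trivial (x y d p : R) : 0 <= x -> 0 <= y -> 0 < d -> 1 < p ->
 x `^ (p - 1) * y <= d * x `^ p + d `^ (1 - p) * y `^ p.
Proof.
move=>x0 y0 d0 p1;have p10 : 0 <= p - 1 by lra.
have [h|h] := leP y (d * x).
 apply:(@le_trans _ _ (d * x `^ p));last by rewrite lerDl mulr_ge0 ?powR_ge0.
 by rewrite (powR_step x0 p1) mulrCA ler_wpM2l ?powR_ge0.
apply:(@le_trans _ _ (d `^ (1 - p) * y `^ p));last by rewrite lerDr mulr_ge0 ?powR_ge0 ?(ltW d0).
rewrite (powR_step y0 p1) mulrA ler_wpM2r//.
have xd : x <= d^-1 * y by rewrite ler_pdivlMl// ltW.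
apply:(@le_trans _ _ ((d^-1 * y) `^ (p - 1))).
 by apply:ge0_ler_powR;rewrite ?nnegrE ?mulr_ge0 ?invr_ge0 ?(ltW d0).
by rewrite powRM ?invr_ge0 ?(ltW d0)// -powR_inv1 ?(ltW d0)// -powRrM mulN1r opprB.
Qed.

End WeakFormulation.

(** * Weak equations tested with Sobolev functions *)

Section SobolevTest.
Context {R : realType} {n : nat}.
Local Notation E := 'rV[R]_n.
Implicit Types (f g phi eta w : E -> R) (F G AA : E -> E) (U K : set E) (d p e : R).

Lemma gradM f g x : Ck 1 f -> Ck 1 g -> grad (fun y => f y * g y) x = f x *: grad g x + g x *: grad f x.
Proof.
move=>[_ Cf] [_ Cg];apply/rowP => i;rewrite gradE !mxE.
by have [_ ->] := is_deriveM_rV ((Cf i).1 x) ((Cg i).1 x).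
Qed.

Lemma grad_bounded K eta : compact K -> Ck 1 eta -> exists2 M : R, 0 < M &
 forall x, K x -> `|eta x| <= M /\ enorm (grad eta x) <= M.
Proof.
move=>cK [ce Ce];have [M M0 hM] := cont_maxK cK (fun x _ => ce x).
have /choice[D hD] : forall i : 'I_n, exists D : R, 0 < D /\ forall x, K x -> `|'D_(evec i) eta x| <= D.
 by move=>i;have [D D0 hD] := cont_maxK cK (fun x _ => (Ce i).2 x);exists D.
have s0 : 0 <= \sum_(i < n) D i by apply:sumr_ge0 => i _;rewrite ltW// (hD i).1.
exists (M + \sum_(i < n) D i);first by rewrite ltr_wpDr.
move=>x Kx;split;first by rewrite (le_trans (hM x Kx))// lerDl.
apply:(le_trans (enorm_le_sum _));apply:(@le_trans _ _ (\sum_(i < n) D i));last by rewrite lerDr ltW.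
by apply:ler_sum => i _;rewrite gradE;exact:(hD i).2.
Qed.

Lemma powR_sub1_le (x p : R) : 0 <= x -> 1 < p -> x `^ (p - 1) <= x `^ p + 1.
Proof.
move=>x0 p1;have := @young_trivial R x 1 1 p x0 ler01 ltr01 p1.
by rewrite mulr1 mul1r !powR1 mul1r.
Qed.

Lemma powR_mono (p a c : R) : 0 <= p -> 0 <= a -> a <= c -> a `^ p <= c `^ p.
Proof. by move=>p0 a0 ac;apply:ge0_ler_powR;rewrite ?nnegrE// (le_trans a0). Qed.

Lemma sum3B (x y z x' y' z' : R) : x' + y' + z' = 0 -> x + y + z = (x - x') + ((y - y') + (z - z')).
Proof. by move=>h;rewrite -[LHS]subr0 -h;ring. Qed.

Section Field.
Variables (U : set E) (p b : R) (AA G : E -> E) (w : E -> R).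
Hypotheses (p1 : 1 < p) (b0 : 0 <= b) (oU : open U).
Hypothesis mAA : forall K, compact K -> K `<=` U -> forall i, meas K (fun x => AA x ord0 i).
Hypothesis AAG : forall x, U x -> enorm (AA x) <= b * enorm (G x) `^ (p - 1).
Hypothesis iG : forall K, compact K -> K `<=` U -> integ K (fun x => enorm (G x) `^ p).
Hypothesis iw : forall K, compact K -> K `<=` U -> integ K w.
Hypothesis weak : forall phi, test_function U phi ->
 intg U (fun x => dot (AA x) (grad phi x)) + intg U (fun x => w x * phi x) = 0.

Lemma field_dot_le x (F : E) (d : R) : U x -> 0 < d ->
 `|dot (AA x) F| <= b * (d * enorm (G x) `^ p + d `^ (1 - p) * enorm F `^ p).
Proof.
move=>Ux d0;apply:(le_trans (CauchySchwarz_dot _ _)).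
apply:(le_trans (ler_wpM2r (enorm_ge0 _) (AAG Ux)));rewrite -mulrA ler_wpM2l//.
by apply:young_trivial;rewrite ?enorm_ge0.
Qed.

Lemma field_dot_integ K F : compact K -> K `<=` U -> (forall i, meas K (fun x => F x ord0 i)) ->
 integ K (fun x => enorm (F x) `^ p) -> integ K (fun x => dot (AA x) (F x)).
Proof.
move=>cK KU mF iF;have mK := msr_cpt cK.
have i1 := integZ b mK (integD mK (integZ 1 mK (iG cK KU)) (integZ (1 `^ (1 - p)) mK iF)).
apply:(integ_le mK _ _ i1);first by apply:meas_dot => //;exact:mAA.
by move=>x /KU Ux;exact:field_dot_le.
Qed.

Lemma field_integ K i : compact K -> K `<=` U -> integ K (fun x => AA x ord0 i).
Proof.
move=>cK KU;have mK := msr_cpt cK.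
have i1 := integZ b mK (integD mK (iG cK KU) (integ_cst 1 mK (lamK_lty cK))).
apply:(integ_le mK _ _ i1);first exact:mAA.
move=>x /KU Ux;apply:(le_trans (coord_le_enorm _ _));apply:(le_trans (AAG Ux)).
by rewrite ler_wpM2l//;apply:powR_sub1_le;rewrite ?enorm_ge0.
Qed.

Lemma integ_powR_scale K F eta (M : R) : compact K -> (forall i, meas K (fun x => F x ord0 i)) -> meas K eta ->
 (forall x, K x -> `|eta x| <= M) -> integ K (fun x => enorm (F x) `^ p) ->
 integ K (fun x => enorm (eta x *: F x) `^ p).
Proof.
move=>cK mF me hM iF;have mK := msr_cpt cK.
apply:(integ_le mK _ _ (integZ (M `^ p) mK iF)).
 apply:meas_powR;apply:meas_enorm => i.
 by apply:(@eq_meas _ _ _ (fun x => eta x * F x ord0 i));[move=>x _;rewrite mxE|exact:measM].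
move=>x Kx;rewrite ger0_norm ?powR_ge0// enormZ powRM ?enorm_ge0// ler_wpM2r ?powR_ge0//.
by apply:powR_mono => //;[exact:ltW (lt_trans ltr01 p1)|exact:hM].
Qed.

(** The C^1 functions [phi * eta] are admissible, and [phi] approximates [f] in the sense of [Wfn];
    all terms pass to the limit because [AA] is bounded by the power [p - 1] of [G]. *)
Lemma weak_Wfn_test f F eta K : Wfn p U f F -> Ck 1 eta -> compact K -> K `<=` U ->
 (forall x, ~ K x -> eta x = 0) ->
 [/\ integ K (fun x => dot (AA x) (eta x *: F x)), integ K (fun x => dot (AA x) (f x *: grad eta x)),
   integ K (fun x => w x * (f x * eta x)) &
 intg K (fun x => dot (AA x) (eta x *: F x)) + intg K (fun x => dot (AA x) (f x *: grad eta x)) +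
 intg K (fun x => w x * (f x * eta x)) = 0].
Proof.
move=>W Ceta cK KU eta0;have [f1 f2 f3 f4] := W;have mK := msr_cpt cK.
have ceta := Ck_cont Ceta.
have [M M0 hM] := grad_bounded cK Ceta.
have [N N0 hN] := Wfn_bounded W cK KU.
have mf : meas K f by exact:meas_cont_pts f1.
have meta : meas K eta by exact:meas_cont.
have GI := iG cK KU;have FI := f3 K cK KU;have wI := iw cK KU.
have [_ _ geI _] := @Wfn_C1 R n p U eta p1 Ceta;have {}geI := geI K cK KU.
have mge i : meas K (fun x => grad eta x ord0 i) by exact:meas_grad.
have mF i := f2 K cK KU i.
have mZ (c : E -> R) (X : E -> E) : meas K c -> (forall i, meas K (fun x => X x ord0 i)) ->
  forall i, meas K (fun x => (c x *: X x) ord0 i).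
 by move=>mc mX i;apply:(@eq_meas _ _ _ (fun x => c x * X x ord0 i));[move=>x _;rewrite mxE|exact:measM].
have j1 : integ K (fun x => dot (AA x) (eta x *: F x)).
 exact:(field_dot_integ cK KU (mZ _ _ meta mF) (integ_powR_scale cK mF meta (fun x Kx => (hM x Kx).1) FI)).
have j2 : integ K (fun x => dot (AA x) (f x *: grad eta x)).
 exact:(field_dot_integ cK KU (mZ _ _ mf mge) (integ_powR_scale cK mge mf hN geI)).
have j3 : integ K (fun x => w x * (f x * eta x)).
 apply:(eq_integ mK (fun x _ => mulrC (f x * eta x) (w x))).
 apply:(@integ_mulb _ _ _ _ _ (N * M)) => //;first exact:measM.
 by move=>x Kx;rewrite normrM ler_pM//;[exact:hN|exact:(hM x Kx).1].
split;[exact:j1|exact:j2|exact:j3|].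
set I := intg K (fun x => enorm (G x) `^ p) in GI *.
have I0 : 0 <= I by apply:intg_ge0 => x _;exact:powR_ge0.
set S := _ + _;apply/eqP;rewrite -normr_le0.
have B0 : 0 <= b * M * I by rewrite !mulr_ge0// ltW.
(* Young's inequality with parameter [d] leaves an error [d * B0] plus [e * C] with [C] depending on
   [d]; so [e] tends to 0 before [d] does. *)
apply:(le_all_small B0) => d d0;rewrite -subr_le0.
pose W0 := intg K (fun x => `|w x|);have W00 : 0 <= W0 by exact:intg_ge0.
pose C := b * M * d `^ (1 - p) + b * M * (I + vol K) + M * W0.
have C0 : 0 <= C by rewrite !addr_ge0 ?mulr_ge0 ?powR_ge0 ?addr_ge0 ?vol_ge0// ltW.
apply:(le_all_small C0) => e e0;rewrite lerBlDr addrC.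
have [phi [Cphi phif ip lp]] := f4 K e cK KU e0.
have phi0 x : ~ K x -> phi x * eta x = 0 by move=>/eta0 ->;rewrite mulr0.
have := weak_C1_test oU (fun K cK KU i => field_integ i cK KU) iw weak (C1_mul Cphi Ceta) cK KU phi0.
have cphi := Ck_cont Cphi;have mphi : meas K phi by exact:meas_cont.
have mgp i : meas K (fun x => grad phi x ord0 i) by exact:meas_grad.
have [_ _ gpI _] := @Wfn_C1 R n p U phi p1 Cphi;have {}gpI := gpI K cK KU.
have [N' N'0 hN'] := cont_maxK cK (fun x _ => cphi x).
have k1 : integ K (fun x => dot (AA x) (eta x *: grad phi x)).
 exact:(field_dot_integ cK KU (mZ _ _ meta mgp) (integ_powR_scale cK mgp meta (fun x Kx => (hM x Kx).1) gpI)).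
have k2 : integ K (fun x => dot (AA x) (phi x *: grad eta x)).
 exact:(field_dot_integ cK KU (mZ _ _ mphi mge) (integ_powR_scale cK mge mphi hN' geI)).
have k3 : integ K (fun x => w x * (phi x * eta x)).
 apply:(eq_integ mK (fun x _ => mulrC (phi x * eta x) (w x))).
 apply:(@integ_mulb _ _ _ _ _ (N' * M)) => //;first exact:measM.
 by move=>x Kx;rewrite normrM ler_pM//;[exact:hN'|exact:(hM x Kx).1].
have -> : intg K (fun x => dot (AA x) (grad (fun y => phi y * eta y) x)) =
  intg K (fun x => dot (AA x) (eta x *: grad phi x)) + intg K (fun x => dot (AA x) (phi x *: grad eta x)).
 by rewrite -(intgD mK k1 k2);apply:eq_intg => x _;rewrite gradM// dotDr addrC.
move=>eq0;have -> : S = intg K (fun x => dot (AA x) (eta x *: F x) - dot (AA x) (eta x *: grad phi x)) +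
 (intg K (fun x => dot (AA x) (f x *: grad eta x) - dot (AA x) (phi x *: grad eta x)) +
 intg K (fun x => w x * (f x * eta x) - w x * (phi x * eta x))).
 rewrite (intgB mK j1 k1) (intgB mK j2 k2) (intgB mK j3 k3).
 exact:(sum3B _ _ _ eq0).
have l1 := le_norm_intg mK (integB mK j1 k1).
have l2 := le_norm_intg mK (integB mK j2 k2).
have l3 := le_norm_intg mK (integB mK j3 k3).
have t1 : intg K (fun x => `|dot (AA x) (eta x *: F x) - dot (AA x) (eta x *: grad phi x)|) <=
  b * M * d * I + b * M * d `^ (1 - p) * e.
 have q1 := integZ (b * M * d) mK GI;have q2 := integZ (b * M * d `^ (1 - p)) mK ip.
 apply:(@le_trans _ _ (intg K (fun x => b * M * d * enorm (G x) `^ p + b * M * d `^ (1 - p) * enorm (grad phi x - F x) `^ p))).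
  apply:intg_le => //;[exact:integ_abs (integB mK j1 k1)|exact:integD|].
  move=>x Kx;rewrite !dotZr -mulrBr normrM -dotNr -dotDr.
  have := field_dot_le (F x - grad phi x) (KU x Kx) d0;rewrite -(enormN (F x - _)) opprB => h.
  apply:(le_trans (ler_pM _ _ (hM x Kx).1 h)) => //.
  by rewrite le_eqVlt;apply/orP;left;apply/eqP;ring.
 rewrite (intgD mK q1 q2) (intgZ _ mK GI) (intgZ _ mK ip) lerD2l ler_wpM2l//.
 by rewrite !mulr_ge0 ?powR_ge0// ltW.
have t2 : intg K (fun x => `|dot (AA x) (f x *: grad eta x) - dot (AA x) (phi x *: grad eta x)|) <=
  b * M * e * (I + vol K).
 have q0 := integD mK GI (integ_cst 1 mK (lamK_lty cK)).
 have q1 := integZ (b * M * e) mK q0.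
 apply:(@le_trans _ _ (intg K (fun x => b * M * e * (enorm (G x) `^ p + 1)))).
  apply:intg_le => //;[exact:integ_abs (integB mK j2 k2)|].
  move=>x Kx;rewrite !dotZr -mulrBl normrM.
  have h1 : `|f x - phi x| <= e by rewrite distrC;exact:phif.
  have h2 : `|dot (AA x) (grad eta x)| <= b * (enorm (G x) `^ p + 1) * M.
   apply:(le_trans (CauchySchwarz_dot _ _));apply:ler_pM;rewrite ?enorm_ge0//;last exact:(hM x Kx).2.
   apply:(le_trans (AAG (KU x Kx)));rewrite ler_wpM2l//;apply:powR_sub1_le => //;exact:enorm_ge0.
  apply:(le_trans (ler_pM _ _ h1 h2)) => //.
  by rewrite le_eqVlt;apply/orP;left;apply/eqP;ring.
 by rewrite (intgZ _ mK q0) (intgD mK GI (integ_cst 1 mK (lamK_lty cK))) intg_cst// mul1r.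
have t3 : intg K (fun x => `|w x * (f x * eta x) - w x * (phi x * eta x)|) <= e * M * W0.
 have q0 := integ_abs mK wI;have q1 := integZ (e * M) mK q0.
 rewrite /W0 -(intgZ _ mK q0).
 apply:intg_le => //;[exact:integ_abs (integB mK j3 k3)|].
 move=>x Kx;rewrite -mulrBr -mulrBl !normrM mulrC ler_wpM2r//.
 by rewrite ler_pM//;[rewrite distrC;exact:phif|exact:(hM x Kx).1].
apply:(le_trans (ler_normD _ _));apply:(le_trans (lerD (lexx _) (ler_normD _ _))).
apply:(le_trans (lerD (le_trans l1 t1) (lerD (le_trans l2 t2) (le_trans l3 t3)))).
by rewrite le_eqVlt;apply/orP;left;apply/eqP;rewrite /C;clear;ring.
Qed.

End Field.
End SobolevTest.

(** * The operator of a fixed norm: homogeneity and monotonicity *)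

Section NormOperator.
Context {R : realType} {n : nat}.
Local Notation E := 'rV[R]_n.
Implicit Types (N : E -> R) (x y xi b : E) (p c : R).

Lemma is_derive_bound (h : R -> R) (l e : R) : is_derive (0 : R) (1 : R) h l -> 0 < e -> exists2 d : R, 0 < d &
 forall t, t != 0 -> `|t| < d -> `|l - (h t - h 0) / t| <= e.
Proof.
move=>[dh lh] e0.
have cv : t^-1 *: (h (t *: 1 + 0) - h 0) @[t --> 0^'] --> l by rewrite -lh;exact:dh.
have /cvgrPdist_le/(_ e e0) := cv.
move=>/nbhs_ballP[d /= d0 hd];exists d => // t t0 td.
have := hd t;rewrite -ball_normE /= sub0r normrN => /(_ td t0).
by rewrite addr0 -[t *: 1]/(t * 1) mulr1 -[_ *: _]/(_ * _) mulrC.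
Qed.

Lemma is_derive_small (h : R -> R) : h 0 = 0 ->
 (forall e : R, 0 < e -> exists2 d : R, 0 < d & forall t, `|t| < d -> `|h t| <= e * `|t|) -> is_derive (0 : R) (1 : R) h 0.
Proof.
move=>h0 H;have cv : t^-1 *: ((h \o shift 0) (t *: 1) - h 0) @[t --> 0^'] --> (0 : R).
 apply/cvgrPdist_le => e e0;have [d d0 hd] := H e e0.
 apply/nbhs_ballP;exists d => //= t;rewrite -ball_normE /= sub0r normrN => td t0.
 rewrite /shift /= addr0 h0 subr0 sub0r normrN -[t *: 1]/(t * 1) mulr1 -[_ *: _]/(_ * _).
 by rewrite normrM normfV mulrC ler_pdivrMr ?normr_gt0//;exact:hd.
by apply:DeriveDef;[apply/cvg_ex;exists 0|exact:cvg_lim].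
Qed.

Lemma is_derive_ge0_right (h : R -> R) (l : R) : is_derive (0 : R) (1 : R) h l -> (forall t, 0 < t -> h 0 <= h t) -> 0 <= l.
Proof.
move=>dh h0;rewrite leNgt;apply/negP => l0.
have e0 : 0 < - l / 2 by lra.
have [d d0 hd] := is_derive_bound dh e0.
have d20 : 0 < d / 2 by lra.
have := hd (d / 2) (lt0r_neq0 d20);rewrite gtr0_norm// => /(_ ltac:(lra)).
have : 0 <= (h (d / 2) - h 0) / (d / 2) by rewrite divr_ge0 ?subr_ge0 ?h0// ltW.
rewrite ler_norml;lra.
Qed.

Lemma dotBB (a b x y : E) : dot (a - b) (x - y) = dot a x + dot b y - (dot a y + dot b x).
Proof. by rewrite dotDl dotNl !dotDr !dotNr;ring. Qed.

Section Fixed.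
Variables (N : E -> R) (p : R).
Hypotheses (Nn : is_norm N) (p1 : 1 < p) (Nd : forall xi, xi != 0 -> differentiable N xi).
Let f := fun eta => N eta `^ p / p.
Let A := grad f.

Let p0 : 0 < p. Proof. by apply:lt_trans p1. Qed.
Let p10 : 0 < p - 1. Proof. by rewrite subr_gt0. Qed.
Let N_ge0 x : 0 <= N x. Proof. by have [] := Nn. Qed.
Let N_gt0 x : x != 0 -> 0 < N x.
Proof.
have [N0 Ne _ _] := Nn => x0;rewrite lt_def N0 andbT;apply:contra x0 => /eqP/Ne ->;exact:eqxx.
Qed.

Lemma is_derive_line_powR (s c : R) : 0 < s -> is_derive (0 : R) (1 : R) (fun t => (s + t * c) `^ p / p) (s `^ (p - 1) * c).
Proof.
move=>s0.
have d1 : is_derive (0 : R) 1 (fun t : R => s + t * c) c.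
 have h := @is_deriveD _ _ _ (cst s) (fun t : R => t * c) 0 1 0 c (is_derive_cst _ _ _).
 rewrite add0r in h;apply:h.
 have -> : (fun t : R => t * c) = (fun t => c * t) by apply/funext => t;rewrite mulrC.
 have := @is_deriveZ _ _ _ (@id R) c (0 : R) (1 : R) 1 (is_derive_id _ _).
 by rewrite /GRing.scale/= mulr1.
have d2 : is_derive (s + 0 * c) (1 : R) ((@powR R) ^~ p) (p * (s + 0 * c) `^ (p - 1)).
 by apply:is_derive1_powR;rewrite mul0r addr0.
have := @is_derive1_comp _ ((@powR R) ^~ p) (fun t => s + t * c) 0 _ _ d2 d1.
rewrite mul0r addr0 => d3.
have := @is_deriveZ _ _ _ ((@powR R) ^~ p \o (fun t => s + t * c)) p^-1 0 1 _ d3.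
have -> : p^-1 \*: ((@powR R) ^~ p \o (fun t => s + t * c)) = (fun t => (s + t * c) `^ p / p).
 by apply/funext => t;rewrite /= [in RHS]mulrC.
by rewrite /GRing.scale/= !mulrA mulVf ?mul1r// gt_eqF.
Qed.

Lemma energy_differentiable xi : xi != 0 -> differentiable f xi.
Proof.
move=>xi0;have -> : f = (fun t => (0 + t * 1) `^ p / p) \o N by apply/funext => x;rewrite /= add0r mulr1.
apply:differentiable_comp;first exact:Nd.
apply/derivable1_diffP.
have := @is_derive_line_powR (N xi) 1 (N_gt0 xi0).
move=>h.
have -> : (fun t : R => (0 + t * 1) `^ p / p) = (fun t : R => (N xi + t * 1) `^ p / p) \o (fun t => t - N xi).
 by apply/funext => t /=;rewrite !mulr1 add0r addrC subrK.
have d1 : is_derive (N xi) (1 : R) (fun t : R => t - N xi) 1.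
 have := @is_deriveB _ _ _ (@id R) (cst (N xi)) (N xi) (1 : R) 1 0 (is_derive_id _ _) (is_derive_cst _ _ _).
 by rewrite subr0.
rewrite -(subrr (N xi)) in h.
by have [] := @is_derive1_comp _ _ (fun t : R => t - N xi) (N xi) _ _ h d1.
Qed.

(** A norm need not be differentiable at the origin, but its power [p > 1] is so by homogeneity,
    with derivative 0. Hence the gradient formula for the operator is meaningful there too. *)
Lemma energy_line0 b : is_derive (0 : R) (1 : R) (fun t : R => f (0 + t *: b)) 0.
Proof.
have [_ _ NZ _] := Nn;apply:is_derive_small => [|e e0].
 by rewrite /f scale0r addr0 is_norm0// powR0 ?mul0r//;apply:lt0r_neq0.
pose c := N b `^ p / p;have c0 : 0 <= c by rewrite divr_ge0 ?powR_ge0// ltW.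
have q0 : 0 < e / (c + 1) by rewrite divr_gt0// ltr_wpDl.
exists ((e / (c + 1)) `^ (p - 1)^-1);first exact:powR_gt0.
move=>t td;rewrite /f add0r NZ powRM// -mulrA -/c (ger0_norm (mulr_ge0 (powR_ge0 _ _) c0)).
rewrite (powR_step (normr_ge0 t) p1) mulrAC ler_wpM2r//.
have h : `|t| `^ (p - 1) <= e / (c + 1).
 have -> : e / (c + 1) = ((e / (c + 1)) `^ (p - 1)^-1) `^ (p - 1).
  by rewrite -powRrM mulVf ?powRr1 ?(ltW q0)//;apply:lt0r_neq0.
 by apply:powR_mono => //;exact:ltW.
apply:(le_trans (ler_wpM2r c0 h));rewrite mulrAC ler_pdivrMr ?ltr_wpDl//.
by rewrite ler_wpM2l ?(ltW e0)// lerDl.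
Qed.

Lemma energy_derivable xi b : derivable f xi b.
Proof.
have [->|xi0] := eqVneq xi 0;last exact:diff_derivable (energy_differentiable xi0).
by have [] := is_der_lineV (energy_line0 b).
Qed.

Lemma opN0 : A 0 = 0.
Proof.
by apply/rowP => i;rewrite gradE mxE;have [_ ->] := is_der_lineV (energy_line0 (evec i)).
Qed.

Lemma opN_dot xi b : dot (A xi) b = 'D_b f xi.
Proof.
have [->|xi0] := eqVneq xi 0.
 by rewrite opN0 dot0l;have [_ ->] := is_der_lineV (energy_line0 b).
have fd := energy_differentiable xi0.
rewrite (deriveE _ fd) {2}(row_sum_delta b) linear_sum /dot;apply:eq_bigr => i _.
by rewrite linearZ/= gradE (deriveE _ fd) mulrC.
Qed.

Lemma opN_line xi b : is_derive (0 : R) (1 : R) (fun t : R => f (xi + t *: b)) (dot (A xi) b).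
Proof.
have := @is_derive_line R n f xi b 0;rewrite scale0r addr0 opN_dot;apply;exact:energy_derivable.
Qed.

(** Euler's identity, read off from the values of [N] on the ray through [xi]. *)
Lemma opN_self xi : dot (A xi) xi = N xi `^ p.
Proof.
have [_ _ NZ _] := Nn.
have [->|xi0] := eqVneq xi 0;first by rewrite dot0r is_norm0// powR0//;apply:lt0r_neq0.
have d1 := opN_line xi xi;have d2 := @is_derive_line_powR (N xi) (N xi) (N_gt0 xi0).
rewrite -powR_step// in d2.
have [_ <-] := d1;have [_ <-] := d2;apply:near_eq_derive.
near=> t.
have t1 : 0 <= 1 + t.
 have : `|t| < 1.
  near: t;apply/nbhs_ballP;exists 1 => //= r;by rewrite -ball_normE /= sub0r normrN.
 by rewrite ltr_norml;lra.
rewrite /f -[X in N (X + _)]scale1r -scalerDl NZ ger0_norm// mulrDl mul1r//.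
Unshelve. all: by end_near. Qed.

(** By the triangle inequality the difference of [(N xi + t * N b)^p / p] and [f (xi + t *: b)] is
    nonnegative for [t > 0] and vanishes at 0, so its derivative at 0 is nonnegative. *)
Lemma opN_le xi b : dot (A xi) b <= N xi `^ (p - 1) * N b.
Proof.
have [_ _ NZ ND] := Nn.
have [->|xi0] := eqVneq xi 0;first by rewrite opN0 dot0l mulr_ge0 ?powR_ge0.
have d1 := opN_line xi b;have d2 := @is_derive_line_powR (N xi) (N b) (N_gt0 xi0).
rewrite -subr_ge0.
have d3 := @is_deriveB _ _ _ _ _ _ _ _ _ d2 d1.
apply:(is_derive_ge0_right d3) => t t0 /=.
rewrite !fctE mul0r addr0 scale0r addr0 subrr subr_ge0 /f ler_wpM2r ?invr_ge0 ?(ltW p0)//.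
apply:powR_mono => //;first exact:ltW.
by rewrite (le_trans (ND _ _))// NZ gtr0_norm.
Qed.

Lemma opN_homog (c : R) xi : 0 < c -> A (c *: xi) = c `^ (p - 1) *: A xi.
Proof.
move=>c0;have [_ _ NZ _] := Nn;apply/rowP => i;rewrite [RHS]mxE /A !gradE.
have fc : f \o affine c 0 = (fun x => c `^ p * f x).
 apply/funext => x;rewrite /f /= /affine addr0 NZ gtr0_norm// powRM ?(ltW c0)//.
 by rewrite mulrA.
have [_ e1] := @is_derive_affine R n f c 0 xi i (@energy_derivable (affine c 0 xi) (evec i)).
have [_ e2] := @derive_scaler R n f xi (evec i) (c `^ p) (@energy_derivable xi (evec i)).
rewrite fc e2 /affine addr0 in e1.
move: e1;move: ('D_(evec i) f (c *: xi)) ('D_(evec i) f xi) => a b e1.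
by apply:(mulfI (lt0r_neq0 c0));rewrite -e1 mulrA [c * _]mulrC -(powR_step (ltW c0) p1).
Qed.

End Fixed.

Section Monotone.
Variables (N : E -> R) (p : R) (A : E -> E).
Hypotheses (Nn : is_norm N) (p1 : 1 < p).
Hypothesis A_self : forall xi, dot (A xi) xi = N xi `^ p.
Hypothesis A_le : forall xi b, dot (A xi) b <= N xi `^ (p - 1) * N b.
Let p10 : 0 < p - 1. Proof. by rewrite subr_gt0. Qed.
Let N_ge0 x : 0 <= N x. Proof. by have [] := Nn. Qed.

Lemma powR_sub1_mono_sub (s t : R) : 0 <= s -> 0 <= t -> 0 <= (s `^ (p - 1) - t `^ (p - 1)) * (s - t).
Proof.
move=>s0 t0;have [st|/ltW ts] := leP s t.
 by rewrite mulr_le0// subr_le0//;apply:powR_mono => //;exact:ltW.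
by rewrite mulr_ge0// subr_ge0//;apply:powR_mono => //;exact:ltW.
Qed.

Lemma powR_sub1_strict (s t : R) : 0 <= s -> 0 <= t -> (s `^ (p - 1) - t `^ (p - 1)) * (s - t) <= 0 -> s = t.
Proof.
move=>s0 t0 h;apply/eqP/negPn/negP => st;move: h;rewrite leNgt => /negP;apply.
wlog lt : s t s0 t0 st / s < t => [H|].
 have [|ts|e] := ltgtP s t;[exact:H| |by rewrite e eqxx in st].
 by rewrite -mulrNN !opprB;apply:H => //;rewrite eq_sym.
by rewrite nmulr_rgt0 subr_lt0//;apply:gt0_ltr_powR => //;rewrite nnegrE.
Qed.

(** Bounding the two mixed terms by [opN_le] reduces monotonicity of the operator to that of
    [s^(p-1)] for the numbers [N x] and [N y]. *)
Lemma opN_gap x y : N x `^ p + N y `^ p - (N x `^ (p - 1) * N y + N y `^ (p - 1) * N x) <=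
 dot (A x - A y) (x - y).
Proof.
have -> : dot (A x - A y) (x - y) = N x `^ p + N y `^ p - (dot (A x) y + dot (A y) x).
 by rewrite dotBB (A_self x) (A_self y).
by rewrite lerB// lerD// A_le.
Qed.

Lemma opN_mono x y : 0 <= dot (A x - A y) (x - y).
Proof.
apply:le_trans (opN_gap x y);have := powR_sub1_mono_sub (N_ge0 x) (N_ge0 y).
rewrite (powR_step (N_ge0 x) p1) (powR_step (N_ge0 y) p1).
by move/le_trans;apply;rewrite le_eqVlt;apply/orP;left;apply/eqP;ring.
Qed.

(** The hypothesis forces [N x = N y] and then [N (x + y) >= 2 * N x]; the midpoint of the
    normalized vectors has norm at least 1, which uniform convexity excludes unless [x = y]. *)
Lemma opN_strict x y : uniformly_convex N -> dot (A x - A y) (x - y) <= 0 -> x = y.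
Proof.
move=>uc h;have [_ Ne NZ ND] := Nn.
have eqN : N x = N y.
 apply:powR_sub1_strict => //;apply:le_trans (le_trans (opN_gap x y) h).
 rewrite (powR_step (N_ge0 x) p1) (powR_step (N_ge0 y) p1).
 by rewrite le_eqVlt;apply/orP;left;apply/eqP;ring.
have [x0|x0] := eqVneq (N x) 0.
 by rewrite (Ne x x0) (Ne y)// -eqN.
have Nx : 0 < N x by rewrite lt_def x0 N_ge0.
apply/eqP/negPn/negP => xy.
have dxy : N x `^ p <= dot (A x) y.
 have h1 := A_le y x;rewrite -eqN -powR_step// in h1.
 move: h;rewrite dotBB (A_self x) (A_self y) -eqN;move: h1.
 move: (dot (A x) y) (dot (A y) x) (N x `^ p) => a b' c;lra.
have N2 : 2 * N x <= N (x + y).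
 have := A_le x (x + y);rewrite dotDr A_self => h1.
 have h2 : 2 * (N x `^ (p - 1) * N x) <= N x `^ (p - 1) * N (x + y).
  by rewrite -powR_step//;apply:le_trans h1;rewrite mulr_natl mulr2n lerD2l.
 by move: h2;rewrite mulrCA ler_pM2l// powR_gt0.
have nz : 0 < N (x - y) / N x.
 rewrite divr_gt0// lt_def N_ge0 andbT;apply:contra xy => /eqP/Ne/eqP;by rewrite subr_eq0.
have [d d0 /(_ ((N x)^-1 *: x) ((N x)^-1 *: y))] := uc _ nz.
rewrite !NZ -eqN (gtr0_norm (_ : 0 < (N x)^-1)) ?invr_gt0// mulVf//.
rewrite -scalerBr -scalerDr !NZ (gtr0_norm (_ : 0 < (N x)^-1)) ?invr_gt0// gtr0_norm//.
rewrite mulrC => /(_ erefl erefl (lexx _)).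
have : 1 <= 2^-1 * ((N x)^-1 * N (x + y)).
 by rewrite mulrCA mulrC ler_pdivlMr// mul1r;lra.
by lra.
Qed.

End Monotone.
End NormOperator.

(** * Measurability of Caratheodory compositions *)

Section Caratheodory.
Context {R : realType} {n : nat}.
Local Notation E := 'rV[R]_n.
Local Notation L := (lebType R n).
Local Notation mu := (@lam R n).
Implicit Types (D : set E) (G : E -> E).

Lemma dot_evec (x : E) i : dot x (evec i) = x ord0 i.
Proof.
rewrite /dot (bigD1 i)//= [X in _ + X]big1 ?addr0;first by rewrite mxE !eqxx mulr1.
by move=>j ji;rewrite mxE (negbTE ji) mulr0.
Qed.

(** Completeness of Caratheodory's sigma-algebra. *)
Lemma null_msr (B A : set E) : mu A = 0%E -> B `<=` A -> msr B /\ mu B = 0%E.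
Proof.
move=>A0 BA;have B0 : mu B = 0%E.
 apply/eqP;rewrite eq_le measure_ge0 andbT -A0;exact:le_leb.
split => //;apply:le_caratheodory_measurable => X.
have XB : leb (X `&` B) = 0%E.
 apply/eqP;rewrite eq_le leb_ge0 andbT -[leRHS]B0;apply:le_leb;exact:subIsetr.
rewrite [X in (X + _)%E]XB add0e;apply:le_leb;exact:subIsetl.
Qed.

Lemma ae_null (P : E -> Prop) : {ae mu, forall x, P x} -> exists A : set E, [/\ msr A, mu A = 0%E & forall x, ~ A x -> P x].
Proof.
move=>[A [mA A0 hA]];exists A;split => // x Ax;apply:contrapT => Px.
by apply:Ax;exact:hA.
Qed.

Definition round_vec (k : nat) (x : E) : 'rV[int]_n := \row_i Num.floor (k.+1%:R * x ord0 i).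
Definition unround (k : nat) (z : 'rV[int]_n) : E := \row_i ((z ord0 i)%:~R / k.+1%:R).

Lemma round_close k x : `|x - unround k (round_vec k x)| <= k.+1%:R^-1.
Proof.
apply:norm_leP => [|i];first by rewrite invr_ge0.
rewrite !mxE;have := floor_le (k.+1%:R * x ord0 i);have := lt_succ_floor (k.+1%:R * x ord0 i).
rewrite intrD;set t := (Num.floor _)%:~R => h1 h2.
have k0 : (0 : R) < k.+1%:R by [].
have -> : x ord0 i - t / k.+1%:R = (k.+1%:R * x ord0 i - t) / k.+1%:R.
 by rewrite mulrBl mulrAC mulfV ?mul1r// gt_eqF.
rewrite normrM (gtr0_norm (_ : 0 < k.+1%:R^-1)) ?invr_gt0// ler_piMl ?invr_ge0// ler_norml.
by apply/andP;split;lra.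
Qed.

(** Rounding [G] to the grid of mesh [k.+1%:R^-1] leaves countably many values, and for each of them
    measurability of [F] in [x] suffices; continuity in the second variable gives the limit. *)
Lemma meas_caratheodory D (F : E -> E -> R) G : msr D -> (forall xi, meas D (fun x => F x xi)) ->
 (forall x, D x -> continuous (F x)) -> (forall i, meas D (fun x => G x ord0 i)) ->
 meas D (fun x => F x (G x)).
Proof.
move=>mD mF cF mG.
apply:(@measurable_fun_cvg _ _ _ (D : set L) (fun k x => F x (unround k (round_vec k (G x)))));last first.
 move=>x Dx;have /cont_rVP c := cF x Dx (G x).
 apply/cvgrPdist_le => e e0;have [d d0 hd] := c e e0.
 near=> k;apply:hd;apply:le_lt_trans (round_close _ _) _.
 by near: k;exact:near_infty_natSinv_lt (PosNum d0).
move=>k;apply:(measurability _ (@RGenOInfty.measurableE R)) => // _ [_ [a ->] <-].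
pose Dz (z : 'rV[int]_n) : set L := (D : set L) `&` [set x | round_vec k (G x) = z].
rewrite (_ : _ `&` _ = \bigcup_z (Dz z `&` ((D : set L) `&` [set x : L | a < F x (unround k z)])));last first.
 apply/seteqP;split => x.
  move=>[Dx];rewrite /= in_itv/= andbT => h.
  by exists (round_vec k (G x)).
 by move=>[z _ [[Dx /= <-] [_ /=]]];rewrite in_itv/= andbT.
apply:countable_bigcupT_measurable => [|z];first exact:countableP.
apply:measurableI;last exact:(msr_gt _ mD (mF _)).
rewrite (_ : Dz z = (D : set L) `&` \bigcap_(i in [set: 'I_n]) ((D : set L) `&` [set x : L | Num.floor (k.+1%:R * G x ord0 i) = z ord0 i]));last first.
 apply/seteqP;split => x.
  by move=>[Dx /= <-];split => // i _;split => //=;rewrite mxE.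
 move=>[Dx h];split => //=;apply/rowP => i;rewrite mxE.
 by have [_ /= ->] := h i Logic.I.
apply:measurableI => //;apply:fin_bigcap_measurable => [|i _];first exact:finite_finset.
rewrite (_ : _ `&` _ = ((D : set L) `&` [set x : L | (z ord0 i)%:~R <= k.+1%:R * G x ord0 i]) `&`
 ((D : set L) `&` [set x : L | k.+1%:R * G x ord0 i < (z ord0 i + 1)%:~R]));last first.
 apply/seteqP;split => x.
  move=>[Dx /= <-];split;split => //=;first exact:floor_le.
  exact:lt_succ_floor.
 move=>[[Dx /= h1] [_ /= h2]];split => //=.
 by apply:floor_def;rewrite h1.
have mk : meas D (fun x => k.+1%:R * G x ord0 i) by apply:measM;[exact:meas_cst|exact:mG].
by apply:measurableI;[exact:(msr_ge _ mD mk)|exact:(msr_lt _ mD mk)].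
Unshelve. all: by end_near. Qed.

(** A component of the gradient is a limit of difference quotients in the direction [evec i], and
    these are Caratheodory compositions. *)
Lemma meas_opA (p : R) (H : E -> E -> R) D G i : 1 < p -> msr D -> (forall xi, meas D (fun x => H x xi)) ->
 (forall x, D x -> is_norm (H x)) -> (forall x, D x -> forall xi, xi != 0 -> differentiable (H x) xi) ->
 (forall i, meas D (fun x => G x ord0 i)) ->
 meas D (fun x => opA p H x (G x) ord0 i).
Proof.
move=>p1 mD mH Hn Hd mG.
pose F (c : R) x xi := H x (xi + c *: evec i) `^ p / p.
have mF c : meas D (fun x => F c x (G x)).
 apply:measM;last exact:meas_cst.
 apply:meas_powR;apply:(meas_caratheodory mD (F := fun x xi => H x (xi + c *: evec i))) => //.
 move=>x Dx xi;apply:continuous_comp;last exact:(norm_cont (Hn x Dx)).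
 by apply:continuousD;[exact:cvg_id|exact:cst_continuous].
apply:(@measurable_fun_cvg _ _ _ (D : set L) (fun k x => k.+1%:R * (F k.+1%:R^-1 x (G x) - F 0 x (G x)))).
 by move=>k;apply:measM;[exact:meas_cst|apply:measB;exact:mF].
move=>x Dx;apply/cvgrPdist_le => e e0.
have dl : is_derive (0 : R) (1 : R) (fun t : R => F t x (G x)) (opA p H x (G x) ord0 i).
 have := opN_line (Hn x Dx) p1 (Hd x Dx) (G x) (evec i).
 rewrite /F;congr is_derive.
 exact:dot_evec.
have [d d0 hd] := is_derive_bound dl e0.
near=> k;have kd : k.+1%:R^-1 < d by near: k;exact:near_infty_natSinv_lt (PosNum d0).
have := hd k.+1%:R^-1;rewrite invr_eq0 pnatr_eq0 gtr0_norm ?invr_gt0// invrK => /(_ isT kd).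
by rewrite mulrC.
Unshelve. all: by end_near. Qed.

End Caratheodory.

(** * Null sets, local integrability of the potential, and solutions *)

Section Solutions.
Context {R : realType} {n : nat}.
Local Notation E := 'rV[R]_n.
Local Notation L := (lebType R n).
Local Notation mu := (@lam R n).
Implicit Types (f g phi u V : E -> R) (G : E -> E) (U K B D W : set E) (p q : R).

Section AlmostEverywhere.
Variables (B : set E) (B0 : mu B = 0%E).

Lemma eq_meas_ae D f g : msr D -> (forall x, D x -> ~ B x -> f x = g x) -> meas D f -> meas D g.
Proof.
move=>mD fg mf _ Y mY.
have mB : msr B by have [] := null_msr B0 (@subset_refl _ B).
have -> : (D : set L) `&` g @^-1` Y = ((D `&` f @^-1` Y) `\` B) `|` (D `&` g @^-1` Y `&` B).
 apply/seteqP;split => x.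
  move=>[Dx Yx];have [Bx|Bx] := pselect (B x);first by right.
  by left;split => //;split => //=;rewrite fg.
 by move=>[[[Dx /= Yx] Bx]|[[Dx Yx] _]//];split => //=;rewrite -fg.
apply:measurableU;first by apply:measurableD => //;exact:mf.
by have [] := null_msr B0 (@subIsetr _ (D `&` g @^-1` Y) B).
Qed.

Lemma ae_eq_off D f g : (forall x, D x -> ~ B x -> f x = g x) ->
 ae_eq mu (D : set L) (EFin \o (f : L -> R)) (EFin \o (g : L -> R)).
Proof.
move=>fg;have mB : msr B by have [] := null_msr B0 (@subset_refl _ B).
exists B;split => // x /= h;apply:contrapT => Bx;apply:h => Dx.
by rewrite /= fg.
Qed.

Lemma eq_intg_ae D f g : msr D -> (forall x, D x -> ~ B x -> f x = g x) -> meas D f -> intg D f = intg D g.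
Proof.
move=>mD fg mf;have mg := eq_meas_ae mD fg mf;rewrite /intg /Rintegral;congr fine.
apply:ae_eq_integral;[exact:mD|exact/measurable_EFinP|exact/measurable_EFinP|exact:ae_eq_off].
Qed.

Lemma eq_integ_ae D f g : msr D -> (forall x, D x -> ~ B x -> f x = g x) -> integ D f -> integ D g.
Proof.
move=>mD fg fi;have mf := integ_meas fi;have mg := eq_meas_ae mD fg mf.
have := fi => /integrableP[_ foo];apply/integrableP;split;first exact/measurable_EFinP.
apply:le_lt_trans foo;rewrite le_eqVlt;apply/orP;left;apply/eqP.
apply:ae_eq_integral;[exact:mD|exact/measurable_EFinP/measurableT_comp|exact/measurable_EFinP/measurableT_comp|].
have := ae_eq_off fg;apply:filterS => x h Dx /=;by have [->] := h Dx.
Qed.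

Lemma Wfn_ae p U f G G' : (forall x, U x -> ~ B x -> G x = G' x) -> Wfn p U f G -> Wfn p U f G'.
Proof.
move=>GG [h1 h2 h3 h4];split;first exact:h1.
- move=>K cK KU i;apply:eq_meas_ae (h2 K cK KU i);first exact:msr_cpt.
 by move=>x Kx Bx;rewrite GG//;exact:KU.
- move=>K cK KU;apply:eq_integ_ae (h3 K cK KU);first exact:msr_cpt.
 by move=>x Kx Bx;rewrite GG//;exact:KU.
- move=>K e cK KU e0;have [phi [p1 p2 p3 p4]] := h4 K e cK KU e0.
 have ee x : K x -> ~ B x -> enorm (grad phi x - G x) `^ p = enorm (grad phi x - G' x) `^ p.
  by move=>Kx Bx;rewrite GG//;exact:KU.
 exists phi;split;[exact:p1|exact:p2|exact:(eq_integ_ae (msr_cpt cK) ee p3)|].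
 by rewrite -(eq_intg_ae (msr_cpt cK) ee (integ_meas p3)).
Qed.

End AlmostEverywhere.

Lemma integ_setU A B f : msr A -> msr B -> integ A f -> integ B f -> integ (A `|` B) f.
Proof.
move=>mA mB iA iB;have mAB := msrU mA mB.
have jA := integ_abs msrT ((integ_mk f mA).1 iA);have jB := integ_abs msrT ((integ_mk f mB).1 iB).
apply/(integ_mk _ mAB).2;apply:(integ_le msrT _ _ (integD msrT jA jB)).
 apply/(meas_restrict _ mAB).1/(measurable_funU _ mA mB).2;split;exact:integ_meas.
move=>x _;rewrite !patchE;have [/set_mem[Ax|Bx]|_] := boolP (x \in A `|` B).
- by rewrite (mem_set Ax) lerDl.
- by rewrite (mem_set Bx) lerDr.
by rewrite normr0 addr_ge0.
Qed.

Lemma integ_cover K f : compact K -> (forall x, K x -> exists2 r, 0 < r & integ (ball x r) f) -> integ K f.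
Proof.
move=>cK h;have mK := msr_cpt cK.
have /choice[r hr] : forall x : E, exists r : R, K x -> 0 < r /\ integ (ball x r) f.
 move=>x;have [Kx|nK] := pselect (K x);last by exists 0.
 by have [r r0 ri] := h x Kx;exists r.
have cK' := cK;rewrite compact_cover in cK'.
have [||D DK Dc] := cK' E K (fun x => ball x (r x)).
- by move=>x /hr[r0 _];exact:ball_open.
- by move=>x Kx;exists x => //;apply:ballxx;have [] := hr x Kx.
suff [mA iA] : msr (\bigcup_(x in [set` D]) ball x (r x)) /\ integ (\bigcup_(x in [set` D]) ball x (r x)) f.
 by apply:integ_sub Dc iA.
have {Dc} : forall x, x \in enum_fset D -> integ (ball x (r x)) f.
 by move=>x xD;have /set_mem/hr[] := DK x xD.
have -> : [set` D] = [set` enum_fset D] by apply/seteqP;split => x.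
elim:(enum_fset D) => [_|x s ih hs].
 by rewrite set_nil bigcup_set0;split;[exact:msr0|rewrite /integ;exact:integrable_set0].
have [|mS iS] := ih;first by move=>y ys;apply:hs;rewrite inE ys orbT.
have -> : \bigcup_(y in [set` x :: s]) ball y (r y) = ball x (r x) `|` \bigcup_(y in [set` s]) ball y (r y).
 apply/seteqP;split => z.
  by move=>[y /=];rewrite inE => /orP[/eqP ->|ys] hy;[left|right;exists y].
 by move=>[hy|[y /= ys hy]];[exists x => //=;rewrite inE eqxx|exists y => //=;rewrite inE ys orbT].
split;first by apply:msrU => //;exact:msr_ball.
by apply:integ_setU => //;[exact:msr_ball|apply:hs;rewrite inE eqxx].
Qed.

Lemma star_connected (A : set E) (x : E) : A x -> (forall y (t : R), A y -> 0 <= t <= 1 -> A (x + t *: (y - x))) -> connected A.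
Proof.
move=>Ax hA.
have -> : A = \bigcup_(y in A) ((fun t : R => x + t *: (y - x)) @` `[0, 1]).
 apply/seteqP;split => y.
  by move=>Ay;exists y => //;exists 1;rewrite ?scale1r ?subrKC//= in_itv/= ler01 lexx.
 by move=>[z Az [t]];rewrite /= in_itv/= => t01 <-;exact:hA.
apply:bigcup_connected.
 by exists x => y Ay;exists 0;rewrite ?scale0r ?addr0//= in_itv/= ler01 lexx.
move=>y Ay;apply:connected_continuous_connected;first exact:segment_connected.
apply:continuous_subspaceT => t;apply:(@continuousD _ _ _ (cst x) (fun t : R => t *: (y - x)));first exact:cst_continuous.
exact:scalel_continuous.
Qed.

Lemma ball_connected (x : E) (r : R) : 0 < r -> connected (ball x r).
Proof.
move=>r0;apply:(@star_connected _ x);first exact:ballxx.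
move=>y t;rewrite -!ball_normE /= => yx /andP[t0 t1].
rewrite opprD addrA subrr sub0r normrN normrZ ger0_norm// distrC (le_lt_trans _ yx)//.
by rewrite distrC ler_piMl.
Qed.

Lemma cball_cpt (x : E) (r : R) : compact [set y | `|x - y| <= r].
Proof.
apply:(@clbd_cpt _ _ _ (`|x| + r)).
 apply:(@closed_comp _ _ (fun y : E => `|x - y|) [set s | s <= r]);last exact:closed_le.
 by move=>y _;apply:continuous_comp;[apply:continuousB => //;exact:cst_continuous|exact:norm_continuous].
by move=>y /= h;have := ler_normB x (x - y);rewrite opprB addrC subrK;lra.
Qed.

Lemma small_domain W (x : E) : open W -> W x -> exists2 r, 0 < r &
 domain (ball x r) /\ csubset (ball x r) W.
Proof.
move=>oW Wx;have /nbhs_ballP[r /= r0 rW] := open_nbhs_nbhs (conj oW Wx).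
have r2 : 0 < r / 2 by lra.
exists (r / 2) => //.
have cl : closure (ball x (r / 2)) `<=` [set y | `|x - y| <= r / 2].
 rewrite ((closure_id [set y | `|x - y| <= r / 2]).1 (compact_closed (@norm_hausdorff _ _) (@cball_cpt x _))).
 by apply:closureS => y;rewrite -ball_normE /= => /ltW.
split;first by split;[exists x;exact:ballxx|exact:ball_open|exact:ball_connected].
split;first by apply:subclosed_compact cl;[exact:closed_closure|exact:cball_cpt].
by move=>y /cl /= h;apply:rW;rewrite -ball_normE /=;lra.
Qed.

Lemma morrey_loc_integ p q W V K : open W -> in_morrey_loc p q W V -> compact K -> K `<=` W -> integ K V.
Proof.
move=>oW hV cK KW;apply:integ_cover => // x /KW Wx.
have [r r0 [dr sr]] := small_domain oW Wx;have := hV _ dr sr.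
have norm1 (D : set E) : msr D -> in_Lp 1 D V -> integ D V.
 move=>mD /(in_Lp_integ (lexx 1) mD)[mV iV].
 apply:(integ_le mD mV _ iV) => y _;by rewrite powRr1.
rewrite /in_morrey;case:ifP => _.
 by move=>h;exists r => //;apply:norm1 => //;exact:msr_ball.
(* For [p <= n] the Morrey class gives only local integrability in the ball, hence the smaller
   concentric one. *)
move=>[h _];exists (r / 2);first by lra.
pose C : set E := [set y | `|x - y| <= r / 2].
have cC : compact C by exact:cball_cpt.
apply:(@integ_sub _ _ C);[exact:msr_cpt|exact:msr_ball| |].
 by move=>y;rewrite -ball_normE /= => /ltW.
apply:norm1;first exact:msr_cpt.
by apply:h => // y;rewrite -ball_normE /C /= => hy;lra.
Qed.

(* [B] is a null set on which the operator is replaced by zero, so that the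
 inequalities known almost everywhere hold everywhere off [B]. *)
Definition elliptic p (al be : R) U B (A : E -> E -> E) : Prop :=
[/\ forall x xi, U x -> enorm (A x xi) <= be * enorm xi `^ (p - 1),
  forall x xi, U x -> ~ B x -> al * enorm xi `^ p <= dot (A x xi) xi,
  forall x a b, U x -> ~ B x -> dot (A x a - A x b) (a - b) <= 0 -> a = b &
  forall x a b, U x -> [/\ 0 <= dot (A x a - A x b) (a - b),
   0 <= dot (A x a) a - p * dot (A x b) a + (p - 1) * dot (A x b) b &
   forall c, 0 < c -> A x (c *: a) = c `^ (p - 1) *: A x a]].

(** Positive solutions in the form used below: the gradient is modified to vanish on the null set
    [B], and the signed power of [u] is an ordinary power because [u] is positive. *)
Definition wsol p B (A : E -> E -> E) V U u G : Prop :=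
[/\ Wfn p U u G, forall x, U x -> 0 < u x, forall x, B x -> G x = 0,
  forall K, compact K -> K `<=` U -> forall i, meas K (fun x => A x (G x) ord0 i) &
  forall phi, test_function U phi -> intg U (fun x => dot (A x (G x)) (grad phi x)) +
   intg U (fun x => V x * u x `^ (p - 1) * phi x) = 0].

Lemma intg_cut U K h : K `<=` U -> (forall x, U x -> ~ K x -> h x = 0) -> intg U h = intg K h.
Proof.
move=>KU h0;rewrite intg_mk [RHS]intg_mk;apply:eq_intg => x _.
rewrite !patchE;case:ifPn => xU;case:ifPn => xK //.
 by rewrite h0 => [//||/mem_set h'];[exact:set_mem|rewrite h' in xK].
by exfalso;move/negP: xU;apply;apply/mem_set/KU/set_mem.
Qed.

Lemma clsupp0 phi x : ~ closure [set x | phi x != 0] x -> phi x = 0 /\ grad phi x = 0.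
Proof.
move=>hx;have oC : open (~` closure [set x | phi x != 0]) by apply:closed_openC;exact:closed_closure.
have z y : (~` closure [set x | phi x != 0]) y -> phi y = 0.
 by move=>hy;apply/eqP/negPn/negP => h;apply:hy;exact:subset_closure.
split;first exact:z.
apply/rowP => i;rewrite gradE mxE -(derive_cst (0 : R) x (evec i));apply:near_eq_derive.
exact:filterS (open_nbhs_nbhs (conj oC hx)).
Qed.

Lemma spow_powR p (t : R) : 0 < t -> spow p t = t `^ (p - 1).
Proof.
move=>t0;rewrite /spow gtr0_norm// -{1}(powRr1 (ltW t0)) -powRD;last by rewrite (gt_eqF t0) implybT.
by congr (_ `^ _);ring.
Qed.

Definition good_pt p (H : E -> E -> R) (al be : R) (x : E) : Prop :=
 [/\ is_norm (H x), uniformly_convex (H x), forall xi, xi != 0 -> differentiable (H x) xi &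
 forall xi, al * enorm xi `^ p <= dot (opA p H x xi) xi /\
   enorm (opA p H x xi) <= be * enorm xi `^ (p - 1)].

Definition Aop p (H : E -> E -> R) B (x xi : E) : E := if x \in B then 0 else opA p H x xi.

Lemma good_elliptic p H al be U B : 1 < p -> 0 <= be -> (forall x, U x -> ~ B x -> good_pt p H al be x) ->
 elliptic p al be U B (Aop p H B).
Proof.
move=>p1 be0 hg;have p0 : 0 <= p by lra.
have inB x : B x -> forall xi, Aop p H B x xi = 0 by move=>Bx xi;rewrite /Aop mem_set.
have outB x : ~ B x -> forall xi, Aop p H B x xi = opA p H x xi by move=>Bx xi;rewrite /Aop memNset.
split.
- move=>x xi Ux;have [Bx|Bx] := pselect (B x).
  by rewrite inB// enorm0 mulr_ge0 ?powR_ge0.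
 by rewrite outB//;have [_ _ _ h] := hg x Ux Bx;exact:(h xi).2.
- by move=>x xi Ux Bx;rewrite outB//;have [_ _ _ h] := hg x Ux Bx;exact:(h xi).1.
- move=>x a b Ux Bx;rewrite !outB//;have [hn uc hd _] := hg x Ux Bx.
 exact:(opN_strict hn p1 (opN_self hn p1 hd) (opN_le hn p1 hd) uc).
move=>x a b Ux;have [Bx|Bx] := pselect (B x).
 rewrite !inB// subrr !dot0l mulr0 subr0 mulr0 addr0;split => // c _.
 by rewrite inB// scaler0.
rewrite !outB//;have [hn uc hd _] := hg x Ux Bx;have [H0 _ _ _] := hn.
split;first exact:(opN_mono hn p1 (opN_self hn p1 hd) (opN_le hn p1 hd)).
 (* The Picone-type inequality: through [opN_self] and [opN_le] it becomes [powR_tangent] for the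
    numbers [H x a] and [H x b]. *)
 rewrite [X in X - _](opN_self hn p1 hd) [X in _ + _ * X](opN_self hn p1 hd).
 have h1 := opN_le hn p1 hd b a;have h2 := powR_tangent (H0 a) (H0 b) p1.
 have : p * dot (opA p H x b) a <= p * (H x b `^ (p - 1) * H x a) by rewrite ler_wpM2l.
 move: h2;rewrite -mulrA;move: (p * _) (p * _) ((p - 1) * _) (H x a `^ p) => c1 c2 c3 c4;lra.
by move=>c c0;rewrite !outB//;exact:opN_homog.
Qed.

Lemma meas_Aop p H al be U B W G K i : 1 < p -> open W -> U `<=` W ->
 (forall xi, measurable_fun (W : set L) (fun x => H x xi)) -> mu B = 0%E ->
 (forall x, U x -> ~ B x -> good_pt p H al be x) ->
 compact K -> K `<=` U -> (forall i, meas K (fun x => G x ord0 i)) ->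
 meas K (fun x => Aop p H B x (G x) ord0 i).
Proof.
move=>p1 oW UW mH B0 hg cK KU mG;have mK := msr_cpt cK.
have mB : msr B by have [] := null_msr B0 (@subset_refl _ B).
have mKB := msrD mK mB.
have h : meas (K `\` B) (fun x => opA p H x (G x) ord0 i).
 apply:meas_opA => //.
 - move=>xi;apply:(@meas_sub _ _ W);[exact:msr_open| |exact:mH].
  by move=>x [/KU/UW].
 - by move=>x [/KU Ux Bx];have [] := hg x Ux Bx.
 - by move=>x [/KU Ux Bx];have [] := hg x Ux Bx.
 - by move=>j;apply:meas_sub (mG j) => //;exact:subDsetl.
have := (meas_restrict _ mKB).1 h => h'.
apply:(eq_meas_ae B0 mK _ (meas_sub msrT (@subsetT _ K) h')) => x Kx Bx.
by rewrite patchE mem_set// /Aop memNset.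
Qed.

Lemma weak_solution_wsol p H al be U U' B W V u : 1 < p -> open W -> U `<=` W -> open U' -> U' `<=` U ->
 (forall xi, measurable_fun (W : set L) (fun x => H x xi)) -> mu B = 0%E ->
 (forall x, U x -> ~ B x -> good_pt p H al be x) ->
 positive_solution p H V (cst 0) U' u -> exists G, wsol p B (Aop p H B) V U' u G.
Proof.
move=>p1 oW UW oU' UU' mH B0 hg [cu u0 [G WG wk]].
have mB : msr B by have [] := null_msr B0 (@subset_refl _ B).
have cu' x : U' x -> {for x, continuous u}.
 by move=>Ux;move: cu;rewrite continuous_open_subspace// => /(_ x (mem_set Ux)).
have W0 := W1p_Wfn p1 oU' cu' WG.
pose G' x := if x \in B then 0 else G x.
have GG x : U' x -> ~ B x -> G x = G' x by move=>_ Bx;rewrite /G' memNset.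
have W1 := Wfn_ae B0 GG W0.
have mA K : compact K -> K `<=` U' -> forall i, meas K (fun x => Aop p H B x (G' x) ord0 i).
 move=>cK KU i;apply:(meas_Aop i p1 oW UW mH B0 hg) => //;first exact:subset_trans KU UU'.
 by have [_ h _ _] := W1;exact:h.
exists G';split;[exact:W1|exact:u0|by move=>x Bx;rewrite /G' mem_set|exact:mA|].
move=>phi tphi;have [Cphi cK KU] := tphi;set K := closure _ in cK KU.
have h : intg U' (fun x => dot (opA p H x (G x)) (grad phi x)) + intg U' (fun x => V x * spow p (u x) * phi x) = 0.
 have := wk phi tphi;move=>h;rewrite -[RHS](@intg0 R n U');apply:etrans h _.
 by apply:eq_intg => x _;rewrite mul0r.
rewrite -[RHS]h;congr (_ + _);last by apply:eq_intg => x Ux;rewrite spow_powR//;exact:u0.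
have z (X : E -> E) x : U' x -> ~ K x -> dot (X x) (grad phi x) = 0.
 by move=>_ /clsupp0[_ ->];rewrite dot0r.
rewrite (intg_cut KU (z _)) (intg_cut KU (z _)).
apply:(eq_intg_ae B0 (msr_cpt cK)).
 by move=>x Kx Bx;rewrite -GG//;[rewrite /Aop memNset|exact:KU].
by apply:meas_dot;[exact:mA|move=>i;apply:meas_grad;exact:(Cphi 1%N)].
Qed.

(** [B] unites the exceptional sets of all the hypotheses that hold almost everywhere, so that later
    arguments are pointwise. *)
Lemma elliptic_setup p H U W : 1 < p -> open W -> U `<=` W -> norm_family W H ->
 (exists a b : R, [/\ 0 < a, 0 < b & {ae mu, forall x, U x -> forall xi,
   a * enorm xi `^ p <= dot (opA p H x xi) xi /\ enorm (opA p H x xi) <= b * enorm xi `^ (p - 1)}]) ->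
 exists B (al be : R), [/\ mu B = 0%E, 0 < al, 0 < be & forall x, U x -> ~ B x -> good_pt p H al be x].
Proof.
move=>p1 oW UW [h1 mH _ h4 h5] [a [b [a0 b0 h]]].
have [B1 [_ z1 k1]] := ae_null h1;have [B2 [_ z2 k2]] := ae_null h4.
have [B3 [_ z3 k3]] := ae_null h5;have [B4 [_ z4 k4]] := ae_null h.
have zU (X Y : set E) : mu X = 0%E -> mu Y = 0%E -> mu (X `|` Y) = 0%E.
 move=>X0 Y0;apply/eqP;rewrite eq_le measure_ge0 andbT.
 by apply:(le_trans (outer_measureU2 _ _ _));rewrite [X in (X + _)%E]X0 [X in (_ + X)%E]Y0 adde0.
exists (B1 `|` B2 `|` (B3 `|` B4)), a, b;split => //;first exact:(zU _ _ (zU _ _ z1 z2) (zU _ _ z3 z4)).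
move=>x Ux /not_orP[/not_orP[b1 b2] /not_orP[b3 b4]].
by split;[apply:k1 => //;exact:UW|apply:k2 => //;exact:UW|apply:k3 => //;exact:UW|exact:k4].
Qed.

End Solutions.

(** * Translations and De Giorgi's isoperimetric inequality *)

Section Translation.
Context {R : realType} {n : nat}.
Local Notation E := 'rV[R]_n.
Local Notation L := (lebType R n).
Local Notation mu := (@lam R n).
Implicit Types (f g phi : E -> R) (F G : E -> E) (U K A B Q : set E) (p s r : R).

Lemma intg_tonelli_bdd (F : E * E -> R) (M : R) A B : meas2 F -> msr A -> msr B ->
 (mu A < +oo)%E -> (mu B < +oo)%E -> (forall z, 0 <= F z <= M) ->
 (forall x y, F (x, y) != 0 -> A x /\ B y) ->
 [/\ forall x, integ setT (fun y => F (x, y)), forall y, integ setT (fun x => F (x, y)),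
   integ setT (fun y => intg setT (fun x => F (x, y))),
   integ setT (fun x => intg setT (fun y => F (x, y))) &
   intg setT (fun x => intg setT (fun y => F (x, y))) = intg setT (fun y => intg setT (fun x => F (x, y)))].
Proof.
move=>mF mA mB Af Bf F0 FAB.
have F0' z : 0 <= F z by have /andP[] := F0 z.
have dom (D : set E) (h : E -> R) (C : R) : msr D -> (mu D < +oo)%E -> meas setT h ->
  (forall x, 0 <= h x <= C) -> (forall x, h x != 0 -> D x) -> integ setT h.
 move=>mD Df mh h0 hD.
 have iD : integ setT ((fun=> C) \_ D) by apply:(integ_mk _ mD).1;exact:integ_cst.
 apply:(integ_le msrT mh _ iD) => x _;have /andP[a1 a2] := h0 x.
 rewrite ger0_norm// patchE;case:ifPn => // xD.
 have [->//|/hD /mem_set h'] := eqVneq (h x) 0;by rewrite h' in xD.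
have fx x : integ setT (fun y => F (x, y)).
 apply:(dom B _ M) => //;last by move=>y /FAB[].
 by apply:(@measurableT_comp _ _ _ _ _ _ (F : (L * L)%type -> R)) => //;exact:measurable_pair1.
have fy y : integ setT (fun x => F (x, y)).
 apply:(dom A _ M) => //;last by move=>x /FAB[].
 by apply:(@measurableT_comp _ _ _ _ _ _ (F : (L * L)%type -> R)) => //;exact:measurable_pair2.
have mI : meas setT (fun y => intg setT (fun x => F (x, y))).
 pose F' (z : L * L) : \bar R := (F (z.2, z.1))%:E.
 have mF' : measurable_fun setT F'.
  apply/measurable_EFinP;apply:(@measurableT_comp _ _ _ _ _ _ (F : (L * L)%type -> R) _ (fun z => (z.2, z.1))) => //.
  exact:measurable_swap.
 have := measurable_lam_tonelli mF' (fun z => _ : (0 <= F' z)%E) => h;have {}h := h (fun z => F0' (z.2, z.1)).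
 apply/measurable_EFinP;move: h;congr measurable_fun;apply/funext => y.
 by rewrite /F' /= -(intgE msrT (fy y)).
have A0 : 0 <= vol A by exact:vol_ge0.
have M0 : 0 <= M by have /andP[h1 h2] := F0 (0, 0);exact:le_trans h2.
have le1 (y : E) : 0 <= intg setT (fun x => F (x, y)) <= M * vol A.
 apply/andP;split;first exact:intg_ge0.
 have iD : integ setT ((fun=> M) \_ A) by apply:(integ_mk _ mA).1;exact:integ_cst.
 rewrite -(intg_cst M mA) [leRHS]intg_mk;apply:intg_le => // x _.
 have /andP[h1 h2] := F0 (x, y);rewrite patchE;case:ifPn => // xA.
 have [->//|/FAB[/mem_set h' _]] := eqVneq (F (x, y)) 0;by rewrite h' in xA.
have iy : integ setT (fun y => intg setT (fun x => F (x, y))).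
 apply:(dom B _ (M * vol A)) => // y;apply:contraPP => yB;apply/negP;rewrite negbK.
 apply/eqP;rewrite -[RHS](@intg0 R n setT);apply:eq_intg => x _.
 by apply/eqP/negPn/negP => /FAB[_].
have [ix e] := intg_tonelli mF F0' fx fy iy.
by split.
Qed.

(** The l^1 norm, because the mean value theorem used here moves one coordinate at a time. *)
Definition gsum (X : E) : R := \sum_(i < n) `|X ord0 i|.

Lemma gsum_ge0 X : 0 <= gsum X. Proof. by apply:sumr_ge0. Qed.

Lemma gsumB X Y : gsum X <= gsum Y + gsum (X - Y).
Proof.
rewrite -big_split/=;apply:ler_sum => i _;rewrite !mxE.
by have := ler_normD (Y ord0 i) (X ord0 i - Y ord0 i);rewrite (addrC (Y ord0 i)) subrK.
Qed.

Lemma gsum_le_enorm X : gsum X <= n%:R * enorm X.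
Proof.
rewrite mulr_natl -[n in _ *+ n]card_ord -sumr_const;apply:ler_sum => i _.
exact:coord_le_enorm.
Qed.

Lemma ball_convex (x0 : E) r x y (t : R) : ball x0 r x -> ball x0 r (x + y) -> 0 <= t <= 1 -> ball x0 r (x + t *: y).
Proof.
rewrite -!ball_normE /= => h1 h2 /andP[t0 t1].
have -> : x0 - (x + t *: y) = (1 - t) *: (x0 - x) + t *: (x0 - (x + y)).
 rewrite scalerBl scale1r !scalerBr scalerDr;apply/rowP => i;rewrite !mxE;ring.
apply:(le_lt_trans (ler_normD _ _));rewrite !normrZ !ger0_norm ?subr_ge0//.
have [->|t0'] := eqVneq t 0;first by rewrite subr0 mul1r mul0r addr0.
have tp : 0 < t by rewrite lt_def t0'.
have a1 : (1 - t) * `|x0 - x| <= (1 - t) * r by rewrite ler_wpM2l ?subr_ge0// ltW.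
have a2 : t * `|x0 - (x + y)| < t * r by rewrite ltr_pM2l.
by have := ltr_leD a2 a1;rewrite addrC => /lt_le_trans;apply;lra.
Qed.

Lemma gsum_grad_integ phi (x0 : E) r : Ck 1 phi -> integ (ball x0 r) (fun x => gsum (grad phi x)).
Proof.
move=>Cp;apply:integ_sum;first exact:msr_ball.
move=>i;apply:integ_abs;first exact:msr_ball.
have [_ /(_ i)[_ ci]] := Cp.
have [M M0 hM] := cont_maxK (@cball_cpt R n x0 r) (fun x _ => ci x).
apply:(@integ_bdd _ _ _ _ M);[exact:msr_ball|exact:lamB_lty|exact:meas_grad|].
by move=>x;rewrite -ball_normE /= gradE => /ltW;exact:hM.
Qed.

(** The segment from [x] to [x + y] is cut into [m] short pieces, which stay in the convex cube. On
    each piece the increment of [phi] is bounded, up to [e], by the gradient at the starting point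
    [zk k x]; each of the resulting integrals is a translate of the integral over the cube. *)
Lemma translation_C1 phi (x0 y : E) r : Ck 1 phi -> 0 < r ->
 let g := fun x => `|phi (x + y) - phi x| * (\1_(ball x0 r) x * \1_(ball x0 r) (x + y)) in
 integ setT g /\ intg setT g <= `|y| * intg (ball x0 r) (fun x => gsum (grad phi x)).
Proof.
move=>Cp r0 g;have [cp Cd] := Cp;set Q : set E := ball x0 r.
have mQ : msr Q by exact:msr_ball.
have Qf : (mu Q < +oo)%E by exact:lamB_lty.
have shiftE (z : E) x : affine 1 z x = x + z by rewrite /affine scale1r.
have mshift (h : E -> R) z : meas setT h -> meas setT (fun x => h (x + z)).
 move=>mh;have := measurableT_comp mh (@measurable_affine R n 1 z (oner_neq0 _)).
 by congr measurable_fun;apply/funext => x /=;rewrite shiftE.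
have m1Q : meas setT (\1_Q : E -> R) by exact:meas_indic.
have mi : meas setT (fun x => \1_Q x * \1_Q (x + y) : R) := measM m1Q (mshift (\1_Q : E -> R) y m1Q).
have mphi : meas setT phi := meas_cont cp.
have mp := meas_norm (measB (mshift phi y mphi) mphi).
have mg : meas setT g := measM mp mi.
pose S := fun x => gsum (grad phi x).
have iS : integ Q S by exact:gsum_grad_integ.
have iST := (integ_mk S mQ).1 iS.
have i1 : integ setT ((fun=> (1 : R)) \_ Q) by apply:(integ_mk _ mQ).1;exact:integ_cst.
have shift_int (h : E -> R) z : integ setT h -> integ setT (fun x => h (x + z)) /\ intg setT (fun x => h (x + z)) = intg setT h.
 move=>hi;have [j1 j2] := intg_affine z (oner_neq0 _) hi.
 have e (x : E) : setT x -> h (affine 1 z x) = h (x + z) by rewrite shiftE.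
 split;first exact:eq_integ e j1.
 by rewrite -(eq_intg e) j2 normr1 expr1n invr1 mul1r.
suff key e : 0 < e -> exists h : E -> R, [/\ integ setT h, (forall x, 0 <= g x <= h x) &
  intg setT h <= `|y| * intg Q S + e * (`|y| * n%:R * vol Q)].
 have gi : integ setT g.
  have [h [hi gh _]] := key 1 ltr01;apply:(integ_le msrT mg _ hi) => x _.
  by have /andP[a1 a2] := gh x;rewrite ger0_norm.
 split => //;rewrite -subr_le0.
 apply:(@le_all_small _ _ (`|y| * n%:R * vol Q));first by rewrite !mulr_ge0 ?vol_ge0.
 move=>e e0;have [h [hi gh hh]] := key e e0;rewrite lerBlDl (le_trans _ hh)//.
 by apply:intg_le => // x _;have /andP[] := gh x.
move=>e0.
have [d d0 hd] : exists2 d0, 0 < d0 & forall (i : 'I_n) d, 0 < d <= d0 ->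
  forall x z, Q x -> `|x - z| <= d -> `|'D_(evec i) phi x - 'D_(evec i) phi z| <= e.
 apply:finite_small => i;have [_ ci] := Cd i.
 have [dd dd0 hdd] := cpt_ucont (@cball_cpt R n x0 r) (fun x _ => ci x) e0.
 exists dd => // d /andP[_ dle] x z;rewrite /Q -ball_normE /= => /ltW xQ xz.
 by apply:hdd => //;exact:le_trans dle.
(* The pieces have length at most [d], so the partial derivatives vary by at most [e] along them. *)
pose m := (Num.bound (`|y| / d)).+1.
have m0 : (0 : R) < m%:R by [].
have ym : `|y| / m%:R <= d.
 rewrite ler_pdivrMr// mulrC -ler_pdivrMr// ltW//.
 apply:(lt_le_trans (@archi_boundP R _ _));first by rewrite divr_ge0 ?(ltW d0).
 by rewrite ler_nat.
pose zk (k : nat) (x : E) : E := x + (k%:R / m%:R) *: y.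
pose h (x : E) : R := \sum_(k < m) (`|y| / m%:R) * ((S \_ Q) (zk k x) + n%:R * e * ((fun=> (1 : R)) \_ Q) (zk k x)).
have hki k : integ setT (fun x => (S \_ Q) (zk k x) + n%:R * e * ((fun=> (1 : R)) \_ Q) (zk k x)) /\
  intg setT (fun x => (S \_ Q) (zk k x) + n%:R * e * ((fun=> (1 : R)) \_ Q) (zk k x)) = intg Q S + n%:R * e * vol Q.
 have [a1 a2] := shift_int _ ((k%:R / m%:R) *: y) iST.
 have [b1 b2] := shift_int _ ((k%:R / m%:R) *: y) i1.
 have b3 := integZ (n%:R * e) msrT b1.
 split;first exact:(integD msrT a1 b3).
 rewrite (intgD msrT a1 b3) a2 (intgZ _ msrT b1) b2 -(intg_mk Q S) -(intg_mk Q (fun=> 1)).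
 by rewrite (intg_cst 1 mQ) mul1r.
exists h;split.
- by apply:integ_sum => // k;apply:integZ => //;have [] := hki k.
- move=>x;apply/andP;split;first by rewrite !mulr_ge0// indicE ler0n.
 have h0 : 0 <= h x.
  apply:sumr_ge0 => k _;rewrite mulr_ge0 ?divr_ge0// addr_ge0//.
   by rewrite patchE;case:ifP => // _;exact:gsum_ge0.
  by rewrite !mulr_ge0 ?(ltW e0)// patchE;case:ifP.
 rewrite /g;have [/set_mem xQ|xQ] := boolP (x \in Q);last by rewrite !indicE (negbTE xQ) mul0r mulr0.
 have [/set_mem yQ|yQ] := boolP (x + y \in Q);last by rewrite !indicE (negbTE yQ) !mulr0.
 rewrite !indicE !mem_set// !mulr1.
 have zQ k : (k <= m)%N -> Q (zk k x).
  move=>km;apply:ball_convex => //;rewrite divr_ge0// ler_pdivrMr// mul1r ler_nat//.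
 have -> : phi (x + y) - phi x = \sum_(k < m) (phi (zk k.+1 x) - phi (zk k x)).
  rewrite -(big_mkord xpredT (fun k => phi (zk k.+1 x) - phi (zk k x))) telescope_sumr// /zk.
  by rewrite mul0r scale0r addr0 divff ?scale1r// gt_eqF.
 apply:(le_trans (ler_norm_sum _ _ _));apply:ler_sum => k _.
 have km : (k <= m)%N by exact:ltnW.
 rewrite !patchE (mem_set (zQ k km)) mulr1.
 have [xi [xid ->]] := coordinate_mean_value (zk k x) (zk k.+1 x) Cp.
 have dz : zk k.+1 x - zk k x = m%:R^-1 *: y.
  by rewrite /zk opprD addrACA subrr add0r -scalerBl -mulrBl -natrB// subSn// subnn mul1r.
 have dzn : `|zk k.+1 x - zk k x| = `|y| / m%:R by rewrite dz normrZ ger0_norm ?invr_ge0// mulrC.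
 apply:(le_trans (ler_norm_sum _ _ _)).
 apply:(@le_trans _ _ (\sum_(j < n) (`|y| / m%:R) * (`|grad phi (zk k x) ord0 j| + e)));last first.
  by rewrite -mulr_sumr ler_wpM2l ?divr_ge0// big_split/= lerD2l sumr_const card_ord mulr_natl lexx.
 apply:ler_sum => j _;rewrite normrM mulrC;apply:ler_pM => //.
  by rewrite -dzn;have := coord_le_norm (zk k.+1 x - zk k x) j;rewrite !mxE.
 rewrite gradE -lerBlDl;apply:(le_trans (lerB_dist _ _));rewrite distrC.
 apply:(hd j d);rewrite ?d0 ?lexx//;first exact:zQ.
 by rewrite distrC (le_trans (xid j))// dzn.
- rewrite /h intg_sum//;last by move=>k;apply:integZ => //;have [] := hki k.
 rewrite (eq_bigr (fun=> (`|y| / m%:R) * (intg Q S + n%:R * e * vol Q)));last first.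
  by move=>k _;have [k1 k2] := hki k;rewrite (intgZ _ msrT k1) k2.
 have cancel (X : R) : m%:R * (`|y| / m%:R * X) = `|y| * X by field;rewrite gt_eqF.
 rewrite sumr_const card_ord -[_ *+ m]mulr_natl cancel.
 by rewrite le_eqVlt;apply/orP;left;apply/eqP;ring.
Qed.

Lemma meas2_comp (h : R -> R) (F : E * E -> R) : measurable_fun setT h -> meas2 F -> meas2 (fun z => h (F z)).
Proof. by move=>mh mF;exact:measurableT_comp. Qed.

Lemma meas2_indic_ball (x0 : E) r (F : E * E -> E) : continuous F -> 0 < r ->
 meas2 (fun z => \1_(ball x0 r) (F z)).
Proof.
move=>cF r0.
have -> : (fun z => \1_(ball x0 r) (F z)) = (fun z => (\1_(`]0, +oo[%classic) : R -> R) (r - `|x0 - F z|)).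
 apply/funext => z;rewrite !indicE;congr (_%:R);congr nat_of_bool.
 apply/idP/idP => /set_mem;rewrite -ball_normE /= ?in_itv/= ?andbT => h;apply/mem_set.
  by rewrite /= in_itv/= andbT subr_gt0.
 by rewrite /= -subr_gt0.
apply:(@meas2_comp _ (fun z => r - `|x0 - F z|));first by apply:measurable_indic.
apply:meas2_cont => z;apply:(@continuousB _ _ _ (cst r) (fun z => `|x0 - F z|));first exact:cst_continuous.
apply:continuous_comp;last exact:norm_continuous.
by apply:(@continuousB _ _ _ (cst x0) F);[exact:cst_continuous|exact:cF].
Qed.

(** The increments of [phi] are integrated over [x] in the ball and [|y| < s]. By [translation_C1]
    the result is at most the right-hand side; and the integrand is at least [del] on the pairs with
    [x] in [Z1] and [x + y] in [Z0], which have measure at least [vol Z1 * kap]. *)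
Lemma level_gap_C1 phi (x0 : E) r s (Z0 Z1 : set E) (kap del : R) : Ck 1 phi -> 0 < r -> 0 < s ->
 msr Z0 -> msr Z1 -> Z0 `<=` ball x0 r -> Z1 `<=` ball x0 r -> 0 <= kap -> 0 <= del ->
 (forall x z, Z1 x -> Z0 z -> del <= `|phi z - phi x|) ->
 (forall x, Z1 x -> kap <= vol (Z0 `&` ball x s)) ->
 vol Z1 * kap * del <= s * vol (ball (0 : E) s) * intg (ball x0 r) (fun x => gsum (grad phi x)).
Proof.
move=>Cp r0 s0 m0 m1 Z0Q Z1Q k0 d0 hdel hkap;have cp := Ck_cont Cp.
set Q : set E := ball x0 r;set Bs : set E := ball 0 s.
have mQ : msr Q by exact:msr_ball.
have mB : msr Bs by exact:msr_ball.
have Qf : (mu Q < +oo)%E by exact:lamB_lty.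
have Bf : (mu Bs < +oo)%E by exact:lamB_lty.
set IS := intg Q _;have IS0 : 0 <= IS by apply:intg_ge0 => x _;exact:gsum_ge0.
pose F (z : E * E) : R := `|phi (z.1 + z.2) - phi z.1| * (\1_Q z.1 * \1_Q (z.1 + z.2)) * \1_Bs z.2.
have cadd : continuous (fun z : E * E => z.1 + z.2) by move=>z;apply:cvgD;[exact:cvg_fst|exact:cvg_snd].
have mF : meas2 F.
 apply:meas2M;last by apply:(@meas2_snd _ _ (\1_Bs : E -> R));exact:meas_indic.
 apply:meas2M.
  apply:meas2_cont => z.
  apply:(@continuous_comp _ _ _ (fun z : E * E => phi (z.1 + z.2) - phi z.1) (fun t : R => `|t|));last exact:norm_continuous.
  apply:(@continuousB _ _ _ (fun z : E * E => phi (z.1 + z.2)) (fun z => phi z.1)).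
   by apply:continuous_comp;[exact:cadd|exact:cp].
  by apply:continuous_comp;[exact:cvg_fst|exact:cp].
 apply:meas2M;last exact:meas2_indic_ball.
 by apply:(@meas2_fst _ _ (\1_Q : E -> R));exact:meas_indic.
have [M M0 hM] := cont_maxK (@cball_cpt R n x0 r) (fun x _ => cp x).
have hMQ x : Q x -> `|phi x| <= M by rewrite /Q -ball_normE /= => /ltW;exact:hM.
have Fb z : 0 <= F z <= 2 * M.
 rewrite /F;have [/set_mem q1|q1] := boolP (z.1 \in Q);last by rewrite !indicE (negbTE q1) mul0r mulr0 mul0r lexx mulr_ge0 ?ltW.
 have [/set_mem q2|q2] := boolP (z.1 + z.2 \in Q);last by rewrite !indicE (negbTE q2) !mulr0 mul0r lexx mulr_ge0 ?ltW.
 rewrite !indicE (mem_set q1) (mem_set q2) !mulr1;case:(z.2 \in Bs);last by rewrite mulr0 lexx mulr_ge0 ?ltW.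
 rewrite mulr1 normr_ge0/=;apply:(le_trans (ler_normB _ _));have := hMQ _ q1;have := hMQ _ q2;lra.
have Fs x y : F (x, y) != 0 -> Q x /\ Bs y.
 rewrite /F /=;have [/set_mem q1|q1] := boolP (x \in Q);last by rewrite !indicE (negbTE q1) mul0r mulr0 mul0r eqxx.
 have [/set_mem q2 //|q2] := boolP (y \in Bs);by rewrite !indicE (negbTE q2) mulr0 eqxx.
have [i1 i2 i3 i4 e] := intg_tonelli_bdd mF mQ mB Qf Bf Fb Fs.
have up : intg setT (fun y => intg setT (fun x => F (x, y))) <= s * vol Bs * IS.
 have iB : integ setT ((fun=> s * IS) \_ Bs) by apply:(integ_mk _ mB).1;exact:integ_cst.
 have -> : s * vol Bs * IS = intg setT ((fun=> s * IS) \_ Bs).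
  by rewrite -(intg_mk Bs (fun=> s * IS)) (intg_cst _ mB);ring.
 apply:(intg_le msrT i3 iB) => y _.
 have [gi gl] := translation_C1 x0 y Cp r0.
 have -> : (fun x => F (x, y)) = (fun x => \1_Bs y * (`|phi (x + y) - phi x| * (\1_Q x * \1_Q (x + y)))).
  by apply/funext => x;rewrite /F /= mulrC.
 rewrite (intgZ _ msrT gi) patchE indicE;case:ifPn => yB;last by rewrite mul0r.
 rewrite mul1r;apply:(le_trans gl);apply:(ler_wpM2r IS0).
 by move/set_mem: yB;rewrite /Bs -ball_normE /= sub0r normrN => /ltW.
rewrite -e in up;apply:le_trans up.
have Z1f : (mu Z1 < +oo)%E by exact:lamS_lty Qf.
have iZ : integ setT ((fun=> kap * del) \_ Z1) by apply:(integ_mk _ m1).1;exact:integ_cst.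
have -> : vol Z1 * kap * del = intg setT ((fun=> kap * del) \_ Z1).
 by rewrite -(intg_mk Z1 (fun=> kap * del)) (intg_cst _ m1);ring.
apply:(intg_le msrT iZ i4) => x _;rewrite patchE;case:ifPn => [/set_mem xZ|_];last first.
 by apply:intg_ge0 => y _;have /andP[] := Fb (x, y).
set C : set E := Z0 `&` ball x s.
have mC : msr C := msrI m0 (@msr_ball R n x s).
have Cf : (mu C < +oo)%E by apply:lamS_lty Qf => z [/Z0Q].
have iC : integ setT ((fun=> del) \_ C) by apply:(integ_mk _ mC).1;exact:integ_cst.
have [j1 j2] := intg_affine x (oner_neq0 _) iC.
have lo : intg setT (fun y => ((fun=> del) \_ C) (affine 1 x y)) <= intg setT (fun y => F (x, y)).
 apply:(intg_le msrT j1 (i1 x)) => y _;rewrite patchE;case:ifPn => [/set_mem|_];last by have /andP[] := Fb (x, y).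
 rewrite /affine scale1r addrC => -[yZ];rewrite -ball_normE /= opprD addrA subrr sub0r normrN => ys.
 rewrite /F /= !indicE !mem_set;[|by rewrite /Bs -ball_normE /= sub0r normrN|exact:Z0Q|exact:Z1Q].
 by rewrite !mulr1;exact:hdel.
apply:le_trans lo;rewrite j2 normr1 expr1n invr1 mul1r -(intg_mk C (fun=> del)) (intg_cst _ mC) mulrC.
exact:(ler_wpM2l d0 (hkap x xZ)).
Qed.

(** De Giorgi's isoperimetric inequality. Approximation by C^1 functions blurs the levels by [e] on
    each side; the gradient error in L^1 is split by Young's inequality with parameter [d], and [e]
    tends to 0 before [d]. *)
Lemma level_gap p U f G (x0 : E) r s (Z0 Z1 : set E) (kap a b : R) : 1 < p -> Wfn p U f G ->
 [set y | `|x0 - y| <= r] `<=` U -> 0 < r -> 0 < s -> msr Z0 -> msr Z1 ->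
 Z0 `<=` ball x0 r -> Z1 `<=` ball x0 r -> 0 <= kap -> a < b ->
 (forall x, Z0 x -> f x <= a) -> (forall x, Z1 x -> b <= f x) ->
 (forall x, Z1 x -> kap <= vol (Z0 `&` ball x s)) ->
 integ (ball x0 r) (fun x => enorm (G x)) /\
 vol Z1 * kap * (b - a) <= s * vol (ball (0 : E) s) * (n%:R * intg (ball x0 r) (fun x => enorm (G x))).
Proof.
move=>p1 W KU r0 s0 m0 m1 Z0Q Z1Q k0 ab h0 h1 hk.
have [_ f2 f3 f4] := W;set K := [set y | _] in KU;have cK : compact K by exact:cball_cpt.
have mK := msr_cpt cK;set Q : set E := ball x0 r;have mQ : msr Q by exact:msr_ball.
have QK : Q `<=` K by move=>x;rewrite /Q -ball_normE /= => /ltW.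
have Qf : (mu Q < +oo)%E by exact:lamB_lty.
have dom (X : E -> E) (d : R) : 0 < d -> (forall i, meas K (fun x => X x ord0 i)) -> integ K (fun x => enorm (X x) `^ p) ->
  integ Q (fun x => enorm (X x)) /\ intg Q (fun x => enorm (X x)) <= d * vol Q + d `^ (1 - p) * intg K (fun x => enorm (X x) `^ p).
 move=>d0 mX iX;have iQ := integ_sub mK mQ QK iX.
 have bd x : Q x -> enorm (X x) <= d + d `^ (1 - p) * enorm (X x) `^ p.
  by move=>_;have := young_trivial ler01 (enorm_ge0 (X x)) d0 p1;rewrite !powR1 mul1r mulr1.
 have c1 := integ_cst d mQ Qf;have c2 := integZ (d `^ (1 - p)) mQ iQ;have isum := integD mQ c1 c2.
 have mXQ : meas Q (fun x => enorm (X x)) by apply:(meas_sub mK QK);exact:meas_enorm.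
 have ii : integ Q (fun x => enorm (X x)).
  by apply:(integ_le mQ mXQ _ isum) => x Qx;rewrite ger0_norm ?enorm_ge0// bd.
 split => //;apply:(le_trans (intg_le mQ ii isum bd)).
 rewrite (intgD mQ c1 c2) (intg_cst _ mQ) (intgZ _ mQ iQ) lerD2l ler_wpM2l ?powR_ge0//.
 by apply:(intg_subset mK mQ QK iX) => x _;exact:powR_ge0.
have GI := f3 K cK KU;have mG := f2 K cK KU.
have [iG _] := dom G 1 ltr01 mG GI;split => //.
set I := intg Q _;set v1 := vol Z1;have v10 : 0 <= v1 by exact:vol_ge0.
set c := s * vol _;have c0 : 0 <= c by rewrite mulr_ge0 ?vol_ge0// ltW.
rewrite -subr_le0;apply:(@le_all_small _ _ (c * (n%:R * vol Q)));first exact:(mulr_ge0 c0 (mulr_ge0 (ler0n _ _) (vol_ge0 _))).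
move=>d d0;rewrite -subr_le0.
have C0 : 0 <= 2 * (v1 * kap) + c * (n%:R * d `^ (1 - p)).
 exact:(addr_ge0 (mulr_ge0 (ler0n _ 2) (mulr_ge0 v10 k0)) (mulr_ge0 c0 (mulr_ge0 (ler0n _ _) (powR_ge0 _ _)))).
apply:(@le_all_small _ _ (2 * (v1 * kap) + c * (n%:R * d `^ (1 - p)))).
 exact:C0.
(* With [e <= (b - a) / 2] the two levels of [phi] do not cross. *)
move=>e0 e00;pose e := Num.min e0 ((b - a) / 2).
have epos : 0 < e by rewrite lt_min e00 divr_gt0// subr_gt0.
have ee : e <= e0 by rewrite ge_min lexx.
have eb : e <= (b - a) / 2 by rewrite ge_min lexx orbT.
have [phi [Cp pf ip lp]] := f4 K e cK KU epos.
have mgp i : meas K (fun x => (grad phi x - G x) ord0 i).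
 apply:(@eq_meas _ _ _ (fun x => grad phi x ord0 i - G x ord0 i));first by move=>x _;rewrite !mxE.
 by apply:measB;[exact:meas_grad|exact:mG].
have [iD lD] := dom (fun x => grad phi x - G x) d d0 mgp ip.
have del0 : 0 <= b - a - 2 * e by move: eb;clear;lra.
have := @level_gap_C1 phi x0 r s Z0 Z1 kap (b - a - 2 * e) Cp r0 s0 m0 m1 Z0Q Z1Q k0 del0 _ hk.
have hdel x z : Z1 x -> Z0 z -> b - a - 2 * e <= `|phi z - phi x|.
 move=>x1 z0;have a1 := pf x (QK x (Z1Q x x1));have a2 := pf z (QK z (Z0Q z z0)).
 have a3 := h1 x x1;have a4 := h0 z z0.
 rewrite distrC;apply:le_trans (ler_norm _).
 move: a1 a2;rewrite !ler_norml => /andP[b1 b2] /andP[b3 b4];lra.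
move=>/(_ hdel) hgap.
have SI : intg Q (fun x => gsum (grad phi x)) <= n%:R * I + n%:R * intg Q (fun x => enorm (grad phi x - G x)).
 have q1 := integZ n%:R mQ iG;have q2 := integZ n%:R mQ iD.
 rewrite -(intgZ _ mQ iG) -(intgZ _ mQ iD) -(intgD mQ q1 q2).
 apply:intg_le => //;[exact:gsum_grad_integ|exact:integD|].
 by move=>x _;apply:(le_trans (gsumB _ (G x)));apply:lerD;exact:gsum_le_enorm.
have c1 : c * intg Q (fun x => gsum (grad phi x)) <= c * (n%:R * I + n%:R * (d * vol Q + d `^ (1 - p) * e)).
 rewrite ler_wpM2l// (le_trans SI)// lerD2l ler_wpM2l// (le_trans lD)// lerD2l ler_wpM2l ?powR_ge0//.
have c2 := le_trans hgap c1.
have c3 : e * (2 * (v1 * kap) + c * (n%:R * d `^ (1 - p))) <= e0 * (2 * (v1 * kap) + c * (n%:R * d `^ (1 - p))).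
 exact:(ler_wpM2r C0 ee).
apply:le_trans c3;move: c2;rewrite -/v1.
move: (d `^ (1 - p)) (vol Q) => P vQ;clear;lra.
Qed.

(** If [f x > f y], small balls around the two points lie in a high and in a low level set, both of
    positive measure, which [level_gap] forbids when the gradient vanishes. *)
Lemma Wfn_ball_const p U B f G (x0 : E) r : 1 < p -> open U -> mu B = 0%E -> Wfn p U f G ->
 (forall x, U x -> ~ B x -> G x = 0) -> 0 < r -> [set y | `|x0 - y| <= r] `<=` U ->
 forall x y, ball x0 r x -> ball x0 r y -> f x <= f y.
Proof.
move=>p1 oU B0 W G0 r0 KU x y Qx Qy;rewrite leNgt;apply/negP => yx.
have [f1 _ _ _] := W.
have UQ z : ball x0 r z -> U z by move=>Qz;apply:KU;move: Qz;rewrite -ball_normE /= => /ltW.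
pose a := (2 * f y + f x) / 3;pose b := (f y + 2 * f x) / 3.
have ab : a < b by rewrite /a /b;lra.
have nb (z : E) (c : R) : ball x0 r z -> 0 < c -> exists2 d, 0 < d & ball z d `<=` ball x0 r `&` [set w | `|f z - f w| <= c].
 move=>Qz c0;have /cont_rVP/(_ c c0)[d1 d10 hd1] := f1 z (UQ z Qz).
 have /nbhs_ballP[d2 /= d20 hd2] := open_nbhs_nbhs (conj (ball_open x0 r) Qz).
 exists (Num.min d1 d2);first by rewrite lt_min d10.
 move=>w;rewrite -ball_normE /= lt_min => /andP[w1 w2];split;last exact:hd1.
 by have := hd2 w;rewrite -!ball_normE /=;apply.
have c0 : 0 < (f x - f y) / 3 by lra.
have [d0 d00 hd0] := nb y _ Qy c0;have [d1 d10 hd1] := nb x _ Qx c0.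
pose Z0 : set E := ball y d0;pose Z1 : set E := ball x d1.
have Z0Q : Z0 `<=` ball x0 r by move=>z /hd0[].
have Z1Q : Z1 `<=` ball x0 r by move=>z /hd1[].
have h0 z : Z0 z -> f z <= a.
 by move=>/hd0[_ /=];rewrite ler_norml /a => /andP[h1 h2];lra.
have h1 z : Z1 z -> b <= f z.
 by move=>/hd1[_ /=];rewrite ler_norml /b => /andP[h1 h2];lra.
have r2 : 0 < 2 * r by lra.
have hk z : Z1 z -> vol Z0 <= vol (Z0 `&` ball z (2 * r)).
 move=>/Z1Q Qz;rewrite (_ : Z0 `&` _ = Z0)//;apply/seteqP;split=> [w []//|w Zw];split => //.
 move: (Z0Q w Zw) Qz;rewrite -!ball_normE /= => w1 z1.
 by have := ler_distD x0 z w;rewrite (distrC z x0);lra.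
have [iG hG] := level_gap p1 W KU r0 r2 (@msr_ball R n y d0) (@msr_ball R n x d1) Z0Q Z1Q (vol_ge0 _) ab h0 h1 hk.
have : intg (ball x0 r) (fun z => enorm (G z)) = 0.
 rewrite -[RHS](@intg0 R n (ball x0 r));apply:(eq_intg_ae B0 (@msr_ball R n x0 r)).
  by move=>z Qz Bz;rewrite (G0 z (UQ z Qz) Bz) enorm0.
 exact:integ_meas iG.
move=>e;rewrite e !mulr0 in hG;move: hG;rewrite leNgt => /negP;apply.
by rewrite !mulr_gt0 ?subr_gt0// vol_ball// mulr_gt0 ?exprn_gt0//;exact:cube_vol_gt0.
Qed.

End Translation.

(** * Sobolev calculus: products, logarithms and cutoffs *)

Section SobolevCalculus.
Context {R : realType} {n : nat}.
Local Notation E := 'rV[R]_n.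
Local Notation L := (lebType R n).
Local Notation mu := (@lam R n).
Implicit Types (f g : E -> R) (F G : E -> E) (U K : set E) (p : R).

Definition pospart (t : R) : R := 2^-1 * (t + `|t|).
(** Squaring makes the positive part C^1, as composition with a [Wfn] function requires. *)
Definition sqpos (t : R) : R := pospart t ^+ 2.

Lemma pospartE (t : R) : pospart t = if t < 0 then 0 else t.
Proof.
rewrite /pospart;case:ltP => t0;last by rewrite ger0_norm//;lra.
by rewrite ltr0_norm//;lra.
Qed.

Lemma pospart_ge0 t : 0 <= pospart t. Proof. by rewrite pospartE;case:ltP. Qed.

Lemma pos_cont : continuous pospart.
Proof.
apply:contM;first exact:contC.
by apply:contD => t;[exact:cvg_id|exact:norm_continuous].
Qed.

Lemma is_derive_sqpos (t : R) : is_derive t (1 : R) sqpos (2 * pospart t).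
Proof.
have sq (s : R) : is_derive s (1 : R) (fun r : R => r * r) (2 * s).
 have := @is_deriveM _ _ (@id R) id s 1 1 1 (is_derive_id _ _) (is_derive_id _ _).
 by rewrite /GRing.scale/= !mulr1;congr is_derive;ring.
have [t0|t0|t0] := ltgtP t 0.
- rewrite pospartE t0 mulr0.
 have loc : \forall s \near t, (0 : R) = sqpos s.
  by near=> s;rewrite /sqpos pospartE ifT ?expr0n//;near: s;exact:lt_nbhsl.
 apply:(near_eq_is_derive loc);exact:is_derive_cst.
- rewrite pospartE ltNge (ltW t0)/=.
 have loc : \forall s \near t, s * s = sqpos s.
  by near=> s;rewrite /sqpos pospartE ifF ?expr2//;apply/negbTE;rewrite -leNgt ltW//;near: s;exact:lt_nbhsr.
 exact:(near_eq_is_derive loc).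
- rewrite t0 pospartE ltxx mulr0;apply:is_derive_small;first by rewrite /sqpos pospartE ltxx expr0n.
 move=>e e0;exists e => // s se;rewrite ger0_norm ?sqr_ge0// /sqpos pospartE;case:ltP => s0.
  by rewrite expr0n/= mulr_ge0// ltW.
 by rewrite expr2;move: se;rewrite ger0_norm// => /ltW;exact:ler_wpM2r.
Unshelve. all: by end_near. Qed.

Lemma Wfn_compC p U f G (h dh : R -> R) : 1 < p -> open U -> Wfn p U f G ->
 (forall t, is_derive t (1 : R) h (dh t)) -> continuous dh ->
 Wfn p U (fun x => h (f x)) (fun x => dh (f x) *: G x).
Proof.
move=>p1 oU W hd cd;apply:Wfn_comp => // K _ _;exists h.
have e : derive1 h = dh by apply/funext => t;exact:is_derive1_eq.
by split => [t||x _];rewrite ?e//;have [] := hd t.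
Qed.

(** Polarization: the product is a quarter of the difference of two squares, so linear combinations
    and compositions suffice. *)
Lemma Wfn_mul p U f F g G : 1 < p -> open U -> Wfn p U f F -> Wfn p U g G ->
 Wfn p U (fun x => f x * g x) (fun x => f x *: G x + g x *: F x).
Proof.
move=>p1 oU Wf Wg.
have sq (s : R) : is_derive s (1 : R) (fun r : R => r * r) (2 * s).
 have := @is_deriveM _ _ (@id R) id s 1 1 1 (is_derive_id _ _) (is_derive_id _ _).
 by rewrite /GRing.scale/= !mulr1;congr is_derive;ring.
have c2 : continuous (fun s : R => 2 * s).
 by apply:contM => [|t];[exact:contC|exact:cvg_id].
have W1 := Wfn_compC p1 oU (Wfn_lin 1 1 p1 oU Wf Wg) sq c2.
have W2 := Wfn_compC p1 oU (Wfn_lin 1 (-1) p1 oU Wf Wg) sq c2.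
have W3 := Wfn_lin 4^-1 (- 4^-1) p1 oU W1 W2.
apply:Wfn_eq W3 => // x _;first by field.
by apply/rowP => i;rewrite !mxE;field.
Qed.

(** A C^1 extension of the logarithm from [t >= c] to the whole line: its argument equals [t] for
    [t >= c] and stays positive everywhere. *)
Lemma is_derive_lncut (c t : R) : 0 < c ->
 let th := t + c^-1 * sqpos (c - t) in
 0 < th /\ is_derive t (1 : R) (fun t => ln (t + c^-1 * sqpos (c - t))) ((1 - c^-1 * (2 * pospart (c - t))) / th).
Proof.
move=>c0 th;have cn0 : c != 0 by rewrite gt_eqF.
have th0 : 0 < th.
 rewrite /th /sqpos pospartE;case:(ltP (c - t) 0) => h;first by rewrite expr0n/= mulr0;lra.
 have -> : t + c^-1 * (c - t) ^+ 2 = c^-1 * ((t - c / 2) ^+ 2 + 3 / 4 * c ^+ 2) by field.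
 rewrite mulr_gt0 ?invr_gt0//;have : 0 < c ^+ 2 by rewrite exprn_gt0.
 by have := sqr_ge0 (t - c / 2);lra.
split => //.
have d1 : is_derive t (1 : R) (fun t : R => c - t) (-1).
 have := @is_deriveB _ _ _ (cst c) (@id R) t (1 : R) 0 1 (is_derive_cst _ _ _) (is_derive_id _ _).
 by rewrite sub0r.
have d2 := @is_derive1_comp _ sqpos (fun t => c - t) t _ _ (is_derive_sqpos _) d1.
have d3 := @is_deriveZ _ _ _ (sqpos \o (fun t => c - t)) c^-1 t 1 _ d2.
have d4 := @is_deriveD _ _ _ (@id R) _ t (1 : R) 1 _ (is_derive_id _ _) d3.
have d5 := @is_derive1_ln _ _ th0.
have := @is_derive1_comp _ (@ln R) (fun t => t + c^-1 * sqpos (c - t)) t _ _ d5 d4.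
congr is_derive;rewrite /GRing.scale/= -/th;ring.
Qed.

Lemma Wfn_ln p U f G : 1 < p -> open U -> (forall x, U x -> 0 < f x) -> Wfn p U f G ->
 Wfn p U (fun x => ln (f x)) (fun x => (f x)^-1 *: G x).
Proof.
move=>p1 oU f0 W;apply:(Wfn_comp (dh := fun t : R => t^-1)) => // K cK KU.
have [c c0 hc] : exists2 c, 0 < c & forall x, K x -> c <= f x.
 have [W1 _ _ _] := W.
 have ci : {in K, continuous (fun x => (f x)^-1)}.
  move=>x /set_mem/KU Ux;apply:(@continuousV R _ f x);last exact:W1.
  by rewrite gt_eqF// f0.
 have [M M0 hM] := cont_maxK cK ci.
 exists M^-1;first by rewrite invr_gt0.
 move=>x Kx;have fx := f0 x (KU x Kx);rewrite -[leRHS]invrK lef_pV2 ?posrE ?invr_gt0//.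
 by apply:le_trans (hM x Kx);exact:ler_norm.
pose dPsi (t : R) := (1 - c^-1 * (2 * pospart (c - t))) / (t + c^-1 * sqpos (c - t)).
have dE t : is_derive t (1 : R) (fun t => ln (t + c^-1 * sqpos (c - t))) (dPsi t).
 by have [] := is_derive_lncut t c0.
have e : derive1 (fun t => ln (t + c^-1 * sqpos (c - t))) = dPsi by apply/funext => t;exact:is_derive1_eq.
have z t : c <= t -> pospart (c - t) = 0.
 rewrite pospartE;case:ltP => // h1 h2;apply/eqP;rewrite eq_le h1 andbT;lra.
exists (fun t => ln (t + c^-1 * sqpos (c - t)));split.
- by move=>t;have [] := dE t.
- rewrite e.
 have cpp : continuous (fun t => pospart (c - t)).
  apply:cont_comp pos_cont.
  by apply:contB => [|t];[exact:contC|exact:cvg_id].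
 apply:contM.
  apply:contB;first exact:contC.
  apply:contM;first exact:contC.
  by apply:contM => //;exact:contC.
 move=>t;apply:(@continuousV R _ (fun t => t + c^-1 * sqpos (c - t)) t).
  by have [/lt0r_neq0] := is_derive_lncut t c0.
 move: t;apply:contD;first by move=>t;exact:cvg_id.
 by apply:contM;[exact:contC|exact:contM].
- move=>x Kx;have zx := z _ (hc x Kx).
 by rewrite e /dPsi /sqpos zx expr0n/= !mulr0 addr0 subr0 div1r.
Qed.

Lemma Wfn_exp p U f G : 1 < p -> open U -> Wfn p U f G ->
 Wfn p U (fun x => expR (f x)) (fun x => expR (f x) *: G x).
Proof.
move=>p1 oU W;exact:(Wfn_compC p1 oU W (@is_derive_expR R) (@continuous_expR R)).
Qed.

Lemma cutoff K U : compact K -> open U -> K `<=` U -> exists eta K2,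
 [/\ Ck 1 eta, compact K2, K2 `<=` U & [/\ forall x, ~ K2 x -> eta x = 0, forall x, 0 <= eta x <= 1,
   K `<=` K2 & forall x, K x -> eta x = 1 /\ grad eta x = 0]].
Proof.
move=>cK oU KU;have [K2 [d2 [d20 cK2 K2U h2]]] := compact_nbhd cK oU KU.
pose d := d2 / 4;have d0 : 0 < d by rewrite /d;lra.
pose K1 : set E := [set x | exists2 y, K y & `|y - x| <= 2 * d].
have [K1' cK1' K1E] : exists2 K1' : set E, compact K1' & K1' = K1.
 exists ((fun z : E * E => z.1 + z.2) @` (K `*` [set x | `|x| <= 2 * d])).
  apply:continuous_compact;last by apply:compact_setX => //;exact:clnorm_le.
  by apply:continuous_subspaceT => z;apply:cvgD;[exact:cvg_fst|exact:cvg_snd].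
 apply/seteqP;split => x.
  by move=>[[y z] [/= Ky zd] <-];exists y => //;rewrite opprD addrA subrr sub0r normrN.
 move=>[y Ky yx];exists (y, x - y);rewrite /= ?subrKC//;split => //=;by rewrite distrC.
have cK1 : compact K1 by rewrite -K1E.
have mK1 := msr_cpt cK1.
have f1 : integ setT ((fun=> (1 : R)) \_ K1).
 by apply:(integ_mk _ mK1).1;exact:(integ_cst _ mK1 (lamK_lty cK1)).
have sm := @moll_smooth R n d d0.
have f1v x : ((fun=> (1 : R)) \_ K1) x = 1 \/ ((fun=> (1 : R)) \_ K1) x = 0.
 by rewrite patchE;case:ifP;[left|right].
have conv1 x : (forall y, `|x - y| <= d -> K1 y) -> convol ((fun=> (1 : R)) \_ K1) (moll d) x = 1.
 move=>h;have K1x : ((fun=> (1 : R)) \_ K1) x = 1 by rewrite patchE mem_set//;apply:h;rewrite subrr normr0 ltW.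
 apply/eqP;rewrite -subr_eq0 -normr_le0 -[X in `|_ - X|]K1x.
 apply:conv_moll_close => // y xy;rewrite K1x patchE mem_set ?subrr ?normr0//;exact:h.
exists (convol ((fun=> (1 : R)) \_ K1) (moll d)), K2;split;[exact:Ck_conv sm|exact:cK2|exact:K2U|split].
- move=>x K2x;rewrite /convol -[RHS](@intg0 R n setT);apply:eq_intg => y _.
 have [yd|yd] := leP `|x - y| d;last by rewrite sm.2// mulr0.
 rewrite patchE memNset ?mul0r// => -[z Kz zy];apply:K2x;apply:(h2 z) => //.
 by have := ler_distD y z x;rewrite (distrC y x);rewrite /d in yd zy;lra.
- move=>x;have [mi m1] := moll_mass x d0.
 have ci := conv_integrable x f1 sm.
 apply/andP;split.
  by apply:intg_ge0 => y _;rewrite mulr_ge0 ?moll_ge0//;have [->|->] := f1v y.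
 have := intg_le msrT ci mi;rewrite m1;apply => y _.
 by rewrite ler_piMl ?moll_ge0//;have [->|->] := f1v y.
- by move=>x Kx;apply:(h2 x) => //;rewrite subrr normr0 ltW.
have near1 x y : K x -> `|x - y| <= d -> convol ((fun=> (1 : R)) \_ K1) (moll d) y = 1.
 move=>Kx xy;apply:conv1 => z yz;exists x => //.
 by have := ler_distD y x z;lra.
move=>x Kx;split;first by apply:(near1 x) => //;rewrite subrr normr0 ltW.
apply/rowP => i;rewrite gradE mxE -(derive_cst (1 : R) x (evec i));apply:near_eq_derive.
by apply/nbhs_ballP;exists d => //= y;rewrite -ball_normE /= => /ltW;exact:near1.
Qed.

Lemma intg_eq0_null (D : set E) f : msr D -> integ D f -> (forall x, D x -> 0 <= f x) -> intg D f = 0 ->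
 exists2 N : set E, mu N = 0%E & forall x, D x -> ~ N x -> f x = 0.
Proof.
move=>mD fi f0 I0.
have : (\int[mu]_(x in (D : set L)) `|(EFin \o (f : L -> R)) x| = 0)%E.
 rewrite (@eq_integral _ _ _ _ _ (EFin \o (f : L -> R)));last first.
  by move=>x /set_mem Dx /=;rewrite ger0_norm//;exact:f0.
 by have := intgE mD fi;rewrite I0 => <-.
have mf : measurable_fun (D : set L) (EFin \o (f : L -> R)) by exact/measurable_EFinP/(integ_meas fi).
move/(ae_eq_integral_abs mu mD mf) => /ae_null[N [_ N0 hN]].
exists N => // x Dx Nx;by have := hN x Nx Dx;move=>[].
Qed.

End SobolevCalculus.

(** * Weak comparison principle *)

Section Comparison.
Context {R : realType} {n : nat}.
Local Notation E := 'rV[R]_n.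
Local Notation mu := (@lam R n).
Implicit Types (f g u v V : E -> R) (F G : E -> E) (U K B : set E).

Lemma connected_locally_const U f (c : R) : open U -> connected U -> (forall x, U x -> {for x, continuous f}) ->
 (forall x, U x -> exists2 r, 0 < r & forall y, `|x - y| < r -> f y = f x) ->
 (exists2 x, U x & f x = c) -> forall x, U x -> f x = c.
Proof.
move=>oU cU cf loc [x0 Ux0 fx0].
pose D : set E := U `&` [set x | f x = c].
have oD : open D.
 rewrite openE => x [Ux fx];have [r r0 hr] := loc x Ux.
 have /nbhs_ballP[s /= s0 sU] := open_nbhs_nbhs (conj oU Ux).
 apply/nbhs_ballP;exists (Num.min r s);rewrite /= ?lt_min ?r0// => y.
 rewrite -ball_normE /= lt_min => /andP[y1 y2];split;first by apply:sU;rewrite -ball_normE.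
 by rewrite /= hr.
pose C : set E := U `&` [set x | f x != c].
have oC : open C.
 rewrite openE => x [Ux fx];have [r r0 hr] := loc x Ux.
 have /nbhs_ballP[s /= s0 sU] := open_nbhs_nbhs (conj oU Ux).
 apply/nbhs_ballP;exists (Num.min r s);rewrite /= ?lt_min ?r0// => y.
 rewrite -ball_normE /= lt_min => /andP[y1 y2];split;first by apply:sU;rewrite -ball_normE.
 by rewrite /= hr.
have DU : D = U.
 apply:cU;first by exists x0.
 - by exists D => //;apply/seteqP;split => x;[move=>[Ux fx];split|move=>[]].
 - exists (~` C);first exact:open_closedC.
  apply/seteqP;split => x.
   by move=>[Ux fx];split => // -[_ /eqP].
  move=>[Ux Cx];split => //=;apply/eqP/negPn/negP => h;exact:Cx.
move=>x Ux;have : D x by rewrite DU.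
by case.
Qed.

Section Fixed.
Variables (p al be : R) (U B : set E) (A : E -> E -> E) (V : E -> R).
Hypotheses (p1 : 1 < p) (be0 : 0 <= be) (oU : open U) (B0 : mu B = 0%E).
Hypothesis ell : elliptic p al be U B A.
Hypothesis iV : forall K, compact K -> K `<=` U -> integ K V.

Lemma wsol_scale u G (c : R) : 0 < c -> wsol p B A V U u G -> wsol p B A V U (fun x => c * u x) (fun x => c *: G x).
Proof.
move=>c0 [W u0 G0 mA wk];have [_ _ _ hA] := ell.
have hc x : U x -> A x (c *: G x) = c `^ (p - 1) *: A x (G x).
 by move=>Ux;have [_ _ ->] := hA x (G x) (G x) Ux.
have Wc : Wfn p U (fun x => c * u x) (fun x => c *: G x).
 apply:Wfn_eq (Wfn_lin c 0 p1 oU W W) => // x _;first by rewrite mul0r addr0.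
 by rewrite scale0r addr0.
split;first exact:Wc.
- by move=>x Ux;rewrite mulr_gt0// u0.
- by move=>x Bx;rewrite G0// scaler0.
- move=>K cK KU i;apply:(@eq_meas _ _ _ (fun x => c `^ (p - 1) * A x (G x) ord0 i)).
  by move=>x /KU Ux;rewrite hc// mxE.
 by apply:measM;[exact:meas_cst|exact:mA].
move=>phi tphi;have [Cphi cK KU] := tphi.
have h := wk phi tphi.
have [W1 W2 W3 _] := W.
set K := closure _ in cK KU;have mK := msr_cpt cK.
have ag x : U x -> enorm (A x (G x)) <= be * enorm (G x) `^ (p - 1) by have [h1 _ _ _] := ell;exact:h1.
have [_ _ gphi _] := @Wfn_C1 R n p U phi p1 (Cphi 1%N);have {}gphi := gphi K cK KU.
have i1 : integ K (fun x => dot (A x (G x)) (grad phi x)).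
 apply:(field_dot_integ p1 be0 (G := G) mA ag W3 cK KU _ gphi) => i;exact:meas_grad _ (Cphi 1%N).
have cphi := Ck_cont (Cphi 0%N).
have [M M0 hM] := cont_maxK cK (fun x _ => cphi x).
have up0 x : K x -> `|u x `^ (p - 1)| <= 1 + 0 + `|u x `^ (p - 1)| by move=>_;rewrite addr0 lerDr.
have [N N0 hN] := Wfn_bounded W cK KU.
have p10 : 0 <= p - 1 by rewrite subr_ge0 ltW.
have mu' : meas K u by exact:meas_cont_pts W1.
have i2 : integ K (fun x => V x * u x `^ (p - 1) * phi x).
 have mm : meas K (fun x => u x `^ (p - 1) * phi x) by apply:measM;[exact:meas_powR|exact:meas_cont].
 have hb x : K x -> `|u x `^ (p - 1) * phi x| <= N `^ (p - 1) * M.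
  move=>Kx;rewrite normrM ler_pM//;last exact:hM.
  rewrite ger0_norm ?powR_ge0//;apply:powR_mono => //;first by rewrite ltW// u0//;exact:KU.
  by apply:le_trans (hN x Kx);exact:ler_norm.
 apply:(eq_integ mK _ (integ_mulb mK mm hb (iV cK KU))) => x _.
 by rewrite mulrC mulrA.
rewrite (intg_cut KU);last by move=>x _ /clsupp0[_ ->];rewrite dot0r.
rewrite [X in _ + X](intg_cut KU);last by move=>x _ /clsupp0[-> _];rewrite mulr0.
rewrite (intg_cut KU) in h;last by move=>x _ /clsupp0[_ ->];rewrite dot0r.
rewrite [X in _ + X](intg_cut KU) in h;last by move=>x _ /clsupp0[-> _];rewrite mulr0.
have -> : intg K (fun x => dot (A x (c *: G x)) (grad phi x)) = c `^ (p - 1) * intg K (fun x => dot (A x (G x)) (grad phi x)).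
 by rewrite -(intgZ _ mK i1);apply:eq_intg => x /KU Ux;rewrite hc// dotZl.
have -> : intg K (fun x => V x * (c * u x) `^ (p - 1) * phi x) = c `^ (p - 1) * intg K (fun x => V x * u x `^ (p - 1) * phi x).
 rewrite -(intgZ _ mK i2);apply:eq_intg => x /KU Ux;rewrite powRM ?(ltW c0) ?(ltW (u0 x Ux))//.
 by ring.
by rewrite -mulrDr h mulr0.
Qed.

Lemma wsol_test u G f F eta K : wsol p B A V U u G -> Wfn p U f F -> Ck 1 eta -> compact K -> K `<=` U ->
 (forall x, ~ K x -> eta x = 0) ->
 [/\ integ K (fun x => dot (A x (G x)) (eta x *: F x)), integ K (fun x => dot (A x (G x)) (f x *: grad eta x)),
   integ K (fun x => V x * u x `^ (p - 1) * (f x * eta x)) &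
 intg K (fun x => dot (A x (G x)) (eta x *: F x)) + intg K (fun x => dot (A x (G x)) (f x *: grad eta x)) +
 intg K (fun x => V x * u x `^ (p - 1) * (f x * eta x)) = 0].
Proof.
move=>[W u0 G0 mA wk] Wf;have [W1 W2 W3 _] := W;have [ag _ _ _] := ell.
have iw K' : compact K' -> K' `<=` U -> integ K' (fun x => V x * u x `^ (p - 1)).
 move=>cK' KU';have mK' := msr_cpt cK'.
 have [N N0 hN] := Wfn_bounded W cK' KU'.
 have mm : meas K' (fun x => u x `^ (p - 1)) by apply:meas_powR;exact:meas_cont_pts W1.
 have hb x : K' x -> `|u x `^ (p - 1)| <= N `^ (p - 1).
  move=>Kx;rewrite ger0_norm ?powR_ge0//;apply:powR_mono;first by rewrite subr_ge0 ltW.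
   by rewrite ltW// u0//;exact:KU'.
  by apply:le_trans (hN x Kx);exact:ler_norm.
 by apply:(eq_integ mK' _ (integ_mulb mK' mm hb (iV cK' KU'))) => x _;rewrite mulrC.
exact:(weak_Wfn_test p1 be0 oU mA (fun x Ux => ag x (G x) Ux) W3 iw wk Wf).
Qed.

(* Testing the equation of u with [phi u] and that of v with [phi u^p v^(1-p)],
 where phi is an increasing function of log u - log v, cancels V and leaves
 the sum of two nonnegative terms. *)
Lemma weak_comparison u G v G' K : connected U -> wsol p B A V U u G -> wsol p B A V U v G' ->
 compact K -> K `<=` U -> (forall x, U x -> ~ K x -> u x <= v x) -> (exists2 x, U x & ~ K x) ->
 forall x, U x -> u x <= v x.
Proof.
move=>cU su sv cK KU uv [x1 Ux1 Kx1].
have [W u0 G0 mA wk] := su;have [W' v0 G'0 mA' wk'] := sv.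
have [ag _ hstrict hA] := ell.
pose a x := ln (u x);pose b x := ln (v x).
pose ha x := (u x)^-1 *: G x;pose hb x := (v x)^-1 *: G' x.
have Wa : Wfn p U a ha := Wfn_ln p1 oU u0 W.
have Wb : Wfn p U b hb := Wfn_ln p1 oU v0 W'.
pose s x := 1 * a x + (-1) * b x;pose D x := 1 *: ha x + (-1) *: hb x.
have Ws : Wfn p U s D := Wfn_lin 1 (-1) p1 oU Wa Wb.
pose Phi x := sqpos (s x);pose dPhi x := 2 * pospart (s x).
have cdP : continuous (fun t : R => 2 * pospart t).
 by apply:contM;[exact:contC|exact:pos_cont].
have WP : Wfn p U Phi (fun x => dPhi x *: D x) := Wfn_compC p1 oU Ws is_derive_sqpos cdP.
(* This is [u^p v^(1-p)], written as an exponential to stay in the class [Wfn]. *)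
pose g x := expR (p * a x + (1 - p) * b x).
have Wg := Wfn_exp p1 oU (Wfn_lin p (1 - p) p1 oU Wa Wb).
have W1 := Wfn_mul p1 oU WP W;have W2 := Wfn_mul p1 oU WP Wg.
have Phi0 x : 0 <= Phi x by exact:sqr_ge0.
have dPhi0 x : 0 <= dPhi x by rewrite mulr_ge0 ?pospart_ge0.
have off x : U x -> ~ K x -> pospart (s x) = 0.
 move=>Ux Kx;have := uv x Ux Kx.
 rewrite -ler_ln ?posrE ?u0 ?v0// => h;rewrite pospartE /s /a /b mul1r mulN1r.
 by case:ltP => // h';apply/eqP;rewrite eq_le h' andbT subr_le0.
(* [Phi] vanishes off [K], where [u <= v]; a cutoff equal to 1 on [K] therefore gives the test
   functions compact support without leaving a gradient term. *)
have [eta [K2 [Ce cK2 K2U [eta0 eta01 KK2 eta1]]]] := cutoff cK oU KU.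
have mK2 := msr_cpt cK2.
have [i1 j1 k1 e1] := wsol_test su W1 Ce cK2 K2U eta0.
have [i2 j2 k2 e2] := wsol_test sv W2 Ce cK2 K2U eta0.
have PhiK x : U x -> ~ K x -> Phi x = 0 /\ dPhi x = 0.
 by move=>Ux Kx;rewrite /Phi /dPhi /sqpos off// expr0n/= mulr0.
have zz (c : R) (X : E) : 0 *: X = 0 :> E by rewrite scale0r.
have ge0 x : U x -> Phi x *: grad eta x = 0.
 move=>Ux;have [Kx|Kx] := pselect (K x);first by have [_ ->] := eta1 x Kx;rewrite scaler0.
 by have [-> _] := PhiK x Ux Kx;rewrite scale0r.
have ge1 x : U x -> eta x * Phi x = Phi x /\ eta x * dPhi x = dPhi x.
 move=>Ux;have [Kx|Kx] := pselect (K x);first by have [-> _] := eta1 x Kx;rewrite !mul1r.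
 by have [-> ->] := PhiK x Ux Kx;rewrite !mulr0.
have uE x : U x -> G x = u x *: ha x by move=>Ux;rewrite /ha scalerA mulfV ?scale1r// gt_eqF// u0.
have vE x : U x -> G' x = v x *: hb x by move=>Ux;rewrite /hb scalerA mulfV ?scale1r// gt_eqF// v0.
have gv x : U x -> v x `^ (p - 1) * g x = u x `^ p.
 move=>Ux;rewrite /g /powR !gt_eqF ?u0 ?v0//;rewrite -expRD;congr expR;rewrite /a /b;ring.
have upE x : U x -> u x `^ (p - 1) * u x = u x `^ p by move=>Ux;rewrite -powR_step// ltW// u0.
(* The difference of the two tested equations. Its first summand comes from monotonicity of the
   operator, the second from the Picone-type inequality; both are nonnegative, so a vanishing
   integral makes them vanish almost everywhere. *)
pose J x := u x `^ p * (dPhi x * dot (A x (ha x) - A x (hb x)) (ha x - hb x) +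
 Phi x * (dot (A x (ha x)) (ha x) - p * dot (A x (hb x)) (ha x) + (p - 1) * dot (A x (hb x)) (hb x))).
have Jpos x : U x -> 0 <= u x `^ p * (dPhi x * dot (A x (ha x) - A x (hb x)) (ha x - hb x)) /\
 0 <= u x `^ p * (Phi x * (dot (A x (ha x)) (ha x) - p * dot (A x (hb x)) (ha x) + (p - 1) * dot (A x (hb x)) (hb x))).
 move=>Ux;have [q1 q2 _] := hA x (ha x) (hb x) Ux.
 by split;(apply:mulr_ge0;[exact:powR_ge0|exact:mulr_ge0]).
have AG x : U x -> A x (G x) = u x `^ (p - 1) *: A x (ha x).
 by move=>Ux;rewrite {1}uE//;have [_ _ ->//] := hA x (ha x) (hb x) Ux;exact:u0.
have AG' x : U x -> A x (G' x) = v x `^ (p - 1) *: A x (hb x).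
 by move=>Ux;rewrite {1}vE//;have [_ _ ->//] := hA x (hb x) (hb x) Ux;exact:v0.
pose F1 x := eta x *: (Phi x *: G x + u x *: (dPhi x *: D x)).
pose F2 x := eta x *: (Phi x *: (expR (p * a x + (1 - p) * b x) *: (p *: ha x + (1 - p) *: hb x)) +
 expR (p * a x + (1 - p) * b x) *: (dPhi x *: D x)).
have JE x : U x -> dot (A x (G x)) (F1 x) - dot (A x (G' x)) (F2 x) = J x.
 move=>Ux;have [ep ed] := ge1 x Ux.
 have DE : D x = ha x - hb x by rewrite /D scale1r scaleN1r.
 have -> : dot (A x (G x)) (F1 x) = u x `^ p * (Phi x * dot (A x (ha x)) (ha x) + dPhi x * dot (A x (ha x)) (D x)).
  rewrite AG// /F1 {1}uE// -(upE x Ux) !(dotZl, dotZr, dotDr) -[in RHS]ep -[in RHS]ed;ring.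
 have -> : dot (A x (G' x)) (F2 x) = u x `^ p * (Phi x * (p * dot (A x (hb x)) (ha x) + (1 - p) * dot (A x (hb x)) (hb x)) + dPhi x * dot (A x (hb x)) (D x)).
  rewrite AG'// /F2 -(gv x Ux) /g !(dotZl, dotZr, dotDr) -[in RHS]ep -[in RHS]ed;ring.
 rewrite /J DE [dot (A x (ha x) - _) _]dotDl dotNl;ring.
have iJ : integ K2 J by apply:(eq_integ mK2 _ (integB mK2 i1 i2)) => x /K2U Ux;exact:JE.
have IJ : intg K2 J = 0.
 rewrite -(eq_intg (fun x Kx => JE x (K2U x Kx))) (intgB mK2 i1 i2).
 have z1 : intg K2 (fun x => dot (A x (G x)) ((Phi x * u x) *: grad eta x)) = 0.
  rewrite -[RHS](@intg0 R n K2);apply:eq_intg => x /K2U Ux.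
  by rewrite mulrC -scalerA ge0// scaler0 dot0r.
 have z2 : intg K2 (fun x => dot (A x (G' x)) ((Phi x * expR (p * a x + (1 - p) * b x)) *: grad eta x)) = 0.
  rewrite -[RHS](@intg0 R n K2);apply:eq_intg => x /K2U Ux.
  by rewrite mulrC -scalerA ge0// scaler0 dot0r.
 have z3 : intg K2 (fun x => V x * u x `^ (p - 1) * (Phi x * u x * eta x)) =
  intg K2 (fun x => V x * v x `^ (p - 1) * (Phi x * expR (p * a x + (1 - p) * b x) * eta x)).
  apply:eq_intg => x /K2U Ux;have := gv x Ux;rewrite /g -(upE x Ux) => h.
  have -> : V x * u x `^ (p - 1) * (Phi x * u x * eta x) = V x * Phi x * eta x * (u x `^ (p - 1) * u x) by ring.
  by rewrite -h;ring.
 rewrite z1 addr0 z3 in e1;rewrite z2 addr0 in e2.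
 by apply/eqP;rewrite subr_eq0;apply/eqP;apply:(addIr _ (etrans e1 (esym e2))).
have J0 x : K2 x -> 0 <= J x.
 by move=>/K2U Ux;have [q1 q2] := Jpos x Ux;rewrite /J mulrDr addr_ge0.
have [N N0 hN] := intg_eq0_null mK2 iJ J0 IJ.
have NB0 : mu (N `|` B) = 0%E.
 apply/eqP;rewrite eq_le measure_ge0 andbT.
 by apply:(le_trans (outer_measureU2 _ _ _));rewrite [X in (X + _)%E]N0 [X in (_ + X)%E]B0 adde0.
(* Where [u > v], strict monotonicity forces the logarithmic gradients to agree, so [Phi] has zero
   gradient almost everywhere. *)
have gz x : U x -> ~ (N `|` B) x -> dPhi x *: D x = 0.
 move=>Ux /not_orP[Nx Bx];have [K2x|K2x] := pselect (K2 x);last first.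
  by have [_ ->] := PhiK x Ux (fun Kx => K2x (KK2 x Kx));rewrite scale0r.
 have := hN x K2x Nx;have [q1 q2] := Jpos x Ux.
 rewrite /J mulrDr => /eqP;rewrite paddr_eq0// => /andP[/eqP h _].
 have [->|dp] := eqVneq (dPhi x) 0;first by rewrite scale0r.
 have {}dp : 0 < dPhi x by rewrite lt_def dp dPhi0.
 move/eqP: h;rewrite mulf_eq0 (gt_eqF (powR_gt0 _ (u0 x Ux)))/= mulf_eq0 (gt_eqF dp)/= => /eqP h.
 have h0 : dot (A x (ha x) - A x (hb x)) (ha x - hb x) <= 0 by rewrite h.
 have := hstrict x _ _ Ux Bx h0;rewrite /D scale1r scaleN1r => ->.
 by rewrite subrr scaler0.
have [WP1 _ _ _] := WP.
have loc x : U x -> exists2 r, 0 < r & forall y, `|x - y| < r -> Phi y = Phi x.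
 move=>Ux;have /nbhs_ballP[r /= r0 rU] := open_nbhs_nbhs (conj oU Ux).
 have r20 : 0 < r / 2 by lra.
 have sub : [set y | `|x - y| <= r / 2] `<=` U.
  by move=>y /= h;apply:rU;rewrite -ball_normE /=;lra.
 exists (r / 2) => // y xy;have yb : ball x (r / 2) y by rewrite -ball_normE.
 have xb : ball x (r / 2) x by exact:ballxx.
 have le1 := Wfn_ball_const p1 oU NB0 WP gz r20 sub.
 by apply/eqP;rewrite eq_le (le1 _ _ yb xb) (le1 _ _ xb yb).
(* [Phi] is locally constant, hence constant, and it vanishes at the given point outside [K]. *)
have const := connected_locally_const oU cU WP1 loc (ex_intro2 _ _ x1 Ux1 (PhiK x1 Ux1 Kx1).1).
move=>x Ux;have := const x Ux;rewrite /Phi /sqpos => /eqP;rewrite sqrf_eq0 pospartE.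
rewrite -ler_ln ?posrE ?u0 ?v0// => h.
rewrite -subr_le0;have : s x = ln (u x) - ln (v x) by rewrite /s mul1r mulN1r.
by move: h;case:ltP => [h1 _ <-|_ /eqP -> <-//];exact:ltW.
Qed.

End Fixed.
End Comparison.

(** * Truncation profiles and cutoffs for De Giorgi's method *)

Section DeGiorgiClass.
Context {R : realType} {n : nat}.
Local Notation E := 'rV[R]_n.
Implicit Types (f eta : E -> R).

Definition cube (x : E) (r : R) : set E := [set y | `|x - y| <= r].

(** A C^1 version of the positive part: the slope rises linearly from 0 to 1 on [[0, 1]] and stays
    1. *)
Definition ramp (y : R) : R := 2^-1 * (sqpos y - sqpos (y - 1)).
Definition dramp (y : R) : R := pospart y - pospart (y - 1).
(** A C^1 step from 0 to 1 across [[1, 3]]. Its slope is a tent supported where [dramp] is already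
    1, so the energy of the step is controlled by that of the ramp. *)
Definition hump (y : R) : R := 2^-1 * (sqpos (y - 1) - 2 * sqpos (y - 2) + sqpos (y - 3)).
Definition dhump (y : R) : R := pospart (y - 1) - 2 * pospart (y - 2) + pospart (y - 3).

Lemma is_der_sqpos (c y : R) : is_derive y (1 : R) (fun y => sqpos (y - c)) (2 * pospart (y - c)).
Proof.
have d1 : is_derive y (1 : R) (fun y : R => y - c) 1.
 have := @is_deriveB _ _ _ (@id R) (cst c) y (1 : R) 1 0 (is_derive_id _ _) (is_derive_cst _ _ _).
 by rewrite subr0.
by have := @is_derive1_comp _ sqpos (fun y => y - c) y _ _ (is_derive_sqpos _) d1;rewrite mulr1.
Qed.

Lemma is_derive_ramp y : is_derive y (1 : R) ramp (dramp y).
Proof.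
have d := @is_deriveZ _ _ _ _ 2^-1 y 1 _ (@is_deriveB _ _ _ _ _ y 1 _ _ (is_derive_sqpos y) (is_der_sqpos 1 y)).
by move: d;congr is_derive;rewrite /dramp /GRing.scale/=;field.
Qed.

Lemma is_derive_hump y : is_derive y (1 : R) hump (dhump y).
Proof.
have d2 := @is_deriveZ _ _ _ _ 2 y 1 _ (is_der_sqpos 2 y).
have d := @is_deriveZ _ _ _ _ 2^-1 y 1 _ (@is_deriveD _ _ _ _ _ y 1 _ _ (@is_deriveB _ _ _ _ _ y 1 _ _ (is_der_sqpos 1 y) d2) (is_der_sqpos 3 y)).
by move: d;congr is_derive;rewrite /dhump /GRing.scale/=;field.
Qed.

Lemma posshift_cont (c : R) : continuous (fun y => pospart (y - c)).
Proof.
apply:cont_comp pos_cont.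
by apply:contB => [y|];[exact:cvg_id|exact:contC].
Qed.

Lemma dramp_continuous : continuous dramp.
Proof. by apply:contB;[exact:pos_cont|exact:posshift_cont]. Qed.

Lemma dhump_continuous : continuous dhump.
Proof.
apply:contD;last exact:posshift_cont.
apply:contB;first exact:posshift_cont.
by apply:contM;[exact:contC|exact:posshift_cont].
Qed.

Lemma rampP y : [/\ 0 <= ramp y, 0 <= dramp y, dramp y <= 1, ramp y <= pospart y * dramp y &
 (y <= 0 -> ramp y = 0 /\ dramp y = 0) /\ (1 <= y -> dramp y = 1)].
Proof.
rewrite /ramp /dramp /sqpos !pospartE !expr2.
by case:(ltP y 0) => h1;case:(ltP (y - 1) 0) => h2;split;try split;try nra;move=>h;try split;nra.
Qed.

Lemma humpP y : [/\ 0 <= hump y, 0 <= dhump y, dhump y <= dramp y, hump y <= dramp y &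
 (y <= 1 -> hump y = 0) /\ (3 <= y -> hump y = 1)].
Proof.
rewrite /hump /dhump /dramp /sqpos !pospartE !expr2.
case:(ltP y 0) => h1;case:(ltP (y - 1) 0) => h2;case:(ltP (y - 2) 0) => h3;
 case:(ltP (y - 3) 0) => h4;split;try split;try nra;move=>h;nra.
Qed.

Lemma is_derive_rescale (h dh : R -> R) (l t y : R) : 0 < t -> (forall s, is_derive s (1 : R) h (dh s)) ->
 is_derive y (1 : R) (fun y => t * h ((y - l) / t)) (dh ((y - l) / t)).
Proof.
move=>t0 hd.
have d1 : is_derive y (1 : R) (fun y : R => (y - l) / t) t^-1.
 have := @is_deriveB _ _ _ (@id R) (cst l) y (1 : R) 1 0 (is_derive_id _ _) (is_derive_cst _ _ _).
 move/(@is_deriveZ _ _ _ _ t^-1 y (1 : R));rewrite subr0 /GRing.scale/= mulr1.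
 by congr is_derive;apply/funext => s /=;rewrite mulrC.
have := @is_deriveZ _ _ _ _ t y (1 : R) _ (@is_derive1_comp _ h _ y _ _ (hd _) d1).
by congr is_derive;rewrite /GRing.scale/= mulrCA mulfV ?mulr1// gt_eqF.
Qed.

Lemma rescale_cont (dh : R -> R) (l t : R) : continuous dh -> continuous (fun y => dh ((y - l) / t)).
Proof.
move=>cd;apply:cont_comp cd;apply:contM;last exact:contC.
by apply:contB => [y|];[exact:cvg_id|exact:contC].
Qed.

Lemma C1_pow f (m : nat) : Ck 1 f -> Ck 1 (fun x => f x ^+ m.+1) /\
 forall x, grad (fun x => f x ^+ m.+1) x = (m.+1%:R * f x ^+ m) *: grad f x.
Proof.
move=>Cf;elim:m => [|m [Cm gm]].
 split;first by have : (fun x => f x ^+ 1) = f;[apply/funext => x;rewrite expr1|move=> ->].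
 by move=>x;rewrite expr0 mulr1 scale1r;congr grad;apply/funext => y;rewrite expr1.
have e : (fun x => f x ^+ m.+2) = (fun x => f x * f x ^+ m.+1) by apply/funext => x;rewrite exprS.
split;first by rewrite e;exact:C1_mul.
move=>x;rewrite e gradM// gm scalerA -scalerDl;congr (_ *: _).
by rewrite -[in RHS](@natr1 _ m.+1) mulrDl mul1r exprS;ring.
Qed.

(** A power [m.+1 >= p] of an ordinary cutoff. Its gradient is bounded by the power [(p - 1) / p] of
    the cutoff itself, which allows Young's inequality to absorb the gradient term. *)
Lemma cube_cutoff p : 1 < p -> exists2 M : R, 0 < M & forall (x0 : E) r, 0 < r -> exists eta,
 [/\ Ck 1 eta, forall x, 0 <= eta x <= 1, forall x, cube x0 (r / 2) x -> eta x = 1,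
   forall x, ~ cube x0 r x -> eta x = 0 & forall x, enorm (grad eta x) <= M / r * eta x `^ ((p - 1) / p)].
Proof.
move=>p1;have p0 : 0 < p by lra.
have sub : cube 0 (2^-1) `<=` ball (0 : E) 1.
 by move=>x;rewrite /cube -ball_normE /= => h;apply:le_lt_trans h _;lra.
have [ze [K2 [Cz cK2 K2U [z0 z01 KK2 z1]]]] := cutoff (@cball_cpt R n 0 2^-1) (ball_open (0 : E) 1) sub.
have [M M0 hM] := grad_bounded cK2 Cz.
pose m := Num.bound p;have pm : p <= m.+1%:R.
 by apply:ltW;apply:(lt_le_trans (@archi_boundP R p (ltW p0)));rewrite ler_nat.
exists (m.+1%:R * M);first by rewrite mulr_gt0.
have [Cm gm] := C1_pow m Cz.
move=>x0 r r0;have ri : 0 < r^-1 by rewrite invr_gt0.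
pose T (x : E) := affine r^-1 (- (r^-1 *: x0)) x.
have TE x : T x = r^-1 *: (x - x0) by rewrite /T /affine scalerBr.
have Tn x : `|0 - T x| = `|x0 - x| / r by rewrite TE sub0r normrN normrZ gtr0_norm// mulrC distrC.
pose et := fun x : E => ze x ^+ m.+1.
have Cet : Ck 1 (et \o affine r^-1 (- (r^-1 *: x0))) := Ck_affine _ _ Cm.
have z0le x : 0 <= ze x by have /andP[] := z01 x.
exists (et \o affine r^-1 (- (r^-1 *: x0)));split.
- exact:Cet.
- by move=>x;rewrite /= exprn_ge0//= exprn_ile1//;have /andP[] := z01 (T x).
- move=>x hx;rewrite /= -/(T x) /et;have hT : cube 0 2^-1 (T x) by rewrite /cube /= Tn ler_pdivrMr// mulrC.
 by have [-> _] := z1 (T x) hT;rewrite expr1n.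
- move=>x hx;rewrite /= -/(T x) /et z0 ?expr0n// => /K2U;rewrite -ball_normE /= Tn ltr_pdivrMr// mul1r => /ltW.
 exact:hx.
move=>x.
have -> : grad (et \o affine r^-1 (- (r^-1 *: x0))) x = r^-1 *: grad et (T x).
 apply/rowP => i;rewrite [RHS]mxE !gradE.
 by have [_ ->] := @is_derive_affine R n et r^-1 (- (r^-1 *: x0)) x i ((Cm.2 i).1 _).
rewrite /et gm !enormZ gtr0_norm// ger0_norm ?mulr_ge0 ?exprn_ge0// /= -/(T x) /et.
have [K2x|K2x] := pselect (K2 (T x));last first.
 have gz : grad ze (T x) = 0.
  apply/rowP => i;rewrite gradE mxE -(derive_cst (0 : R) (T x) (evec i));apply:near_eq_derive.
  have oK : open (~` K2) by apply:closed_openC;exact:(compact_closed (@norm_hausdorff _ _)).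
  exact:filterS (open_nbhs_nbhs (conj oK K2x)).
 by rewrite gz enorm0 !mulr0 mulr_ge0 ?powR_ge0// divr_ge0 ?(ltW r0)// mulr_ge0// ltW.
set y := ze (T x);have y0 : 0 <= y by exact:z0le.
have y1 : y <= 1 by have /andP[] := z01 (T x).
have mp : 0 < m%:R :> R by move: pm;rewrite -natr1;lra.
have hy : y ^+ m <= (y ^+ m.+1) `^ ((p - 1) / p).
 rewrite -!powR_mulrn// -powRrM.
 have [->|yn] := eqVneq y 0;first by rewrite powR0 ?powR_ge0//;exact:lt0r_neq0.
 have yp : 0 < y by rewrite lt_def yn.
 apply:ger_powR;first by rewrite yp.
 rewrite mulrA ler_pdivrMr// -natr1 mulrDl mulrBr mulr1 mul1r;move: pm;rewrite -natr1;lra.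
have gM : enorm (grad ze (T x)) <= M by have [] := hM (T x) K2x.
apply:(@le_trans _ _ (r^-1 * (m.+1%:R * y ^+ m * M))).
 by rewrite ler_wpM2l ?(ltW ri)// ler_wpM2l// mulr_ge0// exprn_ge0.
have -> : r^-1 * (m.+1%:R * y ^+ m * M) = m.+1%:R * M / r * y ^+ m by ring.
by rewrite ler_wpM2l// divr_ge0 ?(ltW r0)// mulr_ge0// ltW.
Qed.

End DeGiorgiClass.

(** * Caccioppoli inequality for truncations *)

Section DeGiorgiStep.
Context {R : realType} {n : nat}.
Local Notation E := 'rV[R]_n.
Local Notation mu := (@lam R n).
Implicit Types (f g u V z eta P Q : E -> R) (F G D : E -> E) (U K B : set E).

(* Caccioppoli inequality in pointwise form: the weak formulation tested with [h z * eta], with [P] and [Q] the terms that are kept. *)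
Definition dgfun (p al be : R) U z D g : Prop :=
[/\ Wfn p U z D, forall x, 0 <= g x, forall K, compact K -> K `<=` U -> integ K g &
 forall (h dh : R -> R) eta K P Q, (forall t, is_derive t (1 : R) h (dh t)) -> continuous dh ->
  (forall t, 0 <= h t) -> (forall t, 0 <= dh t) -> (forall t, t <= 0 -> h t = 0) ->
  Ck 1 eta -> (forall x, 0 <= eta x) -> compact K -> K `<=` U -> (forall x, ~ K x -> eta x = 0) ->
  integ K P -> integ K Q ->
  (forall x, K x -> P x + be * (enorm (D x) `^ (p - 1) * (h (z x) * enorm (grad eta x))) + g x * (h (z x) * eta x) <=
   al * (eta x * dh (z x) * enorm (D x) `^ p) + Q x) ->
  intg K P <= intg K Q].

Lemma sol_arith (P Q y1 y2 y3 y4 y5 y6 : R) : y4 <= y1 -> - y5 <= y2 -> - y6 <= y3 -> P + y5 + y6 <= y4 + Q -> P - Q <= y1 + y2 + y3.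
Proof. lra. Qed.

Section Solution.
Variables (p al be : R) (U B : set E) (A : E -> E -> E) (V : E -> R).
Hypotheses (p1 : 1 < p) (al0 : 0 < al) (be0 : 0 <= be) (oU : open U) (B0 : mu B = 0%E).
Hypothesis ell : elliptic p al be U B A.
Hypothesis iV : forall K, compact K -> K `<=` U -> integ K V.

(** The tested equation says that an integral is 0, so any pointwise lower bound [P - Q] of its
    integrand off the null set yields an inequality between integrals. *)
Lemma wsol_ineq u G f F eta K P Q : wsol p B A V U u G -> Wfn p U f F -> Ck 1 eta -> compact K -> K `<=` U ->
 (forall x, ~ K x -> eta x = 0) -> integ K P -> integ K Q ->
 (forall x, K x -> ~ B x -> P x - Q x <= dot (A x (G x)) (eta x *: F x) + dot (A x (G x)) (f x *: grad eta x) +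
   V x * u x `^ (p - 1) * (f x * eta x)) ->
 intg K P <= intg K Q.
Proof.
move=>su Wf Ce cK KU e0 iP iQ hPQ;have mK := msr_cpt cK.
have [i1 i2 i3 e] := wsol_test p1 be0 oU ell iV su Wf Ce cK KU e0.
have i12 := integD mK i1 i2;have i123 := integD mK i12 i3.
rewrite -(intgD mK i1 i2) -(intgD mK i12 i3) in e.
have iPQ := integB mK iP iQ.
pose T x := if x \in B then P x - Q x else dot (A x (G x)) (eta x *: F x) + dot (A x (G x)) (f x *: grad eta x) +
   V x * u x `^ (p - 1) * (f x * eta x).
have Te x : K x -> ~ B x -> dot (A x (G x)) (eta x *: F x) + dot (A x (G x)) (f x *: grad eta x) +
   V x * u x `^ (p - 1) * (f x * eta x) = T x by move=>_ Bx;rewrite /T memNset.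
have iT := eq_integ_ae B0 mK Te i123;have eT := eq_intg_ae B0 mK Te (integ_meas i123).
have le : intg K (fun x => P x - Q x) <= intg K T.
 apply:(intg_le mK iPQ iT) => x Kx;rewrite /T;case:ifPn => // /negP nB.
 by apply:hPQ => // /mem_set.
by move: le;rewrite -eT e (intgB mK iP iQ);lra.
Qed.

Lemma wsol_dgfun u G (sg b La : R) : sg = 1 \/ sg = -1 -> wsol p B A V U u G -> 0 <= La ->
 (forall x, U x -> 0 < sg * u x + b -> u x <= La) ->
 dgfun p al be U (fun x => sg * u x + b) (fun x => sg *: G x) (fun x => La `^ (p - 1) * `|V x|).
Proof.
move=>sg1 su La0 uLa;have [W u0 G0 mA _] := su;have [a1 a2 _ _] := ell.
have s2 : sg * sg = 1 by case:sg1 => ->;rewrite ?mulr1// mulrNN mulr1.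
have sn : `|sg| = 1 by case:sg1 => ->;rewrite ?normrN normr1.
have en x : enorm (sg *: G x) = enorm (G x) by rewrite enormZ sn mul1r.
have Wz : Wfn p U (fun x => sg * u x + b) (fun x => sg *: G x).
 have C1b : Ck 1 (cst b : E -> R).
  split;first exact:cst_continuous.
  move=>i;split;first by move=>x;exact:derivable_cst.
  have -> : 'D_(evec i) (cst b : E -> R) = cst 0 by apply/funext => x;exact:derive_cst.
  exact:cst_continuous.
 have W1 := Wfn_C1 U p1 C1b.
 apply:Wfn_eq (Wfn_lin sg 1 p1 oU W W1) => // x Ux;first by rewrite mul1r.
 suff -> : grad (cst b) x = 0 by rewrite scaler0 addr0.
 by apply/rowP => i;rewrite gradE mxE derive_cst.
split=> [//|x|K cK KU|h dh eta K P Q hd cd h0 dh0 hz Ce e0 cK KU eK iP iQ hPQ].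
- by rewrite mulr_ge0 ?powR_ge0.
- exact:(integZ _ (msr_cpt cK) (integ_abs (msr_cpt cK) (iV cK KU))).
have Wh := Wfn_compC p1 oU Wz hd cd.
have Wh' : Wfn p U (fun x => sg * h (sg * u x + b)) (fun x => dh (sg * u x + b) *: G x).
 apply:Wfn_eq (Wfn_lin sg 0 p1 oU Wh Wh) => // x Ux;first by rewrite mul0r addr0.
 by rewrite scale0r addr0 !scalerA (mulrC sg (dh _)) -mulrA s2 mulr1.
apply:(wsol_ineq su Wh' Ce cK KU eK iP iQ) => x Kx nB;have Ux := KU x Kx.
have := hPQ x Kx;rewrite !en;set zx := sg * u x + b;set e := enorm (G x);set t := h zx;set dt := dh zx.
have t0 : 0 <= t by exact:h0.
have dt0 : 0 <= dt by exact:dh0.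
have b1 : al * (eta x * dt * e `^ p) <= dot (A x (G x)) (eta x *: (dt *: G x)).
 rewrite !dotZr -mulrA !(mulrCA al);apply:(ler_wpM2l (e0 x));apply:(ler_wpM2l dt0).
 exact:a2.
have b2 : `|dot (A x (G x)) ((sg * t) *: grad eta x)| <= be * (e `^ (p - 1) * (t * enorm (grad eta x))).
 apply:(le_trans (CauchySchwarz_dot _ _));rewrite enormZ normrM sn mul1r (ger0_norm t0) mulrA.
 by rewrite ler_wpM2r ?mulr_ge0 ?enorm_ge0// a1.
have b3 : `|V x * u x `^ (p - 1) * (sg * t * eta x)| <= La `^ (p - 1) * `|V x| * (t * eta x).
 have [z0|z0] := leP zx 0;first by rewrite /t hz// !(mulr0, mul0r) normr0.
 rewrite !normrM sn mul1r (ger0_norm t0) (ger0_norm (e0 x)) (ger0_norm (powR_ge0 _ _)).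
 rewrite ler_wpM2r ?mulr_ge0// mulrC ler_wpM2r//;apply:powR_mono;[by rewrite subr_ge0 ltW|exact/ltW/u0|exact:uLa].
move: b1 b2 b3;rewrite !ler_norml.
move: (dot _ _) (dot _ _) (V x * _ * _) (al * _) (be * _) (La `^ _ * _ * _) => y1 y2 y3 y4 y5 y6 c1 /andP[c2 _] /andP[c3 _] c4.
exact:(sol_arith c1 c2 c3 c4).
Qed.

End Solution.

Lemma eq_lexx (a b : R) : a = b -> a <= b. Proof. by move=> ->. Qed.

Lemma integ_indic_sub K (S : set E) : compact K -> msr S -> S `<=` K ->
 integ K (\1_S) /\ intg K (\1_S : E -> R) = vol S.
Proof.
move=>cK mS SK;have mK := msr_cpt cK;have Kf := lamK_lty cK.
split.
 have mi : meas K (\1_S : E -> R) by exact:meas_indic.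
 apply:(integ_bdd (c := 1) mK Kf mi) => x _.
 by rewrite indicE;case:(_ \in _);rewrite ?normr1 ?normr0.
rewrite intg_mk -[RHS]mul1r -(intg_cst 1 mS) [RHS]intg_mk;congr intg.
apply/funext => x;rewrite !patchE indicE;case:ifPn => xK.
 by case:(_ \in _).
by rewrite memNset// => /SK/mem_set;rewrite (negbTE xK).
Qed.

Lemma cube_cpt (x0 : E) r : compact (cube x0 r).
Proof. exact:cball_cpt. Qed.

Lemma cube_sub (x0 : E) r s : r <= s -> cube x0 r `<=` cube x0 s.
Proof. by move=>rs x /= h;exact:le_trans h rs. Qed.

Lemma msr_level U z K (l : R) : open U -> compact K -> K `<=` U -> (forall x, U x -> {for x, continuous z}) ->
 meas K z /\ msr (K `&` [set x | l < z x]).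
Proof.
move=>oU cK KU cz;have mK := msr_cpt cK;have mz := meas_cont_pts oU KU cz.
by split=> //;exact:msr_gt.
Qed.

(** Caccioppoli inequality for the truncation [t * ramp ((z - l) / t)]. Since this is at most
    [Z * dramp ((z - l) / t)], the term with the cutoff gradient carries the same factor [dramp] as
    the energy, and half of the ellipticity absorbs it. The constant is independent of [t]. *)
Lemma dg_energy1 (p al be Z : R) : 1 < p -> 0 < al -> 0 <= be -> 0 <= Z ->
 exists2 C : R, 0 <= C & forall U z D g (x0 : E) (r l t : R), open U -> dgfun p al be U z D g ->
 0 < r -> cube x0 r `<=` U -> 0 <= l -> 0 < t -> (forall x, cube x0 r x -> z x <= Z) ->
 intg (cube x0 (r / 2)) (fun x => dramp ((z x - l) / t) * enorm (D x) `^ p) <=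
  C * (r^-1 `^ p * vol (cube x0 r `&` [set x | l < z x]) + intg (cube x0 r) g).
Proof.
move=>p1 al0 be0 Z0;have [M M0 hM] := @cube_cutoff R n p p1.
pose d := al / 2;have d0 : 0 < d by rewrite /d;lra.
pose c1 := d `^ (1 - p) * (be * Z * M) `^ p;have c10 : 0 <= c1 by rewrite mulr_ge0 ?powR_ge0.
exists ((c1 + Z) / d);first by rewrite divr_ge0 ?addr_ge0 // ltW.
move=>U z D g x0 r l t oU [W g0 ig cacc] r0 KU l0 t0 zZ;have [W1 W2 W3 _] := W.
have [eta [Ce e01 e1 eK ge]] := hM x0 r r0.
set K := cube x0 r in KU zZ eK *;have cK : compact K := cube_cpt (x0:=x0) (r:=r).
have mK := msr_cpt cK;have [mz mS] := msr_level l oU cK KU W1;set S : set E := K `&` _ in mS *.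
have SK : S `<=` K by move=>x [].
have [iS vS] := integ_indic_sub cK mS SK.
have e0 x : 0 <= eta x by have /andP[] := e01 x.
have mdr : meas K (fun x => dramp ((z x - l) / t)) := meas_comp_cont (rescale_cont (l:=l) (t:=t) dramp_continuous) mz.
have bdr x : K x -> `|dramp ((z x - l) / t)| <= 1.
 by move=>_;have [_ a b _ _] := rampP ((z x - l) / t);rewrite ger0_norm.
have iE := integ_mulb mK mdr bdr (W3 K cK KU).
have iP0 : integ K (fun x => eta x * (dramp ((z x - l) / t) * enorm (D x) `^ p)).
 apply:(integ_mulb mK _ _ iE (c := 1));first by apply:meas_cont;exact:Ck_cont Ce.
 by move=>x _;rewrite ger0_norm;have /andP[] := e01 x.
have iP := integZ d mK iP0.
have iQ1 := integZ (c1 * r^-1 `^ p) mK iS;have iQ2 := integZ Z mK (ig K cK KU).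
have iQ := integD mK iQ1 iQ2.
have hd s := is_derive_rescale l s t0 is_derive_ramp.
have F0 s : 0 <= t * ramp ((s - l) / t) by rewrite mulr_ge0 ?(ltW t0)//;case:(rampP ((s - l) / t)).
have dF0 s : 0 <= dramp ((s - l) / t) by case:(rampP ((s - l) / t)).
have neg s : s <= l -> t * ramp ((s - l) / t) = 0 /\ dramp ((s - l) / t) = 0.
 move=>sl;have [_ _ _ _ [+ _]] := rampP ((s - l) / t).
 have h : (s - l) / t <= 0 by rewrite pmulr_lle0 ?invr_gt0// subr_le0.
 by move=>/(_ h)[-> ->];rewrite mulr0.
have := cacc _ _ eta K _ _ hd (rescale_cont (l:=l) (t:=t) dramp_continuous) F0 dF0 (fun s s0 => (neg s (le_trans s0 l0)).1)
 Ce e0 cK KU eK iP iQ.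
rewrite (intgZ _ mK iP0) (intgD mK iQ1 iQ2) (intgZ _ mK iS) (intgZ _ mK (ig K cK KU)) vS => main.
have {}main : d * intg K (fun x => eta x * (dramp ((z x - l) / t) * enorm (D x) `^ p)) <=
  c1 * r^-1 `^ p * vol S + Z * intg K g.
 apply:main => x Kx;have [zl|zl] := leP (z x) l.
  have [-> ->] := neg _ zl;rewrite !(mul0r, mulr0) !addr0 add0r;apply:addr_ge0;last exact:mulr_ge0.
  by apply:mulr_ge0;[rewrite mulr_ge0 ?powR_ge0|rewrite indicE ler0n].
 have xS : S x by split.
 rewrite indicE mem_set// mulr1.
 set y := (z x - l) / t;have [f0 df0 df1 fdf _] := rampP y.
 have Fle : t * ramp y <= Z * dramp y.
  apply:(@le_trans _ _ (t * (pospart y * dramp y)));first by rewrite ler_wpM2l// ltW.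
  rewrite mulrA ler_wpM2r// pospartE;case:ltP => [|_];first by rewrite mulr0.
  rewrite /y mulrCA mulfV ?gt_eqF// mulr1;move: (zZ x Kx) l0;clear;lra.
 have Fle2 : t * ramp y <= Z by apply:(le_trans Fle);rewrite ler_piMr.
 set e := enorm (D x);have en : 0 <= e by exact:enorm_ge0.
 have y0 : 0 <= be * Z * (M / r) by rewrite !mulr_ge0// ?(ltW M0)// invr_ge0 ltW.
 have hY : (be * Z * (M / r)) `^ p = (be * Z * M) `^ p * r^-1 `^ p.
  by rewrite mulrA powRM// ?invr_ge0 ?(ltW r0)// !mulr_ge0// ltW.
 have pn : p != 0 by rewrite gt_eqF//;lra.
 have := young_trivial (mulr_ge0 en (powR_ge0 (eta x) p^-1)) y0 d0 p1.
 rewrite hY (powRM p en (powR_ge0 _ _)) (powRM (p - 1) en (powR_ge0 _ _)) -!powRrM mulVf// powRr1// (mulrC p^-1) => yg.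
 have gr := ge x;have en1 : 0 <= e `^ (p - 1) by exact:powR_ge0.
 set w := eta x `^ ((p - 1) / p) in yg gr.
 have t1 : be * (e `^ (p - 1) * (t * ramp y * enorm (grad eta x))) <=
   dramp y * (e `^ (p - 1) * w * (be * Z * (M / r))).
  apply:(@le_trans _ _ (be * (e `^ (p - 1) * (Z * dramp y * (M / r * w)))));last first.
   by apply:eq_lexx;ring.
  by apply:(ler_wpM2l be0);apply:(ler_wpM2l en1);exact:(ler_pM (mulr_ge0 (ltW t0) f0) (enorm_ge0 _) Fle gr).
 have t2 : dramp y * (e `^ (p - 1) * w * (be * Z * (M / r))) <=
  dramp y * (d * (e `^ p * eta x)) + c1 * r^-1 `^ p.
  apply:(le_trans (ler_wpM2l df0 yg));rewrite mulrDr lerD2l;apply:(le_trans (ler_piMl _ df1)).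
   by rewrite !mulr_ge0 ?powR_ge0.
  by apply:eq_lexx;rewrite /c1;ring.
 have t3 : g x * (t * ramp y * eta x) <= Z * g x.
  rewrite [leRHS]mulrC;apply:(ler_wpM2l (g0 x));apply:le_trans Fle2;apply:ler_piMr => //.
   by rewrite mulr_ge0// ltW.
  by have /andP[] := e01 x.
 have ald : al = d + d by rewrite /d;lra.
 rewrite ald;move: t1 t2 t3;rewrite -/y -/e.
 move: (be * _) (dramp y * (_ * _ * _)) (g x * _) (Z * g x) (c1 * _) (enorm (D x)) => s1 s2 s3 s4 s5 _.
 by move: (e `^ p) (eta x) (dramp y) => s6 s7 s8;clear;nra.
have step : intg (cube x0 (r / 2)) (fun x => dramp ((z x - l) / t) * enorm (D x) `^ p) <=
  intg K (fun x => eta x * (dramp ((z x - l) / t) * enorm (D x) `^ p)).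
 set K' : set E := cube x0 (r / 2);have mK' : msr K' := msr_cpt (cube_cpt (x0:=x0) (r:=r/2)).
 have K'K : K' `<=` K by apply:cube_sub;lra.
 have -> : intg K' (fun x => dramp ((z x - l) / t) * enorm (D x) `^ p) =
  intg K' (fun x => eta x * (dramp ((z x - l) / t) * enorm (D x) `^ p)).
  by apply:eq_intg => x K'x;rewrite e1// mul1r.
 by apply:(intg_subset mK mK' K'K iP0) => x _;rewrite mulr_ge0// mulr_ge0 ?powR_ge0.
apply:(le_trans step);rewrite mulrAC ler_pdivlMr// mulrC;apply:(le_trans main).
have v0 : 0 <= r^-1 `^ p * vol S by rewrite mulr_ge0 ?powR_ge0 ?vol_ge0.
have i0 : 0 <= intg K g by apply:intg_ge0 => x _.
rewrite -mulrA;move: (r^-1 `^ p * vol S) (intg K g) v0 i0 c10 Z0 => s1 s2;clear;nra.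
Qed.

End DeGiorgiStep.

(** * Energy in a thin layer of levels *)

Section DeGiorgiIteration.
Context {R : realType} {n : nat}.
Local Notation E := 'rV[R]_n.
Implicit Types (g z eta : E -> R) (D : E -> E) (U K : set E).

Lemma energy2_arith (m t I C a a0 b b0 : R) : 0 <= m -> 0 <= t -> 0 <= a0 -> 0 <= b0 -> I <= C * (a0 + b0) -> a <= a0 ->
 b <= b0 -> m * t * I + (m * t * a + t * b) <= (m * (C + 1) + 1) * (t * (a0 + b0)).
Proof.
move=>m0 t0 a00 b00 IC aa bb;have mt := mulr_ge0 m0 t0.
have h1 := ler_wpM2l mt IC;have h2 := ler_wpM2l mt aa;have h3 := ler_wpM2l t0 bb.
have h4 := mulr_ge0 mt b00;have h5 := mulr_ge0 t0 a00;lra.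
Qed.

(** The test function [t * hump ((z - l) / t)] is at most [t], which gains a factor [t] for the
    energy in the layer between the levels [l + t] and [l + 3 * t]. The gradient term is estimated
    on the intermediate cube by [dg_energy1]. *)
Lemma dg_energy2 (p al be Z : R) : 1 < p -> 0 < al -> 0 <= be -> 0 <= Z ->
 exists2 C : R, 0 <= C & forall U z D g (x0 : E) (r l t : R), open U -> dgfun p al be U z D g ->
 0 < r -> cube x0 r `<=` U -> 0 <= l -> 0 < t -> (forall x, cube x0 r x -> z x <= Z) ->
 intg (cube x0 (r / 4)) (fun x => dhump ((z x - l) / t) * enorm (D x) `^ p) <=
  C * t * (r^-1 `^ p * vol (cube x0 r `&` [set x | l < z x]) + intg (cube x0 r) g).
Proof.
move=>p1 al0 be0 Z0;have [M M0 hM] := @cube_cutoff R n p p1.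
have [C1 C10 hC1] := @dg_energy1 R n p al be Z p1 al0 be0 Z0.
exists ((be * (2 * M) * (C1 + 1) + 1) / al).
 by rewrite divr_ge0 ?(ltW al0)// addr_ge0// !mulr_ge0 ?addr_ge0// ltW.
move=>U z D g x0 r l t oU dg r0 KU l0 t0 zZ;have en1 := hC1 U z D g x0 r l t oU dg r0 KU l0 t0 zZ.
have [W g0 ig cacc] := dg;have [W1 W2 W3 _] := W.
have r20 : 0 < r / 2 by rewrite divr_gt0.
have [eta [Ce e01 e1 eK ge]] := hM x0 (r / 2) r20.
set K0 : set E := cube x0 r in KU zZ en1 *;have cK0 : compact K0 := cube_cpt (x0:=x0) (r:=r).
have mK0 := msr_cpt cK0.
set K : set E := cube x0 (r / 2) in en1 eK *;have cK : compact K := cube_cpt (x0:=x0) (r:=r/2).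
have KK0 : K `<=` K0 by apply:cube_sub;lra.
have KU' : K `<=` U := subset_trans KK0 KU.
have mK := msr_cpt cK;have [mz mS] := msr_level l oU cK KU' W1;set S : set E := K `&` _ in mS.
have [mz0 mS0] := msr_level l oU cK0 KU W1;set S0 : set E := K0 `&` _ in mS0 en1 *.
have SK : S `<=` K by move=>x [].
have [iS vS] := integ_indic_sub cK mS SK.
have vSS : vol S <= vol S0.
 apply:(le_vol mS mS0);first by move=>x [/KK0].
 by apply:lamS_lty (lamK_lty cK0) => x [].
have e0 x : 0 <= eta x by have /andP[] := e01 x.
have mdr : meas K (fun x => dramp ((z x - l) / t)) := meas_comp_cont (rescale_cont (l:=l) (t:=t) dramp_continuous) mz.
have mdh : meas K (fun x => dhump ((z x - l) / t)) := meas_comp_cont (rescale_cont (l:=l) (t:=t) dhump_continuous) mz.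
have bdr x : K x -> `|dramp ((z x - l) / t)| <= 1.
 by move=>_;have [_ a b _ _] := rampP ((z x - l) / t);rewrite ger0_norm.
have bdh x : K x -> `|dhump ((z x - l) / t)| <= 1.
 move=>_;have [_ _ b _ _] := rampP ((z x - l) / t);have [_ a c _ _] := humpP ((z x - l) / t).
 by rewrite ger0_norm//;exact:le_trans b.
have iE := integ_mulb mK mdr bdr (W3 K cK KU').
have iE2 := integ_mulb mK mdh bdh (W3 K cK KU').
have iP0 : integ K (fun x => eta x * (dhump ((z x - l) / t) * enorm (D x) `^ p)).
 apply:(integ_mulb mK _ _ iE2 (c := 1));first by apply:meas_cont;exact:Ck_cont Ce.
 by move=>x _;rewrite ger0_norm;have /andP[] := e01 x.
have iP := integZ al mK iP0;set c := be * (2 * M) * t.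
have c0 : 0 <= c by rewrite !mulr_ge0// ltW.
have iQ1 := integZ (c * r^-1 `^ p) mK iS;have iQ2 := integZ t mK (ig K cK KU').
have iQ3 := integZ c mK iE;have iQ12 := integD mK iQ1 iQ2;have iQ := integD mK iQ3 iQ12.
have hd s := is_derive_rescale l s t0 is_derive_hump.
have F0 s : 0 <= t * hump ((s - l) / t) by rewrite mulr_ge0 ?(ltW t0)//;case:(humpP ((s - l) / t)).
have dF0 s : 0 <= dhump ((s - l) / t) by case:(humpP ((s - l) / t)).
have neg s : s <= l -> [/\ hump ((s - l) / t) = 0, dhump ((s - l) / t) = 0 & dramp ((s - l) / t) = 0].
 move=>sl;have [_ _ _ _ [+ _]] := rampP ((s - l) / t).
 have h : (s - l) / t <= 0 by rewrite pmulr_lle0 ?invr_gt0// subr_le0.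
 move=>/(_ h)[_ d0];have [a b] := humpP ((s - l) / t);rewrite d0 => b0 a0 _.
 by split => //;apply/eqP;rewrite eq_le ?a0 ?a ?b0 ?b.
have neg0 s : s <= 0 -> t * hump ((s - l) / t) = 0.
 by move=>s0;have [-> _ _] := neg s (le_trans s0 l0);rewrite mulr0.
have := cacc _ _ eta K _ _ hd (rescale_cont (l:=l) (t:=t) dhump_continuous) F0 dF0 neg0 Ce e0 cK KU' eK iP iQ.
rewrite (intgZ _ mK iP0) (intgD mK iQ3 iQ12) (intgD mK iQ1 iQ2) (intgZ _ mK iS) (intgZ _ mK (ig K cK KU')) (intgZ _ mK iE) vS => main.
have {}main : al * intg K (fun x => eta x * (dhump ((z x - l) / t) * enorm (D x) `^ p)) <=
  c * intg K (fun x => dramp ((z x - l) / t) * enorm (D x) `^ p) + (c * r^-1 `^ p * vol S + t * intg K g).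
 apply:main => x Kx;have [zl|zl] := leP (z x) l.
  have [-> -> ->] := neg _ zl;rewrite !(mul0r, mulr0) !addr0 !add0r;apply:addr_ge0;last exact:(mulr_ge0 (ltW t0)).
  by apply:mulr_ge0;[rewrite mulr_ge0 ?powR_ge0|rewrite indicE ler0n].
 have xS : S x by split.
 rewrite indicE mem_set// mulr1.
 set y := (z x - l) / t;have [f0 df0 df1 fdf _] := humpP y;have [_ dr0 dr1 _ _] := rampP y.
 set e := enorm (D x);have en : 0 <= e by exact:enorm_ge0.
 have ri0 : 0 <= r^-1 by rewrite invr_ge0 ltW.
 have yg := young_trivial en ri0 ltr01 p1;rewrite powR1 !mul1r in yg.
 have en2 : 0 <= e `^ (p - 1) by exact:powR_ge0.
 have gr : enorm (grad eta x) <= 2 * M * r^-1.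
  apply:(le_trans (ge x));rewrite (_ : 2 * M * r^-1 = M / (r / 2));last by field;rewrite gt_eqF.
  apply:ler_piMr;first by rewrite divr_ge0 ?ltW.
  have /andP[_ b] := e01 x;have pp : 0 <= (p - 1) / p by rewrite divr_ge0//;lra.
  by have := powR_mono pp (e0 x) b;rewrite powR1.
 have t1 : be * (e `^ (p - 1) * (t * hump y * enorm (grad eta x))) <= c * (dramp y * (e `^ (p - 1) * r^-1)).
  apply:(@le_trans _ _ (be * (e `^ (p - 1) * (t * dramp y * (2 * M * r^-1)))));last by apply:eq_lexx;rewrite /c;ring.
  apply:(ler_wpM2l be0);apply:(ler_wpM2l en2);apply:(ler_pM (mulr_ge0 (ltW t0) f0) (enorm_ge0 _) _ gr).
  by rewrite ler_wpM2l// ltW.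
 have t2 : c * (dramp y * (e `^ (p - 1) * r^-1)) <= c * (dramp y * e `^ p) + c * r^-1 `^ p.
  rewrite -mulrDr;apply:(ler_wpM2l c0);apply:(le_trans (ler_wpM2l dr0 yg));rewrite mulrDr lerD2l.
  by apply:ler_piMl => //;exact:powR_ge0.
 have t3 : g x * (t * hump y * eta x) <= t * g x.
  rewrite [leRHS]mulrC;apply:(ler_wpM2l (g0 x));rewrite -mulrA;apply:ler_piMr;first exact:ltW.
  by rewrite mulr_ile1//;[exact:le_trans (le_trans fdf dr1)|have /andP[] := e01 x].
 rewrite -/y -/e (mulrA (eta x));move: t1 t2 t3.
 move: (c * (dramp y * (e `^ (p - 1) * r^-1))) (c * (dramp y * e `^ p)) (c * r^-1 `^ p) (be * _) (g x * (_ * _)) (t * g x) (al * _) => s1 s2 s3 s4 s5 s6 s7.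
 by clear;lra.
have step : intg (cube x0 (r / 4)) (fun x => dhump ((z x - l) / t) * enorm (D x) `^ p) <=
  intg K (fun x => eta x * (dhump ((z x - l) / t) * enorm (D x) `^ p)).
 set K' : set E := cube x0 (r / 4);have mK' : msr K' := msr_cpt (cube_cpt (x0:=x0) (r:=r/4)).
 have K'K : K' `<=` K by apply:cube_sub;lra.
 have -> : intg K' (fun x => dhump ((z x - l) / t) * enorm (D x) `^ p) =
  intg K' (fun x => eta x * (dhump ((z x - l) / t) * enorm (D x) `^ p)).
  apply:eq_intg => x K'x;rewrite e1 ?mul1r//.
  by apply:(cube_sub _ K'x);lra.
 by apply:(intg_subset mK mK' K'K iP0) => x _;rewrite mulr_ge0// mulr_ge0 ?powR_ge0.
have gg : intg K g <= intg K0 g by apply:(intg_subset mK0 mK KK0 (ig K0 cK0 KU)) => x _.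
apply:(le_trans step);rewrite -mulrA mulrAC ler_pdivlMr// mulrC;apply:(le_trans main).
have v0 : 0 <= r^-1 `^ p * vol S by rewrite mulr_ge0 ?powR_ge0 ?vol_ge0.
have v1 : r^-1 `^ p * vol S <= r^-1 `^ p * vol S0 by rewrite ler_wpM2l ?powR_ge0.
have i0 : 0 <= intg K0 g by apply:intg_ge0 => x _.
have m0 : 0 <= be * (2 * M) by rewrite !mulr_ge0// ltW.
rewrite /c -(mulrA _ _ (vol S)).
exact:(energy2_arith m0 (ltW t0) (le_trans v0 v1) i0 en1 v1 gg).
Qed.

End DeGiorgiIteration.

(** * One De Giorgi step *)

Section DeGiorgiLevels.
Context {R : realType} {n : nat}.
Local Notation E := 'rV[R]_n.
Local Notation mu := (@lam R n).
Local Notation cv := (@cube_vol R n).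
Implicit Types (g v z Q : E -> R) (D : E -> E) (U K B : set E).

Lemma vol_setD_ge (A B : set E) : msr A -> msr B -> (mu A < +oo)%E -> (mu B < +oo)%E ->
 vol A - vol B <= vol (A `\` B).
Proof.
move=>mA mB Af Bf.
have If : (mu (A `&` B) < +oo)%E by apply:lamS_lty Bf => x [].
have Df : (mu (A `\` B) < +oo)%E by apply:lamS_lty Af => x [].
have fn X : (mu X < +oo)%E -> mu X \is a fin_num by move=>Xf;rewrite ge0_fin_numE.
have e : vol A = vol (A `\` B) + vol (A `&` B) by rewrite /vol (measureDI mu mA mB) fineD//;exact:fn.
rewrite e;have := le_vol (msrI mA mB) mB (@subIsetr _ A B) Bf;lra.
Qed.

Lemma level_step_arith (v t a sg r d' C X c w v0 m rp q1 q2 : R) : 0 < a -> 0 < t -> 0 <= sg -> 0 <= r -> 0 <= q1 -> 0 <= C -> 0 <= m ->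
 v * (a / 2) * t <= sg * r * a * (m * (d' * (c * v0) + q1 * (C * t * X))) ->
 X <= rp * (c + w) * v0 -> r * q1 * rp = q2 ->
 v * t <= 2 * m * sg * (r * d' * c + C * t * q2 * (c + w)) * v0.
Proof.
move=>a0 t0 sg0 r0 q10 C0 m0 h hX hq;rewrite -(ler_pM2r a0).
have k : 0 <= sg * r * a * m * q1 * C * t by rewrite !mulr_ge0// ltW.
have h2 := ler_wpM2l k hX;rewrite -hq;lra.
Qed.

(** The set above level [l] has relative measure at most [c], and [2 * c <= sg ^+ n] makes the set
    below [l] fill half of every ball of radius [sg * r] near the smaller cube. So [level_gap]
    applies at this small scale and yields the factor [sg]. The number [d] is the Young parameter
    between the L^1 and L^p norms of the gradient, and [w] measures the potential. *)
Lemma dg_step (p al be Z : R) : 1 < p -> 0 < al -> 0 <= be -> 0 <= Z ->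
 exists2 C : R, 0 < C & forall U z D g (x0 : E) (r l t d sg c w : R), open U -> dgfun p al be U z D g ->
 0 < r -> cube x0 r `<=` U -> 0 <= l -> 0 < t -> (forall x, cube x0 r x -> z x <= Z) ->
 0 < sg <= 8^-1 -> 2 * c <= sg ^+ n -> 0 < d ->
 vol (cube x0 r `&` [set x | l < z x]) <= c * (r ^+ n * cv) ->
 intg (cube x0 r) g <= w * (r^-1 `^ p * (r ^+ n * cv)) ->
 vol (cube x0 (r / 8) `&` [set x | l + 3 * t <= z x]) <=
  C * sg * (d * c / t + d `^ (1 - p) * (c + w)) * ((r / 8) ^+ n * cv).
Proof.
move=>p1 al0 be0 Z0;have [C1 C10 hC1] := @dg_energy2 R n p al be Z p1 al0 be0 Z0.
have e80 : 0 < 8 ^+ n :> R by rewrite exprn_gt0.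
exists (2 * (n%:R + 1) * (C1 + 1) * 8 ^+ n).
 by rewrite !mulr_gt0// ltr_pwDr.
move=>U z D g x0 r l t d sg c w oU dg r0 KU l0 t0 zZ /andP[sg0 sg8] csg d0 hv hg.
have en := hC1 U z D g x0 r l t oU dg r0 KU l0 t0 zZ.
have [W g0 ig _] := dg;have [W1 W2 W3 _] := W.
set K : set E := cube x0 r in KU zZ hv hg en *;have cK : compact K := cube_cpt (x0:=x0) (r:=r).
have mK := msr_cpt cK;have [mz mS] := msr_level l oU cK KU W1;set S : set E := K `&` _ in mS hv en *.
have SK : S `<=` K by move=>x [].
have [iS vS] := integ_indic_sub cK mS SK.
have Sf : (mu S < +oo)%E := lamS_lty SK (lamK_lty cK).
have cv0 : 0 < cv by exact:cube_vol_gt0.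
set v0 := r ^+ n * cv in hv hg;have v00 : 0 < v0 by rewrite mulr_gt0// exprn_gt0.
have r40 : 0 < r / 4 by rewrite divr_gt0.
have s0 : 0 < sg * r by rewrite mulr_gt0.
have Wh := Wfn_compC p1 oU W (fun s => is_derive_rescale l s t0 is_derive_hump) (rescale_cont (l:=l) (t:=t) dhump_continuous).
set K4 : set E := [set y | `|x0 - y| <= r / 4].
have K4K : K4 `<=` K by apply:cube_sub;lra.
have cK4 : compact K4 := cube_cpt (x0:=x0) (r:=r/4);have mK4 := msr_cpt cK4.
set Q : set E := ball x0 (r / 4);have mQ : msr Q by exact:msr_ball.
have QK4 : Q `<=` K4 by move=>x;rewrite /Q -ball_normE /= => /ltW.
have QK := subset_trans QK4 K4K.
pose Z0' : set E := Q `\` S;have mZ0 : msr Z0' := msrD mQ mS.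
set Z1 : set E := cube x0 (r / 8) `&` _.
have K8K : cube x0 (r / 8) `<=` K by apply:cube_sub;lra.
have cK8 : compact (cube x0 (r / 8)) := cube_cpt (x0:=x0) (r:=r/8).
have mZ1 : msr Z1.
 by apply:(msr_ge _ (msr_cpt cK8));exact:(msr_level l oU cK8 (subset_trans K8K KU) W1).1.
have Z0Q : Z0' `<=` Q by move=>x [].
have Z1Q : Z1 `<=` Q by move=>x [h _];rewrite /Q -ball_normE /=;move: h;rewrite /cube /=;lra.
set a := (sg * r) ^+ n * cv;have a0 : 0 < a by rewrite mulr_gt0// exprn_gt0.
have h0 x : Z0' x -> t * hump ((z x - l) / t) <= 0.
 move=>[Qx nS];have zl : z x <= l by rewrite leNgt;apply/negP => h;apply:nS;split=> //;exact:QK.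
 have [_ _ _ _ [e _]] := humpP ((z x - l) / t);rewrite e ?mulr0//.
 by apply:le_trans ler01;rewrite pmulr_lle0 ?invr_gt0// subr_le0.
have h1 x : Z1 x -> t <= t * hump ((z x - l) / t).
 move=>[_ zl];have [_ _ _ _ [_ e]] := humpP ((z x - l) / t);rewrite e ?mulr1//.
 by rewrite ler_pdivlMr// lerBrDl.
have hk x : Z1 x -> a / 2 <= vol (Z0' `&` ball x (sg * r)).
 move=>[Z1x _].
 have bQ : ball x (sg * r) `<=` Q.
  move=>y;rewrite /Q -!ball_normE /= => xy;have := ler_distD x x0 y;move: Z1x;rewrite /cube /=.
  have : sg * r <= 8^-1 * r by rewrite ler_wpM2r// ltW.
  by move: xy r0;move: (sg * r) (`|x0 - x|) (`|x0 - y|) (`|x - y|) => a1 a2 a3 a4;clear;lra.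
 have mb : msr (ball x (sg * r)) by exact:msr_ball.
 rewrite (_ : Z0' `&` _ = ball x (sg * r) `\` S);last first.
  by apply/seteqP;split=> [y [[_ ?] ?]//|y [by_ ny]];split=> //;split=> //;exact:bQ.
 apply:le_trans (vol_setD_ge mb mS (lamB_lty _ _) Sf);rewrite vol_ball//.
 have ae : a = sg ^+ n * v0 by rewrite /a exprMn mulrA.
 have : vol S <= a / 2;last by rewrite -/a;lra.
 apply:(le_trans hv);rewrite ae;have := ler_wpM2r (ltW v00) csg;lra.
have [iQG hQ] := level_gap p1 Wh (subset_trans K4K KU) r40 s0 mZ0 mZ1 Z0Q Z1Q (divr_ge0 (ltW a0) (ler0n _ 2)) t0 h0 h1 hk.
rewrite subr0 vol_ball// -/a in hQ.
(* Dividing by [r] makes [d] dimensionless; [hq] below removes the remaining powers of [r]. *)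
set d' := d / r;have d'0 : 0 < d' by rewrite divr_gt0.
have dhb x : [/\ 0 <= dhump ((z x - l) / t), dhump ((z x - l) / t) <= 1 & z x <= l -> dhump ((z x - l) / t) = 0].
 have [_ b1 b2 _ [b3 _]] := rampP ((z x - l) / t);have [_ c1 c2 _ _] := humpP ((z x - l) / t).
 split=> [//||zl];first exact:le_trans b2.
 have [|_ e0] := b3;first by rewrite pmulr_lle0 ?invr_gt0// subr_le0.
 by apply/eqP;rewrite eq_le c1 andbT -e0.
have mdh : meas K (fun x => dhump ((z x - l) / t)) := meas_comp_cont (rescale_cont (l:=l) (t:=t) dhump_continuous) mz.
have iE : integ K (fun x => dhump ((z x - l) / t) * enorm (D x) `^ p).
 apply:(integ_mulb mK mdh _ (W3 K cK KU) (c := 1)) => x _.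
 by have [b1 b2 _] := dhb x;rewrite ger0_norm.
have IQ : intg Q (fun x => enorm (dhump ((z x - l) / t) *: D x)) <=
  d' * vol S + d' `^ (1 - p) * intg K4 (fun x => dhump ((z x - l) / t) * enorm (D x) `^ p).
 have j1 := integ_sub mK mQ QK iS;have j2 := integ_sub mK mQ QK iE.
 have k1 := integZ d' mQ j1;have k2 := integZ (d' `^ (1 - p)) mQ j2.
 apply:(@le_trans _ _ (d' * intg Q (\1_S : E -> R) + d' `^ (1 - p) * intg Q (fun x => dhump ((z x - l) / t) * enorm (D x) `^ p))).
  rewrite -(intgZ _ mQ j1) -(intgZ _ mQ j2) -(intgD mQ k1 k2).
  apply:(intg_le mQ iQG (integD mQ k1 k2)) => x Qx;have [b1 b2 b3] := dhb x.
  rewrite enormZ (ger0_norm b1).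
  have [zl|zl] := leP (z x) l.
   by rewrite b3// !(mul0r, mulr0) addr0 mulr_ge0 ?(ltW d'0)// indicE ler0n.
  rewrite indicE mem_set;last by split=> //;exact:QK.
  have := young_trivial ler01 (enorm_ge0 (D x)) d'0 p1;rewrite !powR1 mul1r mulr1 => yg.
  apply:(le_trans (ler_wpM2l b1 yg));rewrite mulrDr;apply:lerD;first by apply:ler_piMl => //;exact:ltW.
  by rewrite mulrCA.
 apply:lerD.
  apply:(ler_wpM2l (ltW d'0));rewrite -vS;apply:(intg_subset mK mQ QK iS) => x _.
  by rewrite indicE ler0n.
 apply:ler_wpM2l;first exact:powR_ge0.
 apply:(intg_subset mK4 mQ QK4 (integ_sub mK mK4 K4K iE)) => x _;have [b1 _ _] := dhb x.
 by rewrite mulr_ge0 ?powR_ge0.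
set X := r^-1 `^ p * vol S + intg K g in en.
have hX : X <= r^-1 `^ p * (c + w) * v0.
 rewrite /X;have := ler_wpM2l (powR_ge0 r^-1 p) hv;move: hg.
 by move: (r^-1 `^ p) (intg K g) (vol S) => q1 q2 q3;clear;nra.
have q1 : 0 <= d' `^ (1 - p) by exact:powR_ge0.
have hq : r * d' `^ (1 - p) * r^-1 `^ p = d `^ (1 - p).
 have ri0 : 0 <= r^-1 by rewrite invr_ge0 ltW.
 rewrite /d' powRM ?(ltW d0)// mulrCA -!mulrA -powRD;last by rewrite invr_neq0 ?implybT// gt_eqF.
 by rewrite subrK powRr1// mulfV ?mulr1// gt_eqF.
have m0 : 0 <= n%:R :> R by [].
have hfin : vol Z1 * (a / 2) * t <= sg * r * a * (n%:R * (d' * (c * v0) + d' `^ (1 - p) * (C1 * t * X))).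
 apply:(le_trans hQ);apply:ler_wpM2l;first by rewrite mulr_ge0 ?ltW.
 apply:(ler_wpM2l m0);apply:(le_trans IQ);apply:lerD;first by apply:(ler_wpM2l (ltW d'0)).
 exact:(ler_wpM2l q1 en).
have := level_step_arith a0 t0 (ltW sg0) (ltW r0) q1 C10 m0 hfin hX hq.
have -> : r * d' * c = d * c by rewrite /d';field;rewrite gt_eqF.
have c0 : 0 <= c by rewrite -(pmulr_lge0 _ v00);exact:le_trans (vol_ge0 _) hv.
have cw0 : 0 <= c + w.
 have : 0 <= r^-1 `^ p * (c + w) * v0.
  apply:le_trans hX;rewrite addr_ge0 ?mulr_ge0 ?powR_ge0 ?vol_ge0//;exact:intg_ge0.
 by rewrite pmulr_lge0// pmulr_rge0// powR_gt0// invr_gt0.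
move=>fin;have vt : (r / 8) ^+ n * cv * 8 ^+ n = v0 by rewrite mulrAC -exprMn divfK.
rewrite -(ler_pM2r t0);apply:(le_trans fin).
have -> : 2 * (n%:R + 1) * (C1 + 1) * 8 ^+ n * sg * (d * c / t + d `^ (1 - p) * (c + w)) * ((r / 8) ^+ n * cv) * t =
 2 * (n%:R + 1) * (C1 + 1) * sg * ((d * c / t + d `^ (1 - p) * (c + w)) * t) * v0 by rewrite -vt;ring.
apply:(ler_wpM2r (ltW v00));rewrite [(_ + _) * t]mulrDl divfK ?gt_eqF//.
have e1 : 0 <= d * c by rewrite mulr_ge0 ?(ltW d0).
have e2 : 0 <= d `^ (1 - p) * (c + w) * t by rewrite !mulr_ge0 ?powR_ge0 ?(ltW t0).
have -> : C1 * t * d `^ (1 - p) * (c + w) = C1 * (d `^ (1 - p) * (c + w) * t) by ring.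
move: e1 e2;move: (d * c) (d `^ (1 - p) * (c + w) * t) => y1 y2 y10 y20.
rewrite -!(mulrA 2);apply:(ler_wpM2l (ler0n _ 2)).
have e : (n%:R + 1) * (C1 + 1) * sg * (y1 + y2) - n%:R * sg * (y1 + C1 * y2) =
 sg * ((n%:R + 1) * (C1 * y1 + y2) + (y1 + C1 * y2)) by ring.
rewrite -!mulrA in e *;rewrite -subr_ge0 e.
by rewrite mulr_ge0 ?(ltW sg0)// addr_ge0// ?mulr_ge0 ?addr_ge0// ?mulr_ge0.
Qed.

End DeGiorgiLevels.

(** * De Giorgi iteration *)

Section DeGiorgiLimit.
Context {R : realType} {n : nat}.
Local Notation E := 'rV[R]_n.
Local Notation cv := (@cube_vol R n).
Implicit Types (g z : E -> R) (D : E -> E) (U : set E).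

Lemma powR_inv_cancel (x k : R) : 0 <= x -> k != 0 -> (x `^ k) `^ k^-1 = x.
Proof. by move=>x0 k0;rewrite -powRrM mulfV// powRr1. Qed.

(* [d] and [t] make the two summands equal to [(sg * th) ^+ n / 4]. *)
Lemma dg_params (p C th : R) : 1 < p -> 0 < C -> 0 < th -> exists2 C2 : R, 0 < C2 & forall sg w : R, 0 < sg <= 1 -> 0 <= w ->
 exists d t : R, [/\ 0 < d, 0 < t,
  C * sg * (d * (sg ^+ n / 2) / t + d `^ (1 - p) * (sg ^+ n / 2 + w)) <= (sg * th) ^+ n / 2 &
  t <= C2 * (sg + (sg `^ (p - n%:R) * w) `^ (p - 1)^-1)].
Proof.
move=>p1 C0 th0;have k0 : 0 < (p - 1)^-1 by rewrite invr_gt0 subr_gt0.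
set k := (p - 1)^-1 in k0 *;have thn : 0 < th ^+ n by rewrite exprn_gt0.
pose a := 2 * C / th ^+ n;have a0 : 0 < a by rewrite divr_gt0// mulr_gt0.
have a20 : 0 < 2 * a by rewrite mulr_gt0.
exists (a * (2 * a) `^ k * 2 `^ k).
 by apply:mulr_gt0;[apply:mulr_gt0 => //|];exact:powR_gt0.
move=>sg w /andP[sg0 sg1] w0;have sn : 0 < sg ^+ n by rewrite exprn_gt0.
pose D := sg ^+ n / 2 + w;have D0 : 0 < D by rewrite ltr_wpDr// divr_gt0.
(* With [t = a * sg * d] the first summand has the right size for every [d]; the second one then
   asks for [d^(p-1) = b]. *)
pose b := 2 * a * sg * D / sg ^+ n;have b0 : 0 < b := divr_gt0 (mulr_gt0 (mulr_gt0 a20 sg0) D0) sn.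
pose d := b `^ k;have d0 : 0 < d by rewrite powR_gt0.
exists d, (a * sg * d);split=> [//|||];first exact:(mulr_gt0 (mulr_gt0 a0 sg0) d0).
 have -> : d `^ (1 - p) = b^-1.
  have pn : p - 1 != 0 by rewrite gt_eqF// subr_gt0.
  have kk : (p - 1)^-1 * (1 - p) = -1 by field.
  by rewrite /d -powRrM /k kk powRN powRr1 ?(ltW b0).
 rewrite -/D exprMn le_eqVlt;apply/orP;left;apply/eqP;rewrite /b /a;field.
 by rewrite !gt_eqF.
have kp : sg = (sg `^ (p - 1)) `^ k by rewrite /k powR_inv_cancel// ?ltW// gt_eqF// subr_gt0.
have e1 : sg * d = (2 * a) `^ k * (sg `^ (p - n%:R) * D) `^ k.
 have g0 : 0 <= sg `^ (p - 1) by exact:powR_ge0.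
 have D1 : 0 <= sg `^ (p - n%:R) * D := mulr_ge0 (powR_ge0 _ _) (ltW D0).
 rewrite -(powRM k (ltW a20) D1) [in LHS]kp -(powRM k g0 (ltW b0));congr (_ `^ k).
 have -> : sg `^ (p - n%:R) = sg `^ (p - 1) * sg / sg ^+ n.
  have sn0 : sg != 0 by rewrite gt_eqF.
  by rewrite -(powR_step (ltW sg0) p1) powRD ?sn0 ?implybT// powRN powR_mulrn// ltW.
 by rewrite /b;ring.
rewrite -!(mulrA a) e1 -(mulrA ((2 * a) `^ k));apply:(ler_wpM2l (ltW a0));apply:(ler_wpM2l (powR_ge0 _ _)).
have -> : sg `^ (p - n%:R) * D = sg `^ p / 2 + sg `^ (p - n%:R) * w.
 rewrite mulrDr mulrA;congr (_ / _ + _);rewrite -powR_mulrn ?(ltW sg0)// -powRD ?subrK//.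
 by rewrite (gt_eqF sg0) implybT.
have w1 : 0 <= sg `^ (p - n%:R) * w by rewrite mulr_ge0 ?powR_ge0.
apply:(@le_trans _ _ (2 `^ k * ((sg `^ p / 2) `^ k + (sg `^ (p - n%:R) * w) `^ k))).
 by apply:powR_add_le;[rewrite divr_ge0 ?powR_ge0|exact:w1|exact:ltW].
rewrite ler_pM2l ?powR_gt0// lerD2r [leRHS]kp;apply:powR_mono;[exact:ltW|by rewrite divr_ge0 ?powR_ge0|].
apply:(@le_trans _ _ (sg `^ p));first by rewrite ler_pdivrMr// ler_peMr ?powR_ge0// ler1n.
by apply:ger_powR;[rewrite sg0|lra].
Qed.

Lemma vol_cube_ge (x : E) (s : R) : 0 < s -> s ^+ n * cv <= vol (cube x s).
Proof.
move=>s0;rewrite -(vol_ball x s0);apply:le_vol.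
- exact:msr_ball.
- exact:(msr_cpt (cube_cpt (x0:=x) (r:=s))).
- by move=>y;rewrite -ball_normE /= => /ltW.
- exact:(lamK_lty (cube_cpt (x0:=x) (r:=s))).
Qed.

(** A Dini-type condition: [m] bounds the normalized mass of the potential in cubes, and the sum is
    a discrete Wolff potential along the radii [rho / 8 ^+ j]. The weights account for the decrease
    of the parameter [sg] of [dg_step] by the factor [th] at each iteration. *)
Definition kato (p th : R) (m : R -> R) : Prop :=
 [/\ 0 < th < 1, forall s, 0 < s -> 0 <= m s, forall s t, 0 < s -> s <= t -> m s <= m t &
  forall e, 0 < e -> exists2 rho, 0 < rho & forall N : nat,
   \sum_(j < N) ((th ^+ j) `^ (p - n%:R) * m (rho / 8 ^+ j)) `^ (p - 1)^-1 <= e].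

(** [dg_step] is iterated on cubes of radius [r / 8 ^+ j] with [sg = s0 * th ^+ j]: the densities
    decrease geometrically while the levels rise in total by at most 1/2. *)
Lemma dg_local (p al be Z th Lg : R) m : 1 < p -> 0 < al -> 0 <= be -> 0 <= Z -> 0 <= Lg -> kato p th m ->
 exists c0 rho : R, [/\ 0 < c0, 0 < rho & forall U z D g (x0 : E) (r ka : R), open U -> dgfun p al be U z D g ->
  0 < ka -> 0 < r -> r <= rho * ka -> cube x0 r `<=` U -> (forall x, cube x0 r x -> z x <= Z) ->
  (forall s, 0 < s -> s <= r -> intg (cube x0 s) g <= Lg * m (s / ka) * (s^-1 `^ p * (s ^+ n * cv))) ->
  vol (cube x0 r `&` [set x | 0 < z x]) <= c0 * (r ^+ n * cv) -> z x0 <= 2^-1].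
Proof.
move=>p1 al0 be0 Z0 Lg0 [th01 m0 mm hm];have /andP[th0 th1] := th01.
have [C C0 hC] := @dg_step R n p al be Z p1 al0 be0 Z0.
have [C2 C20 hC2] := dg_params p1 C0 th0.
set k := (p - 1)^-1 in hm hC2 *;have k0 : 0 < k by rewrite invr_gt0 subr_gt0.
have th2 : 0 < 1 - th by rewrite subr_gt0.
(* [s0 <= 8^-1] is what [dg_step] asks for; the other bound keeps the geometric part of the total
   rise of the levels below 1/4. *)
have [s0 [s00 s08 s0s]] : exists s0 : R, [/\ 0 < s0, s0 <= 8^-1 & 3 * C2 * (s0 / (1 - th)) <= 4^-1].
 exists (Num.min 8^-1 ((1 - th) / (12 * C2)));split;first by rewrite lt_min invr_gt0 ltr0n/= divr_gt0 ?mulr_gt0.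
  by rewrite ge_min lexx.
 rewrite mulrA ler_pdivrMr// mulrC -ler_pdivlMr ?mulr_gt0//.
 rewrite ge_min;apply/orP;right;rewrite le_eqVlt;apply/orP;left;apply/eqP;field.
 by rewrite gt_eqF.
pose A := 3 * C2 * (s0 `^ (p - n%:R) * Lg) `^ k;have A0 : 0 <= A by rewrite !mulr_ge0 ?powR_ge0// ltW.
(* This smallness of the potential sum keeps its part of the rise below 1/4 as well. *)
have e0 : 0 < (4 * (A + 1))^-1 by rewrite invr_gt0 mulr_gt0// ltr_wpDl.
have [rho rho0 hrho] := hm _ e0.
exists (s0 ^+ n / 2), rho;split=> [||U z D g x0 r ka oU dg ka0 r0 rka KU zZ hg hv].
 by rewrite divr_gt0// exprn_gt0.
 by [].
pose sg (j : nat) := s0 * th ^+ j.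
have sg0 j : 0 < sg j by rewrite mulr_gt0// exprn_gt0.
have thj j : th ^+ j <= 1 by apply:exprn_ile1;exact:ltW.
have sgs j : sg j <= s0 by rewrite /sg ler_piMr// ltW.
pose rr (j : nat) := r / 8 ^+ j.
have rr0 j : 0 < rr j by rewrite divr_gt0// exprn_gt0.
have rrr j : rr j <= r by rewrite ler_pdivrMr ?exprn_gt0// ler_peMr ?(ltW r0)// exprn_ege1// ler1n.
pose w (j : nat) := Lg * m (rr j / ka).
have w0 j : 0 <= w j by rewrite mulr_ge0// m0// divr_gt0.
have sg1 j : 0 < sg j <= 1 by rewrite sg0;apply:(le_trans (sgs j));apply:(le_trans s08);rewrite invf_le1// ler1n.
have /choice[d /choice[t hdt]] : forall j, exists d, exists t, [/\ 0 < d, 0 < t,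
  C * sg j * (d * (sg j ^+ n / 2) / t + d `^ (1 - p) * (sg j ^+ n / 2 + w j)) <= (sg j * th) ^+ n / 2 &
  t <= C2 * (sg j + (sg j `^ (p - n%:R) * w j) `^ k)].
 by move=>j;exact:hC2 (sg1 j) (w0 j).
pose l (N : nat) := \sum_(j < N) 3 * t j.
have l0 N : 0 <= l N by apply:sumr_ge0 => j _;have [_ t0 _ _] := hdt j;rewrite mulr_ge0// ltW.
have ind N : vol (cube x0 (rr N) `&` [set x | l N < z x]) <= sg N ^+ n / 2 * (rr N ^+ n * cv).
 elim:N => [|N IH].
  by rewrite /l big_ord0 /rr /sg !expr0 divr1 mulr1.
 have [d0 t0 hd _] := hdt N.
 have KN : cube x0 (rr N) `<=` U by apply:subset_trans KU;exact:cube_sub.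
 have sg8 : 0 < sg N <= 8^-1 by rewrite sg0 (le_trans (sgs N)).
 have c2 : 2 * (sg N ^+ n / 2) <= sg N ^+ n by rewrite mulrC divfK.
 have zN x : cube x0 (rr N) x -> z x <= Z by move=>/(cube_sub (rrr N));exact:zZ.
 have := hC U z D g x0 (rr N) (l N) (t N) (d N) (sg N) (sg N ^+ n / 2) (w N) oU dg (rr0 N) KN (l0 N) t0 zN sg8 c2 d0 IH (hg _ (rr0 N) (rrr N)).
 have e8 : rr N / 8 = rr N.+1 by rewrite /rr exprSr invfM mulrA.
 have es : sg N * th = sg N.+1 by rewrite /sg exprSr mulrA.
 have el : l N + 3 * t N = l N.+1 by rewrite /l big_ord_recr.
 rewrite e8 el => h;rewrite -es.
 have cK8 : compact (cube x0 (rr N.+1)) := cube_cpt (x0:=x0) (r:=rr N.+1).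
 have K8U : cube x0 (rr N.+1) `<=` U by apply:subset_trans KU;exact:cube_sub.
 have [W _ _ _] := dg;have [W1 _ _ _] := W;have [mz8 m8] := msr_level (l N.+1) oU cK8 K8U W1.
 have v0 : 0 <= rr N.+1 ^+ n * cv by rewrite mulr_ge0 ?exprn_ge0 ?(ltW (rr0 _))// ltW// cube_vol_gt0.
 apply:le_trans (le_trans h _);last exact:(ler_wpM2r v0 hd).
 apply:(le_vol m8 (msr_ge _ (msr_cpt cK8) mz8));first by move=>x [? /ltW].
 by apply:lamS_lty (lamK_lty cK8) => x [].
have lhalf N : l N <= 2^-1.
 apply:(@le_trans _ _ (3 * C2 * (\sum_(j < N) sg j) + A * \sum_(j < N) ((th ^+ j) `^ (p - n%:R) * m (rho / 8 ^+ j)) `^ k)).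
  rewrite !mulr_sumr -big_split/=;apply:ler_sum => j _;have [_ _ _ ht] := hdt j.
  apply:(le_trans (ler_wpM2l (ler0n _ 3) ht));rewrite mulrA mulrDr lerD2l.
  rewrite /A -!mulrA ler_pM2l// ler_pM2l// -powRM ?mulr_ge0 ?powR_ge0//;last first.
   by apply:m0;rewrite divr_gt0// exprn_gt0.
  apply:powR_mono;[exact:ltW|by rewrite mulr_ge0 ?powR_ge0|].
  rewrite /sg powRM ?(ltW s00) ?exprn_ge0 ?(ltW th0)// /w.
  have -> : s0 `^ (p - n%:R) * (th ^+ j) `^ (p - n%:R) * (Lg * m (rr j / ka)) =
   s0 `^ (p - n%:R) * (Lg * ((th ^+ j) `^ (p - n%:R) * m (rr j / ka))) by ring.
  rewrite -(mulrA _ Lg) ler_wpM2l ?powR_ge0// ler_wpM2l// ler_wpM2l ?powR_ge0//;apply:mm;first by rewrite divr_gt0.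
  by rewrite /rr mulrAC ler_wpM2r ?invr_ge0 ?exprn_ge0// ler_pdivrMr.
 have -> : 2^-1 = 4^-1 + 4^-1 :> R by field.
 apply:lerD.
  apply:le_trans s0s;rewrite ler_wpM2l ?mulr_ge0 ?(ltW C20)// -mulr_sumr ler_wpM2l ?(ltW s00)//.
  rewrite -[leRHS]div1r ler_pdivlMr// mulrC;elim:N {ind} => [|N IH];first by rewrite big_ord0 mulr0.
  have -> : (1 - th) * \sum_(j < N.+1) th ^+ j = 1 - th ^+ N.+1.
   elim:N.+1 => [|M IH'];first by rewrite big_ord0 mulr0 expr0 subrr.
   by rewrite big_ord_recr/= mulrDr IH' exprS;ring.
  by rewrite gerBl exprn_ge0// ltW.
 apply:(le_trans (ler_wpM2l A0 (hrho N)));rewrite invfM mulrCA ler_piMr// ler_pdivrMr ?mul1r;last by rewrite ltr_wpDl.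
 by rewrite lerDl.
rewrite leNgt;apply/negP => zx.
have [W _ _ _] := dg;have [W1 _ _ _] := W.
have Ux0 : U x0 by apply:KU;rewrite /cube /= subrr normr0 ltW.
(* By continuity a small cube about [x0] would lie entirely above the level [l N], although by [ind]
   this level set fills at most half of it. *)
have ez : 0 < z x0 - 2^-1 by rewrite subr_gt0.
have e20 : 0 < (z x0 - 2^-1) / 2 by rewrite divr_gt0.
have /cont_rVP/(_ _ e20)[del del0 hdel] := W1 x0 Ux0.
pose N := Num.bound (r / del).
have rN : rr N < del.
 rewrite ltr_pdivrMr ?exprn_gt0// mulrC -ltr_pdivrMr//.
 apply:(lt_trans (archi_boundP (divr_ge0 (ltW r0) (ltW del0)))).
 by rewrite -natrX ltr_nat;exact:ltn_expl.
have sub : cube x0 (rr N) `<=` cube x0 (rr N) `&` [set x | l N < z x].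
 move=>y h;split=> //;rewrite /=;have := hdel y (le_lt_trans h rN).
 rewrite ler_norml => /andP[_ h2];apply:(le_lt_trans (lhalf N));lra.
have := ind N;rewrite (_ : cube x0 (rr N) `&` _ = cube x0 (rr N));last first.
 by apply/seteqP;split=> // y [].
move=>/(le_trans (vol_cube_ge x0 (rr0 N))).
have v0 : 0 < rr N ^+ n * cv by rewrite mulr_gt0 ?exprn_gt0// cube_vol_gt0.
rewrite -[leLHS]mul1r ler_pM2r// ler_pdivlMr// mul1r => h.
have : sg N ^+ n <= 1 by apply:exprn_ile1;[exact:ltW|have /andP[] := sg1 N].
move: h;rewrite leNgt => /negP + h;apply;apply:(le_lt_trans h);exact:ltr1n.
Qed.

End DeGiorgiLimit.

(** * Logarithmic gradient estimate *)

Section HarnackSteps.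
Context {R : realType} {n : nat}.
Local Notation E := 'rV[R]_n.
Local Notation mu := (@lam R n).
Local Notation cv := (@cube_vol R n).
Implicit Types (u v V eta : E -> R) (G D : E -> E) (U K B : set E) (A : E -> E -> E) (m : R -> R).

(** [ka] is a unit of length: the modulus [m] is evaluated at [s / ka], and the constants below
    depend on [m] but not on [ka], which makes them scale invariant. *)
Definition hsol (p al be : R) m U B A V (ka : R) u G : Prop :=
[/\ open U, mu B = 0%E, elliptic p al be U B A, forall K, compact K -> K `<=` U -> integ K V &
 wsol p B A V U u G /\ forall x s, 0 < s -> cube x s `<=` U ->
  intg (cube x s) (fun y => `|V y|) <= m (s / ka) * (s^-1 `^ p * (s ^+ n * cv))].

Lemma wsol_sub p B A V U U' u G : U' `<=` U -> wsol p B A V U u G -> wsol p B A V U' u G.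
Proof.
move=>sU [W u0 G0 mA wk];split.
- exact:Wfn_sub W.
- by move=>x /sU;exact:u0.
- exact:G0.
- by move=>K cK KU;apply:mA => //;exact:subset_trans sU.
move=>phi [Cp cK KU'];have := wk phi;set K := closure _ in cK KU' *.
have KU := subset_trans KU' sU.
move=>/(_ (And3 Cp cK KU)).
by rewrite !(intg_cut KU) ?(intg_cut KU') // => x _ /clsupp0[e1 e2];rewrite ?e1 ?e2 ?dot0r ?mulr0.
Qed.

Lemma elliptic_sub p al be U U' B A : U' `<=` U -> elliptic p al be U B A -> elliptic p al be U' B A.
Proof.
move=>sU [h1 h2 h3 h4];split.
- by move=>x xi /sU;exact:h1.
- by move=>x xi /sU;exact:h2.
- by move=>x a b /sU;exact:h3.
- by move=>x a b /sU;exact:h4.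
Qed.

Lemma hsol_sub p al be m U U' B A V ka u G : open U' -> U' `<=` U -> hsol p al be m U B A V ka u G ->
 hsol p al be m U' B A V ka u G.
Proof.
move=>oU' sU [oU B0 ell iV [su hV]];split => //.
- exact:elliptic_sub ell.
- by move=>K cK KU;apply:iV => //;exact:subset_trans sU.
split;first exact:wsol_sub su.
by move=>x s s0 h;apply:hV => //;exact:subset_trans sU.
Qed.

Lemma hsol_scale p al be m U B A V ka u G (c : R) : 1 < p -> 0 <= be -> 0 < c -> hsol p al be m U B A V ka u G ->
 hsol p al be m U B A V ka (fun x => c * u x) (fun x => c *: G x).
Proof.
move=>p1 be0 c0 [oU B0 ell iV [su hV]].
by have sc := wsol_scale p1 be0 oU ell iV c0 su.
Qed.

Lemma vol_cube_le (x : E) (s : R) : 0 < s -> vol (cube x s) <= 2 ^+ n * (s ^+ n * cv).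
Proof.
move=>s0;have s20 : 0 < 2 * s by rewrite mulr_gt0.
rewrite mulrA -exprMn -(vol_ball x s20);apply:le_vol.
- exact:(msr_cpt (cube_cpt (x0:=x) (r:=s))).
- exact:msr_ball.
- by move=>y;rewrite -ball_normE /cube /= => h;apply:(le_lt_trans h);rewrite ltr_pMl// ltr1n.
- exact:lamB_lty.
Qed.

Lemma log_arith (d X t1 D q v av : R) : (d + d) * X <= t1 -> D <= d * X + q -> v <= av -> d * X - (q + av) <= t1 - D - v.
Proof. lra. Qed.

(** The test function is [- u^(1-p) * eta]. It turns the potential term into [- V * eta], whatever
    the size of [u], so the bound for the gradient of [ln u] does not involve [u]. *)
Lemma log_gradient p al be : 1 < p -> 0 < al -> 0 <= be -> exists2 C : R, 0 <= C &
 forall m U B A V (ka : R) u G (x0 : E) (r : R), hsol p al be m U B A V ka u G -> 0 < r -> cube x0 (2 * r) `<=` U ->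
 [/\ Wfn p U (fun x => ln (u x)) (fun x => (u x)^-1 *: G x) &
 intg (cube x0 r) (fun x => enorm ((u x)^-1 *: G x) `^ p) <=
  C * (1 + m (2 * r / ka)) * (r^-1 `^ p * (r ^+ n * cv))].
Proof.
move=>p1 al0 be0;have [M M0 hM] := @cube_cutoff R n p p1.
have p10 : 0 < p - 1 by rewrite subr_gt0.
pose d := (p - 1) * al / 2;have d0 : 0 < d by rewrite divr_gt0 ?mulr_gt0.
pose C1 := d `^ (1 - p) * (be * M) `^ p;have C10 : 0 <= C1 by rewrite mulr_ge0 ?powR_ge0.
exists ((C1 + 1) * 4 ^+ n / d);first by rewrite divr_ge0 ?(ltW d0)// mulr_ge0 ?exprn_ge0// addr_ge0.
move=>m U B A V ka u G x0 r [oU B0 ell iV [su hV]] r0 KU;have [W u0 G0 mA _] := su;have [a1 a2 _ a4] := ell.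
have W0 := Wfn_ln p1 oU u0 W;split;first exact:W0.
have r20 : 0 < 2 * r by rewrite mulr_gt0.
have [eta [Ce e01 e1 eK ge]] := hM x0 (2 * r) r20;have [_ _ W3 _] := W0.
set Y := fun x => (u x)^-1 *: G x in W0 W3 *.
set K : set E := cube x0 (2 * r) in eK KU *;have cK : compact K := cube_cpt (x0:=x0) (r:=2*r).
have mK := msr_cpt cK;have iY := W3 K cK KU.
have e0 x : 0 <= eta x by have /andP[] := e01 x.
have iP0 : integ K (fun x => eta x * enorm (Y x) `^ p).
 apply:(integ_mulb mK _ _ iY (c := 1));first by apply:meas_cont;exact:Ck_cont Ce.
 by move=>x _;rewrite ger0_norm;have /andP[] := e01 x.
have iP := integZ d mK iP0.
have iQ1 := integ_cst (C1 * (2 * r)^-1 `^ p) mK (lamK_lty cK);have iQ2 := integ_abs mK (iV K cK KU).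
have iQ := integD mK iQ1 iQ2.
have Wf : Wfn p U (fun x => - (u x)^-1 `^ (p - 1)) (fun x => ((p - 1) * (u x)^-1 `^ (p - 1)) *: Y x).
 have W1 := Wfn_exp p1 oU (Wfn_lin (1 - p) 0 p1 oU W0 W0).
 have ex x : U x -> expR ((1 - p) * ln (u x) + 0 * ln (u x)) = (u x)^-1 `^ (p - 1).
  move=>Ux;rewrite mul0r addr0 /powR invr_eq0 gt_eqF ?u0// lnV ?posrE ?u0//.
  by congr expR;ring.
 apply:Wfn_eq (Wfn_lin (-1) 0 p1 oU W1 W1) => // x Ux;rewrite (ex x Ux) ?mul0r ?addr0 ?mulN1r// !scale0r !addr0.
 by rewrite !scalerA;congr (_ *: _);ring.
have main : intg K (fun x => d * (eta x * enorm (Y x) `^ p)) <= intg K (fun x => C1 * (2 * r)^-1 `^ p + `|V x|).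
 apply:(wsol_ineq p1 be0 oU B0 ell iV su Wf Ce cK KU eK iP iQ) => x Kx nB;have Ux := KU x Kx;have ux := u0 x Ux.
 have ui : 0 < (u x)^-1 by rewrite invr_gt0.
 set s := (u x)^-1 `^ (p - 1).
 have hA : A x (Y x) = s *: A x (G x) by have [_ _ ->] := a4 x (G x) (G x) Ux.
 have us : u x `^ (p - 1) * s = 1 by rewrite /s -powRM ?(ltW ux) ?(ltW ui)// mulfV ?gt_eqF// powR1.
 have -> : dot (A x (G x)) (eta x *: (((p - 1) * s) *: Y x)) = eta x * ((p - 1) * dot (A x (Y x)) (Y x)).
  by rewrite hA dotZl !dotZr;ring.
 have -> : dot (A x (G x)) ((- s) *: grad eta x) = - dot (A x (Y x)) (grad eta x).
  by rewrite hA dotZl dotZr;ring.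
 have -> : V x * u x `^ (p - 1) * (- s * eta x) = - (V x * eta x).
  by transitivity (- (V x * eta x * (u x `^ (p - 1) * s)));[ring|rewrite us mulr1].
 set e := enorm (Y x);have en : 0 <= e by exact:enorm_ge0.
 have b1 : eta x * ((p - 1) * (al * e `^ p)) <= eta x * ((p - 1) * dot (A x (Y x)) (Y x)).
  by apply:(ler_wpM2l (e0 x));apply:(ler_wpM2l (ltW p10));exact:a2.
 have b3 : V x * eta x <= `|V x|.
  apply:(le_trans (ler_norm _));rewrite normrM ler_piMr// ger0_norm//;by have /andP[] := e01 x.
 have y0 : 0 <= be * (M / (2 * r)) := mulr_ge0 be0 (divr_ge0 (ltW M0) (ltW r20)).
 have ri0 : 0 <= (2 * r)^-1 by rewrite invr_ge0 ltW.
 have hY : (be * (M / (2 * r))) `^ p = (be * M) `^ p * (2 * r)^-1 `^ p.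
  by rewrite mulrA (powRM p (mulr_ge0 be0 (ltW M0)) ri0).
 have pn : p != 0 by rewrite gt_eqF//;lra.
 have := young_trivial (mulr_ge0 en (powR_ge0 (eta x) p^-1)) y0 d0 p1.
 rewrite hY (powRM p en (powR_ge0 _ _)) (powRM (p - 1) en (powR_ge0 _ _)) -!powRrM mulVf// powRr1// (mulrC p^-1) => yg.
 have b2 : dot (A x (Y x)) (grad eta x) <= d * (e `^ p * eta x) + C1 * (2 * r)^-1 `^ p.
  rewrite (_ : C1 * _ = d `^ (1 - p) * ((be * M) `^ p * (2 * r)^-1 `^ p));last by rewrite /C1 -mulrA.
  apply:le_trans yg;apply:(le_trans (dot_le_enorm _ _)).
  apply:(@le_trans _ _ ((be * e `^ (p - 1)) * (M / (2 * r) * eta x `^ ((p - 1) / p)))).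
   by apply:ler_pM;rewrite ?enorm_ge0//;exact:a1.
  by apply:eq_lexx;ring.
 have dd : (p - 1) * al = d + d by rewrite /d;lra.
 have {}b1 : (d + d) * (eta x * e `^ p) <= eta x * ((p - 1) * dot (A x (Y x)) (Y x)).
  by apply:le_trans b1;rewrite -dd;apply:eq_lexx;ring.
 rewrite (mulrC (e `^ p)) in b2;exact:(log_arith b1 b2 b3).
rewrite (intgZ _ mK iP0) (intgD mK iQ1 iQ2) (intg_cst _ mK) in main.
set K' : set E := cube x0 r;have mK' : msr K' := msr_cpt (cube_cpt (x0:=x0) (r:=r)).
have K'K : K' `<=` K by apply:cube_sub;lra.
have step : intg K' (fun x => enorm (Y x) `^ p) <= intg K (fun x => eta x * enorm (Y x) `^ p).
 have -> : intg K' (fun x => enorm (Y x) `^ p) = intg K' (fun x => eta x * enorm (Y x) `^ p).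
  apply:eq_intg => x K'x;rewrite e1 ?mul1r// mulrAC mulfV ?mul1r//.
 by apply:(intg_subset mK mK' K'K iP0) => x _;rewrite mulr_ge0 ?powR_ge0.
have h1 := vol_cube_le x0 r20;have h2 := hV x0 (2 * r) r20 KU.
have qq : (2 * r)^-1 `^ p <= r^-1 `^ p.
 have p0 : 0 <= p by lra.
 apply:(powR_mono p0);first by rewrite invr_ge0 ltW.
 by rewrite lef_pV2 ?posrE// ler_peMl ?(ltW r0)// ler1n.
set v0 := r ^+ n * cv;have v00 : 0 <= v0 by rewrite mulr_ge0 ?exprn_ge0 ?(ltW r0)// ltW// cube_vol_gt0.
have e4 : 2 ^+ n * ((2 * r) ^+ n * cv) = 4 ^+ n * v0.
 by rewrite /v0 exprMn (_ : 4 = 2 * 2 :> R) ?exprMn;[ring|rewrite -natrM].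
have e2 : (2 * r) ^+ n * cv = 2 ^+ n * v0 by rewrite /v0 exprMn mulrA.
have t24 : 2 ^+ n <= 4 ^+ n :> R by rewrite lerXn2r ?nnegrE ?ler_nat.
rewrite e4 in h1;rewrite e2 in h2.
have m0 : 0 <= m (2 * r / ka).
 have : 0 <= m (2 * r / ka) * ((2 * r)^-1 `^ p * (2 ^+ n * v0)) by apply:le_trans h2;exact:intg_ge0.
 by rewrite pmulr_lge0// mulr_gt0 ?powR_gt0 ?invr_gt0// mulr_gt0 ?exprn_gt0// mulr_gt0 ?exprn_gt0// cube_vol_gt0.
have x1 : C1 * (2 * r)^-1 `^ p * vol K <= C1 * (r^-1 `^ p * (4 ^+ n * v0)).
 by rewrite -mulrA;apply:(ler_wpM2l C10);apply:ler_pM => //;[exact:powR_ge0|exact:vol_ge0].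
have x2 : intg K (fun x => `|V x|) <= m (2 * r / ka) * (r^-1 `^ p * (4 ^+ n * v0)).
 apply:(le_trans h2);apply:(ler_wpM2l m0);apply:ler_pM => //;first exact:powR_ge0.
  by rewrite mulr_ge0 ?exprn_ge0.
 exact:(ler_wpM2r v00 t24).
have X0 : 0 <= r^-1 `^ p * (4 ^+ n * v0) by rewrite mulr_ge0 ?powR_ge0// mulr_ge0 ?exprn_ge0.
have -> : (C1 + 1) * 4 ^+ n / d * (1 + m (2 * r / ka)) * (r^-1 `^ p * (r ^+ n * cv)) =
 (C1 + 1) * ((1 + m (2 * r / ka)) * (r^-1 `^ p * (4 ^+ n * v0))) / d by rewrite /v0;ring.
apply:(le_trans step);rewrite ler_pdivlMr// mulrC;apply:(le_trans main);apply:(le_trans (lerD x1 x2)).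
move: C10 m0 X0;move: (m _) (_ * (4 ^+ n * v0)) => y1 y2 C10 y10 y20.
have := mulr_ge0 C10 (mulr_ge0 y10 y20);have := mulr_ge0 C10 y20;lra.
Qed.

End HarnackSteps.

(** * Spreading of positivity and the Harnack inequality *)

Section Harnack.
Context {R : realType} {n : nat}.
Local Notation E := 'rV[R]_n.
Local Notation cv := (@cube_vol R n).
Implicit Types (u V Q : E -> R) (G : E -> E) (U B : set E) (A : E -> E -> E) (m : R -> R).

Lemma hsol_dg p al be m U B A V ka u G (sg b La : R) : 1 < p -> 0 < al -> 0 <= be -> sg = 1 \/ sg = -1 -> 0 <= La ->
 hsol p al be m U B A V ka u G -> (forall x, U x -> 0 < sg * u x + b -> u x <= La) ->
 dgfun p al be U (fun x => sg * u x + b) (fun x => sg *: G x) (fun x => La `^ (p - 1) * `|V x|) /\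
 forall x s, 0 < s -> cube x s `<=` U ->
  intg (cube x s) (fun y => La `^ (p - 1) * `|V y|) <= La `^ (p - 1) * m (s / ka) * (s^-1 `^ p * (s ^+ n * cv)).
Proof.
move=>p1 al0 be0 sg1 La0 [oU B0 ell iV [su hV]] h;split;first exact:(wsol_dgfun p1 be0 oU B0 ell iV sg1 su La0 h).
move=>x s s0 sU;have cK : compact (cube x s) := cube_cpt (x0:=x) (r:=s);have mK := msr_cpt cK.
rewrite (intgZ _ mK (integ_abs mK (iV _ cK sU))) -mulrA.
by apply:ler_wpM2l;[exact:powR_ge0|exact:hV].
Qed.

(** This is [dg_local] for [u / k - 1/2], which is at most [La] on the cube and equals 1/2 exactly
    when [u = k]. *)
Lemma level_bound p al be th m (La : R) : 1 < p -> 0 < al -> 0 <= be -> @kato R n p th m -> 0 <= La ->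
 exists c0 rho : R, [/\ 0 < c0, 0 < rho & forall U B A V (ka : R) u G x (r k : R), hsol p al be m U B A V ka u G ->
  0 < ka -> 0 < r -> r <= rho * ka -> cube x r `<=` U -> 0 < k -> (forall y, cube x r y -> u y <= La * k) ->
  vol (cube x (r / 2) `&` [set y | k / 2 < u y]) <= c0 * ((r / 2) ^+ n * cv) -> u x <= k].
Proof.
move=>p1 al0 be0 kt La0.
have [c0 [rho [c00 rho0 hdg]]] := dg_local p1 al0 be0 La0 (powR_ge0 La (p - 1)) kt.
exists c0, rho;split=> // U B A V ka u G x r k hs ka0 r0 rka KU k0 uLa hv.
have ki : 0 < k^-1 by rewrite invr_gt0.
pose U' : set E := ball x r;have oU' : open U' by exact:ball_open.
have U'K : U' `<=` cube x r by move=>y;rewrite /U' -ball_normE /= => /ltW.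
have hs' := hsol_scale p1 be0 ki (hsol_sub oU' (subset_trans U'K KU) hs).
have uL y : U' y -> k^-1 * u y <= La.
 by move=>/U'K/uLa h;rewrite mulrC ler_pdivrMr.
have [dg hg] := hsol_dg (b := - 2^-1) p1 al0 be0 (or_introl (erefl (1 : R))) La0 hs' (fun y Uy _ => uL y Uy).
have r20 : 0 < r / 2 by rewrite divr_gt0.
have rka2 : r / 2 <= rho * ka by apply:le_trans rka;rewrite ler_pdivrMr// ler_pMr// ler1n.
have sub : cube x (r / 2) `<=` U'.
 by move=>y h;rewrite /U' -ball_normE /=;apply:(le_lt_trans h);rewrite ltr_pdivrMr// ltr_pMr// ltr1n.
have zle y : cube x (r / 2) y -> 1 * (k^-1 * u y) + - 2^-1 <= La.
 by move=>/sub/uL;move: (k^-1 * u y) => t;clear;lra.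
have := hdg U' _ _ _ x (r / 2) ka oU' dg ka0 r20 rka2 sub zle.
have hg' s : 0 < s -> s <= r / 2 -> intg (cube x s) (fun y => La `^ (p - 1) * `|V y|) <=
  La `^ (p - 1) * m (s / ka) * (s^-1 `^ p * (s ^+ n * cv)).
 by move=>s0 sr;apply:hg => //;apply:subset_trans sub;exact:cube_sub.
have e : [set y | 0 < 1 * (k^-1 * u y) + - 2^-1] = [set y | k / 2 < u y].
 apply/seteqP;split=> y /=;rewrite mul1r subr_gt0 ltr_pdivlMl//.
rewrite e => /(_ hg' hv);rewrite mul1r => h.
have : k^-1 * u x <= 1 by lra.
by rewrite mulrC ler_pdivrMr// mul1r.
Qed.

Lemma spread_arith (v1 z0 T v0 nu r ri s8 s16 nn J : R) : 0 < v0 -> 0 < nu -> 0 < r -> r * ri = 1 -> 0 <= T -> 0 <= z0 -> 0 <= s16 -> 0 <= nn ->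
 nu * v0 <= v1 -> v1 * z0 * T <= 16 * r * (s16 * v0) * (nn * J) -> J <= ri * s8 * v0 ->
 z0 * (nu * T) <= 16 * s16 * nn * s8 * v0.
Proof.
move=>v00 nu0 r0 rr T0 z00 s160 nn0 h1 h2 h3;rewrite -(ler_pM2r v00).
have k1 := ler_wpM2r (mulr_ge0 z00 T0) h1.
have c0 : 0 <= 16 * r * (s16 * v0) * nn by rewrite !mulr_ge0 ?(ltW r0)// ltW.
have k2 := ler_wpM2l c0 h3.
have e : 16 * r * (s16 * v0) * nn * (ri * s8 * v0) = 16 * s16 * nn * s8 * v0 * v0 * (r * ri) by ring.
rewrite e rr mulr1 in k2;move: k1 k2 h2;clear;lra.
Qed.

(** Expansion of positivity. With the bound of [log_gradient], [level_gap] for [ln (u / k)] between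
    the levels [- T] and 0 shows that the set where [u / k] is below [s0 = expR (- T)] has measure
    of order [1 / T]. For large [T] it is small enough for [dg_local] applied to
    [1 - u / (k * s0)]. *)
Lemma measure_spread p al be th m : 1 < p -> 0 < al -> 0 <= be -> @kato R n p th m ->
 exists2 rho : R, 0 < rho & forall nu : R, 0 < nu -> exists2 c : R, 0 < c <= 2^-1 &
  forall U B A V (ka : R) u G x0 (r k : R), hsol p al be m U B A V ka u G ->
  0 < ka -> 0 < r -> 16 * r <= rho * ka -> cube x0 (16 * r) `<=` U -> 0 < k ->
  nu * (r ^+ n * cv) <= vol (cube x0 r `&` [set y | k <= u y]) -> forall x, cube x0 (2 * r) x -> c * k <= u x.
Proof.
move=>p1 al0 be0 kt;have [_ m0 mm _] := kt.
have [c0 [rho [c00 rho0 hdg]]] := dg_local p1 al0 be0 ler01 ler01 kt.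
have [C C0 hC] := @log_gradient R n p al be p1 al0 be0.
exists rho => // nu nu0.
pose S8 : R := 8 ^+ n * (1 + C * (1 + m rho));have mr0 := m0 _ rho0.
have S80 : 0 <= S8 by rewrite mulr_ge0 ?exprn_ge0// addr_ge0 ?mulr_ge0 ?addr_ge0.
pose CC : R := 16 * 16 ^+ n * n%:R * S8;have CC0 : 0 <= CC := mulr_ge0 (mulr_ge0 (mulr_ge0 (ler0n _ 16) (exprn_ge0 _ (ler0n _ 16))) (ler0n _ n)) S80.
(* [CC] is the constant produced by [spread_arith]; this [T] brings the measure of the low set below
   the fraction [c0] demanded by [dg_local]. *)
pose T := CC / (nu * c0) + 1;have T0 : 0 < T by rewrite ltr_wpDl// divr_ge0// mulr_ge0 ?ltW.
pose s0 := expR (- T);have s00 : 0 < s0 := expR_gt0 _.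
have s01 : s0 <= 1 by rewrite /s0 -expR0 ler_expR oppr_le0 ltW.
exists (s0 / 2);first by rewrite divr_gt0// -[leRHS]mul1r ler_pM2r// invr_gt0.
move=>U B A V ka u1 G1 x0 r k hs1 ka0 r0 rka KU k0 hv1 x hx.
have ki : 0 < k^-1 by rewrite invr_gt0.
have hs := hsol_scale p1 be0 ki hs1.
pose u y := k^-1 * u1 y;pose G y := k^-1 *: G1 y;rewrite -/u -/G in hs.
have hv : nu * (r ^+ n * cv) <= vol (cube x0 r `&` [set y | 1 <= u y]).
 rewrite (_ : [set y | 1 <= u y] = [set y | k <= u1 y])//.
 by apply/seteqP;split=> y /=;rewrite /u mulrC ler_pdivlMr// mul1r.
suff : s0 / 2 <= u x by rewrite /u ler_pdivlMl// mulrC.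
have [oU B0 ell iV [su hV]] := hs;have [W u0 _ _ _] := su;have [W1 _ _ _] := W.
have r80 : 0 < 8 * r by rewrite mulr_gt0.
have r160 : 0 < 16 * r by rewrite mulr_gt0.
have KU2 : cube x0 (2 * (8 * r)) `<=` U by rewrite (_ : 2 * (8 * r) = 16 * r)//;ring.
have [WY hY] := hC m U B A V ka u G x0 (8 * r) hs r80 KU2.
set Y := fun y => (u y)^-1 *: G y in WY hY.
set v0 := r ^+ n * cv in hv;have v00 : 0 < v0 by rewrite mulr_gt0 ?exprn_gt0// cube_vol_gt0.
set K8 : set E := [set y | `|x0 - y| <= 8 * r].
have K8U : K8 `<=` U by apply:subset_trans KU;apply:cube_sub;lra.
have cK8 : compact K8 := cube_cpt (x0:=x0) (r:=8*r);have mK8 := msr_cpt cK8.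
have [_ mS] := msr_level s0 oU cK8 K8U W1.
set Q : set E := ball x0 (8 * r);have mQ : msr Q := msr_ball x0 (8 * r).
have QK8 : Q `<=` K8 by move=>y;rewrite /Q -ball_normE /= => /ltW.
pose Z0 : set E := Q `\` (K8 `&` [set y | s0 < u y]).
have mZ0 : msr Z0 := msrD mQ mS.
pose Z1 : set E := cube x0 r `&` [set y | 1 <= u y].
have cK1 : compact (cube x0 r) := cube_cpt (x0:=x0) (r:=r).
have K1K8 : cube x0 r `<=` K8 by apply:cube_sub;lra.
have mZ1 : msr Z1.
 by apply:(msr_ge _ (msr_cpt cK1));exact:(msr_level 0 oU cK1 (subset_trans K1K8 K8U) W1).1.
have Z0Q : Z0 `<=` Q by move=>y [].
have Z1Q : Z1 `<=` Q by move=>y [h _];rewrite /Q -ball_normE /=;move: h;rewrite /cube /=;lra.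
have h0 y : Z0 y -> ln (u y) <= - T.
 move=>[Qy nS];have us : u y <= s0 by rewrite leNgt;apply/negP => h;apply:nS;split=> //;exact:QK8.
 by rewrite -[leRHS]expRK ler_ln ?posrE// u0//;apply:K8U;exact:QK8.
have h1 y : Z1 y -> 0 <= ln (u y) by move=>[_ /= h];rewrite ln_ge0.
have hk y : Z1 y -> vol Z0 <= vol (Z0 `&` ball y (16 * r)).
 move=>Zy;rewrite (_ : Z0 `&` _ = Z0)//;apply/seteqP;split=> [w []//|w Zw];split=> //.
 move: (Z0Q w Zw) (Z1Q y Zy);rewrite /Q -!ball_normE /= => w1 y1.
 by have := ler_distD x0 y w;rewrite (distrC y x0);move: (`|y - w|) (`|x0 - y|) (`|x0 - w|) w1 y1 => a1 a2 a3;lra.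
have T0' : - T < 0 by rewrite oppr_lt0.
have [iG hG] := level_gap p1 WY K8U r80 r160 mZ0 mZ1 Z0Q Z1Q (vol_ge0 _) T0' h0 h1 hk.
have ri0 : 0 < r^-1 by rewrite invr_gt0.
have J : intg Q (fun y => enorm (Y y)) <= r^-1 * S8 * v0.
 have [_ _ W3 _] := WY;have iK := W3 K8 cK8 K8U;have iQ := integ_sub mK8 mQ QK8 iK.
 have c1 := integ_cst r^-1 mQ (lamB_lty x0 (8 * r));have c2 := integZ (r^-1 `^ (1 - p)) mQ iQ.
 apply:(@le_trans _ _ (r^-1 * vol Q + r^-1 `^ (1 - p) * intg K8 (fun y => enorm (Y y) `^ p))).
  apply:(@le_trans _ _ (intg Q (fun y => r^-1 + r^-1 `^ (1 - p) * enorm (Y y) `^ p))).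
   apply:(intg_le mQ iG (integD mQ c1 c2)) => y _.
   by have := young_trivial ler01 (enorm_ge0 (Y y)) ri0 p1;rewrite !powR1 mul1r mulr1.
  rewrite (intgD mQ c1 c2) (intg_cst _ mQ) (intgZ _ mQ iQ) lerD2l;apply:ler_wpM2l;first exact:powR_ge0.
  by apply:(intg_subset mK8 mQ QK8 iK) => y _;exact:powR_ge0.
 have e8 : (8 * r) ^+ n * cv = 8 ^+ n * v0 by rewrite /v0 exprMn mulrA.
 rewrite vol_ball// e8;rewrite e8 in hY.
 have m16 : m (2 * (8 * r) / ka) <= m rho.
  by apply:mm;[rewrite !mulr_gt0// invr_gt0|rewrite ler_pdivrMr//;move: rka;clear;lra].
 have q8 : (8 * r)^-1 `^ p <= r^-1 `^ p.
  have p0 : 0 <= p by lra.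
  apply:(powR_mono p0);first by rewrite invr_ge0 ltW.
  by rewrite lef_pV2 ?posrE// ler_peMl ?(ltW r0)// ler1n.
 have t8 : 0 <= 8 ^+ n * v0 by rewrite mulr_ge0 ?exprn_ge0 ?(ltW v00).
 have hK : intg K8 (fun y => enorm (Y y) `^ p) <= C * (1 + m rho) * (r^-1 `^ p * (8 ^+ n * v0)).
  apply:(le_trans hY);apply:ler_pM;last exact:(ler_wpM2r t8 q8).
  - by rewrite mulr_ge0// addr_ge0// m0// !mulr_gt0 ?invr_gt0.
  - by rewrite mulr_ge0 ?powR_ge0.
  - by apply:(ler_wpM2l C0);rewrite lerD2l.
 have rr : r^-1 `^ (1 - p) * r^-1 `^ p = r^-1.
  by rewrite -powRD ?(gt_eqF ri0) ?implybT// subrK powRr1// ltW.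
 have := ler_wpM2l (powR_ge0 r^-1 (1 - p)) hK.
 have -> : r^-1 `^ (1 - p) * (C * (1 + m rho) * (r^-1 `^ p * (8 ^+ n * v0))) = r^-1 * (C * (1 + m rho) * (8 ^+ n * v0)).
  by transitivity (r^-1 `^ (1 - p) * r^-1 `^ p * (C * (1 + m rho) * (8 ^+ n * v0)));[ring|rewrite rr].
 have -> : r^-1 * S8 * v0 = r^-1 * (8 ^+ n * v0) + r^-1 * (C * (1 + m rho) * (8 ^+ n * v0)) by rewrite /S8;ring.
 by rewrite lerD2l.
have vZ : vol Z0 <= c0 * v0.
 rewrite sub0r opprK vol_ball// (_ : (16 * r) ^+ n * cv = 16 ^+ n * v0) in hG;last by rewrite /v0 exprMn mulrA.
 have e16 : 0 <= 16 ^+ n :> R by rewrite exprn_ge0.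
 have := spread_arith v00 nu0 r0 (mulfV (lt0r_neq0 r0)) (ltW T0) (vol_ge0 Z0) e16 (ler0n _ n) hv hG J.
 rewrite -/CC => h;have nT : 0 < nu * T by rewrite mulr_gt0.
 rewrite -(ler_pM2r nT);apply:(le_trans h);rewrite [leRHS]mulrAC;apply:(ler_wpM2r (ltW v00)).
 rewrite /T mulrDr mulrDr mulr1 mulrCA.
 have -> : nu * (c0 * (CC / (nu * c0))) = CC by field;rewrite !gt_eqF.
 by rewrite lerDl mulr_ge0 ?ltW.
have si : 0 < s0^-1 by rewrite invr_gt0.
have hs' := hsol_scale p1 be0 si hs.
have uneg y : U y -> 0 < -1 * (s0^-1 * u y) + 1 -> s0^-1 * u y <= 1.
 by move=>_;move: (s0^-1 * u y) => t;clear;lra.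
(* A lower bound for [u] is an upper bound for [1 - u / s0], and the latter function is positive
   only where [u / s0 <= 1], so the bound [La] is 1. *)
have [dg hg] := hsol_dg p1 al0 be0 (or_intror (erefl (-1 : R))) ler01 hs' uneg.
have r20 : 0 < 2 * r by rewrite mulr_gt0.
have rka2 : 2 * r <= rho * ka by apply:le_trans rka;rewrite ler_pM2r// ler_nat.
have sub : cube x (2 * r) `<=` ball x0 (8 * r).
 move=>y;rewrite -ball_normE /= => h;have := ler_distD x x0 y;move: h hx;rewrite /cube /=.
 by move: (`|x0 - y|) (`|x0 - x|) (`|x - y|) => a1 a2 a3;move: r0;clear;lra.
have subU := subset_trans sub (subset_trans QK8 K8U).
have zle y : cube x (2 * r) y -> -1 * (s0^-1 * u y) + 1 <= 1.
 by move=>/subU/u0 uy;rewrite mulN1r gerDr oppr_le0 mulr_ge0 ?ltW.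
have hg' s : 0 < s -> s <= 2 * r -> intg (cube x s) (fun y => 1 `^ (p - 1) * `|V y|) <=
  1 * m (s / ka) * (s^-1 `^ p * (s ^+ n * cv)).
 move=>sp sr;apply:(le_trans (hg x s sp (subset_trans (cube_sub sr) subU))).
 by rewrite powR1.
have := hdg U _ _ _ x (2 * r) ka oU dg ka0 r20 rka2 subU zle hg'.
have hv2 : vol (cube x (2 * r) `&` [set y | 0 < -1 * (s0^-1 * u y) + 1]) <= c0 * ((2 * r) ^+ n * cv).
 have cK2 : compact (cube x (2 * r)) := cube_cpt (x0:=x) (r:=2*r).
 have [dW _ _ _] := dg;have [dW1 _ _ _] := dW.
 have [_ m2] := msr_level 0 oU cK2 subU dW1.
 apply:(@le_trans _ _ (vol Z0)).
  apply:(le_vol m2 mZ0);last exact:lamS_lty Z0Q (lamB_lty _ _).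
  move=>y [/sub Qy /= h];split=> // -[_ /= us].
  have : 1 < s0^-1 * u y by rewrite mulrC ltr_pdivlMr// mul1r.
  by move: h;move: (s0^-1 * u y) => t;clear;lra.
 apply:(le_trans vZ);apply:(ler_wpM2l (ltW c00));rewrite exprMn -mulrA ler_peMl ?(ltW v00)//.
 by rewrite exprn_ege1// ler1n.
move=>/(_ hv2) h;have : 2^-1 <= s0^-1 * u x by move: h;move: (s0^-1 * u x) => t;clear;lra.
by rewrite (mulrC _ (u x)) ler_pdivlMr// mulrC.
Qed.

(* If [u] exceeds a large multiple of [u y], then oscillation at smaller and smaller cubes produces a bounded sequence of points along which [u] grows geometrically. *)
Lemma harnack p al be th m : 1 < p -> 0 < al -> 0 <= be -> @kato R n p th m ->
 exists C rho : R, [/\ 0 < C, 0 < rho & forall U B A V (ka : R) u G x0 (r : R), hsol p al be m U B A V ka u G ->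
  0 < ka -> 0 < r -> 100 * r <= rho * ka -> cube x0 (100 * r) `<=` U ->
  forall x y, cube x0 r x -> cube x0 r y -> u x <= C * u y].
Proof.
move=>p1 al0 be0 kt;have [rho1 rho10 hP] := measure_spread p1 al0 be0 kt.
(* [nu = 1] is the case of full density, used to double cubes. The number [c1^-1 >= 2] is at once
   the loss of one doubling and the growth factor of [u] along the sequence. *)
have [c1 /andP[c10 c12] hP1] := hP 1 ltr01.
have La0 : 0 < c1^-1 by rewrite invr_gt0.
have La2 : 2 <= c1^-1 by rewrite -[leLHS]invrK lef_pV2 ?posrE ?invr_gt0.
have [c0 [rho2 [c00 rho20 hN]]] := level_bound p1 al0 be0 kt (ltW La0).
have [cN /andP[cN0 _] hPN] := hP c0 c00.
(* The denominator collects the loss [cN] of one spread from density [c0] and that of four extra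
   doublings; the 4 turns the final comparison into [2 * u y0 <= u y0]. *)
pose Kc : R := 4 / (c1 ^+ 4 * cN);have Kc0 : 0 < Kc by rewrite divr_gt0 ?mulr_gt0 ?exprn_gt0.
pose rho := Num.min rho1 rho2;have rho0 : 0 < rho by rewrite lt_min rho10.
have rr1 : rho <= rho1 by rewrite ge_min lexx.
have rr2 : rho <= rho2 by rewrite ge_min lexx orbT.
exists Kc, rho;split=> // U B A V ka u G x0 r hs ka0 r0 rka KU xs y0 hxs hy0.
have [oU _ _ _ [[W u0 _ _ _] _]] := hs;have [W1 _ _ _] := W.
have U0 : U y0 by apply:KU;apply:cube_sub hy0;lra.
have uy0 : 0 < u y0 by exact:u0.
have inU x s : cube x0 (2 * r) x -> s <= 64 * r -> cube x s `<=` U.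
 move=>hx hs' y h;apply:KU;move: hx h;rewrite /cube /= => h1 h2;have := ler_distD x x0 y.
 by move: (`|x0 - x|) (`|x - y|) (`|x0 - y|) h1 h2 => a1 a2 a3;move: r0 hs';clear;lra.
have ka1 s : s <= 64 * r -> s <= rho1 * ka.
 have h := ler_wpM2r (ltW ka0) rr1;move: h rka r0;clear;lra.
have ka2 s : s <= 64 * r -> s <= rho2 * ka.
 have h := ler_wpM2r (ltW ka0) rr2;move: h rka r0;clear;lra.
(* If [u >= k] on a whole cube, the density hypothesis holds with [nu = 1], so the bound passes to
   the doubled cube with loss [c1]. *)
have doubling x s k i : cube x0 (2 * r) x -> 0 < s -> 2 ^+ i * s <= 8 * r -> 0 < k ->
  (forall y, cube x s y -> k <= u y) -> forall y, cube x (2 ^+ i * s) y -> c1 ^+ i * k <= u y.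
 move=>hx s0 + k0 hk;elim:i => [|i IH] hi;first by rewrite !expr0 !mul1r.
 have ds0 : 0 < 2 ^+ i * s by rewrite mulr_gt0 ?exprn_gt0.
 have hi' : 2 ^+ i * s <= 4 * r by move: hi;rewrite exprS -mulrA;lra.
 have k'0 : 0 < c1 ^+ i * k by rewrite mulr_gt0 ?exprn_gt0.
 have hi8 : 2 ^+ i * s <= 8 * r by move: hi' r0;clear;lra.
 have h16 : 16 * (2 ^+ i * s) <= 64 * r by move: hi';clear;lra.
 move=>y hy;rewrite exprS -mulrA.
 apply:(hP1 U B A V ka u G x (2 ^+ i * s) (c1 ^+ i * k) hs ka0 ds0 (ka1 _ h16) (inU x _ hx h16) k'0).
  rewrite mul1r (_ : _ `&` _ = cube x (2 ^+ i * s));first exact:vol_cube_ge.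
  by apply/seteqP;split=> [? []//|w hw];split=> //;exact:IH.
 by rewrite mulrA -exprS.
(* If [u] stayed below [c1^-1 * k] in the small cube about [x], then by [level_bound] the set where
   [u >= k / 2] would have density at least [c0]. Spreading this and doubling until the cube
   contains [y0] loses exactly the power of [c1] gained so far. *)
have step j x : cube x0 (2 * r) x -> Kc * u y0 * c1^-1 ^+ j < u x ->
  exists2 x', cube x (r / 2 ^+ j.+1) x' & Kc * u y0 * c1^-1 ^+ j.+1 < u x'.
 move=>hx;set k := Kc * u y0 * _ => hk;apply:contrapT => nex.
 have k0 : 0 < k by rewrite mulr_gt0 ?exprn_gt0// mulr_gt0.
 set s := r / 2 ^+ j.+1;have s0 : 0 < s by rewrite divr_gt0// exprn_gt0.
 have sr : s <= r by rewrite ler_pdivrMr ?exprn_gt0// ler_peMr ?(ltW r0)// exprn_ege1// ler1n.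
 have s64 : s <= 64 * r by move: sr r0;clear;lra.
 have s20 : 0 < s / 2 by rewrite divr_gt0.
 have s16 : 16 * (s / 2) <= 64 * r by move: sr r0;clear;lra.
 have ule y : cube x s y -> u y <= c1^-1 * k.
  move=>hy;rewrite leNgt;apply/negP => h;apply:nex;exists y => //.
  by rewrite exprSr mulrA mulrC.
 have k20 : 0 < k / 2 by rewrite divr_gt0.
 have hv : c0 * ((s / 2) ^+ n * cv) <= vol (cube x (s / 2) `&` [set y | k / 2 <= u y]).
  rewrite leNgt;apply/negP => h;move: hk;rewrite ltNge => /negP;apply.
  apply:(hN U B A V ka u G x s k hs ka0 s0 (ka2 _ s64) (inU x s hx s64) k0 ule).
  have cK : compact (cube x (s / 2)) := cube_cpt (x0:=x) (r:=s/2).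
  have sU : cube x (s / 2) `<=` U.
   by apply:inU => //;move: sr r0 s0;clear;lra.
  have [mz m1] := msr_level (k / 2) oU cK sU W1;have m2 := msr_ge (k / 2) (msr_cpt cK) mz.
  apply:(le_trans _ (ltW h));apply:(le_vol m1 m2);first by move=>y [? /ltW].
  by apply:lamS_lty (lamK_lty cK) => y [].
 have hs2 := hPN U B A V ka u G x (s / 2) (k / 2) hs ka0 s20 (ka1 _ s16) (inU x _ hx s16) k20 hv.
 have e2 : 2 * (s / 2) = s by rewrite mulrC divfK.
 rewrite e2 in hs2.
 have k'0 : 0 < cN * (k / 2) by rewrite mulr_gt0.
 (* [j + 4] doublings of [r / 2 ^+ j.+1] reach the radius [8 * r], and [y0] lies within [3 * r] of
    [x]. *)
 have e8 : 2 ^+ (j + 4) * s = 8 * r.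
  rewrite /s exprD [2 ^+ j.+1]exprS;have : (2 ^+ j : R) != 0 by rewrite gt_eqF// exprn_gt0.
  by move: (2 ^+ j) => q q0;field.
 have d8 : 2 ^+ (j + 4) * s <= 8 * r by rewrite e8.
 have yc : cube x (2 ^+ (j + 4) * s) y0.
  rewrite e8;move: hx hy0;rewrite /cube /= => h1 h2;have := ler_distD x0 x y0;rewrite (distrC x x0).
  by move: (`|x0 - x|) (`|x - y0|) (`|x0 - y0|) h1 h2 => a1 a2 a3;move: r0;clear;lra.
 have := doubling x s (cN * (k / 2)) (j + 4)%N hx s0 d8 k'0 hs2 y0 yc.
 have -> : c1 ^+ (j + 4) * (cN * (k / 2)) = 2 * u y0.
  rewrite /k /Kc exprVn exprD;have a1 : c1 ^+ j != 0 by rewrite gt_eqF ?exprn_gt0.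
  have a2 : c1 != 0 by rewrite gt_eqF.
  have a3 : cN != 0 by rewrite gt_eqF.
  by move: (c1 ^+ j) a1 => q q0;field;rewrite a2 a3 q0.
 by move: uy0;clear;lra.
rewrite leNgt;apply/negP => hbig.
(* The steps [r / 2 ^+ j.+1] add up to less than [r], so all points stay in the cube of radius
   [2 * r], where [u] is bounded. *)
have seqx j : exists2 x, `|x0 - x| <= 2 * r - r / 2 ^+ j & Kc * u y0 * c1^-1 ^+ j < u x.
 elim:j => [|j [x hx hux]].
  by exists xs;rewrite ?expr0 ?mulr1// divr1 (_ : 2 * r - r = r)//;ring.
 have p2 : 0 < r / 2 ^+ j by rewrite divr_gt0// exprn_gt0.
 have e2 : r / 2 ^+ j = r / 2 ^+ j.+1 + r / 2 ^+ j.+1.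
  have : (2 ^+ j : R) != 0 by rewrite gt_eqF ?exprn_gt0.
  by rewrite [2 ^+ j.+1]exprS;move: (2 ^+ j) => q q0;field.
 have hx2 : cube x0 (2 * r) x by rewrite /cube /=;move: hx p2;clear;lra.
 have [x' hx' hux'] := step j x hx2 hux;exists x' => //.
 have := ler_distD x x0 x';move: hx' hx;rewrite /cube /= e2.
 by move: (r / _) (`|x0 - x|) (`|x - x'|) (`|x0 - x'|) => a1 a2 a3 a4;clear;lra.
have r2 : 2 * r <= 100 * r by move: r0;clear;lra.
have [M M0 hM] := Wfn_bounded W (cube_cpt (x0:=x0) (r:=2*r)) (fun y h => KU y (cube_sub r2 h)).
pose j := Num.bound (M / (Kc * u y0));have [x hx hux] := seqx j.
have ky : 0 < Kc * u y0 by rewrite mulr_gt0.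
have hx2 : cube x0 (2 * r) x.
 have : 0 < r / 2 ^+ j by rewrite divr_gt0// exprn_gt0.
 by rewrite /cube /=;move: hx;clear;lra.
have := le_trans (ler_norm _) (hM x hx2);rewrite leNgt => /negP;apply;apply:le_lt_trans hux.
rewrite mulrC -ler_pdivrMr//;apply:(@le_trans _ _ (2 ^+ j)).
 apply:(le_trans (ltW (archi_boundP (divr_ge0 (ltW M0) (ltW ky)))));rewrite -/j -natrX ler_nat.
 exact:ltnW (ltn_expl _ _).
by apply:lerXn2r;rewrite ?nnegrE// ltW.
Qed.

End Harnack.

(** * Power and logarithmic moduli of the potential *)

Section Moduli.
Context {R : realType} {n : nat}.

Lemma geometric_le (y : R) (N : nat) : 0 <= y < 1 -> \sum_(j < N) y ^+ j <= (1 - y)^-1.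
Proof.
move=>/andP[y0 y1];rewrite -[leRHS]div1r ler_pdivlMr ?subr_gt0// mulrC.
have -> : (1 - y) * \sum_(j < N) y ^+ j = 1 - y ^+ N.
 elim:N => [|M IH];first by rewrite big_ord0 mulr0 expr0 subrr.
 by rewrite big_ord_recr/= mulrDr IH exprS;ring.
by rewrite gerBl exprn_ge0.
Qed.

Lemma powR_exprn (a b : R) j : 0 <= a -> (a ^+ j) `^ b = (a `^ b) ^+ j.
Proof.
move=>a0;elim:j => [|j IH];first by rewrite !expr0 powR1.
by rewrite !exprS powRM ?exprn_ge0// IH.
Qed.

(** [th] is taken so close to 1 that the weight [th^(p-n)] spoils at most half of the exponent in
    the decay [8^(-del)] per step; the series is then dominated by a geometric one with ratio
    [y]. *)
Lemma kato_power (p K del : R) : 1 < p -> 0 < K -> 0 < del -> exists th, @kato R n p th (fun t => K * t `^ del).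
Proof.
move=>p1 K0 d0;pose c := del / (2 * (`|p - n%:R| + 1)).
have c0 : 0 < c by rewrite divr_gt0// mulr_gt0// ltr_wpDl.
have ln8 : 0 < ln 8 :> R by rewrite ln_gt0// ltr1n.
pose th := expR (- (c * ln 8));have th0 : 0 < th := expR_gt0 _.
have k0 : 0 < (p - 1)^-1 by rewrite invr_gt0 subr_gt0.
set k := (p - 1)^-1 in k0.
pose y := (8 `^ (- (del / 2)) : R) `^ k;have y0 : 0 <= y by exact:powR_ge0.
have y81 : 8 `^ (- (del / 2)) < 1 :> R.
 have h8 : 0 < 8 :> R by rewrite ltr0n.
 have l8 : - (del / 2) * ln 8 < 0 by rewrite mulNr oppr_lt0 (mulr_gt0 _ ln8)// divr_gt0.
 by rewrite /powR (gt_eqF h8) -[ltRHS]expR0 ltr_expR.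
have y1 : y < 1.
 have h8 : 0 < 8 :> R by rewrite ltr0n.
 have l8 : - (del / 2) * k * ln 8 < 0 by rewrite !mulNr oppr_lt0;apply:mulr_gt0 ln8;rewrite mulr_gt0// divr_gt0.
 by rewrite /y -powRrM /powR (gt_eqF h8) -[ltRHS]expR0 ltr_expR.
have hth : th `^ (p - n%:R) * 8^-1 `^ del <= 8 `^ (- (del / 2)).
 rewrite /powR (gt_eqF th0) invr_eq0 !gt_eqF// -expRD ler_expR /th expRK lnV ?posrE//.
 have h : `|p - n%:R| * c <= del / 2.
  rewrite /c mulrA ler_pdivrMr ?mulr_gt0 ?ltr_wpDl//.
  by move: (`|p - n%:R|) => a;lra.
 have h2 : - (p - n%:R) * c <= `|p - n%:R| * c by rewrite ler_wpM2r ?(ltW c0)// ler_normr lexx orbT.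
 have -> : (p - n%:R) * - (c * ln 8) + del * - ln 8 = (- (p - n%:R) * c - del) * ln 8 by ring.
 by rewrite ler_wpM2r ?(ltW ln8)//;lra.
exists th;split.
- by rewrite th0 /th -[ltRHS]expR0 ltr_expR oppr_lt0 mulr_gt0.
- by move=>s s0;rewrite mulr_ge0 ?powR_ge0// ltW.
- by move=>s t s0 st;rewrite ler_wpM2l ?(ltW K0)//;apply:powR_mono => //;exact:ltW.
move=>e e0;pose z := (e * (1 - y)) `^ k^-1.
have ey0 : 0 < e * (1 - y) by rewrite mulr_gt0// subr_gt0.
have z0 : 0 < z by rewrite powR_gt0.
exists ((z / K) `^ del^-1) => [|N];first by rewrite powR_gt0// divr_gt0.
set rho := _ `^ del^-1;have hr : K * rho `^ del = z.
 by rewrite /rho -powRrM mulVf ?gt_eqF// powRr1 ?divr_ge0 ?ltW// mulrC divfK// gt_eqF.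
have r0 : 0 <= rho by exact:powR_ge0.
apply:(@le_trans _ _ (\sum_(j < N) e * (1 - y) * y ^+ j)).
 apply:ler_sum => j _.
 have -> : e * (1 - y) = z `^ k by rewrite /z -powRrM mulVf ?powRr1 ?(ltW ey0)// gt_eqF.
 rewrite /y -powR_exprn ?powR_ge0// -powRM ?exprn_ge0 ?powR_ge0 ?(ltW z0)//.
 apply:powR_mono;[exact:ltW|by rewrite mulr_ge0 ?powR_ge0// mulr_ge0 ?powR_ge0 ?ltW|].
 rewrite powRM ?invr_ge0 ?exprn_ge0// -hr (mulrA K) mulrCA;apply:ler_wpM2l;first by rewrite mulr_ge0 ?powR_ge0 ?ltW.
 rewrite -exprVn !powR_exprn ?(ltW th0) ?invr_ge0// -exprMn.
 by apply:lerXn2r;rewrite ?nnegrE ?mulr_ge0 ?powR_ge0.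
rewrite -mulr_sumr -mulrA -[leRHS]mulr1;apply:ler_wpM2l;first exact:ltW.
rewrite mulrC -ler_pdivlMr ?subr_gt0// mul1r;apply:geometric_le.
by rewrite y0.
Qed.

(** A discrete form of integrating [x^(-s-1)], which makes the sums of [kato_log] telescope; it
    follows from [1 + t <= expR t] and the matching bound for the logarithm. *)
Lemma telescoping_powR (s x : R) : 0 < s -> 1 < x -> s * x `^ (- (s + 1)) <= (x - 1) `^ (- s) - x `^ (- s).
Proof.
move=>s0 x1;have x0 : 0 < x by lra.
have x10 : 0 < x - 1 by lra.
have xi : 0 < x^-1 by rewrite invr_gt0.
have e1 : x `^ (- (s + 1)) = x `^ (- s) * x^-1.
 rewrite opprD powRD ?(gt_eqF x0) ?implybT//;congr (_ * _).
 by rewrite powRN powRr1// ltW.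
have e2 : (x - 1) `^ (- s) = x `^ (- s) * (1 - x^-1) `^ (- s).
 rewrite -powRM ?(ltW x0)//;last by rewrite subr_ge0 invf_le1// ltW.
 by rewrite mulrBr mulr1 mulfV// gt_eqF.
rewrite e1 e2 -[X in _ - X]mulr1 -mulrBr mulrCA;apply:ler_wpM2l;first exact:powR_ge0.
have y1 : 0 < 1 - x^-1 by rewrite subr_gt0 invf_lt1.
rewrite lerBrDr /powR gt_eqF//;apply:le_trans (expR_ge1Dx _).
rewrite addrC lerD2l mulNr -mulrN;apply:ler_wpM2l;first exact:ltW.
by have := le_ln1Dx (_ : -1 < - x^-1);rewrite ltrN2 invf_lt1// => /(_ x1);lra.
Qed.

(** For [p = n] the weights are 1, and at radius [rho / 8 ^+ j] the logarithm is at least [L + j]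
    because [ln 8 >= 1]. The terms decay with the exponent [gam / (p - 1) > 1], and a large [L]
    makes the whole sum small. The maximum with 1 keeps the modulus monotone for large arguments. *)
Lemma kato_log (p K c gam : R) : 1 < p -> p = n%:R -> 0 < K -> 0 < c -> p - 1 < gam ->
 exists th, @kato R n p th (fun t => K * (Num.max 1 (ln (c / t))) `^ (- gam)).
Proof.
move=>p1 pn K0 c0 g0.
have k0 : 0 < (p - 1)^-1 by rewrite invr_gt0 subr_gt0.
set k := (p - 1)^-1 in k0;pose s := gam * k - 1.
have s0 : 0 < s by rewrite subr_gt0 /k ltr_pdivlMr ?subr_gt0// mul1r.
exists 2^-1;split.
- by rewrite invr_gt0 invf_lt1 ltr0n ?ltr1n.
- by move=>t t0;rewrite mulr_ge0 ?powR_ge0// ltW.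
- move=>t t' t0 tt;have t'0 : 0 < t' := lt_le_trans t0 tt;rewrite ler_wpM2l ?(ltW K0)//.
 have m1 a : 0 < Num.max 1 a :> R by rewrite lt_max ltr01.
 rewrite !powRN lef_pV2 ?posrE ?powR_gt0//;apply:powR_mono;[lra|exact:ltW|].
 by rewrite ge_max !le_max lexx/= ler_ln ?posrE ?divr_gt0// ler_pM2l// lef_pV2 ?posrE// tt orbT.
have e8 : expR 1 <= 8 :> R.
 have h : 2^-1 <= expR (- 2^-1) :> R by have := @expR_ge1Dx R (- 2^-1);lra.
 rewrite expRN lef_pV2 ?posrE ?expR_gt0// in h.
 have -> : 1 = 2^-1 + 2^-1 :> R by field.
 by rewrite expRD;have := expR_gt0 (2^-1 : R);nra.
(* [L - 1] exceeds the root at which the bound [K^k / s * (L - 1)^(-s)] of the telescoped sum equals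
   [e]; the summand 2 keeps all arguments [L + j] above 1. *)
move=>e e0;pose L := 2 + ((e * s) / (K `^ k)) `^ (- s^-1).
have L2 : 2 <= L by rewrite lerDl powR_ge0.
exists (c * expR (- L)) => [|N];first by rewrite mulr_gt0 ?expR_gt0.
have Kk : 0 < K `^ k by rewrite powR_gt0.
apply:(@le_trans _ _ (\sum_(j < N) K `^ k / s * ((L + j%:R - 1) `^ (- s) - (L + j.+1%:R - 1) `^ (- s)))).
 apply:ler_sum => j _;have j0 : 0 <= j%:R :> R by [].
 rewrite pn subrr powRr0 mul1r -[in leLHS]pn powRM ?powR_ge0 ?(ltW K0)// -mulrA;apply:ler_wpM2l;first exact:ltW.
 rewrite ler_pdivlMl//.
 have m1 : 0 < Num.max 1 (ln (c / (c * expR (- L) / 8 ^+ j))) by rewrite lt_max ltr01.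
 have Lj1 : 1 < L + j%:R by lra.
 have h := telescoping_powR s0 Lj1.
 have -> : L + j.+1%:R - 1 = L + j%:R by rewrite -natr1;ring.
 apply:le_trans h;apply:ler_wpM2l;first exact:ltW.
 rewrite -powRrM mulNr (_ : gam * k = s + 1);last by rewrite /s;ring.
 rewrite !powRN lef_pV2 ?posrE ?powR_gt0//;last by lra.
 apply:powR_mono;[lra|lra|].
 rewrite le_max;apply/orP;right.
 have -> : c / (c * expR (- L) / 8 ^+ j) = expR L * 8 ^+ j.
  rewrite expRN;have := expR_gt0 L;have := exprn_gt0 j (ltr0n R 8);move: (expR L) (8 ^+ j) => a b b0 a0;field.
  by rewrite !gt_eqF.
 rewrite lnM ?posrE ?expR_gt0 ?exprn_gt0// expRK lerD2l lnXn ?ltr0n// -(mulr_natl (ln 8)) ler_peMr//.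
 by rewrite -[leLHS](expRK 1) ler_ln ?posrE ?expR_gt0.
rewrite -mulr_sumr.
have -> : \sum_(j < N) ((L + j%:R - 1) `^ (- s) - (L + j.+1%:R - 1) `^ (- s)) = (L - 1) `^ (- s) - (L + N%:R - 1) `^ (- s).
 elim:N => [|N IH];first by rewrite big_ord0 addr0 subrr.
 by rewrite big_ord_recr/= IH;ring.
apply:(@le_trans _ _ (K `^ k / s * (L - 1) `^ (- s))).
 by apply:ler_wpM2l;[rewrite divr_ge0 ?ltW|rewrite gerBl powR_ge0].
set a := (e * s) / (K `^ k) in L L2 *;have a0 : 0 < a by rewrite divr_gt0// mulr_gt0.
have la : (L - 1) `^ (- s) <= a.
 have -> : a = (a `^ (- s^-1)) `^ (- s) by rewrite -powRrM mulrNN mulVf ?powRr1 ?(ltW a0)// gt_eqF.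
 have aa : 0 < a `^ (- s^-1) by rewrite powR_gt0.
 set b := a `^ (- s^-1) in L L2 aa *.
 have L10 : 0 < L - 1 by lra.
 rewrite !powRN lef_pV2 ?posrE ?powR_gt0//;apply:powR_mono;[exact:ltW|exact:ltW|by rewrite /L;lra].
apply:(le_trans (ler_wpM2l (divr_ge0 (ltW Kk) (ltW s0)) la)).
by apply:eq_lexx;rewrite /a;field;rewrite !gt_eqF.
Qed.

End Moduli.

(** * Connectedness of norm spheres and annuli, and Harnack chains *)

Section NormGeometry.
Context {R : realType} {n : nat}.
Local Notation E := 'rV[R]_n.
Implicit Types (N f : E -> R).

Lemma level_closed f (c : R) : continuous f -> closed [set x | f x = c].
Proof. by move=>cf;apply:(@preimage_closed _ _ f [set c]) => [x _|];[exact:cf|exact:closed_eq]. Qed.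

Lemma is_norm_ge N : is_norm N -> exists2 c : R, 0 < c & forall x, c * `|x| <= N x.
Proof.
move=>Nn;have [N0 Nz NZ _] := Nn;have cN := norm_cont Nn.
pose S : set E := [set x | `|x| = 1].
have cS : compact S.
 apply:(@clbd_cpt _ _ _ 1) => [|x ->//].
 by apply:level_closed;exact:norm_continuous.
have ci : {in S, continuous (fun x => (N x)^-1)}.
 move=>x /set_mem Sx;apply:continuousV;last exact:cN.
 apply/eqP => /Nz x0;move: Sx;rewrite /S /= x0 normr0 => /eqP;by rewrite eq_sym oner_eq0.
have [M M0 hM] := cont_maxK cS ci.
exists M^-1 => [|x];first by rewrite invr_gt0.
have [->|xn] := eqVneq x 0;first by rewrite normr0 mulr0.
have nx : 0 < `|x| by rewrite normr_gt0.
have Sx : S (`|x|^-1 *: x) by rewrite /S /= normrZ normfV normr_id mulVf// gt_eqF.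
have e : N (`|x|^-1 *: x) = `|x|^-1 * N x by rewrite NZ ger0_norm// invr_ge0.
have := hM _ Sx;rewrite e ger0_norm ?invr_ge0 ?mulr_ge0 ?invr_ge0// invfM invrK => h.
have Nx : 0 < N x by rewrite lt_def N0 andbT;apply/eqP => /Nz /eqP;rewrite (negbTE xn).
have Ni : 0 < (N x)^-1 by rewrite invr_gt0.
by rewrite mulrC ler_pdivrMr// -(ler_pM2r Ni) mulrAC mulfV ?mul1r// gt_eqF.
Qed.

Lemma is_norm_neq0 N x : is_norm N -> x != 0 -> 0 < N x.
Proof. by move=>[N0 Nz _ _] xn;rewrite lt_def N0 andbT;apply:contra_neq xn => /Nz. Qed.

(** The complement of the ray opposite to [e] is star-shaped about [e]. *)
Lemma off_ray_connected (e : E) : e != 0 -> connected [set x : E | forall c, 0 <= c -> x != - c *: e].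
Proof.
move=>en;have ee c : 0 <= c -> e != - c *: e.
 move=>c0;apply/eqP => h;move/eqP: en;apply.
 have : (1 + c) *: e = 0 by rewrite scalerDl scale1r {1}h scaleNr addNr.
 by move=>/eqP;rewrite scaler_eq0 gt_eqF ?ltr_pwDl// => /eqP.
apply:(star_connected (x := e));first exact:ee.
move=>y t Ay /andP[t0 t1] c c0;apply/eqP => h.
have [t00|tn] := eqVneq t 0.
 by move: h;rewrite t00 scale0r addr0 => /eqP;apply/negP;exact:ee.
have tp : 0 < t by rewrite lt_def tn.
have t10 : 0 <= 1 - t by rewrite subr_ge0.
move/eqP: (Ay ((c + (1 - t)) / t) (divr_ge0 (addr_ge0 c0 t10) t0)).
apply;apply:(scalerI tn);rewrite scalerA mulrN mulrCA mulfV// mulr1.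
have -> : t *: y = (e + t *: (y - e)) - (1 - t) *: e.
 by rewrite scalerBr scalerBl scale1r;apply/rowP => i;rewrite !mxE;ring.
by rewrite h !scaleNr -opprD -scalerDl.
Qed.

(** For [n >= 2] two such complements, for linearly independent directions, cover the punctured
    space, and both contain [e0 + e1]. *)
Lemma punctured_connected : (2 <= n)%N -> connected [set x : E | x != 0].
Proof.
move=>n2;have n0 : (0 < n)%N by exact:leq_trans n2.
pose e0 : E := evec (Ordinal n0);pose e1 : E := evec (Ordinal n2).
have v0 i : e0 ord0 i = (i == Ordinal n0)%:R by rewrite mxE eqxx.
have v1 i : e1 ord0 i = (i == Ordinal n2)%:R by rewrite mxE eqxx.
have e0n : e0 != 0 by apply/eqP => /rowP/(_ (Ordinal n0));rewrite v0 mxE eqxx => /eqP;rewrite oner_eq0.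
have e1n : e1 != 0 by apply/eqP => /rowP/(_ (Ordinal n2));rewrite v1 mxE eqxx => /eqP;rewrite oner_eq0.
have -> : [set x : E | x != 0] = [set x : E | forall c, 0 <= c -> x != - c *: e0] `|` [set x : E | forall c, 0 <= c -> x != - c *: e1].
 apply/seteqP;split=> x /=.
  move=>xn;apply:contrapT => /not_orP[/existsNP[c /not_implyP[c0 /negP/negPn/eqP h]] /existsNP[d /not_implyP[d0 /negP/negPn/eqP h']]].
  have d00 : d = 0.
   by move: h';rewrite h => /rowP/(_ (Ordinal n2));rewrite !mxE /= !mulNr mulr0 mulr1 oppr0 => /esym/eqP;rewrite oppr_eq0 => /eqP.
  by move: xn;rewrite h' d00 oppr0 scale0r eqxx.
 by case=> h;have := h 0 (lexx _);rewrite oppr0 scale0r.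
apply:connectedU;[exists (e0 + e1)|exact:off_ray_connected|exact:off_ray_connected].
split=> c c0;apply/eqP => /rowP.
 move=>/(_ (Ordinal n2));rewrite !mxE /= mulr0 add0r => /eqP;by rewrite oner_eq0.
by move=>/(_ (Ordinal n0));rewrite !mxE /= mulr0 addr0 => /eqP;rewrite oner_eq0.
Qed.

(** The set is the image of the punctured space under a radial map. A constant [g] gives spheres, a
    [g] running through an interval gives annuli. *)
Lemma radial_connected N (g : R -> R) : (2 <= n)%N -> is_norm N -> (forall t, 0 < t -> 0 < g t) ->
 (forall t, 0 < t -> {for t, continuous g}) -> connected [set y : E | exists2 t, 0 < t & N y = g t].
Proof.
move=>n2 Nn g0 cg;have [_ _ NZ _] := Nn.
have -> : [set y : E | exists2 t, 0 < t & N y = g t] = (fun x => (g (N x) / N x) *: x) @` [set x : E | x != 0].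
 apply/seteqP;split=> [y [t t0 Ny]|_ [x /= xn <-]].
  have gt0 := g0 t t0;have Nt : N ((t / g t) *: y) = t by rewrite NZ Ny gtr0_norm ?divr_gt0// divfK// gt_eqF.
  exists ((t / g t) *: y) => /=.
   apply/eqP => h;move: Nt;rewrite h (is_norm0 Nn) => e;by rewrite -e ltxx in t0.
  by rewrite Nt scalerA mulrA divfK ?mulfV ?scale1r// gt_eqF.
 have Nx := is_norm_neq0 Nn xn;exists (N x) => //.
 by rewrite NZ gtr0_norm ?divr_gt0 ?g0// divfK// gt_eqF.
apply:connected_continuous_connected;first exact:punctured_connected.
apply:continuous_in_subspaceT => x /set_mem xn;have Nx := is_norm_neq0 Nn xn.
apply:(@continuousZ R E E (fun x => g (N x) / N x) id x);last exact:cvg_id.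
have cNx := norm_cont Nn (x := x).
apply:(@continuousM _ _ (fun x => g (N x)) (fun x => (N x)^-1)).
 by apply:continuous_comp;[exact:cNx|exact:cg].
by apply:continuousV => //;rewrite gt_eqF.
Qed.

Lemma nsphere_connected N r : (2 <= n)%N -> is_norm N -> 0 < r -> connected (nsphere N r).
Proof.
move=>n2 Nn r0;have := @radial_connected N (cst r) n2 Nn (fun _ _ => r0) (fun t _ => (@cst_continuous R R r : continuous (cst r)) t).
by congr connected;apply/seteqP;split=> [y [t _]|y Ny] //;exists 1.
Qed.

Lemma nannulus_connected N r s : (2 <= n)%N -> is_norm N -> 0 <= r -> r < s -> connected (nannulus N r s).
Proof.
move=>n2 Nn r0 rs;have sr : 0 < s - r by rewrite subr_gt0.
have gp t : 0 < t -> 0 < r + (s - r) * (t / (1 + t)).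
 by move=>t0;rewrite ltr_wpDl// mulr_gt0// divr_gt0// addr_gt0.
have := @radial_connected N (fun t => r + (s - r) * (t / (1 + t))) n2 Nn gp.
have -> : [set y : E | exists2 t, 0 < t & N y = r + (s - r) * (t / (1 + t))] = nannulus N r s.
 rewrite /nannulus;apply/seteqP;split=> y /=.
  move=>[t t0 ->];have t1 : 0 < 1 + t by rewrite addr_gt0.
  rewrite ltrDl mulr_gt0 ?divr_gt0//= -ltrBrDl -[ltRHS]mulr1 ltr_pM2l// ltr_pdivrMr// mul1r.
  by rewrite ltrDr.
 move=>/andP[ry ys];have d1 : 0 < N y - r by rewrite subr_gt0.
 have d2 : 0 < s - N y by rewrite subr_gt0.
 exists ((N y - r) / (s - N y));first by rewrite divr_gt0.
 by field;rewrite (_ : s - N y + (N y - r) = s - r) ?gt_eqF//;ring.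
apply=> t t0.
have t1 : 1 + t != 0 by rewrite gt_eqF// addr_gt0.
apply:continuousD;first exact:cst_continuous.
apply:continuousM;first exact:cst_continuous.
apply:continuousM;first exact:cvg_id.
apply:continuousV => //;apply:continuousD;[exact:cst_continuous|exact:cvg_id].
Qed.

Lemma nsphere_compact N r : is_norm N -> compact (nsphere N r).
Proof.
move=>Nn;have [c c0 hc] := is_norm_ge Nn.
apply:(@clbd_cpt _ _ _ (r / c)) => [|x Nx].
 by apply:level_closed;exact:norm_cont.
by rewrite ler_pdivlMr// mulrC -[leRHS]Nx.
Qed.

(** Harnack chain. The sets [T k] quantify over all admissible [f] at once, so that the number of
    links, and with it [C'], is common to all of them. Connectedness shows that every point is
    reached, compactness that boundedly many links suffice. *)
Lemma sphere_chain N (e C : R) : (2 <= n)%N -> is_norm N -> 0 < e -> 1 <= C -> exists2 C' : R, 0 < C' &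
 forall f, (forall x y, N x = 1 -> N y = 1 -> `|x - y| <= e -> f x <= C * f y) ->
  (forall x, N x = 1 -> 0 <= f x) -> forall x y, N x = 1 -> N y = 1 -> f x <= C' * f y.
Proof.
move=>n2 Nn e0 C1;have C0 : 0 < C by lra.
pose good f := (forall x y, N x = 1 -> N y = 1 -> `|x - y| <= e -> f x <= C * f y) /\ (forall x, N x = 1 -> 0 <= f x).
have [x0 Sx0] : exists x0, N x0 = 1.
 have n0 : (0 < n)%N by exact:leq_trans n2.
 have en : (evec (Ordinal n0) : E) != 0.
  by apply/eqP => /rowP/(_ (Ordinal n0));rewrite !mxE !eqxx => /eqP;rewrite oner_eq0.
 have [_ _ NZ _] := Nn;have Ne := is_norm_neq0 Nn en;exists ((N (evec (Ordinal n0)))^-1 *: evec (Ordinal n0)).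
 by rewrite NZ gtr0_norm ?invr_gt0// mulVf// gt_eqF.
pose T k : set E := [set y | N y = 1 /\ forall f, good f -> f x0 <= C ^+ k * f y /\ f y <= C ^+ k * f x0].
have step k y z : T k y -> N z = 1 -> `|y - z| <= e -> T k.+1 z.
 move=>[Ny hy] Nz yz;split=> // f gf;have [gf1 gf2] := gf;have [h1 h2] := hy f gf;split.
  apply:(le_trans h1);rewrite exprSr -mulrA;apply:ler_wpM2l;first by rewrite exprn_ge0// ltW.
  exact:gf1.
 apply:(@le_trans _ _ (C * f y));first by apply:gf1 => //;rewrite distrC.
 by rewrite exprS -mulrA ler_wpM2l// ltW.
have mono k k' y : (k <= k')%N -> T k y -> T k' y.
 move=>kk [Ny hy];split=> // f gf;have [h1 h2] := hy f gf;have [_ gf2] := gf.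
 have ck : C ^+ k <= C ^+ k' by rewrite ler_weXn2l.
 by split;[apply:(le_trans h1)|apply:(le_trans h2)];rewrite ler_wpM2r// gf2.
pose TT : set E := \bigcup_k T k.
have TTE : TT = nsphere N 1.
 apply:(nsphere_connected n2 Nn ltr01).
 - exists x0, 0%N => //;split=> // f _;by rewrite expr0 mul1r.
 - exists (\bigcup_(y in TT) ball y e);first by apply:bigcup_open => y _;exact:ball_open.
  apply/seteqP;split=> [y Ty|z [Nz [y [k _ Tk]]]].
   split;first by case:Ty => k _ [].
   by exists y => //;exact:ballxx.
  by rewrite -ball_normE /= => /ltW yz;exists k.+1 => //;exact:step Tk Nz yz.
 - exists (~` \bigcup_(y in nsphere N 1 `\` TT) ball y e).
   by apply:open_closedC;apply:bigcup_open => y _;exact:ball_open.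
  apply/seteqP;split=> [y Ty|z [Nz hz]].
   split;first by case:Ty => k _ [].
   move=>[z [Nz nT]];rewrite -ball_normE /= => /ltW yz;apply:nT.
   by case:Ty => k _ Tk;exists k.+1 => //;apply:(step k y z) => //;rewrite distrC.
  by apply:contrapT => nT;apply:hz;exists z => //;exact:ballxx.
have [k hk] : exists k, nsphere N 1 `<=` T k.
 have := nsphere_compact (r := 1) Nn;rewrite compact_cover => /(_ E (nsphere N 1) (fun y => ball y e)).
 case;first by move=>y _;exact:ball_open.
  by move=>y Ny;exists y => //;exact:ballxx.
 move=>D DS cov;pose kk (y : E) := xget 0%N [set k | T k y].
 exists (\max_(y <- D) kk y).+1 => z Nz;have [y /= yD yz] := cov z Nz.
 have Ny : nsphere N 1 y by apply/set_mem;exact:DS.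
 have Ty : T (kk y) y by rewrite /kk;case:xgetP => // nk;move: Ny;rewrite -TTE => -[k _ /nk].
 apply:(step _ y z) => //;last by move: yz;rewrite -ball_normE /= => /ltW.
 by apply:mono Ty;exact:(leq_bigmax_seq (F := kk)).
exists (C ^+ k * C ^+ k);first by rewrite mulr_gt0// exprn_gt0.
move=>f f1 f2 x y Nx Ny;have gf : good f by split.
have [_ h1] := (hk x Nx).2 f gf;have [h2 _] := (hk y Ny).2 f gf.
by apply:(le_trans h1);rewrite -mulrA ler_wpM2l// exprn_ge0// ltW.
Qed.

End NormGeometry.

(** * Uniform Harnack inequality on the spheres of N *)

Section FuchsianHarnack.
Context {R : realType} {n : nat}.
Local Notation E := 'rV[R]_n.
Local Notation L := (lebType R n).
Local Notation mu := (@lam R n).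
Local Notation cv := (@cube_vol R n).
Implicit Types (N V u : E -> R) (A : E -> E -> E) (U B K : set E) (p q : R).

Lemma cube_in_ball (x y : E) (s t : R) : (0 < n)%N -> 0 < s -> cube y s `<=` ball x t -> s <= t.
Proof.
move=>n0 s0 sub;pose e : E := evec (Ordinal n0).
have ne : `|e| <= 1.
 apply:norm_leP => // i;rewrite mxE eqxx /=;case:(i == _);rewrite ?normr1 ?normr0//.
have en : `|s *: e| <= s by rewrite normrZ gtr0_norm// ler_piMr// ltW.
have h1 : cube y s (y + s *: e) by rewrite /cube /= opprD addrA subrr sub0r normrN.
have h2 : cube y s (y - s *: e) by rewrite /cube /= opprB addrC subrK.
pose i := Ordinal n0.
have p1 : (x - (y + s *: e)) ord0 i = x ord0 i - y ord0 i - s by rewrite !mxE !eqxx mulr1;ring.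
have p2 : (x - (y - s *: e)) ord0 i = x ord0 i - y ord0 i + s by rewrite !mxE !eqxx mulr1;ring.
move: (sub _ h1) (sub _ h2);rewrite -ball_normE /= => b1 b2.
move: (le_lt_trans (coord_le_norm _ i) b1) (le_lt_trans (coord_le_norm _ i) b2);rewrite p1 p2.
by move: (x _ _) (y _ _) => a b;rewrite !ltr_norml => /andP[h3 h4] /andP[h5 h6];apply:ltW;lra.
Qed.

Lemma oball_open (y : E) r : open (oball y r).
Proof.
rewrite (_ : oball y _ = (fun z => enorm (z - y)) @^-1` [set t | t < r])//.
apply:open_comp;last exact:open_lt.
move=>z _;apply:(@continuous_comp _ _ _ (fun z : E => z - y) (@enorm R n));last exact:enorm_continuous.
by apply:continuousB;[exact:cvg_id|exact:cst_continuous].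
Qed.

(** Passage from the Morrey norm, which involves Euclidean balls and a weight, to the plain mass of
    [V] in cubes. *)
Lemma weight_bound V U (An : set E) y (s ka la w C0 : R) (h : E -> R) : (forall K, compact K -> K `<=` U -> integ K V) ->
 csubset An U -> open An -> cube y s `<=` An -> cube y s `<=` oball y ka -> open (oball y ka) -> 0 < la -> 0 <= w ->
 meas An h -> (forall x, An x -> la <= h x) ->
 (w%:E * (\int[mu]_(x in (An `&` oball y ka : set L)) `|h x * V x|%:E) <= C0%:E)%E ->
 w * (la * intg (cube y s) (fun x => `|V x|)) <= C0.
Proof.
move=>iV [cAn AnU] oAn KAn Kb ob la0 w0 mh hla hI;set K := cube y s in KAn Kb *.
have cK : compact K := cube_cpt (x0:=y) (r:=s);have mK := msr_cpt cK.
have cl : An `<=` closure An by exact:subset_closure.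
have KU : K `<=` U := subset_trans KAn (subset_trans cl AnU).
have mAn := msr_open oAn;set D : set E := An `&` oball y ka;have mD : msr D := msrI mAn (msr_open ob).
have DAn : D `<=` An by move=>x [].
have iVK := integ_abs mK (iV K cK KU);have iVl := integZ la mK iVK.
have mhV : meas D (fun x => `|h x * V x|).
 apply:meas_norm;apply:measM;first exact:meas_sub mAn DAn mh.
 exact:(meas_sub (msr_cpt cAn) (subset_trans DAn cl) (integ_meas (iV _ cAn AnU))).
rewrite -(intgZ _ mK iVK) -lee_fin EFinM;apply:le_trans hI;apply:lee_wpmul2l;first by rewrite lee_fin.
rewrite (intgE mK iVl).
apply:(@le_trans _ _ (\int[mu]_(x in (K : set L)) `|h x * V x|%:E)%E).
 apply:ge0_le_integral => //.
 - by move=>x _;rewrite lee_fin mulr_ge0// ltW.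
 - by apply/measurable_EFinP;exact:(integ_meas iVl).
 - by apply/measurable_EFinP;apply:(meas_sub mD) mhV => x Kx;split;[exact:KAn|exact:Kb].
 move=>x Kx;rewrite lee_fin normrM ler_wpM2r//;apply:le_trans (ler_norm _);exact/hla/KAn.
apply:ge0_subset_integral => //;first by apply/measurable_EFinP.
by move=>x Kx;split;[exact:KAn|exact:Kb].
Qed.

(** The Fuchsian bound on the annulus around a sphere of radius [r] becomes a modulus in the
    scale-free ratio [s / r]: a power with exponent [p - n / q] for [p != n], and for [p = n] a
    logarithm to the power [- q * (n - 1) / n]. *)
Lemma fuchsian_kato p q N V U (aN bN C0 : R) (I : set R) : (2 <= n)%N -> 1 < p -> morrey_exponent (n := n) p q -> is_norm N ->
 0 < aN < 1 -> 1 < bN -> (forall K, compact K -> K `<=` U -> integ K V) ->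
 (forall r, I r -> [/\ 0 < r, csubset (nannulus N (aN * r) (bN * r)) U &
  (morrey_norm p q (nannulus N (aN * r) (bN * r)) (if p == n%:R then V else fun x => (N x `^ (p - n%:R / q) * V x)%R) <= C0%:E)%E]) ->
 exists (m : R -> R) th sm, [/\ @kato R n p th m, 0 < sm & forall r x0, I r -> N x0 = r ->
  ball x0 (sm * r) `<=` U /\ forall y s, 0 < s -> cube y s `<=` ball x0 (sm * r) ->
   intg (cube y s) (fun x => `|V x|) <= m (s / r) * (s^-1 `^ p * (s ^+ n * cv))].
Proof.
move=>n2 p1 [q1 q2 q3] Nn /andP[aN0 aN1] bN1 iV hI.
have n0 : (0 < n)%N by exact:leq_trans n2.
have nR : 2 <= n%:R :> R by rewrite ler_nat.
have [CN CN0 hCN] := is_norm_le_norm Nn;have [c c0 hc] := is_norm_ge Nn;have [N0 Nz NZ ND] := Nn.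
(* With [e1] below, the cube of radius [e1 * r] about a point of the sphere lies in the annulus,
   because [N] changes by at most [a * r / 2] on it. *)
pose a : R := Num.min (1 - aN) (bN - 1);have a0 : 0 < a by rewrite lt_min !subr_gt0 aN1.
pose e1 : R := a / (2 * CN);have e10 : 0 < e1 by rewrite divr_gt0// mulr_gt0.
(* A cube of radius [s] lies in the Euclidean ball of radius [ka * s], since the Euclidean norm is
   at most [n] times the sup norm. *)
pose ka : R := n%:R + 1;have ka1 : 1 <= ka by rewrite lerDr.
have ka0 : 0 < ka by lra.
(* The 8 makes [ka * s] at most an eighth of the diameter of the annulus, so that the logarithm for
   [p = n] is at least 1. *)
pose sm : R := e1 / (8 * ka);have sm0 : 0 < sm by rewrite divr_gt0// mulr_gt0.
have sme : sm * (8 * ka) = e1 by rewrite divfK// gt_eqF// mulr_gt0.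
have cAn (r : R) (x0 : E) : 0 < r -> N x0 = r -> cube x0 (e1 * r) `<=` nannulus N (aN * r) (bN * r).
 move=>r0 Nx y hy;rewrite /nannulus /=.
 have : `|N x0 - N y| <= a / 2 * r.
  apply:(le_trans (is_norm_dist _ _ Nn));apply:(le_trans (hCN _));apply:(le_trans (ler_wpM2l (ltW CN0) hy)).
  by apply:eq_lexx;rewrite /e1;field;rewrite gt_eqF.
 have aa : a <= 1 - aN by rewrite ge_min lexx.
 have ab : a <= bN - 1 by rewrite ge_min lexx orbT.
 rewrite Nx ler_norml => /andP[h1 h2].
 have k1 := ler_wpM2r (ltW r0) aa;have k2 := ler_wpM2r (ltW r0) ab;have k3 := mulr_gt0 a0 r0.
 by apply/andP;split;move: k1 k2 k3 h1 h2;move: (N y) (a) => t b;clear;lra.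
have subb (r : R) (x0 : E) : 0 < r -> ball x0 (sm * r) `<=` cube x0 (e1 * r).
 move=>r0 y;rewrite -ball_normE /cube /= => /ltW h;apply:(le_trans h);rewrite ler_wpM2r ?(ltW r0)//.
 by rewrite -sme ler_peMr ?(ltW sm0)//;lra.
have oAn r s : open (nannulus N r s).
 rewrite (_ : nannulus N r s = N @^-1` [set t | r < t] `&` N @^-1` [set t | t < s]);last first.
  by apply/seteqP;split=> x /=;[move=>/andP[]|move=>[h1 h2];apply/andP].
 by apply:openI;apply:open_comp;[move=>x _;exact:norm_cont|exact:open_gt|move=>x _;exact:norm_cont|exact:open_lt].
have diamge (r : R) (x0 : E) : I r -> N x0 = r -> e1 * r <= diam (nannulus N (aN * r) (bN * r)).
 move=>Ir Nx;have [r0 [cpt _] _] := hI r Ir;have er0 : 0 < e1 * r by rewrite mulr_gt0.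
 have x0A : nannulus N (aN * r) (bN * r) x0 by apply:(cAn r x0 r0 Nx);rewrite /cube /= subrr normr0 ltW.
 have [M M0 hM] := cpt_bd_norm cpt.
 pose y : E := x0 + (e1 * r) *: evec (Ordinal n0).
 have yA : nannulus N (aN * r) (bN * r) y.
  apply:(cAn r x0 r0 Nx);rewrite /cube /= opprD addrA subrr sub0r normrN normrZ gtr0_norm// ler_piMr ?(ltW er0)//.
  by apply:norm_leP => // i;rewrite mxE eqxx /=;case:(i == _);rewrite ?normr1 ?normr0.
 apply:(@le_trans _ _ (enorm (y - x0))).
  rewrite /y addrC addKr enormZ gtr0_norm// ler_peMr ?(ltW er0)//.
  by apply:le_trans (coord_le_enorm _ (Ordinal n0));rewrite mxE !eqxx normr1.
 apply:ub_le_sup;last by exists y => //;exists x0.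
 exists (n%:R * (M + M)) => _ [z zA [w wA <-]];apply:(le_trans (enorm_le_norm _));apply:ler_wpM2l => //.
 by apply:(le_trans (ler_normB _ _));apply:lerD;apply:hM;exact:subset_closure.
have core (r : R) (x0 y : E) (s : R) : I r -> N x0 = r -> 0 < s -> cube y s `<=` ball x0 (sm * r) ->
 [/\ 0 < r, nannulus N (aN * r) (bN * r) y, 0 < ka * s < diam (nannulus N (aN * r) (bN * r)) & 8 * (ka * s) <= e1 * r] /\
 (forall la w (h : E -> R), 0 < la -> 0 <= w -> meas (nannulus N (aN * r) (bN * r)) h ->
  (forall x, nannulus N (aN * r) (bN * r) x -> la <= h x) ->
  (w%:E * (\int[mu]_(x in (nannulus N (aN * r) (bN * r) `&` oball y (ka * s) : set L)) `|h x * V x|%:E) <= C0%:E)%E ->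
  w * (la * intg (cube y s) (fun x => `|V x|)) <= `|C0| + 1).
 move=>Ir Nx s0 Ks;have [r0 cs _] := hI r Ir.
 have ssm := cube_in_ball n0 s0 Ks;have KA := subset_trans Ks (subset_trans (subb r x0 r0) (cAn r x0 r0 Nx)).
 have k8 : 8 * (ka * s) <= e1 * r.
  have k80 : 0 <= 8 * ka by rewrite mulr_ge0// ltW.
  by have := ler_wpM2l k80 ssm;rewrite -sme;lra.
 have ks0 : 0 < ka * s by rewrite mulr_gt0.
 split.
  split=> //;first by apply:KA;rewrite /cube /= subrr normr0 ltW.
  by rewrite ks0 /=;apply:lt_le_trans (diamge r x0 Ir Nx);move: k8 ks0;clear;lra.
 move=>la w h la0 w0 mh hla hw;apply:(@le_trans _ _ C0);last by have := ler_norm C0;lra.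
 have Kb : cube y s `<=` oball y (ka * s).
  move=>z hz;rewrite /oball /=;apply:(le_lt_trans (enorm_le_norm _));rewrite distrC.
  by apply:(le_lt_trans (ler_wpM2l (ler0n _ n) hz));rewrite ltr_pM2r// ltrDl.
 have H := weight_bound iV cs (oAn _ _) KA Kb (@oball_open y (ka * s)) la0 w0 mh hla hw.
 exact:H.
have cv0 : 0 < cv by exact:cube_vol_gt0.
pose C1 : R := `|C0| + 1;have C10 : 0 < C1 by rewrite ltr_wpDl.
have inU (r : R) (x0 : E) : I r -> N x0 = r -> ball x0 (sm * r) `<=` U.
 move=>Ir Nx;have [r0 [_ h] _] := hI r Ir;apply:subset_trans h;apply:subset_trans (@subset_closure _ _).
 exact:subset_trans (subb r x0 r0) (cAn r x0 r0 Nx).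
have [pn|pn] := eqVneq p n%:R.
 have qn := q2 pn;have n10 : 0 < n%:R - 1 :> R by lra.
 pose gam := q / conj_exp (n%:R : R);have gE : gam = q * (n%:R - 1) / n%:R.
  by rewrite /gam /conj_exp;field;rewrite !gt_eqF//;lra.
 (* Here [q > n] enters for [p = n]: the exponent must exceed [p - 1] for the sum in [kato_log] to
    converge. *)
 have pg : p - 1 < gam by rewrite gE pn ltr_pdivlMr;[nra|lra].
 have cc0 : 0 < e1 / ka by rewrite divr_gt0.
 have K0 : 0 < C1 / cv by rewrite divr_gt0.
 have [th kt] := kato_log p1 pn K0 cc0 pg.
 exists (fun t => C1 / cv * (Num.max 1 (ln (e1 / ka / t))) `^ (- gam)), th, sm;split=> // r x0 Ir Nx;split;first exact:inU.
 move=>y s s0 Ks;have [[r0 yA /andP[ks0 ksd] k8] hcore] := core r x0 y s Ir Nx s0 Ks.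
 have [_ _ hm] := hI r Ir;rewrite pn eqxx /morrey_norm ltxx eqxx in hm.
 set w := ln (diam (nannulus N (aN * r) (bN * r)) / (ka * s)) `^ (q / conj_exp n%:R).
 have hw : (w%:E * (\int[mu]_(x in (nannulus N (aN * r) (bN * r) `&` oball y (ka * s) : set L)) `|cst 1 x * V x|%:E) <= C0%:E)%E.
  apply:le_trans hm;apply:ereal_sup_ubound;exists y, (ka * s);split=> //;first by rewrite ks0.
  by rewrite /w /cst;under [in LHS]eq_integral do rewrite mul1r.
 have w0 : 0 <= w by exact:powR_ge0.
 have mc : meas (nannulus N (aN * r) (bN * r)) (cst 1) by exact:meas_cst.
 have := hcore 1 w (cst 1) ltr01 w0 mc (fun _ _ => lexx _) hw;rewrite mul1r -/C1.
 set J := intg _ _ => hJ;have J0 : 0 <= J by apply:intg_ge0.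
 have t8 : 8 <= e1 / ka / (s / r).
  have -> : e1 / ka / (s / r) = e1 * r / (ka * s) by field;rewrite !gt_eqF.
  by rewrite ler_pdivlMr.
 have e8 : expR 1 <= 8 :> R.
  have h : 2^-1 <= expR (- 2^-1) :> R by have := @expR_ge1Dx R (- 2^-1);lra.
  rewrite expRN lef_pV2 ?posrE ?expR_gt0// in h.
  have -> : 1 = 2^-1 + 2^-1 :> R by field.
  by rewrite expRD;have := expR_gt0 (2^-1 : R);nra.
 have l1 : 1 <= ln (e1 / ka / (s / r)).
  rewrite -[leLHS](expRK 1) ler_ln ?posrE ?expR_gt0//;first exact:le_trans t8.
  by apply:lt_le_trans t8.
 have ll : ln (e1 / ka / (s / r)) <= ln (diam (nannulus N (aN * r) (bN * r)) / (ka * s)).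
  have -> : e1 / ka / (s / r) = e1 * r / (ka * s) by field;rewrite !gt_eqF.
  have ed := diamge r x0 Ir Nx;have er : 0 < e1 * r by rewrite mulr_gt0.
  by rewrite ler_ln ?posrE ?divr_gt0 ?ler_pM2r ?invr_gt0//;exact:lt_le_trans ed.
 have -> : s^-1 `^ p * (s ^+ n * cv) = cv.
  by rewrite pn powR_mulrn ?invr_ge0 ?(ltW s0)// exprVn mulrA mulVf ?mul1r// gt_eqF// exprn_gt0.
 rewrite (max_idPr l1) mulrAC divfK ?gt_eqF// powRN ler_pdivlMr ?powR_gt0 ?(lt_le_trans ltr01 l1)//.
 apply:le_trans hJ;rewrite mulrC ler_wpM2r//;apply:powR_mono ll;last exact:le_trans ler01 l1.
 by apply:ltW;apply:lt_trans pg;rewrite subr_gt0.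
have q0 : 0 < q /\ 0 < p - n%:R / q.
 case:(ltrgtP p n%:R) pn => // h _.
  have h1 := q1 h;have np : 0 < n%:R / p by rewrite divr_gt0//;lra.
  have q0 : 0 < q by exact:lt_trans h1.
  split=> //;rewrite subr_gt0 ltr_pdivrMr//;move: h1;rewrite ltr_pdivrMr;last lra.
  by rewrite mulrC.
 by rewrite (q3 h) divr1 subr_gt0.
have [{}q0 del0] := q0;set del := p - n%:R / q in del0 hI.
pose K := C1 * ka `^ (n%:R - n%:R / q) * aN^-1 `^ del / cv.
have K0 : 0 < K by rewrite divr_gt0// !mulr_gt0// powR_gt0 ?invr_gt0.
have [th kt] := @kato_power R n p K del p1 K0 del0.
exists (fun t => K * t `^ del), th, sm;split=> // r x0 Ir Nx;split;first exact:inU.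
move=>y s s0 Ks;have [[r0 yA /andP[ks0 ksd] k8] hcore] := core r x0 y s Ir Nx s0 Ks.
have [_ _ hm] := hI r Ir;rewrite (negbTE pn) /morrey_norm in hm.
have ar0 : 0 < aN * r by rewrite mulr_gt0.
have la0 : 0 < (aN * r) `^ del by rewrite powR_gt0.
(* The exponent [n / q'] of the Morrey norm. For [p > n], where [q = 1], it is 0 and the factor in
   front of the integral disappears. *)
pose b := n%:R - n%:R / q.
pose w := (ka * s) `^ (- b);have w0 : 0 <= w by exact:powR_ge0.
have mh : meas (nannulus N (aN * r) (bN * r)) (fun x => N x `^ del).
 by apply:meas_powR;apply:meas_cont;exact:norm_cont.
have hla x : nannulus N (aN * r) (bN * r) x -> (aN * r) `^ del <= N x `^ del.
 by move=>/andP[h _];apply:powR_mono;exact:ltW.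
have mhV : meas (nannulus N (aN * r) (bN * r)) (fun x => `|N x `^ del * V x|).
 have [_ [cl clU] _] := hI r Ir;apply:meas_norm;apply:(measM mh).
 by apply:(meas_sub (msr_cpt cl) (@subset_closure _ _) (integ_meas (iV _ cl clU))).
have hw : (w%:E * (\int[mu]_(x in (nannulus N (aN * r) (bN * r) `&` oball y (ka * s) : set L)) `|N x `^ del * V x|%:E) <= C0%:E)%E.
 apply:le_trans hm;case:(ltrgtP p n%:R) pn => // h _.
  apply:ereal_sup_ubound;exists y, (ka * s);split=> //;first by rewrite ks0.
  rewrite /w /b (_ : n%:R / conj_exp q = n%:R - n%:R / q)//.
  have hq : 1 < q.
   by apply:lt_trans (q1 h);rewrite ltr_pdivlMr ?mul1r//;lra.
  by rewrite /conj_exp;field;rewrite !gt_eqF//;lra.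
 rewrite /w /b (q3 h) divr1 subrr oppr0 powRr0 mul1e;apply:ge0_subset_integral.
 - by apply:msrI (msr_open (oAn _ _)) _;apply:msr_open;exact:oball_open.
 - exact:msr_open.
 - exact/measurable_EFinP.
 - by move=>x _;rewrite lee_fin.
 - by move=>x [].
have := hcore _ w _ la0 w0 mh hla hw;set J := intg _ _ => hJ.
have sn : s^-1 `^ p * s ^+ n = s `^ (n%:R - p).
 rewrite -powR_mulrn ?(ltW s0)// -(powR_inv1 (ltW s0)) -powRrM mulN1r -powRD ?(gt_eqF s0) ?implybT//.
 by rewrite addrC.
have -> : K * (s / r) `^ del * (s^-1 `^ p * (s ^+ n * cv)) = C1 * (ka * s) `^ b * ((aN * r)^-1) `^ del.
 have ri : 0 <= r^-1 by rewrite invr_ge0 ltW.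
 have ai : 0 <= aN^-1 by rewrite invr_ge0 ltW.
 rewrite (mulrA (s^-1 `^ p)) sn (powRM del (ltW s0) ri) (powRM b (ltW ka0) (ltW s0)) invfM (powRM del ai ri).
 have -> : s `^ b = s `^ del * s `^ (n%:R - p).
  rewrite -powRD ?(gt_eqF s0) ?implybT//;congr (_ `^ _);rewrite /b /del;ring.
 by rewrite /K -/b;field;rewrite gt_eqF.
have wi : (ka * s) `^ b * w = 1 by rewrite /w powRN mulfV// gt_eqF// powR_gt0.
have li : ((aN * r)^-1) `^ del * (aN * r) `^ del = 1.
 by rewrite -powRM ?invr_ge0 ?(ltW ar0)// mulVf ?powR1// gt_eqF.
have kb : 0 <= (ka * s) `^ b by exact:powR_ge0.
have := ler_wpM2l (powR_ge0 ((aN * r)^-1) del) (ler_wpM2l kb hJ).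
have -> : (aN * r)^-1 `^ del * ((ka * s) `^ b * (w * ((aN * r) `^ del * J))) =
 ((aN * r)^-1 `^ del * (aN * r) `^ del) * ((ka * s) `^ b * w) * J by ring.
by rewrite wi li !mul1r => h;apply:(le_trans h);apply:eq_lexx;rewrite /C1;ring.
Qed.

(** Near each point of the sphere of radius [r] the inequality [harnack] holds on cubes of radius
    [e * r], with [r] as the unit of length; after rescaling to the unit sphere the chain has a
    length independent of [r] and of the solution. *)
Lemma sphere_harnack p q N V U B A (al be aN bN C0 : R) (I : set R) : (2 <= n)%N -> 1 < p -> morrey_exponent (n := n) p q ->
 is_norm N -> 0 < al -> 0 <= be -> 0 < aN < 1 -> 1 < bN -> (mu B = 0)%E -> elliptic p al be U B A ->
 (forall K, compact K -> K `<=` U -> integ K V) ->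
 (forall r, I r -> [/\ 0 < r, csubset (nannulus N (aN * r) (bN * r)) U &
  (morrey_norm p q (nannulus N (aN * r) (bN * r)) (if p == n%:R then V else fun x => (N x `^ (p - n%:R / q) * V x)%R) <= C0%:E)%E]) ->
 exists2 C : R, 0 < C & forall u G r x y, wsol p B A V U u G -> I r -> N x = r -> N y = r -> u x <= C * u y.
Proof.
move=>n2 p1 qa Nn al0 be0 aN1 bN1 B0 ell iV hI.
have [m [th [sm [kt sm0 hm]]]] := fuchsian_kato n2 p1 qa Nn aN1 bN1 iV hI.
have [C [rho [C0' rho0 hC]]] := harnack p1 al0 be0 kt.
(* [100 * e <= rho] is the smallness asked for by [harnack]; the 101 leaves the closed cube strictly
   inside the ball where the potential is controlled. *)
pose e : R := Num.min (rho / 100) (sm / 101);have e0 : 0 < e by rewrite lt_min !divr_gt0.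
have er : 100 * e <= rho by rewrite mulrC -ler_pdivlMr// ge_min lexx.
have es : 101 * e <= sm by rewrite mulrC -ler_pdivlMr// ge_min lexx orbT.
have C1 : 1 <= C + 1 by rewrite lerDr ltW.
have [C' C'0 hC'] := sphere_chain n2 Nn e0 C1;exists C' => // u G r x y su Ir Nx Ny.
have [r0 _ _] := hI r Ir;have [_ u0 _ _ _] := su;have [_ _ NZ _] := Nn.
have inU z : N z = r -> U z by move=>Nz;apply:(hm r z Ir Nz).1;apply:ballxx;rewrite mulr_gt0.
have Nr z : N z = 1 -> N (r *: z) = r by move=>Nz;rewrite NZ Nz mulr1 gtr0_norm.
have loc x1 y1 : N x1 = 1 -> N y1 = 1 -> `|x1 - y1| <= e -> u (r *: x1) <= (C + 1) * u (r *: y1).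
 move=>N1 N2 xy;have [bU hV] := hm r (r *: x1) Ir (Nr _ N1).
 have oB : open (ball (r *: x1) (sm * r)) := ball_open _ _.
 have hs : hsol p al be m (ball (r *: x1) (sm * r)) B A V r u G.
  split=> //;first exact:elliptic_sub ell.
  - by move=>K cK KU;apply:iV => //;exact:subset_trans bU.
  by split=> //;exact:wsol_sub su.
 have er0 : 0 < e * r by rewrite mulr_gt0.
 have h1 : 100 * (e * r) <= rho * r by rewrite mulrA ler_wpM2r// ltW.
 have h2 : cube (r *: x1) (100 * (e * r)) `<=` ball (r *: x1) (sm * r).
  move=>z hz;rewrite -ball_normE /=;apply:(le_lt_trans hz);have := ler_wpM2r (ltW r0) es.
  by move: er0;rewrite -mulrA;move: (e * r) (sm * r) => a b;clear;lra.
 have c1 : cube (r *: x1) (e * r) (r *: x1) by rewrite /cube /= subrr normr0 ltW.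
 have c2 : cube (r *: x1) (e * r) (r *: y1).
  by rewrite /cube /= -scalerBr normrZ gtr0_norm// mulrC ler_wpM2r// ltW.
 apply:(le_trans (hC _ _ _ _ r u G (r *: x1) (e * r) hs r0 er0 h1 h2 _ _ c1 c2)).
 have uy : 0 < u (r *: y1) by apply:u0;apply:inU;exact:Nr.
 by apply:(ler_wpM2r (ltW uy));rewrite lerDl.
have rV z : r *: (r^-1 *: z) = z by rewrite scalerA mulfV ?scale1r// gt_eqF.
have N1 z : N z = r -> N (r^-1 *: z) = 1 by move=>Nz;rewrite NZ Nz gtr0_norm ?invr_gt0// mulVf// gt_eqF.
have := hC' (fun z => u (r *: z)) loc _ (r^-1 *: x) (r^-1 *: y) (N1 _ Nx) (N1 _ Ny);rewrite !rV;apply.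
by move=>z Nz;apply:ltW;apply:u0;apply:inU;exact:Nr.
Qed.

End FuchsianHarnack.

(** * Norm balls as Lipschitz domains and admissible compact sets *)

Section NormBalls.
Context {R : realType} {n : nat}.
Local Notation E := 'rV[R]_n.
Implicit Types (N : E -> R).

Lemma nball_open N r : is_norm N -> open [set x | N x < r].
Proof.
move=>Nn;rewrite (_ : [set x | N x < r] = N @^-1` [set t | t < r])//.
by apply:open_comp;[move=>x _;exact:norm_cont|exact:open_lt].
Qed.

Lemma nball_closed N r : is_norm N -> closed [set x | N x <= r].
Proof.
move=>Nn;apply:(@preimage_closed _ _ N [set t | t <= r]);last exact:closed_le.
by move=>x _;exact:norm_cont.
Qed.

Lemma nball_compact N r : is_norm N -> compact [set x | N x <= r].
Proof.
move=>Nn;have [c c0 hc] := is_norm_ge Nn;apply:(@clbd_cpt _ _ _ (r / c));first exact:nball_closed.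
by move=>x Nx;rewrite ler_pdivlMr// mulrC (le_trans (hc x)).
Qed.

Lemma nball_closure N r : is_norm N -> 0 < r -> closure [set x | N x < r] = [set x | N x <= r].
Proof.
move=>Nn r0;have [N0 _ NZ _] := Nn;apply/seteqP;split.
 move=>x;rewrite (_ : [set x | N x <= r] = closure [set x | N x <= r]);last exact/closure_id/nball_closed.
 by apply:closure_subset => y /= /ltW.
move=>x /= Nx B /nbhs_ballP[d /= d0 hd].
pose t := Num.max 2^-1 (1 - d / (2 * (`|x| + 1))).
have x1 : 0 < `|x| + 1 by rewrite ltr_wpDl.
have dx : 0 < d / (2 * (`|x| + 1)) by rewrite divr_gt0// mulr_gt0.
have t1 : t < 1 by rewrite gt_max;apply/andP;split;lra.
have t0 : 0 < t by rewrite lt_max invr_gt0 ltr0n.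
exists (t *: x);split=> /=.
 rewrite NZ gtr0_norm//;have [->|xp] := eqVneq (N x) 0;first by rewrite mulr0.
 have Np : 0 < N x by rewrite lt_def xp N0.
 by apply:lt_le_trans Nx;rewrite gtr_pMl.
apply:hd;rewrite -ball_normE /= -{1}[x]scale1r -scalerBl normrZ gtr0_norm ?subr_gt0//.
have t2 : 1 - t <= d / (2 * (`|x| + 1)) by rewrite lerBlDl -lerBlDr /t le_max lexx orbT.
apply:(@le_lt_trans _ _ (d / (2 * (`|x| + 1)) * `|x|));first by rewrite ler_wpM2r.
rewrite mulrAC ltr_pdivrMr ?mulr_gt0// ltr_pM2l//;have := normr_ge0 x;lra.
Qed.

Lemma nball_boundary N r : is_norm N -> 0 < r -> boundary [set x | N x < r] = nsphere N r.
Proof.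
move=>Nn r0;rewrite /boundary nball_closure// (interior_id _).1;last exact:nball_open.
apply/seteqP;split=> [x /= [h1 /negP h2]|x /= ->];last by rewrite lexx ltxx;split.
by apply/eqP;rewrite eq_le h1 leNgt.
Qed.

Lemma cnball_boundary N r : is_norm N -> 0 < r -> boundary [set x | N x <= r] `<=` nsphere N r.
Proof.
move=>Nn r0 x [];rewrite -(closure_id _).1;last exact:nball_closed.
move=>/= h1 h2;apply/eqP;rewrite eq_le h1 leNgt;apply/negP => h;apply:h2.
have : nbhs x [set y | N y < r] := open_nbhs_nbhs (conj (nball_open (r:=r) Nn) h).
by apply:filterS => y /= /ltW.
Qed.

(** An infimum of functions with the common Lipschitz constant [Lc]; the lower bound keeps it
    finite. *)
Lemma inf_conv_lipschitz (U : set E) (a : E -> R) (P : E -> E) (Lc C : R) : U !=set0 -> 0 <= Lc ->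
 (forall x, U x -> - C <= a x) ->
 forall y z, inf [set a x + Lc * enorm (y - P x) | x in U] <= inf [set a x + Lc * enorm (z - P x) | x in U] + Lc * enorm (y - z).
Proof.
move=>[x0 Ux0] L0 aC y z;rewrite -lerBlDr;apply:lb_le_inf;first by exists (a x0 + Lc * enorm (z - P x0)), x0.
move=>_ [x Ux <-];rewrite lerBlDr;apply:(@le_trans _ _ (a x + Lc * enorm (y - P x))).
 apply:ge_inf;last by exists x.
 by exists (- C) => _ [w Uw <-];rewrite -[leLHS]addr0;apply:lerD;[exact:aC|rewrite mulr_ge0 ?enorm_ge0].
rewrite -addrA lerD2l -mulrDr;apply:ler_wpM2l => //.
rewrite (_ : y - P x = (z - P x) + (y - z));first exact:enormD.
by apply/rowP => i;rewrite !mxE;ring.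
Qed.

(* The graph function is the largest Lipschitz minorant: [h z] is the infimum over the ball of [a.e + L |z - a'|], with [a'] the projection of [a]. *)
Lemma nball_lipschitz N r : is_norm N -> 0 < r -> lipschitz_domain [set x : E | N x < r].
Proof.
move=>Nn r0;have [N0 Nz NZ ND] := Nn;have [CN CN0 hCN] := is_norm_le_norm Nn;have [c c0 hc] := is_norm_ge Nn.
set U : set E := [set x | N x < r];have oU : open U := nball_open (r:=r) Nn.
have U0 : U 0 by rewrite /U /= (is_norm0 Nn).
split;first split=> //;first by exists 0.
 apply:(star_connected (x := 0)) => // y t Uy /andP[t0 t1].
 by rewrite add0r subr0 /U /= NZ ger0_norm//;apply:le_lt_trans Uy;rewrite ler_piMl.
move=>x0;rewrite nball_boundary// => Nx0.
have x0n : x0 != 0 by apply/eqP => h;move: Nx0;rewrite /nsphere /= h (is_norm0 Nn) => h0;move: r0;rewrite -h0 ltxx.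
have ex : 0 < enorm x0 by rewrite (is_norm_neq0 is_norm_enorm).
(* [e] points from the boundary point to the centre. *)
set s := enorm x0 in ex;pose e : E := - (s^-1 *: x0).
have e1 : enorm e = 1 by rewrite enormN enormZ gtr0_norm ?invr_gt0// mulVf// gt_eqF.
have ee : dot e e = 1 by rewrite -enorm_sqr e1 expr1n.
have x0e : x0 = - (s *: e) by rewrite /e scalerN opprK scalerA mulfV ?scale1r// gt_eqF.
pose Lc := 4 * CN * s / r;have L0 : 0 < Lc by rewrite divr_gt0// !mulr_gt0.
pose P (y : E) : E := y - dot y e *: e.
pose h (z : E) : R := inf [set dot a e + Lc * enorm (z - P a) | a in U].
pose C : R := n%:R * (r / c).
have aC x : U x -> - C <= dot x e.
 move=>Ux;have := CauchySchwarz_dot x e;rewrite e1 mulr1 ler_norml => /andP[+ _];apply:le_trans.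
 rewrite lerN2;apply:(le_trans (enorm_le_norm x));rewrite /C ler_wpM2l// ler_pdivlMr// mulrC.
 by apply:(le_trans (hc x));exact:ltW.
have lip := inf_conv_lipschitz P (ex_intro _ 0 U0 : U !=set0) (ltW L0) aC.
exists e, (r / (4 * CN)), Lc, h;split=> //;first by rewrite divr_gt0// mulr_gt0.
 move=>y z;rewrite ler_norml;apply/andP;split.
  by rewrite lerNl opprB lerBlDl addrC -(enormN (y - z)) opprB;rewrite addrC;exact:lip.
 by rewrite lerBlDl;exact:lip.
move=>y hy;split.
 move=>Uy;have /nbhs_ballP[d /= d0 hd] := open_nbhs_nbhs (conj oU Uy).
 pose w : E := y - (d / 2) *: e.
 have Uw : U w.
  apply:hd;rewrite -ball_normE /= /w opprB addrC subrK normrZ gtr0_norm ?divr_gt0//.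
  have : `|e| <= 1 by rewrite -e1 norm_le_enorm.
  by move=>h1;apply:(@le_lt_trans _ _ (d / 2));[rewrite ler_piMr// divr_ge0 ?ltW|lra].
 apply:(@le_lt_trans _ _ (dot w e));last first.
  by rewrite /w dotDl dotNl dotZl ee mulr1 gtrDl oppr_lt0 divr_gt0.
 apply:ge_inf.
  by exists (- C) => _ [z Uz <-];rewrite -[leLHS]addr0;apply:lerD;[exact:aC|rewrite mulr_ge0 ?enorm_ge0 ?ltW].
 exists w => //;rewrite (_ : y - dot y e *: e - P w = 0) ?enorm0 ?mulr0 ?addr0//.
 rewrite /P /w dotDl dotNl dotZl ee mulr1 scalerBl;apply/rowP => i;rewrite !mxE;ring.
move=>hlt;have [_ [a Ua <-] ha] : exists2 t, [set dot a e + Lc * enorm (y - dot y e *: e - P a) | a in U] t & t < dot y e.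
 apply:contrapT => nex;move: hlt;rewrite ltNge => /negP;apply.
 apply:lb_le_inf;first by exists (dot 0 e + Lc * enorm (y - dot y e *: e - P 0)), 0.
 by move=>t St;rewrite leNgt;apply/negP => tl;apply:nex;exists t.
pose tau := dot y e - dot a e.
have Pw0 := enorm_ge0 (y - dot y e *: e - P a).
have tau0 : 0 < tau by rewrite /tau subr_gt0;apply:le_lt_trans ha;rewrite lerDl mulr_ge0// ltW.
(* [w] has component [tau] along [e] and a transversal part of size at most [tau / Lc], so
   [y + (s / tau) *: w] is close to the centre; the choice of [Lc] and of the radius gives
   [N b <= r / 2]. Then [y] is a convex combination of the points [a] and [b] of the ball. *)
pose w := y - a;pose b : E := y + (s / tau) *: w.
have wE : w = tau *: e + (y - dot y e *: e - P a).
 by rewrite /w /tau /P;apply/rowP => i;rewrite !mxE;ring.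
have Nb : N b < r.
 have bE : b = (y - x0) + (s / tau) *: (y - dot y e *: e - P a).
  rewrite /b wE scalerDr scalerA divfK ?gt_eqF// x0e opprK addrA;congr (_ + _).
 apply:(@le_lt_trans _ _ (CN * (r / (4 * CN) + s / tau * (tau / Lc)))).
  apply:(le_trans (hCN b));apply:(ler_wpM2l (ltW CN0));apply:(le_trans (norm_le_enorm b)).
  rewrite bE;apply:(le_trans (enormD _ _));apply:lerD;first exact:ltW hy.
  rewrite enormZ gtr0_norm ?divr_gt0//;apply:ler_wpM2l;first by rewrite divr_ge0 ?ltW.
  by rewrite ler_pdivlMr// mulrC /tau lerBrDl ltW.
 have -> : CN * (r / (4 * CN) + s / tau * (tau / Lc)) = r / 2.
  by rewrite /Lc;field;rewrite !gt_eqF.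
 lra.
have yE : y = (tau / (tau + s)) *: b + (s / (tau + s)) *: a.
 have ts : tau + s != 0 by rewrite gt_eqF// addr_gt0.
 rewrite /b /w;apply/rowP => i;rewrite !mxE;field.
 by rewrite ts gt_eqF.
have ts0 : 0 < tau + s by rewrite addr_gt0.
rewrite /U /= yE;apply:(le_lt_trans (ND _ _));rewrite !NZ !gtr0_norm ?divr_gt0//.
have -> : r = tau / (tau + s) * r + s / (tau + s) * r by field;rewrite gt_eqF.
by apply:ltrD;rewrite ltr_pM2l// divr_gt0.
Qed.

Lemma nball_bounded N r : is_norm N -> bounded_set [set x : E | N x < r].
Proof.
move=>Nn;have [c c0 hc] := is_norm_ge Nn;exists (r / c);split;first exact:num_real.
move=>M /ltW hM x /= Nx;apply:le_trans hM;rewrite ler_pdivlMr// mulrC;apply:(le_trans (hc x));exact:ltW.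
Qed.

Lemma nball_admissible N r : (2 <= n)%N -> is_norm N -> 0 < r -> admissible_compact [set x : E | N x <= r].
Proof.
move=>n2 Nn r0;split;first exact:nball_compact.
exists [set x | N x < r];split;first exact:nball_lipschitz.
 by rewrite nball_boundary//;exact:nsphere_connected.
by rewrite nball_closure.
Qed.

Implicit Types (p q : R) (A : set E).
Lemma in_Lp0 (s : R) A : 1 <= s -> in_Lp s A (cst 0 : E -> R).
Proof.
move=>s1;apply/in_LpE => //.
have e : (cst 0 : E -> R) \_ A = cst 0 by apply/funext => x;rewrite patchE;case:ifP.
rewrite e;split;first exact:meas_cst.
apply:(eq_integ msrT _ (integ0 msrT)) => x _ /=;rewrite normr0 powR0//;apply/eqP => s0;move: s1;rewrite s0;lra.
Qed.

Lemma in_morrey0 p q A : in_morrey p q A (cst 0 : E -> R).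
Proof.
rewrite /in_morrey;case:ltP => _;first exact:in_Lp0.
split;first by move=>K _ _;exact:in_Lp0.
have e (D : set E) : (\int[@lam R n]_(x in (D : set (lebType R n))) `|(cst 0 : E -> R) x|%:E)%E = 0%E.
 by rewrite integral0_eq// => x _;rewrite normr0.
rewrite /morrey_norm;case:(p < n%:R);last case:(p == n%:R);last by rewrite e ltry.
- by apply:(@le_lt_trans _ _ 0%E);rewrite ?ltry//;apply:ub_ereal_sup => _ [y [r [_ _ ->]]];rewrite e mule0.
- by apply:(@le_lt_trans _ _ 0%E);rewrite ?ltry//;apply:ub_ereal_sup => _ [y [r [_ _ ->]]];rewrite e mule0.
Qed.

End NormBalls.

(** * Monotone and quasi-convex functions near the endpoint *)

Section Endpoint.
Context {R : realType} {n : nat}.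
Local Notation E := 'rV[R]_n.
Implicit Types (zeta : endpoint) (f : R -> R).

Lemma filter_monotone_cvg (F : set_system R) {FF : ProperFilter F} (T : set R) f : T !=set0 ->
 (forall s, T s -> 0 <= f s) -> F T ->
 (forall a, T a -> \forall s \near F, f a <= f s) \/ (forall a, T a -> \forall s \near F, f s <= f a) ->
 exists2 l : \bar R, (0 <= l)%E & (f s)%:E @[s --> F] --> l.
Proof.
move=>[a0 Ta0] f0 FT mono.
have ge0 (l : \bar R) : (f s)%:E @[s --> F] --> l -> (0 <= l)%E.
 by apply:cvge_ge;apply:filterS FT => s /f0;rewrite lee_fin.
suff [l hl] : exists l : \bar R, (f s)%:E @[s --> F] --> l by exists l => //;exact:ge0.
have real (l : R) : (forall e, 0 < e -> \forall s \near F, `|l - f s| <= e) -> exists l : \bar R, (f s)%:E @[s --> F] --> l.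
 move=>h;exists l%:E;apply:cvg_EFin;first by apply:filterE.
 exact/cvgrPdist_le.
pose S : set R := [set f a | a in T];have S0 : S !=set0 by exists (f a0), a0.
case:mono => mono.
 have [ub|nub] := pselect (has_ubound S);last first.
  exists +oo%E;apply/cvgeyPge => A;have [a Ta Aa] : exists2 a, T a & A < f a.
   apply:contrapT => h;apply:nub;exists A => _ [a Ta <-];rewrite leNgt;apply/negP => Aa;apply:h.
   by exists a.
  by apply:filterS (mono a Ta) => s h;rewrite lee_fin;apply:le_trans h;exact:ltW.
 apply:(real (sup S)) => e e0;have [_ [a Ta <-] ha] := sup_adherent e0 (conj S0 ub).
 apply:filterS2 FT (mono a Ta) => s Ts h.
 have : f s <= sup S by apply:ub_le_sup => //;exists s.
 by move=>h2;rewrite ger0_norm ?subr_ge0//;move: ha h;lra.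
have lb : has_lbound S by exists 0 => _ [a Ta <-];exact:f0.
apply:(real (inf S)) => e e0;have [_ [a Ta <-] ha] := inf_adherent e0 (conj S0 lb).
apply:filterS2 FT (mono a Ta) => s Ts h.
have : inf S <= f s by apply:ge_inf => //;exists s.
by move=>h2;rewrite distrC ger0_norm ?subr_ge0//;move: ha h;lra.
Qed.

Lemma near_Irange zeta (r : R) : 0 < r -> \forall s \near at_endpoint zeta, Irange zeta r s.
Proof.
case:zeta => r0 /=;near=> s;last by near: s;apply:nbhs_pinfty_gt;exact:num_real.
by apply/andP;split;near: s;[exact:nbhs_right_gt|exact:nbhs_right_lt].
Unshelve. all: by end_near. Qed.

Lemma at_endpoint_proper zeta : ProperFilter (@at_endpoint R zeta).
Proof. by case:zeta;[exact:at_right_proper_filter|exact:proper_pinfty_nbhs]. Qed.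

Lemma Irange_gt0 zeta (r s : R) : 0 < r -> Irange zeta r s -> 0 < s.
Proof. by case:zeta => r0 /=;[move=>/andP[]|exact:lt_trans]. Qed.

Lemma Irange_trans zeta (r s t : R) : 0 < r -> Irange zeta r s -> Irange zeta s t -> Irange zeta r t.
Proof.
case:zeta => r0 /=;last by move=>h1 h2;exact:lt_trans h1 h2.
by move=>/andP[s0 sr] /andP[t0 ts];rewrite t0 (lt_trans ts).
Qed.

(** Either [f] never increases towards the endpoint, or some pair of radii witnesses an increase;
    quasi-convexity then forces [f] to keep increasing towards the endpoint from there on. *)
Lemma quasiconvex_monotone zeta (r1 : R) f : 0 < r1 ->
 (forall r t s, Irange zeta r1 r -> Irange zeta r1 s -> r < t < s -> f t <= Num.max (f r) (f s)) ->
 exists r0, [/\ 0 < r0, Irange zeta r0 `<=` Irange zeta r1 &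
  (forall r s, Irange zeta r0 r -> Irange zeta r0 s -> r <= s -> f r <= f s) \/
  (forall r s, Irange zeta r0 r -> Irange zeta r0 s -> r <= s -> f s <= f r)].
Proof.
move=>r10 qc;have [mono|] := pselect (forall r s, Irange zeta r1 r -> Irange zeta r1 s -> r < s ->
  if zeta is Zero then f r <= f s else f s <= f r).
 exists r1;split=> //;case:zeta qc mono => qc mono;[left|right] => r s hr hs;rewrite le_eqVlt => /predU1P[->//|];exact:mono.
move=>/existsNP[a /existsNP[b /not_implyP[Ia /not_implyP[Ib /not_implyP[ab hab]]]]].
have a0 := Irange_gt0 r10 Ia;have b0 := Irange_gt0 r10 Ib.
case:zeta qc Ia Ib hab => qc Ia Ib /negP;rewrite -ltNge => hab.
 exists a;split=> //;first by move=>s;exact:Irange_trans.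
 right => r s Ir Is;rewrite le_eqVlt => /predU1P[->//|rs].
 have I1 : Irange Zero r1 r := Irange_trans r10 Ia Ir.
 move: (Ir) (Is) => /andP[r0 ra] /andP[s0 sa].
 have := qc r a b I1 Ib (introT andP (conj ra ab));rewrite le_max => /orP[h|];last by rewrite leNgt hab.
 have := qc r s b I1 Ib (introT andP (conj rs (lt_trans sa ab)));rewrite le_max => /orP[//|h2].
 by apply:(le_trans h2);apply:(le_trans (ltW hab)).
exists b;split=> //;first by move=>s;exact:Irange_trans.
left => r s Ir Is;rewrite le_eqVlt => /predU1P[->//|rs].
have I2 : Irange Infinity r1 s := Irange_trans r10 Ib Is.
have := qc a b s Ia I2 (introT andP (conj ab Is));rewrite le_max => /orP[|h];first by rewrite leNgt hab.
have := qc a r s Ia I2 (introT andP (conj (lt_trans ab Ir) rs));rewrite le_max => /orP[h2|//].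
by apply:(le_trans h2);apply:(le_trans (ltW hab)).
Qed.

Lemma max_onP (S : set E) (f : E -> R) : compact S -> S !=set0 -> (forall x, S x -> {for x, continuous f}) ->
 (exists2 x, S x & f x = max_on S f) /\ forall x, S x -> f x <= max_on S f.
Proof.
move=>cS S0 cf;have cf' : {within S, continuous f} by apply:continuous_in_subspaceT => x /set_mem;exact:cf.
have [x /set_mem Sx hx'] := EVT_max_rV S0 cS cf';have hx y : S y -> _ := fun Sy => hx' y (mem_set Sy).
have P : exists m, (exists2 x, S x & f x = m) /\ forall x, S x -> f x <= m by exists (f x);split => //;exists x.
by rewrite /max_on;case:xgetP => [m _ []//|h];case:P => m /h.
Qed.

Lemma min_onP (S : set E) (f : E -> R) : compact S -> S !=set0 -> (forall x, S x -> {for x, continuous f}) ->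
 (exists2 x, S x & f x = min_on S f) /\ forall x, S x -> min_on S f <= f x.
Proof.
move=>cS S0 cf;have cf' : {within S, continuous f} by apply:continuous_in_subspaceT => x /set_mem;exact:cf.
have [x /set_mem Sx hx'] := EVT_min_rV S0 cS cf';have hx y : S y -> _ := fun Sy => hx' y (mem_set Sy).
have P : exists m, (exists2 x, S x & f x = m) /\ forall x, S x -> m <= f x by exists (f x);split => //;exists x.
by rewrite /min_on;case:xgetP => [m _ []//|h];case:P => m /h.
Qed.

Lemma nsphere_nonempty (N : E -> R) r : (0 < n)%N -> is_norm N -> 0 < r -> nsphere N r !=set0.
Proof.
move=>n0 Nn r0;have [_ _ NZ _] := Nn.
have en : (evec (Ordinal n0) : E) != 0.
 by apply/eqP => /rowP/(_ (Ordinal n0));rewrite !mxE !eqxx => /eqP;rewrite oner_eq0.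
have Ne := is_norm_neq0 Nn en;exists ((r / N (evec (Ordinal n0))) *: evec (Ordinal n0)).
by rewrite /nsphere /= NZ gtr0_norm ?divr_gt0// divfK// gt_eqF.
Qed.

End Endpoint.

(** * Comparison on annuli and by minimal growth *)

Section GrowthComparison.
Context {R : realType} {n : nat}.
Local Notation E := 'rV[R]_n.
Local Notation L := (lebType R n).
Local Notation mu := (@lam R n).
Implicit Types (zeta : endpoint) (N u v V f : E -> R) (G : E -> E) (U B W K : set E) (A : E -> E -> E) (H : E -> E -> R).

(** [weak_comparison] wants the inequality off a compact subset of the open annulus. With
    [(e + 1) * k] in place of [k] it is strict on the two spheres, hence valid near them by
    continuity, and [K] is what remains; afterwards [e] tends to 0. *)
Lemma annulus_comparison p al be U B A V N u G v G' (r s k : R) : (2 <= n)%N -> 1 < p -> 0 <= be -> (mu B = 0)%E ->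
 elliptic p al be U B A -> (forall K, compact K -> K `<=` U -> integ K V) -> is_norm N ->
 wsol p B A V U u G -> wsol p B A V U v G' -> 0 < r -> r < s -> (forall x, r <= N x <= s -> U x) -> open U -> 0 < k ->
 (forall x, N x = r \/ N x = s -> u x <= k * v x) -> forall x, r <= N x <= s -> u x <= k * v x.
Proof.
move=>n2 p1 be0 B0 ell iV Nn su sv r0 rs CU oU k0 bd x hx;rewrite -subr_le0.
have [[Wu _ _ _] _ _ _ _] := su;have [[Wv _ _ _] v0 _ _ _] := sv.
apply:(@le_all_small _ _ (k * v x));first exact:(mulr_ge0 (ltW k0) (ltW (v0 x (CU x hx)))).
move=>e e0;rewrite lerBlDr (_ : e * (k * v x) + k * v x = ((e + 1) * k) * v x);last by ring.
set c := (e + 1) * k;have c0 : 0 < c by rewrite mulr_gt0// addr_gt0.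
pose C : set E := [set y | N y <= s] `\` [set y | N y < r].
have CE y : C y <-> r <= N y <= s.
 split;first by move=>[/= h1 /negP h2];rewrite h1 leNgt h2.
 by move=>/andP[h1 h2];split=> //=;apply/negP;rewrite -leNgt.
have cC : compact C.
 apply:(subclosed_compact _ (nball_compact (r:=s) Nn));last by move=>y [].
 by apply:closedI;[exact:nball_closed|apply:open_closedC;exact:nball_open].
pose O' : set E := interior [set y | u y < c * v y].
have inO' y : r <= N y <= s -> u y < c * v y -> O' y.
 move=>hy uv;have Uy := CU y hy.
 have cg : {for y, continuous (fun y => c * v y - u y)}.
  by apply:continuousB;[apply:continuousM;[exact:cst_continuous|exact:Wv]|exact:Wu].
 have g0 : 0 < (c * v y - u y) / 2 by rewrite divr_gt0// subr_gt0.
 have /cont_rVP/(_ _ g0)[d d0 hd] := cg.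
 apply/nbhs_ballP;exists d => // z;rewrite -ball_normE /= => /hd;rewrite ler_norml => /andP[_ h].
 by rewrite -subr_gt0;move: h g0;lra.
pose K : set E := C `\` O'.
have cK : compact K.
 apply:(subclosed_compact _ cC);last by move=>y [].
 apply:closedI;first exact:(compact_closed (@norm_hausdorff _ _)).
 by apply:open_closedC;exact:open_interior.
pose O : set E := nannulus N r s.
have kc y : U y -> u y <= k * v y -> u y < c * v y.
 move=>Uy h;apply:(le_lt_trans h);rewrite ltr_pM2r ?v0// /c mulrDl mul1r ltrDr mulr_gt0//.
have bO y : N y = r \/ N y = s -> O' y.
 move=>hy;have hC : r <= N y <= s by case:hy => ->;rewrite lexx ltW.
 by apply:(inO' y hC);apply:kc;[exact:CU|exact:bd].
have KO : K `<=` O.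
 move=>y [/CE/andP[h1 h2] nO];rewrite /O /nannulus /=;apply/andP;rewrite !lt_neqAle h1 h2 !andbT.
 by split;apply/eqP => h;apply:nO;apply:bO;[left|right].
have OU : O `<=` U by move=>y /andP[h1 h2];apply:CU;rewrite !ltW.
have oO : open O.
 rewrite (_ : O = [set y | N y < s] `&` ~` [set y | N y <= r]).
  by apply:openI;[exact:nball_open|apply:closed_openC;exact:nball_closed].
 by apply/seteqP;split=> y /=;[move=>/andP[h1 h2];split=> //;apply/negP;rewrite -ltNge|move=>[h1 /negP];rewrite -ltNge => h2;apply/andP].
have [hxr|hxr] := eqVneq (N x) r;first by apply:ltW;apply:kc;[exact:CU|apply:bd;left].
have [hxs|hxs] := eqVneq (N x) s;first by apply:ltW;apply:kc;[exact:CU|apply:bd;right].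
have Ox : O x by rewrite /O /nannulus /= !lt_neqAle (eq_sym r) hxr hxs /=.
have ellO : elliptic p al be O B A := elliptic_sub OU ell.
have iVO K' : compact K' -> K' `<=` O -> integ K' V by move=>c1 c2;apply:iV => //;exact:subset_trans OU.
have cO : connected O := nannulus_connected n2 Nn (ltW r0) rs.
apply:(weak_comparison p1 be0 oO B0 ellO iVO cO (wsol_sub OU su) (wsol_sub OU (wsol_scale p1 be0 oU ell iV c0 sv)) cK KO _ _ Ox).
 move=>y Oy nK;apply:contrapT => nuv;apply:nK;split.
  by apply/CE;move: Oy => /andP[h1 h2];rewrite !ltW.
 by move=>/interior_subset /ltW.
(* A point of the open annulus outside [K] is found just outside the inner sphere. *)
have [z Nz] := @nsphere_nonempty R n N r (leq_trans (isT : (0 < 2)%N) n2) Nn r0.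
have /nbhs_ballP[d /= d0 hd] : nbhs z O'.
 by apply:open_nbhs_nbhs;split;[exact:open_interior|apply:bO;left].
have [_ _ NZ _] := Nn;have z1 : 0 < `|z| + 1 by rewrite ltr_wpDl.
pose t := Num.min (d / (2 * (`|z| + 1))) ((s / r - 1) / 2).
have t0 : 0 < t by rewrite lt_min !divr_gt0 ?mulr_gt0//= subr_gt0 ltr_pdivlMr// mul1r.
have tr : t <= (s / r - 1) / 2 by rewrite ge_min lexx orbT.
have tr' : (1 + t) * r < s.
 rewrite -ltr_pdivlMr//.
 move: tr;have : 1 < s / r by rewrite ltr_pdivlMr// mul1r.
 by move: (s / r) => q;lra.
exists ((1 + t) *: z).
 by rewrite /O /nannulus /= NZ Nz gtr0_norm ?addr_gt0// tr' andbT ltr_pMl// ltrDl.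
move=>[_];apply;have : ball z d ((1 + t) *: z).
 rewrite -ball_normE /= scalerDl scale1r opprD addrA subrr sub0r normrN normrZ gtr0_norm//.
 have : t <= d / (2 * (`|z| + 1)) by rewrite ge_min lexx.
 move=>h;apply:(le_lt_trans (ler_wpM2r (normr_ge0 z) h)).
 by rewrite mulrAC ltr_pdivrMr ?mulr_gt0// ltr_pM2l//;have := normr_ge0 z;lra.
exact:hd.
Qed.

Lemma Gam_open zeta (r : R) : open (@Gam R n zeta r).
Proof.
case:zeta => /=;last first.
 apply:closed_openC;rewrite (_ : cball 0 r = [set x : E | enorm x <= r]);first exact:(nball_closed (r:=r) is_norm_enorm).
 by apply/seteqP;split=> x;rewrite /cball /= subr0.
apply:openI;first exact:oball_open.
apply:closed_openC;apply:accessible_closed_set1;apply:hausdorff_accessible;exact:norm_hausdorff.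
Qed.

(** Scaling along rays to the sphere replaces a comparison of [N] with the Euclidean norm that
    defines [Gam]. *)
Lemma sphere_far zeta (Rh r : R) N x : is_norm N -> 0 < r -> nsphere N r `<=` Gam zeta Rh ->
 (if zeta is Zero then 0 < N x <= r else r <= N x) -> Gam zeta Rh x.
Proof.
move=>Nn r0 S h;have [N0 Nz NZ _] := Nn.
have Nx : 0 < N x by case:zeta S h => _;[case/andP|move=>h;exact:lt_le_trans h].
have zS : nsphere N r ((r / N x) *: x) by rewrite /nsphere /= NZ gtr0_norm ?divr_gt0// divfK// gt_eqF.
have ez : enorm ((r / N x) *: x) = r / N x * enorm x by rewrite enormZ gtr0_norm// divr_gt0.
have e0 := enorm_ge0 x.
case:zeta S h => /= /(_ _ zS) + h.
 rewrite /oball /= subr0 ez => -[h1 _];split;last by move=>x0;move: Nx;rewrite x0 (is_norm0 Nn) ltxx.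
 rewrite /= subr0;apply:le_lt_trans h1;rewrite ler_peMl// ler_pdivlMr// mul1r.
 by case/andP: h.
by rewrite /cball /= !subr0 ez => h1 h2;apply:h1;apply:le_trans h2;rewrite ler_piMl// ler_pdivrMr// mul1r.
Qed.

Lemma sphere_between zeta (Rh r s : R) N x : is_norm N -> 0 < r -> nsphere N r `<=` Gam zeta Rh -> nsphere N s `<=` Gam zeta Rh ->
 r <= N x <= s -> Gam zeta Rh x.
Proof.
move=>Nn r0 Sr Ss /andP[h1 h2];case:zeta Sr Ss => Sr Ss.
 by apply:(sphere_far (r:=s) Nn _ Ss);[exact:lt_le_trans (le_trans h1 h2)|rewrite h2 (lt_le_trans r0)].
exact:(sphere_far Nn r0 Sr).
Qed.

Lemma in_Lp_scale (s c : R) (D : set E) f : 1 <= s -> in_Lp s D f -> in_Lp s D (fun x => c * f x).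
Proof.
move=>s1 /(in_LpE _ _ s1)[mf iF];apply/in_LpE => //.
have e : (fun x => c * f x) \_ D = (fun x => c * (f \_ D) x).
 by apply/funext => x;rewrite !patchE;case:ifP => //;rewrite mulr0.
rewrite e;split;first by apply:measM => //;exact:meas_cst.
by apply:(eq_integ msrT _ (integZ (`|c| `^ s) msrT iF)) => x _;rewrite normrM powRM.
Qed.

Lemma test_function_scale U (phi : E -> R) (c : R) : c != 0 -> test_function U phi -> test_function U (fun x => c * phi x) /\
 (forall i x, 'D_(evec i) (fun x => c * phi x) x = c * 'D_(evec i) phi x) /\ forall x, grad (fun x => c * phi x) x = c *: grad phi x.
Proof.
move=>c0 [Cp cK KU].
have hD i x : 'D_(evec i) (fun x => c * phi x) x = c * 'D_(evec i) phi x.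
 have d := ((Cp 1%N).2 i).1 x;exact:(deriveZ c d).
split;last by split=> // x;apply/rowP => i;rewrite !mxE hD.
have e : [set x | c * phi x != 0] = [set x | phi x != 0].
 by apply/seteqP;split=> x /=;rewrite mulf_eq0 (negbTE c0).
by split;rewrite ?e // => k;exact:Ck_scale.
Qed.

(** [min_growth] takes its competitors in the sense of [positive_solution], so homogeneity is
    checked at that level too: the weak gradient is tested with [c * phi] and the equation with
    [c^(p-1) * phi]. *)
Lemma positive_solution_scale_sub p H al be U U' B W V v (c : R) : 1 < p -> 0 <= be -> open W -> U `<=` W -> open U -> open U' -> U' `<=` U ->
 (forall xi, measurable_fun (W : set L) (fun x => H x xi)) -> (mu B = 0)%E -> (forall x, U x -> ~ B x -> good_pt p H al be x) ->
 0 < c -> positive_solution p H V (cst 0) U v -> positive_solution p H V (cst 0) U' (fun x => c * v x).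
Proof.
move=>p1 be0 oW UW oU oU' sU mH B0 gp c0 [cv v0 [G [L1 L2 wg] wk]].
have [_ _ _ hA] := good_elliptic p1 be0 gp;have p1' : 1 <= p by exact:ltW.
have cn : c != 0 by rewrite gt_eqF.
split.
- have cU : {within U', continuous v} := continuous_subspaceW sU cv.
 rewrite continuous_open_subspace// in cU.
 apply:continuous_in_subspaceT => x /set_mem Ux;apply:continuousM;first exact:cst_continuous.
 exact:(cU x (mem_set Ux)).
- by move=>x /sU;move/v0;exact:mulr_gt0.
exists (fun x => c *: G x).
 split.
 - by move=>K cK KU;apply:in_Lp_scale => //;apply:L1 => //;exact:subset_trans sU.
 - move=>i K cK KU;have := in_Lp_scale c p1' (L2 i K cK (subset_trans KU sU)).
  by congr in_Lp;apply/funext => x;rewrite mxE.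
 move=>phi i tp;have [tp' [hD _]] := test_function_scale cn tp;have [Cp cK KU'] := tp;have KU := subset_trans KU' sU.
 have tU : test_function U (fun x => c * phi x) by case:tp' => h1 h2 h3;split => //;exact:subset_trans sU.
 have := wg _ i tU;rewrite -!/(intg _ _).
 have s0 x : ~ closure [set x | phi x != 0] x -> phi x = 0 /\ 'D_(evec i) phi x = 0.
  by move=>/clsupp0[-> g0];split=> //;rewrite -gradE g0 mxE.
 move=>e;rewrite (intg_cut KU) in e;last by move=>x _ /s0[_ e'];rewrite hD e' !mulr0.
 rewrite (intg_cut KU) in e;last by move=>x _ /s0[e' _];rewrite e' !mulr0.
 rewrite (intg_cut KU');last by move=>x _ /s0[_ e'];rewrite e' !mulr0.
 rewrite (intg_cut KU');last by move=>x _ /s0[e' _];rewrite e' !mulr0.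
 transitivity (intg (closure [set x | phi x != 0]) (fun x => v x * 'D_(evec i) (fun x0 => c * phi x0) x)).
  by apply:eq_intg => x _;rewrite hD;ring.
 by rewrite e;congr (- _);apply:eq_intg => x _;rewrite mxE;ring.
move=>phi tp;have k0 : 0 < c `^ (p - 1) by rewrite powR_gt0.
have kn : c `^ (p - 1) != 0 by rewrite gt_eqF.
have [tp' [_ hG]] := test_function_scale kn tp;have [Cp cK KU'] := tp;have KU := subset_trans KU' sU.
have tU : test_function U (fun x => c `^ (p - 1) * phi x) by case:tp' => h1 h2 h3;split => //;exact:subset_trans sU.
have := wk _ tU;rewrite -!/(intg _ _);set K := closure _ in cK KU' KU *.
have mK := msr_cpt cK.
move=>e;rewrite (intg_cut KU) in e;last by move=>x _ /clsupp0[_ e'];rewrite hG e' scaler0 dot0r.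
rewrite (intg_cut KU) in e;last by move=>x _ /clsupp0[e' _];rewrite e' !mulr0.
rewrite (intg_cut KU) in e;last by move=>x _ /clsupp0[e' _];rewrite e' !mulr0.
rewrite (intg_cut KU');last by move=>x _ /clsupp0[_ e'];rewrite e' dot0r.
rewrite (intg_cut KU');last by move=>x _ /clsupp0[e' _];rewrite e' !mulr0.
rewrite (intg_cut KU');last by move=>x _ /clsupp0[e' _];rewrite e' !mulr0.
have mG i : meas K (fun x => G x ord0 i) by have [] := in_Lp_integ p1' mK (L2 i K cK KU).
have mA i : meas K (fun x => Aop p H B x (G x) ord0 i) by apply:(meas_Aop _ p1 oW UW mH B0 gp cK KU mG).
have mmid : meas K (fun x => dot (Aop p H B x (G x)) (grad (fun x => c `^ (p - 1) * phi x) x)).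
 have [CU _ _] := tU;apply:meas_dot => // i;exact:meas_grad _ (CU 1%N).
have g1 x : K x -> ~ B x -> dot (Aop p H B x (G x)) (grad (fun x => c `^ (p - 1) * phi x) x) =
  dot (opA p H x (G x)) (grad (fun x => c `^ (p - 1) * phi x) x).
 by move=>Kx Bx;rewrite /Aop memNset.
have g2 x : K x -> ~ B x -> dot (Aop p H B x (G x)) (grad (fun x => c `^ (p - 1) * phi x) x) =
  dot (opA p H x (c *: G x)) (grad phi x).
 move=>Kx Bx;have [_ _ h] := hA x (G x) (G x) (KU x Kx).
 by move: (h c c0);rewrite /Aop memNset// => ->;rewrite hG dotZl dotZr.
have e1 := etrans (esym (eq_intg_ae B0 mK g1 mmid)) (eq_intg_ae B0 mK g2 mmid).
rewrite e1 in e;transitivity (intg K (fun x => cst 0 x * (c `^ (p - 1) * phi x)));last first.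
 by apply:eq_intg => x _ /=;rewrite !mul0r.
rewrite -e;congr (_ + _);apply:eq_intg => x Kx;have vx := v0 x (KU x Kx).
rewrite (spow_powR p (mulr_gt0 c0 vx)) (spow_powR p vx) (powRM (p - 1) (ltW c0) (ltW vx)).
by move: (V x) (c `^ (p - 1)) (v x `^ (p - 1)) (phi x) => a1 a2 a3 a4;ring.
Qed.

(** The competitor is [k * v] with [g = 0]. The compact set at 0 and the Lipschitz domain at
    infinity are the closed and the open ball of [N] of radius [r], whose boundary lies in the
    sphere where the inequality is known. *)
Lemma min_growth_compare p q H al be zeta (Rh : R) B W V N u v (r k : R) : (2 <= n)%N -> 1 < p -> 0 <= be -> open W ->
 Gam zeta Rh `<=` W -> (forall xi, measurable_fun (W : set L) (fun x => H x xi)) -> (mu B = 0)%E ->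
 (forall x, Gam zeta Rh x -> ~ B x -> good_pt p H al be x) -> is_norm N -> 0 < Rh -> 0 < r -> nsphere N r `<=` Gam zeta Rh -> 0 < k ->
 min_growth p q H V zeta Rh u -> positive_solution p H V (cst 0) (Gam zeta Rh) v ->
 (forall x, N x = r -> u x <= k * v x) -> forall x, Gam zeta Rh x -> Irange zeta (N x) r -> u x <= k * v x.
Proof.
move=>n2 p1 be0 oW GW mH B0 gp Nn Rh0 r0 Sr k0 [_ mg] pv uv x Gx xr.
have oG := @Gam_open zeta Rh;have [N0 _ _ _] := Nn.
have sc U' (oU' : open U') sU := positive_solution_scale_sub p1 be0 oW GW oG oU' sU mH B0 gp k0 pv.
have cG := (sc _ oG (@subset_refl _ _)).
case:zeta GW gp Sr mg pv Gx xr oG sc cG => GW gp Sr mg pv Gx xr oG sc [cG _ _].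
 pose K : set E := [set x | N x <= r].
 have Ki : [set x | N x < r] `<=` interior K.
  by rewrite -open_subsetE;[move=>y /= /ltW|exact:nball_open].
 have aK : admissible_compact K by exact:nball_admissible.
 have KO : K `<=` oball 0 Rh.
  move=>y Ky;have [->|yn] := eqVneq y 0;first by rewrite /oball /= subrr enorm0.
  have : Gam Zero Rh y by apply:(sphere_far Nn r0 Sr);rewrite Ky (is_norm_neq0 Nn yn).
  by case.
 have K0 : interior K 0 by apply:Ki;rewrite /= (is_norm0 Nn).
 have s0 (D : set E) : D 0 -> oball 0 Rh `\` D `<=` Gam Zero Rh.
  by move=>D0 y [Oy nDy];split=> // y0;apply:nDy;rewrite y0.
 have oD : open (oball (0 : E) Rh `\` K).
  by apply:openI;[exact:oball_open|apply:closed_openC;exact:nball_closed].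
 apply:(mg K aK KO K0 (cst 0) (fun x => k * v x)).
 - case:ifP => _;last by move=>w _ _;exact:in_morrey0.
  by exists 2;[rewrite ltr1n|move=>K' _ _;apply:in_Lp0;rewrite ler1n].
 - by apply:aeW => y _.
 - by apply:continuous_subspaceW cG;exact:s0.
 - by apply:sc => //;apply:s0;exact:interior_subset.
 - by move=>y /(cnball_boundary Nn r0);exact:uv.
 by case:Gx => h1 _;split=> //;apply/negP;rewrite -ltNge;case/andP: xr.
pose w : set E := [set x | N x < r].
have cw : cball 0 Rh `<=` w.
 move=>y hy;rewrite /w /= ltNge;apply/negP => h;have : Gam Infinity Rh y by exact:(sphere_far Nn r0 Sr).
 by apply.
have ow : open w by exact:nball_open.
have sw : w `\` cball 0 Rh `<=` Gam Infinity Rh by move=>y [].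
have lw : lipschitz_domain w by exact:nball_lipschitz.
have bw : bounded_set w by exact:nball_bounded.
apply:(mg w lw bw cw (cst 0) (fun x => k * v x)).
- case:ifP => _;last exact:in_morrey0.
 by exists 2;[rewrite ltr1n|apply:in_Lp0;rewrite ler1n].
- by apply:aeW => y _.
- by apply:continuous_subspaceW cG;move=>y [].
- by apply:sc => //;apply:openI.
- by move=>y;rewrite nball_boundary//;exact:uv.
by split.
Qed.

End GrowthComparison.

(** * Limits at the endpoint and the two assertions *)

Lemma eventually_monotone_limit {R : realType} (zeta : endpoint) (D : set R) (f : R -> R) : (forall r, D r -> 0 <= f r) ->
 eventually_monotone zeta D f -> exists2 l : \bar R, (0 <= l)%E & (f r)%:E @[r --> at_endpoint zeta] --> l.
Proof.
move=>f0 [r0 [r00 sub mono]];have FF := @at_endpoint_proper R zeta.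
have nr := @near_Irange R zeta r0 r00.
have ne : Irange zeta r0 !=set0 by have [s] := filter_ex nr;exists s.
apply:(filter_monotone_cvg ne _ nr) => [s /sub|];first exact:f0.
have closer a : Irange zeta r0 a -> \forall s \near at_endpoint zeta, Irange zeta r0 s /\ Irange zeta a s.
 by move=>Ia;apply:filterS2 nr (near_Irange zeta (Irange_gt0 r00 Ia)) => s.
case:zeta FF nr ne sub mono closer => FF _ _ _ mono closer.
 case:mono => mono;[right|left] => a Ia;apply:filterS (closer a Ia) => s [Is /andP[_ /ltW sa]];exact:mono.
by case:mono => mono;[left|right] => a Ia;apply:filterS (closer a Ia) => s [Is /ltW sa];exact:mono.
Qed.

Theorem lemma4p6 (R : realType) (n : nat) (p q : R)
  (W : set 'rV[R]_n) (zeta : endpoint) (Rh : R)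
  (H : 'rV[R]_n -> 'rV[R]_n -> R) (V N u v : 'rV[R]_n -> R)
  (n_ge2 : (2 <= n)%N) (p_gt1 : 1 < p) (q_adm : morrey_exponent (n := n) p q)
  (W_domain : domain W) (zeta_isolated : isolated_boundary_point W zeta)
  (Rh_gt0 : 0 < Rh)
  (Gam_sub : forall r, Irange zeta Rh r -> Gam zeta r `<=` W)
  (GamRh_sub : Gam zeta Rh `<=` W)
  (H_norm : norm_family W H)
  (V_morrey : in_morrey_loc p q W V)
  (Q_ge0 : Q_nonneg p H V (Gam zeta Rh))
  (V_strong : in_strong_morrey_loc p q (Gam zeta Rh) V)
  (A_condC : condition_C p (opA p H) (Gam zeta Rh))
  (q_gtn : p < 2 -> n%:R < q)
  (N_norm : is_norm N) (N_C1 : C1_on [set x | x != 0] N)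
  (Q_fuchsian : fuchsian p q H V zeta Rh N)
  (u_sol : positive_solution p H V (cst 0) (Gam zeta Rh) u)
  (v_sol : positive_solution p H V (cst 0) (Gam zeta Rh) v) :
 let D : set R := [set r | 0 < r /\ nsphere N r `<=` Gam zeta Rh] in
 let mN (r : R) : R := min_on (nsphere N r) (fun x => u x / v x) in
 let MN (r : R) : R := max_on (nsphere N r) (fun x => u x / v x) in
 ([/\ eventually_monotone zeta D mN,
   eventually_monotone zeta D MN,
   (exists2 m : \bar R, (0 <= m)%E & (mN r)%:E @[r --> at_endpoint zeta] --> m) &
   (exists2 M : \bar R, (0 <= M)%E & (MN r)%:E @[r --> at_endpoint zeta] --> M)]) /\
 (forall m M : \bar R,
  (mN r)%:E @[r --> at_endpoint zeta] --> m ->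
  (MN r)%:E @[r --> at_endpoint zeta] --> M ->
  min_growth p q H V zeta Rh u -> min_growth p q H V zeta Rh v ->
  [/\ decreasing_towards zeta D mN,
    increasing_towards zeta D MN,
    [/\ (0 < m)%E, (m <= M)%E & (M < +oo)%E] &
    forall x, Gam zeta Rh x ->
     (m * (v x)%:E <= (u x)%:E)%E /\ ((u x)%:E <= M * (v x)%:E)%E]).
Proof.
move=>D mN MN.
have n0 : (0 < n)%N := leq_trans (isT : (0 < 2)%N) n_ge2.
have [_ oW _] := W_domain;have [_ mH _ _ _] := H_norm;have [ell0 [aN [bN [rN [C0 [aN1 bN1 rN0 hF]]]]]] := Q_fuchsian.
have [B [al [be [B0 al0 be0 gp]]]] := elliptic_setup p_gt1 oW GamRh_sub H_norm ell0.
have oG := @Gam_open R n zeta Rh;have ell := good_elliptic p_gt1 (ltW be0) gp.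
have iV K : compact K -> K `<=` Gam zeta Rh -> integ K V.
 by move=>cK KG;exact:(morrey_loc_integ oW V_morrey cK (subset_trans KG GamRh_sub)).
have [Gu su] := weak_solution_wsol p_gt1 oW GamRh_sub oG (@subset_refl _ _) mH B0 gp u_sol.
have [Gv sv] := weak_solution_wsol p_gt1 oW GamRh_sub oG (@subset_refl _ _) mH B0 gp v_sol.
have [[cu _ _ _] u0 _ _ _] := su;have [[cv _ _ _] v0 _ _ _] := sv.
have DI r : Irange zeta rN r -> D r.
 move=>Ir;have [[_ cl] _] := hF r Ir;have r0 := Irange_gt0 rN0 Ir;split=> // x Nx;apply:cl;apply:subset_closure.
 have /andP[_ a1] := aN1;by rewrite /nannulus /= Nx gtr_pMl// ltr_pMl// a1.
have cuv x : Gam zeta Rh x -> {for x, continuous (fun x => u x / v x)}.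
 by move=>Gx;apply:continuousM;[exact:cu|apply:continuousV;[rewrite gt_eqF// v0|exact:cv]].
have MP r : D r -> (exists2 x, N x = r & u x / v x = MN r) /\ forall x, N x = r -> u x / v x <= MN r.
 move=>[r0 S];apply:(max_onP (nsphere_compact (r:=r) N_norm) (nsphere_nonempty n0 N_norm r0)) => x /S;exact:cuv.
have mP r : D r -> (exists2 x, N x = r & u x / v x = mN r) /\ forall x, N x = r -> mN r <= u x / v x.
 move=>[r0 S];apply:(min_onP (nsphere_compact (r:=r) N_norm) (nsphere_nonempty n0 N_norm r0)) => x /S;exact:cuv.
have inG r x : D r -> N x = r -> Gam zeta Rh x by move=>[_ S] Nx;exact:S.
have uv0 x : Gam zeta Rh x -> 0 < u x / v x by move=>Gx;rewrite divr_gt0 ?u0 ?v0.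
have M0 r : D r -> 0 < MN r by move=>Dr;have [[x Nx <-] _] := MP r Dr;apply:uv0;exact:inG Dr Nx.
have m0 r : D r -> 0 < mN r by move=>Dr;have [[x Nx <-] _] := mP r Dr;apply:uv0;exact:inG Dr Nx.
have leM (k : R) x : Gam zeta Rh x -> (u x <= k * v x) = (u x / v x <= k) by move=>/v0 vx;rewrite ler_pdivrMr.
have lem (k : R) x : 0 < k -> Gam zeta Rh x -> (v x <= k^-1 * u x) = (k <= u x / v x).
 by move=>k0 /v0 vx;rewrite ler_pdivlMl// ler_pdivlMr.
have cmp f F g F' (k r s : R) : wsol p B (Aop p H B) V (Gam zeta Rh) f F -> wsol p B (Aop p H B) V (Gam zeta Rh) g F' -> 0 < k ->
  D r -> D s -> r < s -> (forall x, N x = r \/ N x = s -> f x <= k * g x) -> forall x, r <= N x <= s -> f x <= k * g x.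
 move=>sf sg k0 [r0 Sr] [s0 Ss] rs;apply:(annulus_comparison n_ge2 p_gt1 (ltW be0) B0 ell iV N_norm sf sg r0 rs _ oG k0).
 by move=>x;exact:(sphere_between N_norm r0 Sr Ss).
have Dt r t s : D r -> D s -> r < t < s -> D t.
 move=>[r0 Sr] [s0 Ss] /andP[rt ts];split;first exact:lt_trans rt.
 by move=>x Nx;apply:(sphere_between N_norm r0 Sr Ss);rewrite Nx !ltW.
(* On the annulus [u] is compared with [v] times the larger of the two boundary maxima, so [MN] is
   quasi-convex. *)
have qM r t s : D r -> D s -> r < t < s -> MN t <= Num.max (MN r) (MN s).
 move=>Dr Ds rts;have Dt' := Dt r t s Dr Ds rts;have /andP[rt ts] := rts.
 have [[x Nx <-] _] := MP t Dt';have k0 : 0 < Num.max (MN r) (MN s) by rewrite lt_max M0.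
 rewrite -leM;last exact:inG Dt' Nx.
 apply:(cmp u Gu v Gv _ r s su sv k0 Dr Ds (lt_trans rt ts));last by rewrite Nx !ltW.
 move=>y [] Ny;rewrite leM;try exact:inG Ny.
  by apply:le_trans ((MP r Dr).2 y Ny) _;rewrite le_max lexx.
 by apply:le_trans ((MP s Ds).2 y Ny) _;rewrite le_max lexx orbT.
(* For the minima the roles are exchanged: [v] is compared with a multiple of [u], and the
   quasi-convex function is [- mN]. *)
have qm r t s : D r -> D s -> r < t < s -> - mN t <= Num.max (- mN r) (- mN s).
 move=>Dr Ds rts;have Dt' := Dt r t s Dr Ds rts;have /andP[rt ts] := rts.
 have k0 : 0 < Num.min (mN r) (mN s) by rewrite lt_min !m0.
 suff : Num.min (mN r) (mN s) <= mN t by rewrite ge_min le_max !lerN2.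
 have [[x Nx <-] _] := mP t Dt';rewrite -lem//;last exact:inG Dt' Nx.
 have ki : 0 < (Num.min (mN r) (mN s))^-1 by rewrite invr_gt0.
 apply:(cmp v Gv u Gu _ r s sv su ki Dr Ds (lt_trans rt ts));last by rewrite Nx !ltW.
 move=>y [] Ny;rewrite lem//;try exact:inG Ny.
  by apply:le_trans _ ((mP r Dr).2 y Ny);rewrite ge_min lexx.
 by apply:le_trans _ ((mP s Ds).2 y Ny);rewrite ge_min lexx orbT.
have emM : eventually_monotone zeta D MN.
 have [r0 [r00 sub mono]] := quasiconvex_monotone rN0 (fun r t s Ir Is => qM r t s (DI r Ir) (DI s Is)).
 by exists r0;split=> // r /sub/DI.
have emm : eventually_monotone zeta D mN.
 have [r0 [r00 sub mono]] := quasiconvex_monotone rN0 (fun r t s Ir Is => qm r t s (DI r Ir) (DI s Is)).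
 exists r0;split=> //;first by move=>r /sub/DI.
 by case:mono => mono;[right|left] => r s Ir Is rs;have := mono r s Ir Is rs;rewrite lerN2.
split.
 split=> //;first by apply:eventually_monotone_limit emm => r /m0/ltW.
 by apply:eventually_monotone_limit emM => r /M0/ltW.
move=>m M mlim Mlim mgu mgv;have FF := @at_endpoint_proper R zeta.
have cmpu (k r : R) : D r -> 0 < k -> (forall x, N x = r -> u x <= k * v x) ->
  forall x, Gam zeta Rh x -> Irange zeta (N x) r -> u x <= k * v x.
 move=>[r0 Sr] k0;exact:(min_growth_compare n_ge2 p_gt1 (ltW be0) oW GamRh_sub mH B0 gp N_norm Rh_gt0 r0 Sr k0 mgu v_sol).
have cmpv (k r : R) : D r -> 0 < k -> (forall x, N x = r -> v x <= k * u x) ->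
  forall x, Gam zeta Rh x -> Irange zeta (N x) r -> v x <= k * u x.
 move=>[r0 Sr] k0;exact:(min_growth_compare n_ge2 p_gt1 (ltW be0) oW GamRh_sub mH B0 gp N_norm Rh_gt0 r0 Sr k0 mgv u_sol).
(* Minimal growth bounds the quotient at all points farther from the endpoint than the sphere of
   radius [s]. *)
have upM s x : D s -> Gam zeta Rh x -> Irange zeta (N x) s -> u x / v x <= MN s.
 move=>Ds Gx xs;rewrite -leM//;apply:(cmpu _ s Ds (M0 s Ds) _ x Gx xs) => y Ny.
 by rewrite leM;[exact:(MP s Ds).2|exact:inG Ny].
have lowm s x : D s -> Gam zeta Rh x -> Irange zeta (N x) s -> mN s <= u x / v x.
 move=>Ds Gx xs;have ms := m0 s Ds;rewrite -lem//;have mi : 0 < (mN s)^-1 by rewrite invr_gt0.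
 apply:(cmpv _ s Ds mi _ x Gx xs) => y Ny.
 by rewrite lem//;[exact:(mP s Ds).2|exact:inG Ny].
have incM : increasing_towards zeta D MN.
 by move=>r s Dr Ds rs;have [[x Nx <-] _] := MP r Dr;apply:upM => //;[exact:inG Nx|rewrite Nx].
have decm : decreasing_towards zeta D mN.
 by move=>r s Dr Ds rs;have [[x Nx <-] _] := mP r Dr;apply:lowm => //;[exact:inG Nx|rewrite Nx].
have closer r : 0 < r -> \forall s \near at_endpoint zeta, Irange zeta rN s /\ Irange zeta r s.
 by move=>r0;apply:filterS2 (near_Irange zeta rN0) (near_Irange zeta r0) => s.
have Mge r : D r -> ((MN r)%:E <= M)%E.
 move=>Dr;apply:(cvge_ge _ Mlim);apply:filterS (closer r Dr.1) => s [Is rs].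
 by rewrite lee_fin;apply:incM => //;exact:DI.
have mle r : D r -> (m <= (mN r)%:E)%E.
 move=>Dr;apply:(cvge_le _ mlim);apply:filterS (closer r Dr.1) => s [Is rs].
 by rewrite lee_fin;apply:decm => //;exact:DI.
have hI r : Irange zeta rN r -> [/\ 0 < r, csubset (nannulus N (aN * r) (bN * r)) (Gam zeta Rh) &
  (morrey_norm p q (nannulus N (aN * r) (bN * r)) (if p == n%:R then V else fun x => (N x `^ (p - n%:R / q) * V x)%R) <= C0%:E)%E].
 by move=>Ir;have [h1 h2] := hF r Ir;split=> //;exact:Irange_gt0 Ir.
have [C Cpos hC] := sphere_harnack n_ge2 p_gt1 q_adm N_norm al0 (ltW be0) aN1 bN1 B0 ell iV hI.
have C2 : 0 < C * C by rewrite mulr_gt0.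
(* The Harnack inequality is used once for [u] and once for [v], hence the square of [C]. *)
have har s : Irange zeta rN s -> MN s <= C * C * mN s.
 move=>Is;have Ds := DI s Is;have [[x Nx <-] _] := MP s Ds;have [[y Ny <-] _] := mP s Ds.
 have h1 := hC u Gu s x y su Is Nx Ny;have h2 := hC v Gv s y x sv Is Ny Nx.
 have vx := v0 x (inG s x Ds Nx);have vy := v0 y (inG s y Ds Ny);have uy := u0 y (inG s y Ds Ny).
 rewrite ler_pdivrMr// mulrA mulrAC ler_pdivlMr//.
 apply:(@le_trans _ _ (C * u y * v y));first by rewrite ler_pM2r.
 by rewrite -!mulrA ler_pM2l// mulrCA ler_pM2l.
have [r1 [I1 _]] := filter_ex (closer rN rN0);have D1 := DI r1 I1.
have m1M1 : mN r1 <= MN r1.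
 by have [[x Nx <-] _] := MP r1 D1;exact:(mP r1 D1).2.
split=> //.
 split.
 (* [MN] increases towards the endpoint, so all minima nearer to it are at least [MN r1 / (C * C)];
    dually, the maxima there are at most [C * C * mN r1]. *)
 - apply:(@lt_le_trans _ _ (MN r1 / (C * C))%:E);first by rewrite lte_fin divr_gt0// M0.
  apply:(cvge_ge _ mlim);apply:filterS (closer r1 D1.1) => s [Is rs].
  rewrite lee_fin ler_pdivrMr// mulrC;apply:le_trans (har s Is);apply:incM => //;exact:DI.
 - by apply:le_trans (mle r1 D1) _;apply:le_trans (Mge r1 D1);rewrite lee_fin.
 - apply:(@le_lt_trans _ _ (C * C * mN r1)%:E);last exact:ltry.
  apply:(cvge_le _ Mlim);apply:filterS (closer r1 D1.1) => s [Is rs].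
  rewrite lee_fin;apply:(le_trans (har s Is));rewrite ler_pM2l//;apply:decm => //;exact:DI.
move=>x Gx;have xn : x != 0.
 apply/eqP => x0;move: Gx;rewrite x0;case:(zeta) => /=;first by case=> _;apply.
 by rewrite /cball /= subrr enorm0;apply;exact:ltW.
(* A sphere between [x] and the endpoint: minimal growth compares [x] with its extrema, and these
   are bounded by the limits. *)
have [s [Is xs]] := filter_ex (closer _ (is_norm_neq0 N_norm xn));have Ds := DI s Is.
have vx : (0 <= (v x)%:E)%E by rewrite lee_fin ltW// v0.
split.
 apply:(@le_trans _ _ ((mN s)%:E * (v x)%:E)%E);first by apply:lee_wpmul2r => //;exact:mle.
 by rewrite -EFinM lee_fin -ler_pdivlMr ?v0//;exact:lowm.
apply:(@le_trans _ _ ((MN s)%:E * (v x)%:E)%E);last by apply:lee_wpmul2r => //;exact:Mge.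
by rewrite -EFinM lee_fin -ler_pdivrMr ?v0//;exact:upM.
Qed.
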